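(* In the setting described in the context, suppose Assumption (A) holds for the integers $m_{0,k},m_{1,k}$ ($0\le k\le S-1$) and Assumptions (B) and (C) hold for $M,A_1,C$. Then for every $I\in\mathcal I$ the Cauchy problem (E)+(IC) has a solution $X_I(\epsilon,t,z)$ which is holomorphic and bounded in $U_Iq^{-\mathbb N}\times\mathcal T\times\mathbb C$. Moreover (for these solutions), for every $\rho>0$, if $I,I'\in\mathcal I$ are such that $U_Iq^{-\mathbb N}\cap U_{I'}q^{-\mathbb N}\ne\emptyset$, then there exists $C_1=C_1(\rho)>0$ such that $$|X_I(\epsilon,t,z)-X_{I'}(\epsilon,t,z)|\le C_1e^{-\frac1A\log^2|\epsilon|},\qquad(\epsilon,t,z)\in(U_Iq^{-\mathbb N}\cap U_{I'}q^{-\mathbb N})\times\mathcal T\times D(0,\rho),$$ where $\frac1A=(1-\overline\xi)\big(\frac{\xi}{2\log|q|}-M\big)$ with $\xi,\overline\xi$ chosen as in Assumption (C).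
   Context: **Notation.** $\mathbb N=\{0,1,2,\dots\}$, $\mathbb C^\star=\mathbb C\setminus\{0\}$, $D(0,r)$ is the open disc of radius $r$, $\dot D_{r}=D(0,r)\setminus\{0\}$. $q\in\mathbb C$ with $|q|>1$; a determination of $\log q$ is fixed and $q^s=e^{s\log q}$ for $s\in\mathbb R$. For a set $U\subseteq\mathbb C^\star$: $Uq^{-\mathbb N}=\{\epsilon q^{-n}:\epsilon\in U,n\in\mathbb N\}$, $Uq^{\mathbb R_+}=\{\tau q^l:\tau\in U,l\ge0\}$, $Uq^{\mathbb R}=\{\tau q^l:\tau\in U,l\in\mathbb R\}$. $\sigma_q$ acts by $(\sigma_qX)(\epsilon,t,z)=X(\epsilon,qt,z)$ and $(t\sigma_q)^m$ is the $m$-fold composition of $X\mapsto tX(\epsilon,qt,z)$. **Good covering.** For a pair $I=(I_1,I_2)$ of open intervals of $\mathbb R$ of length smaller than $1/4$, $U_I=\{e^{2\pi ui}q^v:u\in I_1,v\in I_2\}$. For a finite family $\mathcal I$ of such pairs, $(U_Iq^{-\mathbb N})_{I\in\mathcal I}$ is a good covering if $\bigcup_{I}U_Iq^{-\mathbb N}=\nu\setminus\{0\}$ with $\nu$ a neighborhood of $0$ in $\mathbb C$, and the sets $U_Iq^{-\mathbb N}$ are four by four disjoint (any four with distinct indices have empty intersection). **Associated family.** Let $\delta>0$. A family $\{(V_I)_{I\in\mathcal I},\mathcal T\}$ of open bounded sets in $\mathbb C^\star$ is associated to the good covering if: (1) there is $\rho_0>1$ with $V_I\cap D(0,\rho_0)\ne\emptyset$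 for all $I$; (2) $|\tau+1|>\delta$ for all $I$ and $\tau\in V_Iq^{\mathbb R}$; (3) $|1+\frac{\lambda_v}{\epsilon_utq^r}|>\delta$ for all $I$, $t\in\mathcal T$, $\epsilon_u\in U_I$, $\lambda_v\in V_I\cap D(0,\rho_0)$, $r\in\mathbb R$; (4) $|t|\le1$ for all $t\in\mathcal T$. **Data and assumptions.** $S\ge1$ is an integer; for $0\le k\le S-1$, $m_{0,k},m_{1,k}$ are positive integers and $b_k(\epsilon,z)=\sum_{s\in I_k}b_{ks}(\epsilon)z^s$ with $I_k\subset\mathbb N$ finite and $b_{ks}$ bounded holomorphic on $D(0,r_0)$, $0<r_0\le1$. $(U_Iq^{-\mathbb N})_{I\in\mathcal I}$ is a good covering with $U_Iq^{-\mathbb N}\subseteq D(0,r_0)$ for all $I$, and $\{(V_I)_I,\mathcal T\}$ is associated to it. $M,A_1,C>0$ are fixed. Assumption (A): for all $0\le k\le S-1$, $s\in I_k$: $m_{0,k}\le C(S-k+s)$ and $m_{1,k}\ge2(S-k+s)A_1$. Assumption (B): $M\le\frac1{2\log|q|}$. Assumption (C): there exist $a_1,a_2,b_1,b_2,d_1,d_2>0$ and $0<\xi,\overline\xi<1$ with (C.1) $\log|q|<\frac{b_1}{b_2}$; (C.2) $\log|q|+\frac{\xi b_1}{2b_2}+\frac{d_1}{d_2}\big(M-\frac{\xi}{2\log|q|}\big)>0$; (C.3) $M-\frac{\xi}{2\log|q|}+\frac{d_2}{d_1}\log|q|<0$; (C.4) $A_1\Big(1-\frac{d_2\log|q|}{d_1(\frac{\xi}{2\log|q|}-M)}\Big)>\frac{C^2}{4\overline\xi\log|q|(\frac{\xi}{2\log|q|}-M)}+\frac{Ca_2}{a_1}$.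 **$q$-Laplace transform.** $\Theta(x)=\sum_{n\in\mathbb Z}q^{-n(n-1)/2}x^n$ ($x\in\mathbb C^\star$), $\pi_q=\log(q)\prod_{n\ge0}(1-q^{-n-1})^{-1}$, and $$\mathcal L^\lambda_{q;1}F(z)=\frac1{\pi_q}\int_0^{\infty\lambda}\frac{F(\xi)}{\Theta(\xi/z)}\frac{d\xi}{\xi}=\frac{\log q}{\pi_q}\int_{-\infty}^{\infty}\frac{F(q^s\lambda)}{\Theta(q^s\lambda/z)}\,ds.$$ **Cauchy problems.** For each $0\le j\le S-1$, let $W_j$ be a bounded holomorphic function on $(D(0,r_0)\setminus\{0\})\times\dot D_{\rho_0}$ (the same for all $I$) which, for every $I\in\mathcal I$, extends to an analytic function $W_{U_I,V_I,j}$ on $U_Iq^{-\mathbb N}\times(V_Iq^{\mathbb R_+}\cup\dot D_{\rho_0})$, with $|W_j(\epsilon,\tau)|\le\Delta e^{\tilde M\log^2|\tau/\epsilon|}$ and $|W_{U_I,V_I,j}(\epsilon,\tau)|\le\Delta e^{\tilde M\log^2|\tau/\epsilon|}$ on the respective domains, for some $\Delta>0$ and $0<\tilde M<M$. Let $\lambda_I\in V_I\cap D(0,\rho_0)$ with $r_0<1<|\lambda_I|$. Put $\phi_{I,j}(\epsilon,t)=\mathcal L^{\lambda_I}_{q;1}(\tau\mapsto W_{U_I,V_I,j}(\epsilon,\tau))(\epsilon t)$. The Cauchy problem for $X_I$ is (E) $\ \epsilon t\,\partial_z^SX_I(\epsilon,qt,z)+\partial_z^SX_I(\epsilon,t,z)=\sum_{k=0}^{S-1}b_k(\epsilon,z)(t\sigma_q)^{m_{0,k}}(\partial_z^kX_I)(\epsilon,t,zq^{-m_{1,k}})$,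 (IC) $\ (\partial_z^jX_I)(\epsilon,t,0)=\phi_{I,j}(\epsilon,t)$, $0\le j\le S-1$.
   Formalization: ''Bounded in U_I q^{-N} × T × C'' is replaced by: holomorphic for all z in C and bounded on U_I q^{-N} × T × D(0,ρ) for every ρ>0; the literal claim fails by Liouville (e.g. S=2, W_1=1 gives ∂_z X_I(ε,t,0)=1). *)

(* Defs.v *)
(* Stdlib real numbers, with Coquelicot for complex analysis. *)
From Stdlib Require Export Reals List ZArith.
From Coquelicot Require Export Coquelicot.
Export ListNotations.
Open Scope R_scope.

Definition Cexp (z : C) : C := (exp (Re z) * cos (Im z), exp (Re z) * sin (Im z)).

Definition Csum {A : Type} (l : list A) (f : A -> C) : C :=
  fold_right Cplus (RtoC 0) (map f l).

Definition CLim_seq (u : nat -> C) : C :=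
  (real (Lim_seq (fun n => Re (u n))), real (Lim_seq (fun n => Im (u n)))).

Definition CSeries (a : nat -> C) : C := CLim_seq (fun n => Csum (seq 0 (S n)) a).

Definition Cpowz (x : C) (n : Z) : C :=
  if (n <? 0)%Z then (/ Cpow x (Z.to_nat (- n)))%C else Cpow x (Z.to_nat n).

Fixpoint C_derive_n (f : C -> C) (n : nat) : C -> C :=
  match n with
  | O => f
  | S k => C_derive (C_derive_n f k)
  end.

(* Holomorphy is complex Frechet differentiability at each point of the domain;
   the predicates are meant for open domains. *)
Definition holo1 (D : C -> Prop) (f : C -> C) : Prop :=
  forall x, D x -> @ex_derive C_AbsRing C_NormedModule f x.

Definition CC : NormedModule C_AbsRing :=
  prod_NormedModule C_AbsRing C_NormedModule C_NormedModule.

Definition CCC : NormedModule C_AbsRing :=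
  prod_NormedModule C_AbsRing CC C_NormedModule.

Definition holo2 (D : C -> C -> Prop) (f : C -> C -> C) : Prop :=
  forall x y, D x y ->
    @ex_filterdiff C_AbsRing CC C_NormedModule
      (fun p => f (fst p) (snd p)) (@locally CC (x, y)).

Definition holo3 (D : C -> C -> C -> Prop) (f : C -> C -> C -> C) : Prop :=
  forall x y z, D x y z ->
    @ex_filterdiff C_AbsRing CCC C_NormedModule
      (fun p => f (fst (fst p)) (snd (fst p)) (snd p)) (@locally CCC (x, y, z)).

Definition disc (r : R) (z : C) : Prop := Cmod z < r.
Definition pdisc (r : R) (z : C) : Prop := Cmod z < r /\ z <> 0.

(* Throughout, [lq] is the chosen determination of log q, so that q = Cexp lq. *)
Definition qpow (lq : C) (s : R) : C := Cexp (RtoC s * lq)%C.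

Definition q_negN (lq : C) (U : C -> Prop) (z : C) : Prop :=
  exists (e : C) (n : nat), U e /\ z = (e * qpow lq (- INR n))%C.

Definition q_Rplus (lq : C) (U : C -> Prop) (z : C) : Prop :=
  exists (tau : C) (l : R), U tau /\ 0 <= l /\ z = (tau * qpow lq l)%C.

Definition q_R (lq : C) (U : C -> Prop) (z : C) : Prop :=
  exists (tau : C) (l : R), U tau /\ z = (tau * qpow lq l)%C.

(* A pair of open intervals ]u_lo, u_hi[ and ]v_lo, v_hi[. *)
Record ipair := IPair { u_lo : R; u_hi : R; v_lo : R; v_hi : R }.

Definition short_ipair (I : ipair) : Prop :=
  u_lo I < u_hi I /\ u_hi I - u_lo I < 1 / 4 /\
  v_lo I < v_hi I /\ v_hi I - v_lo I < 1 / 4.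

Definition U_of (lq : C) (I : ipair) (z : C) : Prop :=
  exists u v : R, u_lo I < u < u_hi I /\ v_lo I < v < v_hi I /\
    z = (Cexp (RtoC (2 * PI * u) * Ci) * qpow lq v)%C.

Definition Uq (lq : C) (I : ipair) : C -> Prop := q_negN lq (U_of lq I).

(* A list serves as a finite set: only membership of pairs is used. *)
Definition good_covering (lq : C) (cI : list ipair) : Prop :=
  (forall I, In I cI -> short_ipair I) /\
  (exists nu : C -> Prop,
      @locally C_UniformSpace (RtoC 0) nu /\
      forall z, (exists I, In I cI /\ Uq lq I z) <-> (nu z /\ z <> 0)) /\
  (forall I1 I2 I3 I4, In I1 cI -> In I2 cI -> In I3 cI -> In I4 cI ->
     I1 <> I2 -> I1 <> I3 -> I1 <> I4 -> I2 <> I3 -> I2 <> I4 -> I3 <> I4 ->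
     forall z, ~ (Uq lq I1 z /\ Uq lq I2 z /\ Uq lq I3 z /\ Uq lq I4 z)).

Definition open_bounded_Cstar (V : C -> Prop) : Prop :=
  @open C_UniformSpace V /\ ~ V (RtoC 0) /\ exists r, forall z, V z -> Cmod z <= r.

Definition associated_family (lq : C) (delta rho0 : R) (cI : list ipair)
    (V : ipair -> C -> Prop) (T : C -> Prop) : Prop :=
  (forall I, In I cI -> open_bounded_Cstar (V I)) /\
  open_bounded_Cstar T /\
  1 < rho0 /\
  (forall I, In I cI -> exists z, V I z /\ disc rho0 z) /\
  (forall I tau, In I cI -> q_R lq (V I) tau -> Cmod (tau + 1)%C > delta) /\
  (forall I t eps lam r, In I cI -> T t -> U_of lq I eps -> V I lam -> disc rho0 lam ->
     Cmod (1 + lam / (eps * t * qpow lq r))%C > delta) /\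
  (forall t, T t -> Cmod t <= 1).

Definition assumption_A (Sd : nat) (J : nat -> list nat) (m0 m1 : nat -> nat)
    (Cst A1 : R) : Prop :=
  forall k s, (k < Sd)%nat -> In s (J k) ->
    INR (m0 k) <= Cst * (INR Sd - INR k + INR s) /\
    INR (m1 k) >= 2 * (INR Sd - INR k + INR s) * A1.

Definition assumption_B (q : C) (M : R) : Prop := M <= 1 / (2 * ln (Cmod q)).

Definition assumption_C (q : C) (M A1 Cst a1 a2 b1 b2 d1 d2 xi xib : R) : Prop :=
  let L := ln (Cmod q) in
  (0 < a1 /\ 0 < a2 /\ 0 < b1 /\ 0 < b2 /\ 0 < d1 /\ 0 < d2) /\
  (0 < xi < 1) /\ (0 < xib < 1) /\
  L < b1 / b2 /\
  L + xi * b1 / (2 * b2) + d1 / d2 * (M - xi / (2 * L)) > 0 /\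
  M - xi / (2 * L) + d2 / d1 * L < 0 /\
  A1 * (1 - d2 * L / (d1 * (xi / (2 * L) - M))) >
    Cst ^ 2 / (4 * xib * L * (xi / (2 * L) - M)) + Cst * a2 / a1.

Definition theta_term (lq x : C) (n : Z) : C :=
  (qpow lq (- (IZR (n * (n - 1)) / 2)) * Cpowz x n)%C.

Definition Theta (lq x : C) : C :=
  (CSeries (fun n => theta_term lq x (Z.of_nat n)) +
   CSeries (fun n => theta_term lq x (- Z.of_nat (S n))))%C.

Definition pi_q (lq : C) : C :=
  (lq * CLim_seq (fun N => fold_right Cmult (RtoC 1)
          (map (fun n => / (1 - qpow lq (- INR n - 1))) (seq 0 N))))%C.

(* The integral along the q-spiral through [lam], parametrised by q^s lam. *)
Definition q_laplace (lq lam : C) (F : C -> C) (z : C) : C :=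
  (lq / pi_q lq *
   @RInt_gen C_R_CompleteNormedModule
     (fun s => F (qpow lq s * lam) / Theta lq (qpow lq s * lam / z))
     (Rbar_locally m_infty) (Rbar_locally p_infty))%C.

(* [W] is the common function, [WI I] its extension attached to [I]. *)
Definition initial_datum (lq : C) (r0 rho0 M : R) (cI : list ipair)
    (V : ipair -> C -> Prop) (W : C -> C -> C) (WI : ipair -> C -> C -> C) : Prop :=
  let dom I eps tau := Uq lq I eps /\ (q_Rplus lq (V I) tau \/ pdisc rho0 tau) in
  let bound Delta Mt eps tau := Delta * exp (Mt * ln (Cmod (tau / eps)%C) ^ 2) in
  holo2 (fun eps tau => pdisc r0 eps /\ pdisc rho0 tau) W /\
  (exists K, forall eps tau, pdisc r0 eps -> pdisc rho0 tau -> Cmod (W eps tau) <= K) /\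
  (forall I, In I cI -> holo2 (dom I) (WI I)) /\
  (forall I eps tau, In I cI -> Uq lq I eps -> pdisc rho0 tau ->
     WI I eps tau = W eps tau) /\
  exists Delta Mt, 0 < Delta /\ 0 < Mt < M /\
    (forall eps tau, pdisc r0 eps -> pdisc rho0 tau ->
       Cmod (W eps tau) <= bound Delta Mt eps tau) /\
    (forall I eps tau, In I cI -> dom I eps tau ->
       Cmod (WI I eps tau) <= bound Delta Mt eps tau).

(* X |-> t X(eps, q t, z) *)
Definition t_sigma (q : C) (X : C -> C -> C -> C) : C -> C -> C -> C :=
  fun eps t z => (t * X eps (q * t) z)%C.

Definition dz (k : nat) (X : C -> C -> C -> C) : C -> C -> C -> C :=
  fun eps t z => C_derive_n (X eps t) k z.

Definition b_poly (J : nat -> list nat) (b : nat -> nat -> C -> C) (k : nat)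
    (eps z : C) : C :=
  Csum (J k) (fun s => b k s eps * Cpow z s)%C.

Definition equation_E (q : C) (Sd : nat) (m0 m1 : nat -> nat) (J : nat -> list nat)
    (b : nat -> nat -> C -> C) (X : C -> C -> C -> C) (eps t z : C) : Prop :=
  (eps * t * dz Sd X eps (q * t) z + dz Sd X eps t z =
   Csum (seq 0 Sd) (fun k =>
     b_poly J b k eps z *
     Nat.iter (m0 k) (t_sigma q) (dz k X) eps t (z / Cpow q (m1 k))))%C.

Definition condition_IC (Sd : nat) (phi : nat -> C -> C -> C) (X : C -> C -> C -> C)
    (eps t : C) : Prop :=
  forall j, (j < Sd)%nat -> dz j X eps t (RtoC 0) = phi j eps t.

(* The terms X(eps, q^m t, z) of the equation leave T, so X lives over the
   sigma_q-stable set T q^{R_+}; there the equation and the initial conditions are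
   imposed, while the bound is over T.  A function holomorphic and bounded in z over
   all of C would be constant in z, so boundedness is over D(0,rho) for every rho. *)
Definition cauchy_solution (q lq : C) (Sd : nat) (m0 m1 : nat -> nat)
    (J : nat -> list nat) (b : nat -> nat -> C -> C) (phi : nat -> C -> C -> C)
    (T : C -> Prop) (I : ipair) (X : C -> C -> C -> C) : Prop :=
  holo3 (fun eps t _ => Uq lq I eps /\ q_Rplus lq T t) X /\
  (forall eps t z, Uq lq I eps -> q_Rplus lq T t ->
     equation_E q Sd m0 m1 J b X eps t z) /\
  (forall eps t, Uq lq I eps -> q_Rplus lq T t -> condition_IC Sd phi X eps t) /\
  (forall rho, 0 < rho -> exists K, forall eps t z,
     Uq lq I eps -> T t -> disc rho z -> Cmod (X eps t z) <= K).

(* Main.v *)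
Require Import Defs.
From Stdlib Require Import Lra Lia Psatz ClassicalEpsilon.

(** In the Borel plane the problem becomes a recursion for the coefficients w_n(eps, tau) of z^n, whose
   right-hand side is divided by tau + 1. With x = max(0, log|tau/eps|) it gives
   |w_n| <= B0 B^n exp(M x^2 + C n x - A1 log|q| n^2). The data W_j are only bounded by
   exp(M log^2|tau/eps|), but for |tau| <= |eps| they are bounded by a constant, and this makes the estimate
   uniform as tau -> 0. By the finite form of the Jacobi triple product, |Theta(x)| is at least a constant times
   exp(log^2|x|/(2 log|q|) + log|x|/2) away from its zeros -q^Z, so that the Laplace integrals x_n of w_n
   converge, have Gaussian decay in n, and X = sum x_n z^n is entire in z. Holomorphy in (eps, t, z) is that of
   a locally bounded pointwise limit of holomorphic functions: Goursat's lemma gives Cauchy estimates, hence a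
   second-order Taylor remainder on complex lines that is uniform along the sequence.

   For the difference of two solutions, cut both spirals at |tau| = 1/2. Below the cut the integrands agree and
   are holomorphic, so Cauchy's theorem on the region swept from one spiral to the other, on the side avoiding
   the pole spiral -eps t q^R, leaves only an arc in |tau| = 1/2. Everything that remains has
   |tau/eps| >= 1/(2|eps|), where the Gaussian margin between 1/Theta and w_n gives the flat factor. *)

(** * Complex differentiability and integration along segments *)

(** How the Gaussian margin is spent: let L = log|q| and x = log|tau/eps|. The kernel supplies
    -x^2/(2L); the coefficients cost M x^2 + C n x - A1 L n^2. Write 1/(2L) - M as (1 - xi)/(2L)
    plus xi/(2L) - M. A share [xib] of the second summand pays for C n x by AM-GM, at a price C^2
    n^2 / (4 xib (xi/(2L) - M)) that (C.4) keeps below A1 L n^2. The rest, (1 - xib)(xi/(2L) - M),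
    is 1/A and becomes the flat factor, while (1 - xi)/(2L) is kept for convergence in tau. The n^2
    decay survives the recursion because the cross term 2 A1 L (S - k + s) l in the difference of
    squares is paid by q^(-m1 l), thanks to (A). Integrands along a spiral are dominated by Cauchy
    densities in s instead of Gaussians: the primitive is atan, and the mass does not change when
    eps and t translate s. The cut at 1/2 lies inside D(0, rho0), where all data agree, and keeps
    clear of the pole tau = -1 of the coefficients. *)

Definition cd (f : C -> C) (z d : C) : Prop :=
  forall e, 0 < e -> exists r, 0 < r /\ forall h, Cmod h < r ->
    Cmod (f (z + h) - f z - d * h)%C <= e * Cmod h.

Lemma Cmod_minus_sym (x y : C) : Cmod (x - y)%C = Cmod (y - x)%C.
Proof. replace (x - y)%C with (- (y - x))%C by ring. apply Cmod_opp. Qed.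

Lemma Cmod_Re_Im_le (z : C) : Cmod z <= Rabs (fst z) + Rabs (snd z).
Proof.
  replace z with (RtoC (fst z) + Ci * RtoC (snd z))%C at 1.
  - eapply Rle_trans; [apply Cmod_triangle|]. rewrite Cmod_mult, !Cmod_R, Cmod_Ci. lra.
  - destruct z; unfold Cplus, Cmult, Ci, RtoC; simpl; f_equal; ring.
Qed.

Lemma Re_le_Cmod (z : C) : Rabs (fst z) <= Cmod z.
Proof. eapply Rle_trans; [apply Rmax_l | apply Rmax_Cmod]. Qed.

Lemma Im_le_Cmod (z : C) : Rabs (snd z) <= Cmod z.
Proof. eapply Rle_trans; [apply Rmax_r | apply Rmax_Cmod]. Qed.

Lemma Cmod_triangle_rev (x y : C) : Cmod x - Cmod y <= Cmod (x - y)%C.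
Proof.
  assert (H := Cmod_triangle (x - y)%C y).
  replace (x - y + y)%C with x in H by ring. lra.
Qed.

Lemma Cmod_minus_le (x y : C) : Cmod (x - y)%C <= Cmod x + Cmod y.
Proof. rewrite <- (Cmod_opp y). apply Cmod_triangle. Qed.

Lemma locally_C_ball (z : C) (P : C -> Prop) :
  @locally (AbsRing_UniformSpace C_AbsRing) z P <->
  exists r, 0 < r /\ forall y, Cmod (y - z)%C < r -> P y.
Proof.
  split.
  - intros [d H]. exists d. split; [apply cond_pos|]. intros y Hy. apply H. exact Hy.
  - intros [r [Hr H]]. exists (mkposreal r Hr). intros y Hy. apply H. exact Hy.
Qed.

(** C carries two uniform structures, that of an absolute ring and that of a product of two real
    lines. [cd] speaks of [Cmod] only and commits to neither; this equivalence connects it with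
    [is_derive], as [ccont_eps] does for continuity in the product structure. *)
Lemma is_derive_cd (f : C -> C) (z d : C) :
  @is_derive C_AbsRing C_NormedModule f z d <-> cd f z d.
Proof.
  split.
  - intros [_ H] e He. specialize (H z (fun P h => h) (mkposreal e He)).
    apply locally_C_ball in H. destruct H as [r [Hr H]]. exists r. split; [exact Hr|].
    intros h Hh. specialize (H (z + h)%C).
    replace (z + h - z)%C with h in H by ring. specialize (H Hh). simpl in H.
    change (Cmod (f (z + h) - f z - (z + h - z) * d)%C <= e * Cmod (z + h - z)%C) in H.
    replace (z + h - z)%C with h in H by ring. rewrite (Cmult_comm d h). exact H.
  - intros H. split.
    + apply is_linear_scal_l.
    + intros x Hx e. assert (x = z) as ->.
      { symmetry. apply (is_filter_lim_locally_unique (V := AbsRing_NormedModule C_AbsRing)). exact Hx. }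
      apply locally_C_ball. destruct (H e (cond_pos e)) as [r [Hr Hd]].
      exists r. split; [exact Hr|]. intros y Hy. specialize (Hd _ Hy).
      replace (z + (y - z))%C with y in Hd by ring. rewrite Cmult_comm in Hd. exact Hd.
Qed.

Lemma C_derive_cd (f : C -> C) (z d : C) : cd f z d -> C_derive f z = d.
Proof. intros H. apply is_C_derive_unique, is_derive_cd, H. Qed.

Lemma cd_loc (f g : C -> C) (z d : C) (r : R) :
  0 < r -> (forall h, Cmod h < r -> f (z + h)%C = g (z + h)%C) -> cd f z d -> cd g z d.
Proof.
  intros Hr E H e He. destruct (H e He) as [r1 [Hr1 H1]].
  exists (Rmin r r1). split; [apply Rmin_pos; assumption|]. intros h Hh.
  assert (Cmod h < r) by (eapply Rlt_le_trans; [exact Hh | apply Rmin_l]).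
  assert (Cmod h < r1) by (eapply Rlt_le_trans; [exact Hh | apply Rmin_r]).
  rewrite <- E by assumption. replace (g z) with (f z); [apply H1; assumption|].
  replace z with (z + 0)%C by ring. apply E. rewrite Cmod_0. exact Hr.
Qed.

Lemma cd_ext (f g : C -> C) (z d : C) : (forall x, f x = g x) -> cd f z d -> cd g z d.
Proof. intros E. apply (cd_loc _ _ _ _ 1); [lra|]. intros; apply E. Qed.

Lemma cd_const (c z : C) : cd (fun _ => c) z 0.
Proof.
  intros e He. exists 1. split; [lra|]. intros h _.
  replace (c - c - 0 * h)%C with (RtoC 0) by ring. rewrite Cmod_0.
  apply Rmult_le_pos; [lra | apply Cmod_ge_0].
Qed.

Lemma cd_id (z : C) : cd (fun x => x) z 1.
Proof.
  intros e He. exists 1. split; [lra|]. intros h _.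
  replace (z + h - z - 1 * h)%C with (RtoC 0) by ring. rewrite Cmod_0.
  apply Rmult_le_pos; [lra | apply Cmod_ge_0].
Qed.

Lemma cd_plus (f g : C -> C) (z d1 d2 : C) :
  cd f z d1 -> cd g z d2 -> cd (fun x => f x + g x)%C z (d1 + d2).
Proof.
  intros H1 H2 e He. destruct (H1 (e/2)) as [r1 [P1 Q1]]; [lra|].
  destruct (H2 (e/2)) as [r2 [P2 Q2]]; [lra|].
  exists (Rmin r1 r2). split; [apply Rmin_pos; assumption|]. intros h Hh.
  specialize (Q1 h (Rlt_le_trans _ _ _ Hh (Rmin_l _ _))).
  specialize (Q2 h (Rlt_le_trans _ _ _ Hh (Rmin_r _ _))).
  replace (f (z + h) + g (z + h) - (f z + g z) - (d1 + d2) * h)%C with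
    ((f (z + h) - f z - d1 * h) + (g (z + h) - g z - d2 * h))%C by ring.
  eapply Rle_trans; [apply Cmod_triangle|]. lra.
Qed.

Lemma cd_continuous (f : C -> C) (z d : C) :
  cd f z d -> forall e, 0 < e -> exists r, 0 < r /\ forall h, Cmod h < r ->
    Cmod (f (z + h) - f z)%C <= e.
Proof.
  intros H e He. destruct (H 1) as [r [Hr Q]]; [lra|].
  assert (K : 0 < 1 + Cmod d) by (generalize (Cmod_ge_0 d); lra).
  exists (Rmin r (e / (1 + Cmod d))). split.
  { apply Rmin_pos; [exact Hr|]. apply Rdiv_lt_0_compat; assumption. }
  intros h Hh. specialize (Q h (Rlt_le_trans _ _ _ Hh (Rmin_l _ _))).
  assert (Hh2 := Rlt_le_trans _ _ _ Hh (Rmin_r _ _)).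
  replace (f (z + h) - f z)%C with ((f (z + h) - f z - d * h) + d * h)%C by ring.
  eapply Rle_trans; [apply Cmod_triangle|]. rewrite Cmod_mult.
  assert (Cmod h * (1 + Cmod d) <= e).
  { apply Rmult_le_reg_r with (/ (1 + Cmod d)); [apply Rinv_0_lt_compat; exact K|].
    rewrite Rmult_assoc, Rinv_r, Rmult_1_r by lra. apply Rlt_le. exact Hh2. }
  nra.
Qed.

Lemma cd_comp (f g : C -> C) (z d1 d2 : C) :
  cd f z d1 -> cd g (f z) d2 -> cd (fun x => g (f x)) z (d2 * d1).
Proof.
  intros H1 H2 e He.
  assert (A1 := Cmod_ge_0 d1). assert (A2 := Cmod_ge_0 d2).
  set (K := Cmod d1 + 1). set (e2 := e / 2 / K).
  assert (HK : 0 < K) by (unfold K; lra).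
  assert (He2 : 0 < e2) by (unfold e2; repeat apply Rdiv_lt_0_compat; lra).
  destruct (H2 e2 He2) as [r2 [P2 Q2]].
  set (e1 := Rmin 1 (e / 2 / (Cmod d2 + 1))).
  assert (He1 : 0 < e1) by (apply Rmin_pos; [lra | repeat apply Rdiv_lt_0_compat; lra]).
  destruct (H1 e1 He1) as [r1 [P1 Q1]].
  exists (Rmin r1 (r2 / K)). split; [apply Rmin_pos; [assumption | apply Rdiv_lt_0_compat; assumption]|].
  intros h Hh.
  specialize (Q1 h (Rlt_le_trans _ _ _ Hh (Rmin_l _ _))).
  assert (Hh2 := Rlt_le_trans _ _ _ Hh (Rmin_r _ _)).
  set (k := (f (z + h) - f z)%C).
  assert (Hn := Cmod_ge_0 h).
  assert (Hk : Cmod k <= K * Cmod h).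
  { replace k with ((f (z + h) - f z - d1 * h) + d1 * h)%C by (unfold k; ring).
    eapply Rle_trans; [apply Cmod_triangle|]. rewrite Cmod_mult.
    assert (e1 <= 1) by apply Rmin_l. unfold K. nra. }
  assert (Hk2 : Cmod k < r2).
  { eapply Rle_lt_trans; [exact Hk|]. rewrite Rmult_comm. apply Rlt_div_r; assumption. }
  specialize (Q2 k Hk2). replace (f z + k)%C with (f (z + h)%C) in Q2 by (unfold k; ring).
  replace (g (f (z + h)) - g (f z) - d2 * d1 * h)%C with
    ((g (f (z + h)) - g (f z) - d2 * k) + d2 * (f (z + h) - f z - d1 * h))%C by (unfold k; ring).
  eapply Rle_trans; [apply Cmod_triangle|]. rewrite Cmod_mult.
  assert (E2 : e2 * K = e / 2) by (unfold e2; field; lra).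
  assert (E1 : e1 * (Cmod d2 + 1) <= e / 2).
  { apply Rle_trans with (e / 2 / (Cmod d2 + 1) * (Cmod d2 + 1)).
    - apply Rmult_le_compat_r; [lra | apply Rmin_r].
    - right. field. lra. }
  assert (T1 : e2 * Cmod k <= e / 2 * Cmod h).
  { rewrite <- E2. rewrite Rmult_assoc. apply Rmult_le_compat_l; [lra | exact Hk]. }
  assert (T2 : Cmod d2 * Cmod (f (z + h) - f z - d1 * h)%C <= e / 2 * Cmod h).
  { apply Rle_trans with ((Cmod d2 + 1) * (e1 * Cmod h)).
    - apply Rmult_le_compat; try apply Cmod_ge_0; lra.
    - nra. }
  lra.
Qed.

Lemma Cmod_sq_bound_cd (f : C -> C) (z d : C) (K r : R) :
  0 < r -> (forall h, Cmod h < r -> Cmod (f (z + h) - f z - d * h)%C <= K * Cmod h ^ 2) ->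
  cd f z d.
Proof.
  intros Hr H e He. set (K' := Rabs K + 1).
  assert (HK : 0 < K') by (unfold K'; generalize (Rabs_pos K); lra).
  exists (Rmin r (e / K')). split; [apply Rmin_pos; [assumption | apply Rdiv_lt_0_compat; assumption]|].
  intros h Hh. assert (H1 := Rlt_le_trans _ _ _ Hh (Rmin_l _ _)).
  assert (H2 := Rlt_le_trans _ _ _ Hh (Rmin_r _ _)).
  eapply Rle_trans; [apply H, H1|]. assert (Hn := Cmod_ge_0 h).
  apply Rle_trans with (K' * Cmod h ^ 2).
  - apply Rmult_le_compat_r; [nra|]. unfold K'. generalize (Rle_abs K); lra.
  - assert (Cmod h * K' <= e) by (apply Rlt_le, Rlt_div_r; assumption). nra.
Qed.

(** Polarisation: 4 f g = (f + g)^2 - (f - g)^2, so the product rule follows from the sum and chain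
    rules and the derivative of the square. The same identity proves [ccont_mult], [vhol_mult] and
    [cvg_mult]. *)
Lemma cd_mult (f g : C -> C) (z d1 d2 : C) :
  cd f z d1 -> cd g z d2 -> cd (fun x => f x * g x)%C z (d1 * g z + f z * d2).
Proof.
  intros H1 H2.
  assert (Hsq : forall a, cd (fun x => x * x)%C a (2 * a)).
  { intros a. apply (Cmod_sq_bound_cd _ _ _ 1 1); [lra|]. intros h _.
    replace ((a + h) * (a + h) - a * a - 2 * a * h)%C with (h * h)%C by ring.
    rewrite Cmod_mult. right. ring. }
  assert (Hs : forall k, cd (fun x => k * x)%C 0 k -> forall a, cd (fun x => k * x)%C a k).
  { intros k _ a. apply (Cmod_sq_bound_cd _ _ _ 0 1); [lra|]. intros h _.
    replace (k * (a + h) - k * a - k * h)%C with (RtoC 0) by ring. rewrite Cmod_0; lra. }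
  assert (Hlin : forall k a, cd (fun x => k * x)%C a k).
  { intros k a. apply (Cmod_sq_bound_cd _ _ _ 0 1); [lra|]. intros h _.
    replace (k * (a + h) - k * a - k * h)%C with (RtoC 0) by ring. rewrite Cmod_0; lra. }
  assert (P := cd_plus _ _ _ _ _ H1 H2).
  assert (M := cd_plus _ _ _ _ _ H1 (cd_comp _ _ _ _ _ H2 (Hlin (-1)%C _))).
  assert (SP := cd_comp _ _ _ _ _ P (Hsq _)).
  assert (SM := cd_comp _ _ _ _ _ M (Hsq _)).
  assert (D := cd_plus _ _ _ _ _ SP (cd_comp _ _ _ _ _ SM (Hlin (-1)%C _))).
  assert (F := cd_comp _ _ _ _ _ D (Hlin (/ 4)%C _)).
  replace (d1 * g z + f z * d2)%C with
   (/ 4 * (2 * (f z + g z) * (d1 + d2) + -1 * (2 * (f z + -1 * g z) * (d1 + -1 * d2))))%C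
   by (field; intro K; injection K; lra).
  eapply cd_ext; [|exact F]. intros x; simpl. field; intro K; injection K; lra.
Qed.

Lemma cd_scal (k : C) (f : C -> C) (z d : C) : cd f z d -> cd (fun x => k * f x)%C z (k * d).
Proof.
  intros H. replace (k * d)%C with (0 * f z + k * d)%C by ring.
  apply (cd_mult (fun _ => k)); [apply cd_const | exact H].
Qed.

Lemma cd_minus (f g : C -> C) (z d1 d2 : C) :
  cd f z d1 -> cd g z d2 -> cd (fun x => f x - g x)%C z (d1 - d2).
Proof.
  intros H1 H2. replace (d1 - d2)%C with (d1 + -1 * d2)%C by ring.
  eapply cd_ext; [|apply (cd_plus _ _ _ _ _ H1 (cd_scal (-1) _ _ _ H2))].
  intros; simpl; ring.
Qed.

Lemma cd_inv (z : C) : z <> 0 -> cd Cinv z (- / (z * z)).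
Proof.
  intros Hz. assert (P := proj1 (Cmod_gt_0 z) Hz).
  apply (Cmod_sq_bound_cd _ _ _ (2 / Cmod z ^ 3) (Cmod z / 2)); [lra|].
  intros h Hh.
  assert (L : Cmod z / 2 <= Cmod (z + h)%C).
  { assert (K := Cmod_triangle_rev z (- h)%C). rewrite Cmod_opp in K.
    replace (z - - h)%C with (z + h)%C in K by ring. lra. }
  assert (Hzh : (z + h)%C <> 0) by (apply Cmod_gt_0; lra).
  replace (/ (z + h) - / z - - / (z * z) * h)%C with (h * h * / (z * z * (z + h)))%C by (field; auto).
  assert (Hzz : (z * z * (z + h))%C <> 0) by (repeat apply Cmult_neq_0; assumption).
  rewrite !Cmod_mult, Cmod_inv, !Cmod_mult by assumption.
  apply Rle_trans with (Cmod h * Cmod h * (2 / Cmod z ^ 3)); [|right; ring].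
  apply Rmult_le_compat_l; [nra|].
  replace (2 / Cmod z ^ 3) with (/ (Cmod z * Cmod z * (Cmod z / 2))) by (field; lra).
  apply Rinv_le_contravar; [|apply Rmult_le_compat_l; nra].
  apply Rmult_lt_0_compat; nra.
Qed.

Lemma cd_pow (n : nat) (z : C) : cd (fun x => Cpow x n) z (INR n * Cpow z (Nat.pred n)).
Proof.
  induction n as [|n IH].
  - simpl. replace (0 * 1)%C with (RtoC 0) by ring. apply cd_const.
  - cbn [Cpow Nat.pred]. assert (D := cd_mult _ _ _ _ _ (cd_id z) IH).
    replace (INR (S n) * Cpow z n)%C with
      (1 * Cpow z n + z * (INR n * Cpow z (Nat.pred n)))%C; [exact D|].
    rewrite S_INR, RtoC_plus. destruct n; simpl Nat.pred; simpl Cpow; simpl INR; ring.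
Qed.

(** * The complex exponential *)

Lemma exp_quad_bound (x : R) : Rabs x <= 1 / 2 -> Rabs (exp x - 1 - x) <= 2 * x ^ 2.
Proof.
  intros H. apply Rabs_le_between in H.
  (* The inequality 1 + x <= exp x gives the lower bound at x, and at -x the upper bound exp x <=
     1/(1 - x). *)
  assert (A := exp_ineq1_le x). assert (B := exp_ineq1_le (- x)).
  rewrite Rabs_right by lra. rewrite exp_Ropp in B.
  assert (exp x * (1 - x) <= 1).
  { apply Rmult_le_reg_l with (/ exp x); [apply Rinv_0_lt_compat; lra|].
    rewrite <- Rmult_assoc, Rinv_l by lra. lra. }
  nra.
Qed.

Lemma cos_quad_bound (y : R) : Rabs (cos y - 1) <= y ^ 2.
Proof.
  replace y with (2 * (y / 2)) at 1 by field. rewrite cos_2a_sin.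
  replace (1 - 2 * sin (y / 2) * sin (y / 2) - 1) with (- (2 * (sin (y / 2))^2)) by ring.
  rewrite Rabs_Ropp, Rabs_right by (generalize (pow2_ge_0 (sin (y/2))); lra).
  assert (H : (sin (y / 2))^2 <= (y / 2) ^ 2).
  { destruct (MVT_gen sin 0 (y/2) cos) as [c [_ E]].
    - intros x _. auto_derive; [trivial | ring].
    - intros x _. apply continuity_sin.
    - rewrite sin_0 in E. replace (sin (y/2)) with (cos c * (y/2)) by lra.
      rewrite Rpow_mult_distr. assert (B := COS_bound c). assert (0 <= (y/2)^2) by apply pow2_ge_0.
      assert ((cos c)^2 <= 1) by nra. nra. }
  nra.
Qed.

Lemma sin_abs_le (y : R) : Rabs (sin y) <= Rabs y.
Proof.
  destruct (MVT_gen sin 0 y cos) as [c [_ E]].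
  - intros x _. auto_derive; [trivial | ring].
  - intros x _. apply continuity_sin.
  - rewrite sin_0 in E. replace (sin y) with (cos c * y) by lra.
    rewrite Rabs_mult. assert (Rabs (cos c) <= 1) by (apply Rabs_le, COS_bound).
    assert (Q := Rabs_pos y). nra.
Qed.

Lemma sin_quad_bound (y : R) : Rabs y <= 1 -> Rabs (sin y - y) <= y ^ 2.
Proof.
  intros Hy. destruct (MVT_gen (fun y => sin y - y) 0 y (fun y => cos y - 1)) as [c [Hc E]].
  - intros x _. auto_derive; [trivial | ring].
  - intros x _. apply continuity_pt_minus; [apply continuity_sin | apply continuity_pt_id].
  - rewrite sin_0 in E. replace (sin y - y) with ((cos c - 1) * y) by lra.
    rewrite Rabs_mult. assert (B := cos_quad_bound c).
    assert (c ^ 2 <= Rabs y).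
    { assert (Rabs c <= Rabs y).
      { unfold Rmin, Rmax in Hc. unfold Rabs.
        destruct (Rle_dec 0 y); destruct (Rcase_abs c); destruct (Rcase_abs y); lra. }
      rewrite <- (pow2_abs c). generalize (Rabs_pos c); nra. }
    rewrite <- (pow2_abs y). generalize (Rabs_pos y); nra.
Qed.

Lemma Cexp_plus (a b : C) : Cexp (a + b) = (Cexp a * Cexp b)%C.
Proof.
  unfold Cexp, Cmult, Cplus, Re, Im; simpl. rewrite exp_plus, cos_plus, sin_plus.
  f_equal; ring.
Qed.

Lemma Cexp_0 : Cexp 0 = 1.
Proof. unfold Cexp, RtoC; simpl. rewrite exp_0, cos_0, sin_0. f_equal; ring. Qed.

Lemma Cmod_Cexp (a : C) : Cmod (Cexp a) = exp (fst a).
Proof.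
  unfold Cmod, Cexp, Re, Im; simpl.
  replace (exp (fst a) * cos (snd a) * (exp (fst a) * cos (snd a) * 1) +
    exp (fst a) * sin (snd a) * (exp (fst a) * sin (snd a) * 1)) with
    (exp (fst a) * exp (fst a) * ((sin (snd a))² + (cos (snd a))²)) by (unfold Rsqr; ring).
  rewrite sin2_cos2, Rmult_1_r. apply sqrt_square. left; apply exp_pos.
Qed.

Lemma Cexp_neq_0 (a : C) : Cexp a <> 0.
Proof. apply Cmod_gt_0. rewrite Cmod_Cexp. apply exp_pos. Qed.

Lemma Cexp_opp (a : C) : Cexp (- a) = (/ Cexp a)%C.
Proof.
  assert (H := Cexp_plus a (- a)). replace (a + - a)%C with (RtoC 0) in H by ring.
  rewrite Cexp_0 in H. assert (N := Cexp_neq_0 a).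
  replace (Cexp (- a)) with (/ Cexp a * (Cexp a * Cexp (- a)))%C by (field; exact N).
  rewrite <- H. ring.
Qed.

(** By the functional equation only the remainder [Cexp h - 1 - h] matters. Its real and imaginary
    parts are at most 4 |h|^2 each, so 10 is a generous constant. *)
Lemma cd_Cexp (z : C) : cd Cexp z (Cexp z).
Proof.
  apply (Cmod_sq_bound_cd _ _ _ (10 * Cmod (Cexp z)) (1/2)); [lra|].
  intros h Hh. rewrite Cexp_plus.
  replace (Cexp z * Cexp h - Cexp z - Cexp z * h)%C with (Cexp z * (Cexp h - 1 - h))%C by ring.
  rewrite Cmod_mult.
  replace (10 * Cmod (Cexp z) * Cmod h ^ 2) with (Cmod (Cexp z) * (10 * Cmod h ^ 2)) by ring.
  apply Rmult_le_compat_l; [apply Cmod_ge_0|].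
  eapply Rle_trans; [apply Cmod_Re_Im_le|].
  assert (A := Re_le_Cmod h). assert (B := Im_le_Cmod h).
  destruct h as [x y]; simpl in A, B |- *. unfold Re, Im; simpl.
  set (m := Cmod (x, y)) in *.
  assert (Ex := exp_quad_bound x ltac:(lra)). assert (Cy := cos_quad_bound y).
  assert (Sy := sin_quad_bound y ltac:(lra)). assert (Sa := sin_abs_le y).
  assert (x ^ 2 <= m ^ 2) by (rewrite <- (pow2_abs x); generalize (Rabs_pos x); nra).
  assert (y ^ 2 <= m ^ 2) by (rewrite <- (pow2_abs y); generalize (Rabs_pos y); nra).
  assert (C1 : Rabs (cos y) <= 1) by (apply Rabs_le, COS_bound).
  assert (E1 : Rabs (exp x * cos y + - (1) + - x) <= 4 * m ^ 2).
  { replace (exp x * cos y + - (1) + - x) with ((exp x - 1 - x) * cos y + (1 + x) * (cos y - 1)) by ring.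
    eapply Rle_trans; [apply Rabs_triang|]. rewrite !Rabs_mult.
    assert (Rabs (1 + x) <= 2) by (apply Rabs_le; apply Rabs_le_between in A; lra).
    generalize (Rabs_pos (exp x - 1 - x)) (Rabs_pos (cos y)) (Rabs_pos (1 + x)) (Rabs_pos (cos y - 1)); nra. }
  assert (E2 : Rabs (exp x * sin y + - 0 + - y) <= 4 * m ^ 2).
  { replace (exp x * sin y + - 0 + - y) with ((exp x - 1) * sin y + (sin y - y)) by ring.
    eapply Rle_trans; [apply Rabs_triang|]. rewrite Rabs_mult.
    assert (Rabs (exp x - 1) <= 2 * m).
    { replace (exp x - 1) with ((exp x - 1 - x) + x) by ring.
      eapply Rle_trans; [apply Rabs_triang|].
      assert (0 <= m) by apply Cmod_ge_0. assert (m ^ 2 <= m / 2) by nra. lra. }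
    generalize (Rabs_pos (exp x - 1)) (Rabs_pos (sin y)); nra. }
  nra.
Qed.

Lemma cd_sum (f : nat -> C -> C) (d : nat -> C) (z : C) (l : list nat) :
  (forall n, In n l -> cd (f n) z (d n)) ->
  cd (fun x => Csum l (fun n => f n x)) z (Csum l d).
Proof.
  induction l as [|n l IH]; intros H.
  - exact (cd_const (RtoC 0) z).
  - apply (cd_plus (f n) (fun x => Csum l (fun n => f n x))); [apply H; left; reflexivity|]. apply IH. intros; apply H; right; assumption.
Qed.

(** * Continuity and integration of complex functions of a real variable *)

Notation is_cint := (@is_RInt C_R_NormedModule).
Notation ex_cint := (@ex_RInt C_R_NormedModule).
Notation cint := (@RInt C_R_CompleteNormedModule).
Notation ccont := (@continuous R_UniformSpace C_UniformSpace).

Lemma norm_C_R (z : C) : @norm R_AbsRing C_R_NormedModule z = Cmod z.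
Proof. symmetry. apply Cmod_norm. Qed.

Lemma ccont_eps (f : R -> C) (s : R) :
  (forall e, 0 < e -> exists r, 0 < r /\ forall h, Rabs h < r -> Cmod (f (s + h)%R - f s)%C <= e) <->
  ccont f s.
Proof.
  split.
  - intros H. apply (filterlim_locally (F := locally s) f (f s)). intros e.
    destruct (H (e / 2)) as [r [Hr Q]]; [destruct e; simpl; lra|].
    exists (mkposreal r Hr). intros y Hy.
    change R in y. assert (Q' := Q (y - s) Hy). replace (s + (y - s)) with y in Q' by (change (y = s + (y - s) :> R); ring).
    assert (A := Re_le_Cmod (f y - f s)%C). assert (B := Im_le_Cmod (f y - f s)%C).
    destruct e as [e He]; simpl in *. split.
    + change (Rabs (fst (f y) - fst (f s)) < e). unfold Rminus. lra.
    + change (Rabs (snd (f y) - snd (f s)) < e). unfold Rminus. lra.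
  - intros H e He. assert (He2 : 0 < e / 2) by lra.
    apply (proj1 (filterlim_locally (F := locally s) f (f s))) with (eps := mkposreal _ He2) in H.
    destruct H as [r Q]. exists r. split; [apply cond_pos|]. intros h Hh.
    destruct (Q (s + h)) as [A B].
    { change (Rabs (s + h - s) < r). replace (s + h - s) with h by ring. exact Hh. }
    eapply Rle_trans; [apply Cmod_Re_Im_le|].
    change (Rabs (fst (f (s + h)) - fst (f s)) < e / 2) in A.
    change (Rabs (snd (f (s + h)) - snd (f s)) < e / 2) in B. simpl. unfold Rminus in *. lra.
Qed.

Lemma ccont_ext (f g : R -> C) (s : R) : (forall x, f x = g x) -> ccont f s -> ccont g s.
Proof. intros E. apply continuous_ext. exact E. Qed.

Lemma ccont_const (c : C) (s : R) : ccont (fun _ => c) s.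
Proof. apply continuous_const. Qed.

Lemma ccont_comp_cd (f : R -> C) (g : C -> C) (s : R) (d : C) :
  ccont f s -> cd g (f s) d -> ccont (fun x => g (f x)) s.
Proof.
  intros Hf Hg. apply ccont_eps. intros e He.
  destruct (cd_continuous _ _ _ Hg e He) as [r [Hr Q]].
  destruct (proj2 (ccont_eps _ _) Hf (r / 2)) as [r2 [Hr2 Q2]]; [lra|].
  exists r2. split; [exact Hr2|]. intros h Hh. specialize (Q2 h Hh).
  replace (f (s + h)) with (f s + (f (s + h)%R - f s))%C by ring. apply Q. lra.
Qed.

Lemma ccont_plus (f g : R -> C) (s : R) :
  ccont f s -> ccont g s -> ccont (fun x => f x + g x)%C s.
Proof. intros Hf Hg. exact (@continuous_plus R_UniformSpace R_AbsRing C_R_NormedModule f g s Hf Hg). Qed.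

Lemma ccont_scal (k : C) (f : R -> C) (s : R) : ccont f s -> ccont (fun x => k * f x)%C s.
Proof. intros Hf. apply (ccont_comp_cd f (fun z => k * z)%C s (k * 1)%C Hf), cd_scal, cd_id. Qed.

Lemma ccont_mult (f g : R -> C) (s : R) :
  ccont f s -> ccont g s -> ccont (fun x => f x * g x)%C s.
Proof.
  intros Hf Hg.
  assert (Sq : forall h, ccont h s -> ccont (fun x => h x * h x)%C s).
  { intros h Hh. eapply (ccont_comp_cd h (fun z => z * z)%C s); [exact Hh|]. apply cd_mult; apply cd_id. }
  assert (D := ccont_plus _ _ _ (Sq _ (ccont_plus _ _ _ Hf Hg))
     (ccont_scal (-1) _ _ (Sq _ (ccont_plus _ _ _ Hf (ccont_scal (-1) _ _ Hg))))).
  apply (ccont_scal (/4)%C) in D. eapply ccont_ext; [|exact D].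
  intros x; simpl. field; intro K; injection K; lra.
Qed.

Lemma ccont_inv (f : R -> C) (s : R) : f s <> 0 -> ccont f s -> ccont (fun x => / f x)%C s.
Proof. intros N Hf. eapply (ccont_comp_cd f Cinv); [exact Hf | apply cd_inv, N]. Qed.

Lemma ccont_RtoC (s : R) : ccont RtoC s.
Proof.
  apply ccont_eps. intros e He. exists e. split; [exact He|]. intros h Hh.
  rewrite <- RtoC_minus, Cmod_R. replace (s + h - s) with h by ring. lra.
Qed.

Lemma ccont_line (c d : C) (s : R) : ccont (fun x => c + RtoC x * d)%C s.
Proof.
  apply ccont_plus; [apply ccont_const|]. apply ccont_mult; [apply ccont_RtoC | apply ccont_const].
Qed.

Lemma ex_cint_cont (f : R -> C) (a b : R) :
  a <= b -> (forall s, a <= s <= b -> ccont f s) -> ex_cint f a b.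
Proof.
  intros H Q. apply (@ex_RInt_continuous C_R_CompleteNormedModule). intros z Hz.
  rewrite Rmin_left, Rmax_right in Hz by exact H. apply Q. exact Hz.
Qed.

(** The integral is linear over R only, so a complex factor is multiplied out on real and imaginary
    parts. *)
Lemma is_cint_scal (k : C) (f : R -> C) (a b : R) (I : C) :
  is_cint f a b I -> is_cint (fun x => k * f x)%C a b (k * I)%C.
Proof.
  intros H. assert (H1 := is_RInt_fct_extend_fst (U := R_NormedModule) (V := R_NormedModule) _ _ _ _ H).
  assert (H2 := is_RInt_fct_extend_snd (U := R_NormedModule) (V := R_NormedModule) _ _ _ _ H).
  apply (is_RInt_fct_extend_pair (U := R_NormedModule) (V := R_NormedModule)).
  - exact (is_RInt_minus _ _ _ _ _ _ (is_RInt_scal _ _ _ (fst k) _ H1) (is_RInt_scal _ _ _ (snd k) _ H2)).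
  - exact (is_RInt_plus _ _ _ _ _ _ (is_RInt_scal _ _ _ (fst k) _ H2) (is_RInt_scal _ _ _ (snd k) _ H1)).
Qed.

Lemma is_cint_bound (f : R -> C) (a b M : R) (I : C) :
  a <= b -> (forall s, a <= s <= b -> Cmod (f s) <= M) -> is_cint f a b I -> Cmod I <= M * (b - a).
Proof.
  intros Hab HM HI. rewrite <- norm_C_R.
  apply (norm_RInt_le (V := C_R_NormedModule) f (fun _ => M) a b I); [exact Hab| |exact HI|].
  - intros x Hx. rewrite norm_C_R. apply HM, Hx.
  - replace (M * (b - a)) with (scal (b - a) M) by (unfold scal; simpl; unfold mult; simpl; ring).
    exact (is_RInt_const (V := R_NormedModule) a b M).
Qed.

Lemma cint_correct (f : R -> C) (a b : R) :
  a <= b -> (forall s, a <= s <= b -> ccont f s) -> is_cint f a b (cint f a b).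
Proof. intros H Q. apply (@RInt_correct C_R_CompleteNormedModule), ex_cint_cont; assumption. Qed.

Lemma cint_unique (f : R -> C) (a b : R) (I : C) : is_cint f a b I -> cint f a b = I.
Proof. apply (@is_RInt_unique C_R_CompleteNormedModule). Qed.

Lemma cint_Chasles (f : R -> C) (a b c : R) :
  a <= b <= c -> (forall s, a <= s <= c -> ccont f s) ->
  cint f a c = (cint f a b + cint f b c)%C.
Proof.
  intros H Q. symmetry. apply (@RInt_Chasles C_R_CompleteNormedModule); apply ex_cint_cont;
  try lra; intros; apply Q; lra.
Qed.

Lemma cint_bound (f : R -> C) (a b M : R) :
  a <= b -> (forall s, a <= s <= b -> ccont f s) ->
  (forall s, a <= s <= b -> Cmod (f s) <= M) -> Cmod (cint f a b) <= M * (b - a).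
Proof. intros H Q HM. apply (is_cint_bound f); auto. apply cint_correct; assumption. Qed.

Lemma cint_minus (f g : R -> C) (a b : R) :
  a <= b -> (forall s, a <= s <= b -> ccont f s) -> (forall s, a <= s <= b -> ccont g s) ->
  (cint f a b - cint g a b)%C = cint (fun x => f x - g x)%C a b.
Proof.
  intros H Hf Hg. symmetry. apply cint_unique.
  exact (is_RInt_minus (V := C_R_NormedModule) _ _ _ _ _ _ (cint_correct _ _ _ H Hf) (cint_correct _ _ _ H Hg)).
Qed.

Lemma cint_scal (k : C) (f : R -> C) (a b : R) :
  a <= b -> (forall s, a <= s <= b -> ccont f s) ->
  (k * cint f a b)%C = cint (fun x => k * f x)%C a b.
Proof. intros H Hf. symmetry. apply cint_unique, is_cint_scal, cint_correct; assumption. Qed.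

Lemma cint_ext (f g : R -> C) (a b : R) :
  a <= b -> (forall s, a <= s <= b -> f s = g s) -> cint f a b = cint g a b.
Proof.
  intros H E. apply (@RInt_ext C_R_CompleteNormedModule). intros x Hx.
  rewrite Rmin_left, Rmax_right in Hx by exact H. apply E; lra.
Qed.

Lemma cd_line_derive (G : C -> C) (c d D : C) (s : R) :
  cd G (c + RtoC s * d)%C D ->
  @is_derive R_AbsRing C_R_NormedModule (fun x => G (c + RtoC x * d)%C) s (d * D)%C.
Proof.
  intros H. split; [apply is_linear_scal_l|].
  intros x Hx e. assert (x = s) as ->.
  { symmetry. apply (is_filter_lim_locally_unique (V := R_NormedModule)). exact Hx. }
  clear Hx. assert (Hd := Cmod_ge_0 d).
  destruct (H (e / (Cmod d + 1))) as [r [Hr Q]]; [apply Rdiv_lt_0_compat; [apply cond_pos | lra]|].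
  assert (Hr2 : 0 < r / (Cmod d + 1)) by (apply Rdiv_lt_0_compat; lra).
  exists (mkposreal _ Hr2). intros y Hy. change (Rabs (y - s) < r / (Cmod d + 1)) in Hy.
  rewrite norm_C_R.
  assert (E : Cmod (RtoC (y - s) * d)%C < r).
  { rewrite Cmod_mult, Cmod_R. apply Rle_lt_trans with (Rabs (y - s) * (Cmod d + 1)).
    - apply Rmult_le_compat_l; [apply Rabs_pos | lra].
    - apply Rlt_div_r; lra. }
  specialize (Q _ E).
  replace (c + RtoC s * d + RtoC (y - s) * d)%C with (c + RtoC y * d)%C in Q
    by (rewrite RtoC_minus; ring).
  eapply Rle_trans; [|eapply Rle_trans; [exact Q|]].
  - right. f_equal.
    change (minus (minus (G (c + RtoC y * d)%C) (G (c + RtoC s * d)%C)) (@scal R_AbsRing C_R_NormedModule (minus y s) (d * D)%C) = (G (c + RtoC y * d) - G (c + RtoC s * d) - D * (RtoC (y - s) * d))%C).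
    apply injective_projections; destruct d as [d1 d2], D as [D1 D2];
      destruct (G (c + RtoC y * (d1, d2))%C) as [g1 g2], (G (c + RtoC s * (d1, d2))%C) as [g3 g4].
    + change (g1 + - g3 + - ((y + - s) * (d1 * D1 - d2 * D2)) =
        g1 + - g3 + - (D1 * ((y + - s) * d1 - 0 * d2) - D2 * ((y + - s) * d2 + 0 * d1))). ring.
    + change (g2 + - g4 + - ((y + - s) * (d1 * D2 + d2 * D1)) =
        g2 + - g4 + - (D1 * ((y + - s) * d2 + 0 * d1) + D2 * ((y + - s) * d1 - 0 * d2))). ring.
  - rewrite Cmod_mult, Cmod_R. change (norm (minus y s)) with (Rabs (y - s)).
    assert (P := Rabs_pos (y - s)). destruct e as [e He]; simpl.
    apply Rle_trans with (e * Rabs (y - s) * (Cmod d / (Cmod d + 1))); [right; field; lra|].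
    rewrite <- (Rmult_1_r (e * Rabs (y - s))) at 2. apply Rmult_le_compat_l; [nra|].
    apply Rle_div_l; lra.
Qed.

Lemma cint_FTC (G g : C -> C) (c d : C) (a b : R) :
  a <= b -> (forall s, a <= s <= b -> cd G (c + RtoC s * d)%C (g (c + RtoC s * d)%C)) ->
  (forall s, a <= s <= b -> ccont (fun x => g (c + RtoC x * d)%C) s) ->
  (d * cint (fun x => g (c + RtoC x * d)%C) a b)%C =
    (G (c + RtoC b * d) - G (c + RtoC a * d))%C.
Proof.
  intros H HG Hg. rewrite cint_scal by assumption. apply cint_unique.
  apply (@is_RInt_derive C_R_CompleteNormedModule (fun x => G (c + RtoC x * d)%C)).
  - intros x Hx. rewrite Rmin_left, Rmax_right in Hx by exact H. apply cd_line_derive, HG, Hx.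
  - intros x Hx. rewrite Rmin_left, Rmax_right in Hx by exact H. apply ccont_scal, Hg, Hx.
Qed.

(** ** Goursat's lemma on parallelograms *)

(** The integral of g along the positively oriented boundary of a parallelogram with sides w al and
    h be. General directions are allowed because two choices are needed: (1, i) for annuli in
    logarithmic coordinates, (lq, i) for the region between two q-spirals. *)
Definition box_int (g : C -> C) (c al be : C) (s a w h : R) : C :=
  (al * (cint (fun x => g (c + RtoC a * be + RtoC x * al)%C) s (s + w)
         - cint (fun x => g (c + RtoC (a + h) * be + RtoC x * al)%C) s (s + w)) +
   be * (cint (fun y => g (c + RtoC (s + w) * al + RtoC y * be)%C) a (a + h)
         - cint (fun y => g (c + RtoC s * al + RtoC y * be)%C) a (a + h)))%C.

Definition in_box (s a w h x y : R) : Prop := s <= x <= s + w /\ a <= y <= a + h.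

Definition holo_box (g : C -> C) (c al be : C) (s a w h : R) : Prop :=
  forall x y, in_box s a w h x y -> exists d, cd g (c + RtoC x * al + RtoC y * be)%C d.

Lemma holo_box_cont_h g c al be s a w h y x :
  holo_box g c al be s a w h -> in_box s a w h x y ->
  ccont (fun x => g (c + RtoC y * be + RtoC x * al)%C) x.
Proof.
  intros H I. destruct (H x y I) as [d Hd].
  apply (ccont_comp_cd (fun x => (c + RtoC y * be + RtoC x * al)%C) g x d); [apply ccont_line|].
  replace (c + RtoC y * be + RtoC x * al)%C with (c + RtoC x * al + RtoC y * be)%C by ring. exact Hd.
Qed.

Lemma holo_box_cont_v g c al be s a w h y x :
  holo_box g c al be s a w h -> in_box s a w h x y ->
  ccont (fun y => g (c + RtoC x * al + RtoC y * be)%C) y.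
Proof.
  intros H I. destruct (H x y I) as [d Hd].
  apply (ccont_comp_cd (fun y => (c + RtoC x * al + RtoC y * be)%C) g y d); [apply ccont_line|]. exact Hd.
Qed.

Lemma holo_box_sub g c al be s a w h s' a' w' h' :
  s <= s' -> s' + w' <= s + w -> a <= a' -> a' + h' <= a + h ->
  holo_box g c al be s a w h -> holo_box g c al be s' a' w' h'.
Proof. intros H1 H2 H3 H4 H x y [I1 I2]. apply H. split; lra. Qed.

(** The inner edges are run through twice in opposite directions and cancel. *)
Lemma box_int_split g c al be s a w h :
  0 <= w -> 0 <= h -> holo_box g c al be s a (w + w) (h + h) ->
  box_int g c al be s a (w + w) (h + h) =
  (box_int g c al be s a w h + box_int g c al be (s + w) a w h +
   (box_int g c al be s (a + h) w h + box_int g c al be (s + w) (a + h) w h))%C.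
Proof.
  intros Hw Hh H. unfold box_int. rewrite <- !Rplus_assoc.
  rewrite (cint_Chasles (fun x => g (c + RtoC a * be + RtoC x * al)%C) s (s + w) (s + w + w))
    by (first [lra | intros; eapply holo_box_cont_h; [exact H | split; lra]]).
  rewrite (cint_Chasles (fun x => g (c + RtoC (a + h + h) * be + RtoC x * al)%C) s (s + w) (s + w + w))
    by (first [lra | intros; eapply holo_box_cont_h; [exact H | split; lra]]).
  rewrite (cint_Chasles (fun y => g (c + RtoC (s + w + w) * al + RtoC y * be)%C) a (a + h) (a + h + h))
    by (first [lra | intros; eapply holo_box_cont_v; [exact H | split; lra]]).
  rewrite (cint_Chasles (fun y => g (c + RtoC s * al + RtoC y * be)%C) a (a + h) (a + h + h))
    by (first [lra | intros; eapply holo_box_cont_v; [exact H | split; lra]]).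
  ring.
Qed.

Lemma box_int_affine A B c al be s a w h :
  0 <= w -> 0 <= h -> box_int (fun z => A + B * z)%C c al be s a w h = 0.
Proof.
  intros Hw Hh.
  set (G := fun z => (A * z + B / 2 * (z * z))%C).
  assert (HG : forall z, cd G z (A + B * z)%C).
  { intros z. replace (A + B * z)%C with (A * 1 + B / 2 * (1 * z + z * 1))%C
      by (field; intro K; injection K; lra).
    apply cd_plus; apply cd_scal; [apply cd_id|]. apply cd_mult; apply cd_id. }
  assert (Hc : forall p d t, ccont (fun x => A + B * (p + RtoC x * d))%C t).
  { intros. apply ccont_plus; [apply ccont_const|]. apply ccont_scal, ccont_line. }
  unfold box_int.
  transitivity (al * cint (fun x => A + B * (c + RtoC a * be + RtoC x * al))%C s (s + w)
    - al * cint (fun x => A + B * (c + RtoC (a + h) * be + RtoC x * al))%C s (s + w)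
    + (be * cint (fun y => A + B * (c + RtoC (s + w) * al + RtoC y * be))%C a (a + h)
    - be * cint (fun y => A + B * (c + RtoC s * al + RtoC y * be))%C a (a + h)))%C; [ring|].
  rewrite !(cint_FTC G (fun z => A + B * z)%C) by (first [lra | intros; first [apply HG | apply Hc]]).
  replace (c + RtoC (a + h) * be + RtoC s * al)%C with (c + RtoC s * al + RtoC (a + h) * be)%C by ring.
  replace (c + RtoC (a + h) * be + RtoC (s + w) * al)%C with (c + RtoC (s + w) * al + RtoC (a + h) * be)%C by ring.
  replace (c + RtoC a * be + RtoC s * al)%C with (c + RtoC s * al + RtoC a * be)%C by ring.
  replace (c + RtoC a * be + RtoC (s + w) * al)%C with (c + RtoC (s + w) * al + RtoC a * be)%C by ring.
  ring.
Qed.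

(** An affine function has a primitive, so its boundary integral vanishes and may be subtracted:
    only the deviation of g from it, at most eta, is integrated over the perimeter. *)
Lemma box_int_bound g A B c al be s a w h eta :
  0 <= w -> 0 <= h -> holo_box g c al be s a w h ->
  (forall x y, in_box s a w h x y ->
     Cmod (g (c + RtoC x * al + RtoC y * be) - (A + B * (c + RtoC x * al + RtoC y * be)))%C <= eta) ->
  Cmod (box_int g c al be s a w h) <= 2 * eta * (Cmod al * w + Cmod be * h).
Proof.
  intros Hw Hh H Hb.
  replace (box_int g c al be s a w h) with
    (box_int g c al be s a w h - box_int (fun z => A + B * z)%C c al be s a w h)%C
    by (rewrite box_int_affine by assumption; ring).
  assert (Hc : forall p d t, ccont (fun x => A + B * (p + RtoC x * d))%C t).
  { intros. apply ccont_plus; [apply ccont_const|]. apply ccont_scal, ccont_line. }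
  unfold box_int.
  match goal with |- Cmod (al * (?I1 - ?I2) + be * (?I3 - ?I4) - (al * (?J1 - ?J2) + be * (?J3 - ?J4)))%C <= _ =>
    replace (al * (I1 - I2) + be * (I3 - I4) - (al * (J1 - J2) + be * (J3 - J4)))%C with
     (al * ((I1 - J1) - (I2 - J2)) + be * ((I3 - J3) - (I4 - J4)))%C by ring end.
  assert (Ch : forall y, a <= y <= a + h ->
     Cmod (cint (fun x => g (c + RtoC y * be + RtoC x * al)) s (s + w) -
           cint (fun x => A + B * (c + RtoC y * be + RtoC x * al)) s (s + w))%C <= eta * w).
  { intros y Hy. rewrite cint_minus; [|lra|intros; eapply holo_box_cont_h; [exact H | split; lra]|intros; apply Hc].
    replace (eta * w) with (eta * (s + w - s)) by ring. apply cint_bound; [lra| |].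
    - intros x Hx. apply ccont_plus; [eapply holo_box_cont_h; [exact H | split; lra]|].
      eapply ccont_ext; [|apply (ccont_scal (-1) _ _ (Hc (c + RtoC y * be)%C al x))]. intros; simpl; ring.
    - intros x Hx. replace (c + RtoC y * be + RtoC x * al)%C with (c + RtoC x * al + RtoC y * be)%C by ring.
      apply Hb. split; lra. }
  assert (Cv : forall x, s <= x <= s + w ->
     Cmod (cint (fun y => g (c + RtoC x * al + RtoC y * be)) a (a + h) -
           cint (fun y => A + B * (c + RtoC x * al + RtoC y * be)) a (a + h))%C <= eta * h).
  { intros x Hx. rewrite cint_minus; [|lra|intros; eapply holo_box_cont_v; [exact H | split; lra]|intros; apply Hc].
    replace (eta * h) with (eta * (a + h - a)) by ring. apply cint_bound; [lra| |].
    - intros y Hy. apply ccont_plus; [eapply holo_box_cont_v; [exact H | split; lra]|].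
      eapply ccont_ext; [|apply (ccont_scal (-1) _ _ (Hc (c + RtoC x * al)%C be y))]. intros; simpl; ring.
    - intros y Hy. apply Hb. split; lra. }
  eapply Rle_trans; [apply Cmod_triangle|]. rewrite !Cmod_mult.
  assert (P1 := Cmod_ge_0 al). assert (P2 := Cmod_ge_0 be).
  assert (Q1 := Ch a ltac:(lra)). assert (Q2 := Ch (a + h) ltac:(lra)).
  assert (Q3 := Cv s ltac:(lra)). assert (Q4 := Cv (s + w) ltac:(lra)).
  assert (R1 := Rle_trans _ _ _ (Cmod_minus_le _ _) (Rplus_le_compat _ _ _ _ Q1 Q2)).
  assert (R2 := Rle_trans _ _ _ (Cmod_minus_le _ _) (Rplus_le_compat _ _ _ _ Q4 Q3)).
  apply (Rmult_le_compat_l _ _ _ P1) in R1. apply (Rmult_le_compat_l _ _ _ P2) in R2. lra.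
Qed.

Section Goursat.
Variables (g : C -> C) (c al be : C) (s0 a0 w0 h0 : R).
Hypothesis (Hw : 0 <= w0) (Hh : 0 <= h0) (Hg : holo_box g c al be s0 a0 w0 h0).

Let wn n := w0 * (/ 2) ^ n.
Let hn n := h0 * (/ 2) ^ n.
Let J n (p : R * R) := Cmod (box_int g c al be (fst p) (snd p) (wn n) (hn n)).

(** Goursat's bisection, keeping a lower left corner only. The last quarter is the default;
    [bad_large] shows that it qualifies when the other three do not, since four quarters below
    e/4^(n+1) would add up to at most e/4^n. *)
Definition bad_quarter (e : R) (n : nat) (p : R * R) : R * R :=
  let w := wn (S n) in let h := hn (S n) in let (s, a) := p in
  let e' := e * (/ 4) ^ S n in
  if Rlt_dec e' (J (S n) (s, a)) then (s, a)
  else if Rlt_dec e' (J (S n) (s + w, a)) then (s + w, a)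
  else if Rlt_dec e' (J (S n) (s, a + h)) then (s, a + h) else (s + w, a + h).

Fixpoint bad_seq (e : R) (n : nat) : R * R :=
  match n with O => (s0, a0) | S k => bad_quarter e k (bad_seq e k) end.

Lemma half_pow_pos n : 0 < (/ 2) ^ n.
Proof. apply pow_lt. lra. Qed.

Lemma wn_half n : wn n = wn (S n) + wn (S n).
Proof. unfold wn. simpl. field. Qed.
Lemma hn_half n : hn n = hn (S n) + hn (S n).
Proof. unfold hn. simpl. field. Qed.
Lemma wn_pos n : 0 <= wn n.
Proof. unfold wn. generalize (half_pow_pos n). nra. Qed.
Lemma hn_pos n : 0 <= hn n.
Proof. unfold hn. generalize (half_pow_pos n). nra. Qed.

Lemma bad_step e n :
  fst (bad_seq e n) <= fst (bad_seq e (S n)) /\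
  fst (bad_seq e (S n)) + wn (S n) <= fst (bad_seq e n) + wn n /\
  snd (bad_seq e n) <= snd (bad_seq e (S n)) /\
  snd (bad_seq e (S n)) + hn (S n) <= snd (bad_seq e n) + hn n.
Proof.
  simpl. unfold bad_quarter. destruct (bad_seq e n) as [s a].
  rewrite (wn_half n), (hn_half n). assert (A := wn_pos (S n)). assert (B := hn_pos (S n)).
  clearbody J wn hn. repeat destruct Rlt_dec; cbn [fst snd]; lra.
Qed.

Lemma bad_nested e n m : (n <= m)%nat ->
  fst (bad_seq e n) <= fst (bad_seq e m) /\
  fst (bad_seq e m) + wn m <= fst (bad_seq e n) + wn n /\
  snd (bad_seq e n) <= snd (bad_seq e m) /\
  snd (bad_seq e m) + hn m <= snd (bad_seq e n) + hn n.
Proof. induction 1 as [|m _ IH]; [lra|]. assert (H := bad_step e m). lra. Qed.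

Lemma bad_holo e n :
  holo_box g c al be (fst (bad_seq e n)) (snd (bad_seq e n)) (wn n) (hn n).
Proof.
  assert (H := bad_nested e 0 n (Nat.le_0_l n)).
  assert (wn 0 = w0) by (unfold wn; simpl; ring). assert (hn 0 = h0) by (unfold hn; simpl; ring).
  simpl (bad_seq e 0) in H. simpl fst in H. simpl snd in H.
  eapply holo_box_sub; [| | | |exact Hg]; lra.
Qed.

Lemma bad_large e n : e < J 0 (s0, a0) -> e * (/ 4) ^ n < J n (bad_seq e n).
Proof.
  intros H0. induction n as [|n IH]; [simpl; lra|].
  assert (Hb := bad_holo e n). simpl bad_seq. unfold bad_quarter.
  revert IH Hb. destruct (bad_seq e n) as [s a]. simpl fst. simpl snd. intros IH Hb.
  destruct (Rlt_dec (e * (/ 4) ^ S n) (J (S n) (s, a))) as [|N1]; [assumption|]. destruct Rlt_dec as [|N2]; [assumption|].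
  destruct Rlt_dec as [|N3]; [assumption|].
  destruct (Rlt_dec (e * (/ 4) ^ S n) (J (S n) (s + wn (S n), a + hn (S n)))) as [|N4]; [assumption|].
  exfalso. unfold J in *. simpl fst in *. simpl snd in *.
  rewrite (wn_half n), (hn_half n) in IH, Hb.
  rewrite box_int_split in IH by (auto using wn_pos, hn_pos).
  assert (T := Cmod_triangle (box_int g c al be s a (wn (S n)) (hn (S n)) +
     box_int g c al be (s + wn (S n)) a (wn (S n)) (hn (S n)))
     (box_int g c al be s (a + hn (S n)) (wn (S n)) (hn (S n)) +
     box_int g c al be (s + wn (S n)) (a + hn (S n)) (wn (S n)) (hn (S n)))).
  assert (T1 := Cmod_triangle (box_int g c al be s a (wn (S n)) (hn (S n)))
     (box_int g c al be (s + wn (S n)) a (wn (S n)) (hn (S n)))).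
  assert (T2 := Cmod_triangle (box_int g c al be s (a + hn (S n)) (wn (S n)) (hn (S n)))
     (box_int g c al be (s + wn (S n)) (a + hn (S n)) (wn (S n)) (hn (S n)))).
  replace (e * (/ 4) ^ n) with (4 * (e * (/ 4) ^ S n)) in IH by (simpl; field). lra.
Qed.

(** The nested boxes shrink to a point where g is affine up to o(distance). The perimeter and the
    distance are both of order 2^(-n), so the integral is o(4^(-n)), against the lower bound e/4^n
    of [bad_large]. *)
Lemma goursat_aux : box_int g c al be s0 a0 w0 h0 = 0.
Proof.
  apply Cmod_eq_0. apply Rle_antisym; [|apply Cmod_ge_0].
  apply Rnot_lt_le. intros Hpos.
  set (e := Cmod (box_int g c al be s0 a0 w0 h0) / 2).
  assert (He : 0 < e) by (unfold e; lra).
  assert (E0 : e < J 0 (s0, a0)).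
  { unfold J, wn, hn; simpl. rewrite !Rmult_1_r. unfold e; lra. }
  assert (Hlim : forall f : nat -> R, (forall n m, (n <= m)%nat -> f n <= f m) ->
     (exists B, forall n, f n <= B) -> exists l, (forall n, f n <= l) /\
     forall B, (forall n, f n <= B) -> l <= B).
  { intros f Hm [B HB]. destruct (completeness (fun x => exists n, x = f n)) as [l [L1 L2]].
    - exists B. intros x [n ->]. apply HB.
    - exists (f O), O. reflexivity.
    - exists l. split; [intros n; apply L1; exists n; reflexivity|].
      intros B' HB'. apply L2. intros x [n ->]. apply HB'. }
  assert (Bs : forall n m, fst (bad_seq e m) <= fst (bad_seq e n) + wn n /\ snd (bad_seq e m) <= snd (bad_seq e n) + hn n).
  { intros n m. destruct (Nat.le_ge_cases n m) as [L|L].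
    - assert (N := bad_nested e n m L). generalize (wn_pos m) (hn_pos m). lra.
    - assert (N := bad_nested e m n L). generalize (wn_pos n) (hn_pos n). lra. }
  destruct (Hlim (fun n => fst (bad_seq e n))) as [s [S1 S2]].
  { intros n m L. apply (bad_nested e n m L). } { exists (fst (bad_seq e 0) + wn 0). intros n. apply Bs. }
  destruct (Hlim (fun n => snd (bad_seq e n))) as [a [A1 A2]].
  { intros n m L. apply (bad_nested e n m L). } { exists (snd (bad_seq e 0) + hn 0). intros n. apply Bs. }
  assert (Ip : forall n, in_box (fst (bad_seq e n)) (snd (bad_seq e n)) (wn n) (hn n) s a).
  { intros n. repeat split; [apply S1 | apply S2 | apply A1 | apply A2]; intros m; apply Bs. }
  destruct (bad_holo e 0 s a (Ip O)) as [d Hd].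
  set (z0 := (c + RtoC s * al + RtoC a * be)%C) in *.
  set (Q := Cmod al * w0 + Cmod be * h0).
  assert (HQ : 0 <= Q).
  { unfold Q. generalize (Cmod_ge_0 al) (Cmod_ge_0 be). nra. }
  (* With [Q] half the perimeter of the initial box, this accuracy bounds the integral over the N-th
     box by e 4^(-N) times 2 Q^2 / (4 (Q + 1)^2), a factor below 1. *)
  destruct (Hd (e / (4 * (Q + 1) ^ 2))) as [r [Hr Hrd]].
  { apply Rdiv_lt_0_compat; [exact He | nra]. }
  destruct (pow_lt_1_zero (/2) ltac:(rewrite Rabs_right; lra) (r / (Q + 1))) as [N HN].
  { apply Rdiv_lt_0_compat; lra. }
  specialize (HN N (Nat.le_refl N)). rewrite Rabs_right in HN by (generalize (half_pow_pos N); lra).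
  assert (HI := Ip N).
  assert (HL := bad_large e N E0). unfold J in HL.
  assert (Hq : Q * (/2) ^ N < r).
  { apply Rlt_div_r in HN; [nra | lra]. }
  set (eta := e / (4 * (Q + 1) ^ 2) * (Q * (/2)^N)) in *.
  assert (HB := box_int_bound g (g z0 - d * z0)%C d c al be (fst (bad_seq e N)) (snd (bad_seq e N)) (wn N) (hn N) eta
     (wn_pos N) (hn_pos N) (bad_holo e N)).
  assert (Hclose : forall x y, in_box (fst (bad_seq e N)) (snd (bad_seq e N)) (wn N) (hn N) x y ->
     Cmod (RtoC (x - s) * al + RtoC (y - a) * be)%C <= Q * (/2)^N).
  { intros x y [X Y]. destruct HI as [X' Y'].
    eapply Rle_trans; [apply Cmod_triangle|]. rewrite !Cmod_mult, !Cmod_R.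
    replace (Q * (/2)^N) with (wn N * Cmod al + hn N * Cmod be) by (unfold Q, wn, hn; ring).
    apply Rplus_le_compat; apply Rmult_le_compat_r; try apply Cmod_ge_0; apply Rabs_le; lra. }
  assert (HB' : Cmod (box_int g c al be (fst (bad_seq e N)) (snd (bad_seq e N)) (wn N) (hn N)) <=
     2 * eta * (Cmod al * wn N + Cmod be * hn N)).
  { apply HB. intros x y Hxy. specialize (Hclose x y Hxy).
    assert (D := Hrd _ (Rle_lt_trans _ _ _ Hclose Hq)).
    replace (z0 + (RtoC (x - s) * al + RtoC (y - a) * be))%C with (c + RtoC x * al + RtoC y * be)%C in D
      by (unfold z0; rewrite !RtoC_minus; ring).
    replace (g (c + RtoC x * al + RtoC y * be) - (g z0 - d * z0 + d * (c + RtoC x * al + RtoC y * be)))%C with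
      (g (c + RtoC x * al + RtoC y * be) - g z0 - d * (RtoC (x - s) * al + RtoC (y - a) * be))%C
      by (rewrite !RtoC_minus; unfold z0; ring).
    eapply Rle_trans; [exact D|]. unfold eta. apply Rmult_le_compat_l; [|exact Hclose].
    apply Rlt_le, Rdiv_lt_0_compat; [exact He | nra]. }
  replace (2 * eta * (Cmod al * wn N + Cmod be * hn N)) with (e * (/4)^N * (2 * Q ^ 2 / (4 * (Q + 1)^2))) in HB'.
  - assert (2 * Q ^ 2 / (4 * (Q + 1)^2) <= 1) by (apply Rle_div_l; nra).
    assert (0 < e * (/4)^N) by (apply Rmult_lt_0_compat; [exact He | apply pow_lt; lra]). nra.
  - unfold eta, wn, hn. replace (Cmod al * (w0 * (/2)^N) + Cmod be * (h0 * (/2)^N)) with (Q * (/2)^N) by (unfold Q; ring).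
    replace (/4) with (/2 * /2) by field. rewrite Rpow_mult_distr. field. lra.
Qed.
End Goursat.

Lemma goursat (g : C -> C) (c al be : C) (s a w h : R) :
  0 <= w -> 0 <= h -> holo_box g c al be s a w h -> box_int g c al be s a w h = 0.
Proof. apply goursat_aux. Qed.

(** * Cauchy estimates *)

Lemma cd_Re_line (G : C -> C) (c d D : C) (s : R) :
  cd G (c + RtoC s * d)%C D ->
  is_derive (fun x => fst (G (c + RtoC x * d)%C)) s (fst (d * D)%C).
Proof.
  intros H. apply cd_line_derive in H.
  assert (K := filterdiff_comp' _ _ _ _ _ H
    (filterdiff_linear (V := R_NormedModule) (fst : C_R_NormedModule -> R_NormedModule) (is_linear_fst (K := R_AbsRing)))).
  exact K.
Qed.

Lemma cd_Im_line (G : C -> C) (c d D : C) (s : R) :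
  cd G (c + RtoC s * d)%C D ->
  is_derive (fun x => snd (G (c + RtoC x * d)%C)) s (snd (d * D)%C).
Proof.
  intros H. apply cd_line_derive in H.
  assert (K := filterdiff_comp' _ _ _ _ _ H
    (filterdiff_linear (V := R_NormedModule) (snd : C_R_NormedModule -> R_NormedModule) (is_linear_snd (K := R_AbsRing)))).
  exact K.
Qed.

(** The real mean value theorem is applied to the real and the imaginary part separately, hence the
    factor 2. *)
Lemma mean_value_C (f : C -> C) (z h : C) (B : R) :
  (forall s, 0 <= s <= 1 -> exists d, cd f (z + RtoC s * h)%C d /\ Cmod d <= B) ->
  Cmod (f (z + h) - f z)%C <= 2 * B * Cmod h.
Proof.
  intros H.
  (* [MVT_gen] wants the derivative as a function, so one is chosen from the pointwise existence. *)
  set (df := fun s => epsilon (inhabits (RtoC 0)) (fun d => cd f (z + RtoC s * h)%C d /\ Cmod d <= B)).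
  assert (Hdf : forall s, 0 <= s <= 1 -> cd f (z + RtoC s * h)%C (df s) /\ Cmod (df s) <= B).
  { intros s Hs. unfold df. apply epsilon_spec, H, Hs. }
  assert (Hmul : forall s, 0 <= s <= 1 -> Cmod (h * df s)%C <= Cmod h * B).
  { intros s Hs. rewrite Cmod_mult. apply Rmult_le_compat_l; [apply Cmod_ge_0 | apply Hdf, Hs]. }
  assert (E1 : (z + RtoC 1 * h)%C = (z + h)%C) by ring.
  assert (E0 : (z + RtoC 0 * h)%C = z) by ring.
  assert (A : Rabs (fst (f (z + h)%C) - fst (f z)) <= Cmod h * B).
  { destruct (MVT_gen (fun x => fst (f (z + RtoC x * h)%C)) 0 1 (fun s => fst (h * df s)%C)) as [c [Hc E]].
    - intros x Hx. rewrite Rmin_left, Rmax_right in Hx by lra. apply cd_Re_line, Hdf; lra.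
    - intros x Hx. rewrite Rmin_left, Rmax_right in Hx by lra.
      apply derivable_continuous_pt. eexists. apply is_derive_Reals. apply cd_Re_line, Hdf; lra.
    - rewrite Rmin_left, Rmax_right in Hc by lra. rewrite E1, E0 in E.
      rewrite E, Rminus_0_r, Rmult_1_r. eapply Rle_trans; [apply Re_le_Cmod | apply Hmul, Hc]. }
  assert (A2 : Rabs (snd (f (z + h)%C) - snd (f z)) <= Cmod h * B).
  { destruct (MVT_gen (fun x => snd (f (z + RtoC x * h)%C)) 0 1 (fun s => snd (h * df s)%C)) as [c [Hc E]].
    - intros x Hx. rewrite Rmin_left, Rmax_right in Hx by lra. apply cd_Im_line, Hdf; lra.
    - intros x Hx. rewrite Rmin_left, Rmax_right in Hx by lra.
      apply derivable_continuous_pt. eexists. apply is_derive_Reals. apply cd_Im_line, Hdf; lra.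
    - rewrite Rmin_left, Rmax_right in Hc by lra. rewrite E1, E0 in E.
      rewrite E, Rminus_0_r, Rmult_1_r. eapply Rle_trans; [apply Im_le_Cmod | apply Hmul, Hc]. }
  eapply Rle_trans; [apply Cmod_Re_Im_le|]. simpl. unfold Rminus in *. lra.
Qed.

(** Written through [Cexp] so that circles are images of vertical segments and annuli are images of
    rectangles. *)
Definition circ (rho th : R) : C := Cexp (RtoC (ln rho) + RtoC th * Ci)%C.

Lemma Cmod_circ rho th : 0 < rho -> Cmod (circ rho th) = rho.
Proof.
  intros H. unfold circ. rewrite Cmod_Cexp. simpl.
  replace (ln rho + (th * 0 - 0 * 1)) with (ln rho) by ring. apply exp_ln, H.
Qed.

Lemma circ_neq_0 rho th : circ rho th <> 0.
Proof. apply Cexp_neq_0. Qed.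

Lemma Cexp_2PI (w : C) : Cexp (w + RtoC (2 * PI) * Ci) = Cexp w.
Proof.
  rewrite Cexp_plus. replace (Cexp (RtoC (2 * PI) * Ci)) with (RtoC 1); [ring|].
  unfold Cexp, RtoC, Cmult, Ci, Re, Im; simpl.
  replace (2 * PI * 0 - 0 * 1) with 0 by ring. replace (2 * PI * 1 + 0 * 0) with (2 * PI) by ring.
  rewrite exp_0, cos_2PI, sin_2PI. f_equal; ring.
Qed.

Definition dquot (f : C -> C) (p h : C) : C := ((f (p + h) - f p) / h)%C.

Lemma dquot_circ_cont f p r rho th :
  0 < rho < r -> (forall z, Cmod (z - p)%C < r -> exists d, cd f z d) ->
  ccont (fun y => dquot f p (circ rho y)) th.
Proof.
  intros Hr Hf.
  assert (Cc : ccont (circ rho) th).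
  { eapply (ccont_comp_cd (fun y => RtoC (ln rho) + RtoC y * Ci)%C Cexp); [apply ccont_line | apply cd_Cexp]. }
  destruct (Hf (p + circ rho th)%C) as [d Hd].
  { replace (p + circ rho th - p)%C with (circ rho th) by ring. rewrite Cmod_circ; lra. }
  unfold dquot. apply ccont_mult.
  - eapply (ccont_comp_cd (circ rho) (fun h => f (p + h) - f p)%C); [exact Cc|].
    apply cd_minus; [|apply cd_const]. eapply (cd_comp (fun h => p + h)%C f); [|exact Hd].
    apply cd_plus; [apply cd_const | apply cd_id].
  - apply ccont_inv; [apply circ_neq_0 | exact Cc].
Qed.

(** Cauchy's formula for the derivative at the centre, obtained without a formula for the integral
    of 1/z: the mean of the difference quotient over a circle does not depend on the radius, and
    tends to the derivative as the radius shrinks. *)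
Lemma circle_derivative f p d r rho :
  0 < rho < r -> (forall z, Cmod (z - p)%C < r -> exists d, cd f z d) -> cd f p d ->
  cint (fun th => dquot f p (circ rho th)) 0 (2 * PI) = (RtoC (2 * PI) * d)%C.
Proof.
  intros Hr Hf Hd. assert (Hpi := PI_RGT_0).
  assert (Hinv : forall rho0, 0 < rho0 <= rho ->
     cint (fun th => dquot f p (circ rho th)) 0 (2 * PI) = cint (fun th => dquot f p (circ rho0 th)) 0 (2 * PI)).
  { intros rho0 [H0 H1].
    assert (Hln : ln rho0 <= ln rho) by (destruct H1 as [H1|H1]; [left; apply ln_increasing; lra | rewrite H1; lra]).
    set (g := fun w => dquot f p (Cexp w)).
    (* In the logarithmic variable the annulus between the two circles is a rectangle of height 2
       pi. Its horizontal sides cancel by periodicity of [Cexp], and the removable singularity at h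
       = 0 is never met. *)
    assert (G := goursat g 0 1 Ci (ln rho0) 0 (ln rho - ln rho0) (2 * PI) ltac:(lra) ltac:(lra)).
    assert (E : forall x y, Cexp (0 + RtoC x * 1 + RtoC y * Ci)%C = circ (exp x) y).
    { intros x y. unfold circ. rewrite ln_exp. f_equal. ring. }
    unfold box_int in G. rewrite Rplus_0_l in G.
    replace (ln rho0 + (ln rho - ln rho0)) with (ln rho) in G by ring.
    rewrite (cint_ext (fun x => g (0 + RtoC (2 * PI) * Ci + RtoC x * 1)%C) (fun x => g (0 + RtoC 0 * Ci + RtoC x * 1)%C)) in G.
    2: exact Hln.
    2:{ intros s _. unfold g. f_equal. replace (0 + RtoC (2 * PI) * Ci + s * 1)%C with ((0 + 0 * Ci + RtoC s * 1) + RtoC (2 * PI) * Ci)%C by ring.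
        apply Cexp_2PI. }
    rewrite (cint_ext (fun y => g (0 + RtoC (ln rho) * 1 + RtoC y * Ci)%C) (fun th => dquot f p (circ rho th))) in G.
    2: lra.
    2:{ intros s _. unfold g. rewrite E, exp_ln by lra. reflexivity. }
    rewrite (cint_ext (fun y => g (0 + RtoC (ln rho0) * 1 + RtoC y * Ci)%C) (fun th => dquot f p (circ rho0 th))) in G.
    2: lra.
    2:{ intros s _. unfold g. rewrite E, exp_ln by lra. reflexivity. }
    assert (HH : holo_box g 0 1 Ci (ln rho0) 0 (ln rho - ln rho0) (2 * PI)).
    { intros x y [Hx Hy]. unfold g.
      assert (Hm : Cmod (Cexp (0 + RtoC x * 1 + RtoC y * Ci)%C) < r).
      { rewrite E, Cmod_circ by apply exp_pos. apply Rle_lt_trans with rho; [|lra].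
        rewrite <- (exp_ln rho) by lra.
        destruct (Rle_lt_or_eq_dec x (ln rho)) as [L|L]; [lra| |rewrite L; lra].
        left. apply exp_increasing. exact L. }
      destruct (Hf (p + Cexp (0 + RtoC x * 1 + RtoC y * Ci))%C) as [d' Hd'].
      { match goal with |- Cmod (p + ?a - p)%C < r => replace (p + a - p)%C with a by ring end. exact Hm. }
      eexists. unfold dquot.
      eapply (cd_comp Cexp (fun h => (f (p + h) - f p) * / h)%C); [apply cd_Cexp|].
      apply cd_mult.
      - apply cd_minus; [|apply cd_const]. eapply (cd_comp (fun h => p + h)%C f); [|exact Hd'].
        apply cd_plus; [apply cd_const | apply cd_id].
      - apply cd_inv, Cexp_neq_0. }
    specialize (G HH).
    set (I1 := cint (fun th => dquot f p (circ rho th)) 0 (2 * PI)) in *.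
    set (I2 := cint (fun th => dquot f p (circ rho0 th)) 0 (2 * PI)) in *.
    assert (NC : Ci <> 0) by (intros K; injection K; lra).
    match type of G with (?a * (?u - ?u) + Ci * (I1 - I2))%C = _ =>
      replace (a * (u - u) + Ci * (I1 - I2))%C with (Ci * (I1 - I2))%C in G by ring end.
    replace I1 with (I2 + / Ci * (Ci * (I1 - I2)))%C by (field; exact NC). rewrite G, Cmult_0_r, Cplus_0_r. reflexivity. }
  assert (Z : (cint (fun th => dquot f p (circ rho th)) 0 (2 * PI) - RtoC (2 * PI) * d)%C = 0).
  { apply Cmod_eq_0, Rle_antisym; [|apply Cmod_ge_0]. apply Rnot_lt_le. intros Hpos.
    set (X := Cmod (cint (fun th => dquot f p (circ rho th)) 0 (2 * PI) - RtoC (2 * PI) * d)%C) in *.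
    set (e := X / (4 * PI)). assert (He : 0 < e) by (apply Rdiv_lt_0_compat; lra).
    destruct (Hd e He) as [r1 [Hr1 Q]].
    set (rho0 := Rmin rho (r1 / 2)).
    assert (0 < rho0) by (apply Rmin_pos; lra).
    assert (rho0 <= rho) by apply Rmin_l. assert (rho0 <= r1 / 2) by apply Rmin_r.
    assert (X <= e * (2 * PI - 0)).
    { unfold X. rewrite (Hinv rho0) by lra.
      replace (RtoC (2 * PI) * d)%C with (cint (fun _ => d) 0 (2 * PI)).
      2:{ rewrite (RInt_const (V := C_R_CompleteNormedModule)).
          unfold scal; simpl. unfold prod_scal, scal; simpl. unfold mult; simpl.
          unfold Cmult, RtoC; simpl. apply injective_projections; simpl; ring. }
      rewrite cint_minus; [|lra|intros; apply (dquot_circ_cont f p r); [lra|exact Hf]|intros; apply ccont_const].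
      assert (Hc : forall s, ccont (fun x => dquot f p (circ rho0 x) - d)%C s).
      { intros s. apply ccont_plus; [apply (dquot_circ_cont f p r); [lra|exact Hf]|apply ccont_const]. }
      apply cint_bound; [lra | intros; apply Hc |].
      intros s _. unfold dquot. assert (N := circ_neq_0 rho0 s).
      replace ((f (p + circ rho0 s) - f p) / circ rho0 s - d)%C with
        ((f (p + circ rho0 s) - f p - d * circ rho0 s) / circ rho0 s)%C by (field; exact N).
      rewrite Cmod_div by exact N.
      assert (Q' := Q (circ rho0 s)). rewrite Cmod_circ in Q' |- * by assumption.
      apply Rle_div_l; [assumption|]. apply Q'. lra. }
    assert (e * (2 * PI - 0) = X / 2) by (unfold e; field; lra). lra. }
  rewrite <- (Cplus_0_r (RtoC (2 * PI) * d)), <- Z. change (cint (fun th => dquot f p (circ rho th)) 0 (2 * PI)) with (cint (fun th => dquot f p (circ rho th)) 0 (2 * PI) : C). set (I := cint _ _ _ : C). change (@eq C I (RtoC (2 * PI) * d + (I - RtoC (2 * PI) * d))%C). ring.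
Qed.

Lemma circle_derivative_bound f p d r rho B :
  0 < rho < r -> (forall z, Cmod (z - p)%C < r -> exists d, cd f z d) -> cd f p d ->
  (forall th, Cmod (f (p + circ rho th) - f p)%C <= B) -> Cmod d <= B / rho.
Proof.
  intros Hr Hf Hd HB. assert (Hpi := PI_RGT_0).
  assert (E := circle_derivative f p d r rho Hr Hf Hd).
  assert (K : Cmod (RtoC (2 * PI) * d)%C <= B / rho * (2 * PI - 0)).
  { rewrite <- E. apply cint_bound; [lra | intros; apply (dquot_circ_cont f p r); assumption |].
    intros s _. unfold dquot. rewrite Cmod_div by apply circ_neq_0. rewrite Cmod_circ by lra.
    apply Rmult_le_compat_r; [left; apply Rinv_0_lt_compat; lra | apply HB]. }
  rewrite Cmod_mult, Cmod_R, Rabs_right in K by lra. nra.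
Qed.

(** The constant 4 is the oscillation 2M divided by the radius r/2 of the circle that is used. *)
Lemma cauchy_estimate f p d r M :
  0 < r -> (forall z, Cmod (z - p)%C < r -> exists d, cd f z d) -> cd f p d ->
  (forall z, Cmod (z - p)%C < r -> Cmod (f z) <= M) -> Cmod d <= 4 * M / r.
Proof.
  intros Hr Hf Hd HM.
  replace (4 * M / r) with (2 * M / (r / 2)) by (field; lra).
  apply (circle_derivative_bound f p d r); [lra | assumption | assumption |].
  intros th. eapply Rle_trans; [apply Cmod_minus_le|].
  assert (Cmod (f (p + circ (r / 2) th)%C) <= M).
  { apply HM. replace (p + circ (r / 2) th - p)%C with (circ (r/2) th) by ring. rewrite Cmod_circ; lra. }
  assert (Cmod (f p) <= M) by (apply HM; replace (p - p)%C with (RtoC 0) by ring; rewrite Cmod_0; lra). lra.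
Qed.

(** The remainder depends on f through its bound M alone, so it is uniform along a bounded sequence
    of holomorphic functions. That uniformity is what makes limits differentiable in [vd_limit]. *)
Lemma taylor_second_order f p d r M :
  0 < r -> (forall z, Cmod (z - p)%C < r -> exists d, cd f z d) -> cd f p d ->
  (forall z, Cmod (z - p)%C < r -> Cmod (f z) <= M) ->
  forall h, Cmod h < r / 4 -> Cmod (f (p + h) - f p - d * h)%C <= 256 * M / r ^ 2 * Cmod h ^ 2.
Proof.
  intros Hr Hf Hd HM.
  assert (HM0 : 0 <= M).
  { eapply Rle_trans; [apply Cmod_ge_0 | apply (HM p)]. replace (p - p)%C with (RtoC 0) by ring. rewrite Cmod_0; lra. }
  assert (Tri : forall z k, Cmod (z - p + k)%C <= Cmod (z - p)%C + Cmod k) by (intros; apply Cmod_triangle).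
  assert (D1 : forall z dz, Cmod (z - p)%C < r / 2 -> cd f z dz -> Cmod dz <= 8 * M / r).
  { intros z dz Hz Hdz. replace (8 * M / r) with (4 * M / (r / 2)) by (field; lra).
    apply (cauchy_estimate f z); [lra| |assumption|].
    - intros y Hy. apply Hf. assert (T := Tri z (y - z)%C). replace (z - p + (y - z))%C with (y - p)%C in T by ring. lra.
    - intros y Hy. apply HM. assert (T := Tri z (y - z)%C). replace (z - p + (y - z))%C with (y - p)%C in T by ring. lra. }
  assert (Seg : forall z k s, 0 <= s <= 1 -> Cmod (z - p)%C + Cmod k < r / 2 -> Cmod (z + RtoC s * k - p)%C < r / 2).
  { intros z k s Hs H. replace (z + RtoC s * k - p)%C with (z - p + RtoC s * k)%C by ring.
    eapply Rle_lt_trans; [apply Tri|]. rewrite Cmod_mult, Cmod_R, Rabs_right by lra.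
    assert (P := Cmod_ge_0 k). apply Rle_lt_trans with (Cmod (z - p)%C + 1 * Cmod k); [|lra]. apply Rplus_le_compat_l, Rmult_le_compat_r; lra. }
  assert (Lip : forall z k, Cmod (z - p)%C + Cmod k < r / 2 -> Cmod (f (z + k) - f z)%C <= 2 * (8 * M / r) * Cmod k).
  { intros z k H. apply mean_value_C. intros s Hs. assert (S := Seg z k s Hs H).
    destruct (Hf (z + RtoC s * k)%C) as [d' Hd']; [lra|]. exists d'. split; [exact Hd'|].
    apply (D1 _ _ S Hd'). }
  assert (DL : forall k dk, Cmod k < r / 4 -> cd f (p + k)%C dk -> Cmod (dk - d)%C <= 128 * M / r ^ 2 * Cmod k).
  { intros k dk Hk Hdk. assert (P := Cmod_ge_0 k).
    replace (128 * M / r ^ 2 * Cmod k) with (2 * (2 * (8 * M / r) * Cmod k) / (r / 4)) by (field; lra).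
    apply (circle_derivative_bound (fun z => f (z + k) - f z)%C p (dk - d)%C (r / 4 + (r / 4 - Cmod k) / 2)); [lra| | |].
    - intros z Hz. destruct (Hf z) as [u Hu]; [lra|].
      destruct (Hf (z + k)%C) as [v Hv].
      { assert (T := Tri z k). replace (z - p + k)%C with (z + k - p)%C in T by ring. lra. }
      exists (v * (1 + 0) - u)%C. apply cd_minus; [|exact Hu].
      apply (cd_comp (fun z => z + k)%C f); [|exact Hv]. apply cd_plus; [apply cd_id | apply cd_const].
    - apply cd_minus; [|exact Hd]. replace dk with (dk * (1 + 0))%C by ring.
      apply (cd_comp (fun z => z + k)%C f); [|exact Hdk]. apply cd_plus; [apply cd_id | apply cd_const].
    - intros th. eapply Rle_trans; [apply Cmod_minus_le|].
      assert (L1 := Lip (p + circ (r / 4) th)%C k). assert (L2 := Lip p k).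
      replace (p + circ (r / 4) th - p)%C with (circ (r / 4) th) in L1 by ring.
      replace (p - p)%C with (RtoC 0) in L2 by ring. rewrite Cmod_0 in L2. rewrite Cmod_circ in L1 by lra.
      specialize (L1 ltac:(lra)). specialize (L2 ltac:(lra)). lra. }
  intros h Hh.
  replace (f (p + h) - f p - d * h)%C with ((f (p + h) - d * (p + h)) - (f p - d * p))%C by ring.
  replace (256 * M / r ^ 2 * Cmod h ^ 2) with (2 * (128 * M / r ^ 2 * Cmod h) * Cmod h) by (field; lra).
  apply (mean_value_C (fun z => f z - d * z)%C). intros s Hs.
  assert (S : Cmod (RtoC s * h)%C <= Cmod h).
  { rewrite Cmod_mult, Cmod_R, Rabs_right by lra. generalize (Cmod_ge_0 h); nra. }
  destruct (Hf (p + RtoC s * h)%C) as [d' Hd'].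
  { replace (p + RtoC s * h - p)%C with (RtoC s * h)%C by ring. lra. }
  exists (d' - d * 1)%C. split.
  - apply cd_minus; [exact Hd' | apply cd_scal, cd_id].
  - replace (d' - d * 1)%C with (d' - d)%C by ring. eapply Rle_trans; [apply (DL (RtoC s * h)%C); [lra | exact Hd']|].
    apply Rmult_le_compat_l; [|exact S]. apply Rmult_le_pos; [lra|]. left. apply Rinv_0_lt_compat. nra.
Qed.

(** * Locally bounded limits of holomorphic functions *)

Definition cvg (u : nat -> C) (l : C) : Prop :=
  forall e, 0 < e -> exists N, forall n, (N <= n)%nat -> Cmod (u n - l)%C <= e.

Lemma cvg_const (c : C) : cvg (fun _ => c) c.
Proof. intros e He. exists O. intros n _. replace (c - c)%C with (RtoC 0) by ring. rewrite Cmod_0; lra. Qed.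

Lemma cvg_ext (u v : nat -> C) (l : C) : (forall n, u n = v n) -> cvg u l -> cvg v l.
Proof. intros E H e He. destruct (H e He) as [N HN]. exists N. intros n Hn. rewrite <- E. apply HN, Hn. Qed.

Lemma cvg_plus (u v : nat -> C) (l m : C) : cvg u l -> cvg v m -> cvg (fun n => u n + v n)%C (l + m).
Proof.
  intros Hu Hv e He. destruct (Hu (e/2)) as [N1 H1]; [lra|]. destruct (Hv (e/2)) as [N2 H2]; [lra|].
  exists (Nat.max N1 N2). intros n Hn. specialize (H1 n ltac:(lia)). specialize (H2 n ltac:(lia)).
  replace (u n + v n - (l + m))%C with ((u n - l) + (v n - m))%C by ring.
  eapply Rle_trans; [apply Cmod_triangle | lra].
Qed.

Lemma cvg_scal (k : C) (u : nat -> C) (l : C) : cvg u l -> cvg (fun n => k * u n)%C (k * l).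
Proof.
  intros Hu e He. assert (P := Cmod_ge_0 k). destruct (Hu (e / (Cmod k + 1))) as [N H].
  { apply Rdiv_lt_0_compat; lra. }
  exists N. intros n Hn. specialize (H n Hn). replace (k * u n - k * l)%C with (k * (u n - l))%C by ring.
  rewrite Cmod_mult. apply Rle_trans with (Cmod k * (e / (Cmod k + 1))); [apply Rmult_le_compat_l; assumption|].
  apply Rle_trans with ((Cmod k + 1) * (e / (Cmod k + 1))); [|right; field; lra].
  apply Rmult_le_compat_r; [left; apply Rdiv_lt_0_compat; lra | lra].
Qed.

Lemma cvg_minus (u v : nat -> C) (l m : C) : cvg u l -> cvg v m -> cvg (fun n => u n - v n)%C (l - m).
Proof.
  intros Hu Hv. replace (l - m)%C with (l + (-1) * m)%C by ring.
  eapply cvg_ext; [|apply (cvg_plus _ _ _ _ Hu (cvg_scal (-1) _ _ Hv))]. intros; simpl; ring.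
Qed.

Lemma cvg_bound (u : nat -> C) (l : C) (B : R) : (forall n, Cmod (u n) <= B) -> cvg u l -> Cmod l <= B.
Proof.
  intros HB H. apply Rnot_lt_le. intros L. destruct (H ((Cmod l - B) / 2)) as [N HN]; [lra|].
  specialize (HN N (Nat.le_refl N)). specialize (HB N).
  assert (T := Cmod_triangle_rev l (u N)). rewrite Cmod_minus_sym in T. lra.
Qed.

Lemma cvg_unique (u : nat -> C) (l m : C) : cvg u l -> cvg u m -> l = m.
Proof.
  intros Hl Hm. assert (H := cvg_minus _ _ _ _ Hl Hm).
  assert (E : Cmod (l - m)%C <= 0).
  { apply (cvg_bound (fun n => u n - u n)%C); [|exact H]. intros n.
    replace (u n - u n)%C with (RtoC 0) by ring. rewrite Cmod_0; lra. }
  assert (Z : (l - m)%C = 0) by (apply Cmod_eq_0, Rle_antisym; [exact E | apply Cmod_ge_0]).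
  replace l with (l - m + m)%C by ring. rewrite Z. ring.
Qed.

Lemma cvg_sub (u : nat -> C) (l : C) (k : nat -> nat) :
  (forall n, (n <= k n)%nat) -> cvg u l -> cvg (fun n => u (k n)) l.
Proof.
  intros Hk H e He. destruct (H e He) as [N HN]. exists N. intros n Hn. apply HN.
  specialize (Hk n). lia.
Qed.

Lemma cvg_shift_inv (u : nat -> C) (l : C) (k : nat) : cvg (fun n => u (n + k)%nat) l -> cvg u l.
Proof.
  intros H e He. destruct (H e He) as [N HN]. exists (N + k)%nat. intros n Hn.
  specialize (HN (n - k)%nat ltac:(lia)). replace (n - k + k)%nat with n in HN by lia. exact HN.
Qed.

Lemma cvg_Re_Im (u : nat -> C) (l : C) :
  is_lim_seq (fun n => fst (u n)) (fst l) -> is_lim_seq (fun n => snd (u n)) (snd l) -> cvg u l.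
Proof.
  intros H1 H2 e He. apply is_lim_seq_spec in H1. apply is_lim_seq_spec in H2.
  assert (He2 : 0 < e / 2) by lra.
  destruct (H1 (mkposreal _ He2)) as [N1 Q1]. destruct (H2 (mkposreal _ He2)) as [N2 Q2].
  exists (Nat.max N1 N2). intros n Hn. specialize (Q1 n ltac:(lia)). specialize (Q2 n ltac:(lia)).
  simpl in Q1, Q2. eapply Rle_trans; [apply Cmod_Re_Im_le|]. simpl. unfold Rminus in *. lra.
Qed.

Lemma cvg_lim_seq (u : nat -> C) (l : C) :
  cvg u l -> is_lim_seq (fun n => fst (u n)) (fst l) /\ is_lim_seq (fun n => snd (u n)) (snd l).
Proof.
  intros H. split; apply is_lim_seq_spec; intros [e He]; destruct (H (e / 2)) as [N HN]; try lra;
  exists N; intros n Hn; specialize (HN n Hn); simpl.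
  - assert (T := Re_le_Cmod (u n - l)%C). simpl in T. unfold Rminus. lra.
  - assert (T := Im_le_Cmod (u n - l)%C). simpl in T. unfold Rminus. lra.
Qed.

Lemma cvg_CLim_seq (u : nat -> C) (l : C) : cvg u l -> CLim_seq u = l.
Proof.
  intros H. apply cvg_lim_seq in H. destruct H as [H1 H2].
  unfold CLim_seq, Re, Im. rewrite (is_lim_seq_unique _ _ H1), (is_lim_seq_unique _ _ H2).
  destruct l; reflexivity.
Qed.

Lemma cvg_cauchy (u : nat -> C) :
  (forall e, 0 < e -> exists N, forall n m, (N <= n)%nat -> (N <= m)%nat -> Cmod (u n - u m)%C <= e) ->
  exists l, cvg u l.
Proof.
  intros H.
  assert (A : ex_finite_lim_seq (fun n => fst (u n))).
  { apply ex_lim_seq_cauchy_corr. intros [e He]. destruct (H (e / 2)) as [N HN]; [lra|]. exists N.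
    intros n m Hn Hm. assert (T := Re_le_Cmod (u n - u m)%C). specialize (HN n m Hn Hm). simpl in *.
    unfold Rminus. lra. }
  assert (B : ex_finite_lim_seq (fun n => snd (u n))).
  { apply ex_lim_seq_cauchy_corr. intros [e He]. destruct (H (e / 2)) as [N HN]; [lra|]. exists N.
    intros n m Hn Hm. assert (T := Im_le_Cmod (u n - u m)%C). specialize (HN n m Hn Hm). simpl in *.
    unfold Rminus. lra. }
  destruct A as [a A], B as [b B]. exists (a, b). apply cvg_Re_Im; assumption.
Qed.

(** * Complex Frechet derivatives on normed modules over C *)

Section Vd.
Context {V : NormedModule C_AbsRing}.

(** Stated over an arbitrary V so that one limit theorem serves one complex variable as well as the
    triple (eps, t, z). *)
Definition vd (f : V -> C) (p : V) (l : V -> C) : Prop :=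
  @is_linear C_AbsRing V C_NormedModule l /\
  forall e, 0 < e -> exists r, 0 < r /\ forall h : V, norm h < r ->
    Cmod (f (plus p h) - f p - l h)%C <= e * norm h.

Lemma minus_plus_l (p h : V) : minus (plus p h) p = h.
Proof.
  unfold minus. rewrite (plus_comm p h), <- plus_assoc.
  transitivity (plus h zero); [apply f_equal, (@plus_opp_r (NormedModule.AbelianGroup C_AbsRing V)) | apply plus_zero_r].
Qed.

Lemma plus_minus_l (p y : V) : plus p (minus y p) = y.
Proof.
  unfold minus. rewrite (plus_comm y), plus_assoc.
  transitivity (plus zero y); [apply (f_equal (fun u => plus u y)), (@plus_opp_r (NormedModule.AbelianGroup C_AbsRing V)) | apply plus_zero_l].
Qed.

Lemma locally_norm_V (p : V) (P : V -> Prop) :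
  locally p P <-> exists r, 0 < r /\ forall h, norm h < r -> P (plus p h).
Proof.
  split.
  - intros H. destruct (locally_norm_le_locally p P H) as [r H']. exists r.
    split; [apply cond_pos|]. intros h Hh. apply H'. unfold ball_norm.
    rewrite minus_plus_l. exact Hh.
  - intros [r [Hr H]]. apply (locally_le_locally_norm p P). exists (mkposreal r Hr). intros y Hy.
    rewrite <- (plus_minus_l p y). apply H, Hy.
Qed.

Lemma vd_filterdiff (f : V -> C) (p : V) (l : V -> C) :
  vd f p l <-> @filterdiff C_AbsRing V C_NormedModule f (locally p) l.
Proof.
  split.
  - intros [Hl H]. split; [exact Hl|]. intros x Hx e.
    assert (x = p) as -> by (symmetry; apply (is_filter_lim_locally_unique (V := V)); exact Hx).
    destruct (H e (cond_pos e)) as [r [Hr Q]]. apply locally_norm_V. exists r. split; [exact Hr|].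
    intros h Hh. rewrite minus_plus_l. apply Q, Hh.
  - intros [Hl H]. split; [exact Hl|]. intros e He.
    specialize (H p (fun P h => h) (mkposreal e He)). apply locally_norm_V in H.
    destruct H as [r [Hr Q]]. exists r. split; [exact Hr|]. intros h Hh. specialize (Q h Hh).
    rewrite minus_plus_l in Q. exact Q.
Qed.

Lemma vd_line (f : V -> C) (p h : V) (l : V -> C) (z : C) :
  vd f (plus p (scal z h)) l -> cd (fun x => f (plus p (scal (x : C_Ring) h))) z (l h).
Proof.
  intros [Hl H] e He. assert (Nh := norm_ge_0 h).
  destruct (H (e / (norm h + 1))) as [r [Hr Q]]; [apply Rdiv_lt_0_compat; lra|].
  exists (r / (norm h + 1)). split; [apply Rdiv_lt_0_compat; lra|]. intros k Hk.
  assert (N : norm (scal (k : C_Ring) h) <= Cmod k * norm h) by exact (norm_scal (V := V) (k : C_AbsRing) h).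
  assert (P := Cmod_ge_0 k).
  assert (S : norm (scal (k : C_Ring) h) < r).
  { eapply Rle_lt_trans; [exact N|]. apply Rle_lt_trans with (Cmod k * (norm h + 1)); [nra|].
    apply Rlt_div_r; lra. }
  specialize (Q _ S). rewrite (linear_scal _ Hl) in Q.
  rewrite <- plus_assoc in Q.
  assert (E : scal ((z + k)%C : C_Ring) h = plus (scal (z : C_Ring) h) (scal (k : C_Ring) h))
    by exact (scal_distr_r (z : C_Ring) (k : C_Ring) h).
  rewrite E.
  change (scal (k : C_Ring) (l h)) with (k * l h)%C in Q. rewrite (Cmult_comm (l h) k).
  eapply Rle_trans; [exact Q|]. eapply Rle_trans; [apply Rmult_le_compat_l; [|exact N]|].
  - left; apply Rdiv_lt_0_compat; lra.
  - apply Rle_trans with (e * Cmod k * (norm h / (norm h + 1))); [right; field; lra|].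
    rewrite <- (Rmult_1_r (e * Cmod k)) at 2. apply Rmult_le_compat_l; [nra|]. apply Rle_div_l; lra.
Qed.

Definition vball (p : V) (r : R) (x : V) : Prop := norm (minus x p) < r.

Lemma vball_line (p h : V) (r R0 : R) (z : C) :
  norm h * R0 <= r -> 0 < norm h -> Cmod (z - 0)%C < R0 -> vball p r (plus p (scal (z : C_Ring) h)).
Proof.
  intros H Hh Hz. unfold vball. rewrite minus_plus_l.
  eapply Rle_lt_trans; [exact (norm_scal (V := V) (z : C_AbsRing) h)|]. change (abs (z : C_AbsRing)) with (Cmod z).
  replace (z - 0)%C with z in Hz by ring. nra.
Qed.

Lemma plus_scal_zero (p h : V) : plus p (scal (RtoC 0 : C_Ring) h) = p.
Proof. change (RtoC 0) with (@zero C_Ring). rewrite scal_zero_l, plus_zero_r. reflexivity. Qed.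

(** On the complex line through p in direction h, the function z -> f(p + z h) is holomorphic on a
    disc of radius r / |h|; the one-variable estimates are read at z = 1. Directions of norm 0 are
    set apart because of this quotient. *)
Lemma vd_estimates (f : V -> C) (p : V) (l : V -> C) (r M : R) :
  0 < r -> (forall x, vball p r x -> exists l, vd f x l) -> (forall x, vball p r x -> Cmod (f x) <= M) ->
  vd f p l ->
  (forall h, Cmod (l h) <= 4 * M / r * norm h) /\
  (forall h, norm h < r / 4 -> Cmod (f (plus p h) - f p - l h)%C <= 256 * M / r ^ 2 * norm h ^ 2).
Proof.
  intros Hr Hf HM Hl.
  assert (Hz : forall h, norm h = 0 -> l h = 0 /\ h = zero).
  { intros h E. apply norm_eq_zero in E. subst. split; [|reflexivity]. apply (linear_zero _ (proj1 Hl)). }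
  assert (Hline : forall h, 0 < norm h ->
    (forall z, Cmod (z - 0)%C < r / norm h -> exists d, cd (fun x => f (plus p (scal (x : C_Ring) h))) z d) /\
    (forall z, Cmod (z - 0)%C < r / norm h -> Cmod (f (plus p (scal (z : C_Ring) h))) <= M) /\
    cd (fun x => f (plus p (scal (x : C_Ring) h))) 0 (l h)).
  { intros h Hh. split; [|split].
    - intros z Hz'. destruct (Hf (plus p (scal (z : C_Ring) h))) as [l' Hl'].
      { apply (vball_line p h r (r / norm h)); [right; field; lra | exact Hh | exact Hz']. }
      exists (l' h). apply vd_line, Hl'.
    - intros z Hz'. apply HM. apply (vball_line p h r (r / norm h)); [right; field; lra | exact Hh | exact Hz'].
    - apply vd_line. rewrite plus_scal_zero. exact Hl. }
  split; intros h; assert (Nh := norm_ge_0 h).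
  - destruct (Req_dec (norm h) 0) as [E|E].
    + rewrite (proj1 (Hz h E)), E, Cmod_0. lra.
    + destruct (Hline h ltac:(lra)) as [A [B D]].
      replace (4 * M / r * norm h) with (4 * M / (r / norm h)) by (field; lra).
      refine (cauchy_estimate _ _ _ _ _ _ A D B). apply Rdiv_lt_0_compat; lra.
  - intros Hsmall. destruct (Req_dec (norm h) 0) as [E|E].
    + destruct (Hz h E) as [E1 E2]. rewrite E1, E2, norm_zero, plus_zero_r.
      replace (f p - f p - 0)%C with (RtoC 0) by ring. rewrite Cmod_0. lra.
    + destruct (Hline h ltac:(lra)) as [A [B D]].
      assert (Hrn : 0 < r / norm h) by (apply Rdiv_lt_0_compat; lra).
      assert (T := taylor_second_order _ _ _ _ _ Hrn A D B 1%C).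
      rewrite Cmod_1 in T. rewrite plus_scal_zero in T.
      replace (scal ((0 + 1)%C : C_Ring) h) with h in T.
      2:{ replace (0 + 1)%C with (RtoC 1) by ring. symmetry. apply (scal_one (K := C_AbsRing)). }
      replace (l h * 1)%C with (l h) in T by ring.
      replace (256 * M / r ^ 2 * norm h ^ 2) with (256 * M / (r / norm h) ^ 2 * 1 ^ 2) by (field; lra).
      apply T. replace (r / norm h / 4) with (r / 4 / norm h) by (field; lra). apply Rlt_div_r; lra.
Qed.

(** For a small fixed s, s l_n(h) equals the increment of F_n from p to p + s h up to O(s^2),
    uniformly in n. The increments converge, so the l_n(h) form a Cauchy sequence, and both
    estimates of [vd_estimates] pass to the limit. *)
Lemma vd_limit (F : nat -> V -> C) (G : V -> C) (p : V) (r M : R) (l : nat -> V -> C) :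
  0 < r -> (forall n x, vball p r x -> exists l, vd (F n) x l) ->
  (forall n x, vball p r x -> Cmod (F n x) <= M) ->
  (forall x, vball p r x -> cvg (fun n => F n x) (G x)) ->
  (forall n, vd (F n) p (l n)) ->
  exists L, vd G p L /\ forall h, cvg (fun n => l n h) (L h).
Proof.
  intros Hr Hf HM HG Hl.
  assert (Est := fun n => vd_estimates (F n) p (l n) r M Hr (Hf n) (HM n) (Hl n)).
  assert (Hp : vball p r p).
  { unfold vball. replace (minus p p) with (@zero V) by (symmetry; apply (@plus_opp_r (NormedModule.AbelianGroup C_AbsRing V))). rewrite norm_zero. exact Hr. }
  assert (HM0 : 0 <= M) by (eapply Rle_trans; [apply Cmod_ge_0 | apply (HM O p Hp)]).
  assert (Hex : forall h, exists L, cvg (fun n => l n h) L).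
  { intros h. apply cvg_cauchy. intros e He. assert (Nh := norm_ge_0 h).
    set (K := 256 * M / r ^ 2 * norm h ^ 2).
    assert (HK : 0 <= K).
    { unfold K. apply Rmult_le_pos; [apply Rmult_le_pos; [lra | left; apply Rinv_0_lt_compat; nra] | nra]. }
    (* The first bound keeps s h inside the range of the Taylor estimate; the second makes the
       quadratic error K s^2 at most (e/4) s, so that dividing by s at the end costs nothing. *)
    set (s := Rmin (r / 8 / (norm h + 1)) (e / (4 * (K + 1)))).
    assert (Hs : 0 < s) by (apply Rmin_pos; repeat apply Rdiv_lt_0_compat; lra).
    assert (Hs1 : s * (norm h + 1) <= r / 8).
    { apply Rle_trans with (r / 8 / (norm h + 1) * (norm h + 1)); [apply Rmult_le_compat_r; [lra | apply Rmin_l]|right; field; lra]. }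
    assert (Hs2 : s * (K + 1) <= e / 4).
    { apply Rle_trans with (e / (4 * (K + 1)) * (K + 1)); [apply Rmult_le_compat_r; [lra | apply Rmin_r]|right; field; lra]. }
    set (x := scal (RtoC s : C_Ring) h).
    assert (Nx : norm x <= s * norm h).
    { eapply Rle_trans; [exact (norm_scal (V := V) (RtoC s : C_AbsRing) h)|]. change (abs (RtoC s : C_AbsRing)) with (Cmod (RtoC s)). rewrite Cmod_R, Rabs_right; lra. }
    assert (Hx : vball p r (plus p x)) by (unfold vball; rewrite minus_plus_l; nra).
    destruct (HG _ Hx (e * s / 8)) as [N1 H1]; [nra|].
    destruct (HG _ Hp (e * s / 8)) as [N2 H2]; [nra|].
    exists (Nat.max N1 N2). intros n m Hn Hm.
    assert (A : forall n, (Nat.max N1 N2 <= n)%nat -> Cmod (RtoC s * l n h - (G (plus p x) - G p))%C <= e * s / 2).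
    { intros k Hk. assert (B := proj2 (Est k) x ltac:(nra)).
      assert (E : l k x = (RtoC s * l k h)%C) by apply (linear_scal _ (proj1 (Hl k))).
      rewrite E in B. specialize (H1 k ltac:(lia)). specialize (H2 k ltac:(lia)).
      replace (RtoC s * l k h - (G (plus p x) - G p))%C with
        ((F k (plus p x) - G (plus p x)) - (F k p - G p) - (F k (plus p x) - F k p - RtoC s * l k h))%C by ring.
      eapply Rle_trans; [apply Cmod_minus_le|].
      assert (T := Cmod_minus_le (F k (plus p x) - G (plus p x)) (F k p - G p)).
      assert (256 * M / r ^ 2 * norm x ^ 2 <= K * s * s).
      { unfold K. replace (256 * M / r ^ 2 * norm h ^ 2 * s * s) with (256 * M / r ^ 2 * (s * norm h) ^ 2) by ring.
        apply Rmult_le_compat_l.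
        - apply Rmult_le_pos; [lra | left; apply Rinv_0_lt_compat; nra].
        - apply pow_incr. split; [apply norm_ge_0 | exact Nx]. }
      assert (K * s * s <= e / 4 * s) by nra. lra. }
    assert (A1 := A n Hn). assert (A2 := A m Hm).
    assert (T := Cmod_minus_le (RtoC s * l n h - (G (plus p x) - G p)) (RtoC s * l m h - (G (plus p x) - G p))).
    replace (RtoC s * l n h - (G (plus p x) - G p) - (RtoC s * l m h - (G (plus p x) - G p)))%C with
      (RtoC s * (l n h - l m h))%C in T by ring.
    rewrite Cmod_mult, Cmod_R, Rabs_right in T by lra.
    apply Rmult_le_reg_l with s; [exact Hs|]. lra. }
  set (L := fun h => epsilon (inhabits (RtoC 0)) (fun L => cvg (fun n => l n h) L)).
  assert (HL : forall h, cvg (fun n => l n h) (L h)) by (intros h; apply epsilon_spec, Hex).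
  exists L. split; [|exact HL]. split.
  - split.
    + intros x y. apply (cvg_unique (fun n => l n (plus x y))); [apply HL|].
      eapply cvg_ext; [|apply (cvg_plus _ _ _ _ (HL x) (HL y))]. intros n; simpl. symmetry. apply (linear_plus _ (proj1 (Hl n))).
    + intros k x. apply (cvg_unique (fun n => l n (scal k x))); [apply HL|].
      eapply cvg_ext; [|apply (cvg_scal k _ _ (HL x))]. intros n; simpl. symmetry. apply (linear_scal _ (proj1 (Hl n))).
    + exists (4 * M / r + 1). split.
      { assert (0 <= 4 * M / r) by (apply Rmult_le_pos; [lra | left; apply Rinv_0_lt_compat; lra]). lra. }
      intros x. change (Cmod (L x) <= (4 * M / r + 1) * norm x).
      apply Rle_trans with (4 * M / r * norm x); [|assert (Nx := norm_ge_0 x); nra].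
      apply (cvg_bound _ _ _ (fun n => proj1 (Est n) x) (HL x)).
  - intros e He. set (K := 256 * M / r ^ 2).
    assert (HK : 0 <= K) by (apply Rmult_le_pos; [lra | left; apply Rinv_0_lt_compat; nra]).
    exists (Rmin (r / 4) (e / (K + 1))). split; [apply Rmin_pos; [lra | apply Rdiv_lt_0_compat; lra]|].
    intros h Hh. assert (H1 := Rlt_le_trans _ _ _ Hh (Rmin_l _ _)). assert (H2 := Rlt_le_trans _ _ _ Hh (Rmin_r _ _)).
    assert (Nh := norm_ge_0 h).
    apply Rle_trans with (K * norm h ^ 2).
    + apply (cvg_bound (fun n => F n (plus p h) - F n p - l n h)%C); [intros n; apply (proj2 (Est n) h H1)|].
      apply cvg_minus; [apply cvg_minus|apply HL]; apply HG; [|exact Hp].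
      unfold vball; rewrite minus_plus_l; lra.
    + assert (norm h * (K + 1) <= e) by (apply Rlt_le, Rlt_div_r; lra). nra.
Qed.

Definition vhol (f : V -> C) (p : V) : Prop := exists l, vd f p l.

Lemma vhol_limit (F : nat -> V -> C) (G : V -> C) (p : V) (r M : R) :
  0 < r -> (forall n x, vball p r x -> vhol (F n) x) ->
  (forall n x, vball p r x -> Cmod (F n x) <= M) ->
  (forall x, vball p r x -> cvg (fun n => F n x) (G x)) -> vhol G p.
Proof.
  intros Hr Hf HM HG.
  assert (Hp : vball p r p).
  { unfold vball. replace (minus p p) with (@zero V) by (symmetry; apply (@plus_opp_r (NormedModule.AbelianGroup C_AbsRing V))). rewrite norm_zero. exact Hr. }
  set (l := fun n => epsilon (inhabits (fun _ => RtoC 0)) (fun l => vd (F n) p l)).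
  destruct (vd_limit F G p r M l Hr Hf HM HG) as [L [HL _]].
  - intros n. unfold l. apply epsilon_spec. apply Hf, Hp.
  - exists L. exact HL.
Qed.

Lemma vhol_ext_loc (f g : V -> C) (p : V) (r : R) :
  0 < r -> (forall x, vball p r x -> f x = g x) -> vhol f p -> vhol g p.
Proof.
  intros Hr E [l [Hl H]]. exists l. split; [exact Hl|]. intros e He. destruct (H e He) as [r1 [Hr1 Q]].
  exists (Rmin r r1). split; [apply Rmin_pos; assumption|]. intros h Hh.
  rewrite <- !E.
  - apply Q. eapply Rlt_le_trans; [exact Hh | apply Rmin_r].
  - unfold vball. replace (minus p p) with (@zero V) by (symmetry; apply (@plus_opp_r (NormedModule.AbelianGroup C_AbsRing V))). rewrite norm_zero. exact Hr.
  - unfold vball. rewrite minus_plus_l. eapply Rlt_le_trans; [exact Hh | apply Rmin_l].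
Qed.

Lemma vhol_const (c : C) (p : V) : vhol (fun _ => c) p.
Proof.
  exists (fun _ => RtoC 0). split; [apply (is_linear_zero (U := V) (V := C_NormedModule))|].
  intros e He. exists 1. split; [lra|]. intros h _. replace (c - c - 0)%C with (RtoC 0) by ring.
  rewrite Cmod_0. generalize (norm_ge_0 h); nra.
Qed.

Lemma vhol_linear (l : V -> C) (p : V) : @is_linear C_AbsRing V C_NormedModule l -> vhol l p.
Proof.
  intros Hl. exists l. split; [exact Hl|].
  intros e He. exists 1. split; [lra|]. intros h _.
  replace (l (plus p h)) with (l p + l h)%C by (symmetry; apply (linear_plus _ Hl)).
  replace (l p + l h - l p - l h)%C with (RtoC 0) by ring.
  rewrite Cmod_0. generalize (norm_ge_0 h); nra.
Qed.

Lemma vhol_plus (f g : V -> C) (p : V) : vhol f p -> vhol g p -> vhol (fun x => f x + g x)%C p.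
Proof.
  intros [l Hl] [m Hm]. exists (fun x => l x + m x)%C.
  apply vd_filterdiff. apply vd_filterdiff in Hl. apply vd_filterdiff in Hm.
  exact (filterdiff_plus_fct (V := C_NormedModule) _ _ _ _ Hl Hm).
Qed.

Lemma vhol_comp (f : V -> C) (g : C -> C) (p : V) (d : C) :
  vhol f p -> cd g (f p) d -> vhol (fun x => g (f x)) p.
Proof.
  intros [l [Hl Hf]] Hg. exists (fun x => d * l x)%C.
  destruct (linear_norm _ Hl) as [B [HB Bl]]. change (forall x, Cmod (l x) <= B * norm x) in Bl.
  split.
  { split.
    - intros x y. rewrite (linear_plus _ Hl). apply (Cmult_plus_distr_l d (l x) (l y)).
    - intros k x. rewrite (linear_scal _ Hl). change (d * (k * l x) = k * (d * l x))%C. ring.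
    - exists ((Cmod d + 1) * B). split; [generalize (Cmod_ge_0 d); nra|]. intros x.
      change (Cmod (d * l x)%C <= (Cmod d + 1) * B * norm x). rewrite Cmod_mult, Rmult_assoc.
      apply Rmult_le_compat; try apply Cmod_ge_0; [lra | apply Bl]. }
  intros e He. assert (Pd := Cmod_ge_0 d).
  destruct (Hg (e / 2 / (B + 1))) as [r2 [P2 Q2]]; [repeat apply Rdiv_lt_0_compat; lra|].
  set (e1 := Rmin 1 (e / 2 / (Cmod d + 1))).
  assert (He1 : 0 < e1) by (apply Rmin_pos; [lra | repeat apply Rdiv_lt_0_compat; lra]).
  destruct (Hf e1 He1) as [r1 [P1 Q1]].
  exists (Rmin r1 (r2 / (B + 1))). split; [apply Rmin_pos; [assumption | apply Rdiv_lt_0_compat; lra]|].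
  intros h Hh. specialize (Q1 h (Rlt_le_trans _ _ _ Hh (Rmin_l _ _))).
  assert (Hh2 := Rlt_le_trans _ _ _ Hh (Rmin_r _ _)). assert (Nh := norm_ge_0 h).
  set (k := (f (plus p h) - f p)%C).
  assert (Hk : Cmod k <= (B + 1) * norm h).
  { replace k with ((f (plus p h) - f p - l h) + l h)%C by (unfold k; ring).
    eapply Rle_trans; [apply Cmod_triangle|]. assert (e1 <= 1) by apply Rmin_l. specialize (Bl h). nra. }
  assert (Hk2 : Cmod k < r2).
  { eapply Rle_lt_trans; [exact Hk|]. rewrite Rmult_comm. apply Rlt_div_r; lra. }
  specialize (Q2 k Hk2). replace (f p + k)%C with (f (plus p h)) in Q2 by (unfold k; ring).
  replace (g (f (plus p h)) - g (f p) - d * l h)%C with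
    ((g (f (plus p h)) - g (f p) - d * k) + d * (f (plus p h) - f p - l h))%C by (unfold k; ring).
  eapply Rle_trans; [apply Cmod_triangle|]. rewrite Cmod_mult.
  assert (E1 : e1 * (Cmod d + 1) <= e / 2).
  { apply Rle_trans with (e / 2 / (Cmod d + 1) * (Cmod d + 1)).
    - apply Rmult_le_compat_r; [lra | apply Rmin_r].
    - right. field. lra. }
  assert (T1 : e / 2 / (B + 1) * Cmod k <= e / 2 * norm h).
  { apply Rle_trans with (e / 2 / (B + 1) * ((B + 1) * norm h)); [|right; field; lra].
    apply Rmult_le_compat_l; [left; repeat apply Rdiv_lt_0_compat; lra | exact Hk]. }
  assert (T2 : Cmod d * Cmod (f (plus p h) - f p - l h)%C <= e / 2 * norm h).
  { apply Rle_trans with ((Cmod d + 1) * (e1 * norm h)).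
    - apply Rmult_le_compat; try apply Cmod_ge_0; lra.
    - nra. }
  lra.
Qed.

Lemma vhol_scal (k : C) (f : V -> C) (p : V) : vhol f p -> vhol (fun x => k * f x)%C p.
Proof. intros H. apply (vhol_comp f (fun z => k * z)%C p (k * 1)%C H), cd_scal, cd_id. Qed.

Lemma vhol_mult (f g : V -> C) (p : V) : vhol f p -> vhol g p -> vhol (fun x => f x * g x)%C p.
Proof.
  intros Hf Hg.
  assert (Sq : forall h, vhol h p -> vhol (fun x => h x * h x)%C p).
  { intros h Hh. eapply (vhol_comp h (fun z => z * z)%C p); [exact Hh|]. apply cd_mult; apply cd_id. }
  assert (D := vhol_plus _ _ _ (Sq _ (vhol_plus _ _ _ Hf Hg))
     (vhol_scal (-1) _ _ (Sq _ (vhol_plus _ _ _ Hf (vhol_scal (-1) _ _ Hg))))).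
  apply (vhol_scal (/4)%C) in D. refine (vhol_ext_loc _ _ p 1 Rlt_0_1 _ D).
  intros x _; simpl. field; intro K; injection K; lra.
Qed.

Lemma vhol_inv (f : V -> C) (p : V) : f p <> 0 -> vhol f p -> vhol (fun x => / f x)%C p.
Proof. intros N H. eapply (vhol_comp f Cinv p); [exact H | apply cd_inv, N]. Qed.

Lemma vhol_sum {A : Type} (f : A -> V -> C) (l : list A) (p : V) :
  (forall a, In a l -> vhol (f a) p) -> vhol (fun x => Csum l (fun a => f a x)) p.
Proof.
  induction l as [|a l IH]; intros H; [exact (vhol_const (RtoC 0) p)|].
  apply (vhol_plus (f a) (fun x => Csum l (fun a => f a x))).
  - apply H; left; reflexivity.
  - apply IH. intros; apply H; right; assumption.
Qed.

Lemma vhol_pow (f : V -> C) (p : V) (n : nat) : vhol f p -> vhol (fun x => Cpow (f x) n) p.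
Proof. intros H. eapply (vhol_comp f (fun z => Cpow z n) p); [exact H | apply cd_pow]. Qed.
End Vd.

(** * Integrals depending holomorphically on parameters *)

Lemma scal_C_R (r : R) (z : C) : @scal R_Ring C_R_NormedModule r z = (RtoC r * z)%C.
Proof.
  destruct z as [x y]. change ((r * x, r * y) = (RtoC r * (x, y))%C).
  unfold Cmult, RtoC; simpl. f_equal; ring.
Qed.

Lemma vhol_Riemann_sum {V : NormedModule C_AbsRing} (f : R -> V -> C) (p : V) (ptd : @SF_seq R) :
  (forall s, vhol (f s) p) ->
  vhol (fun x => @Riemann_sum C_R_NormedModule (fun s => f s x) ptd) p.
Proof.
  intros H. pattern ptd. apply SF_cons_ind; clear ptd.
  - intros x0. exact (vhol_const (RtoC 0) p).
  - intros h ptd IH.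
    refine (vhol_ext_loc (fun x => RtoC (SF_h ptd - fst h) * f (snd h) x + @Riemann_sum C_R_NormedModule (fun s => f s x) ptd)%C _ p 1 Rlt_0_1 _ _).
    + intros x _. rewrite Riemann_sum_cons, scal_C_R. reflexivity.
    + apply vhol_plus; [apply vhol_scal, H | exact IH].
Qed.

(** Differentiation under the integral sign is avoided: the integral is a pointwise limit of Riemann
    sums, which are holomorphic in x and bounded by (b - a) M, so [vhol_limit] applies. *)
Lemma vhol_cint {V : NormedModule C_AbsRing} (f : R -> V -> C) (p : V) (a b r M : R) :
  0 < r -> a <= b ->
  (forall s x, vball p r x -> vhol (f s) x) ->
  (forall s x, vball p r x -> a <= s <= b -> Cmod (f s x) <= M) ->
  (forall s x, vball p r x -> ccont (fun s => f s x) s) ->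
  vhol (fun x => cint (fun s => f s x) a b) p.
Proof.
  intros Hr Hab Hf HM Hc.
  set (ptd := fun n => SF_seq_f2 (fun x _ : R => x) (unif_part a b n)).
  assert (Hptd : forall n, seq_step (SF_lx (ptd n)) <= (b - a) / (INR n + 1) /\
    pointed_subdiv (ptd n) /\ SF_h (ptd n) = a /\ seq.last (SF_h (ptd n)) (SF_lx (ptd n)) = b).
  { intros n. apply (Riemann_fine_unif_part (fun x _ => x)); [intros; lra | exact Hab]. }
  apply (vhol_limit (fun n x => @Riemann_sum C_R_NormedModule (fun s => f s x) (ptd n)) _ p r ((b - a) * M) Hr).
  - intros n x Hx. apply vhol_Riemann_sum. intros s. apply Hf, Hx.
  - intros n x Hx. destruct (Hptd n) as [_ [P [E1 E2]]]. rewrite <- norm_C_R.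
    eapply Rle_trans.
    + apply (Riemann_sum_norm (V := C_R_NormedModule) (fun s => f s x) (fun _ => M) (ptd n) P).
      intros t Ht. rewrite E1 in Ht at 1. rewrite E2 in Ht. rewrite norm_C_R. apply HM; assumption.
    + rewrite (Riemann_sum_const (V := R_ModuleSpace) M), E1, <- E1, E2, E1. right. reflexivity.
  - intros x Hx. intros e He.
    assert (H : is_cint (fun s => f s x) a b (cint (fun s => f s x) a b)) by (apply cint_correct; [lra|]; intros; apply Hc, Hx).
    unfold is_RInt in H.
    assert (Hloc : locally (cint (fun s => f s x) a b : C_R_NormedModule) (fun y => Cmod (y - cint (fun s => f s x) a b)%C <= e)).
    { apply locally_le_locally_norm. exists (mkposreal e He). intros y Hy.
      unfold ball_norm in Hy. rewrite norm_C_R in Hy. left. exact Hy. }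
    destruct (H _ Hloc) as [d Hd].
    assert (Hd0 := cond_pos d).
    destruct (INR_unbounded ((b - a) / d)) as [N HN].
    exists N. intros n Hn. destruct (Hptd n) as [P0 [P [E1 E2]]].
    assert (Q := Hd (ptd n)). simpl in Q.
    assert (HQ : Cmod (scal (sign (b - a)) (@Riemann_sum C_R_NormedModule (fun s => f s x) (ptd n)) - cint (fun s => f s x) a b)%C <= e).
    { apply Q.
      - unfold ball, AbsRing_ball. eapply Rle_lt_trans; [|apply (Rle_lt_trans _ ((b - a) / (INR n + 1)) d)].
        + right. reflexivity.
        + exact P0.
        + apply Rlt_div_l; [generalize (pos_INR n); lra|]. apply le_INR in Hn.
          apply Rlt_div_l in HN; [|exact Hd0]. rewrite Rmult_comm. nra.
      - rewrite Rmin_left, Rmax_right by exact Hab. auto. }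
    (* [is_RInt] multiplies Riemann sums by the sign of b - a, which is 0 when a = b; the degenerate
       interval is therefore handled by bounding the sums themselves. *)
    destruct (Rle_lt_or_eq_dec a b Hab) as [L|L].
    + rewrite sign_eq_1 in HQ by lra. rewrite scal_C_R in HQ. rewrite Cmult_1_l in HQ. exact HQ.
    + rewrite <- L, RInt_point.
      assert (Z : Cmod (@Riemann_sum C_R_NormedModule (fun s => f s x) (ptd n)) <= 0).
      { rewrite <- norm_C_R. eapply Rle_trans.
        - apply (Riemann_sum_norm (V := C_R_NormedModule) (fun s => f s x) (fun _ => M) (ptd n) P).
          intros t Ht. rewrite E1 in Ht at 1. rewrite E2 in Ht. rewrite norm_C_R. apply HM; assumption.
        - rewrite (Riemann_sum_const (V := R_ModuleSpace) M).
          match goal with |- scal (?u - ?v) _ <= _ => replace (u - v) with 0 by (rewrite E2, E1, L; ring) end.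
          right. unfold scal; simpl; unfold mult; simpl. ring. }
      eapply Rle_trans; [apply Cmod_minus_le|]. change (@zero C_R_CompleteNormedModule) with (RtoC 0). rewrite Cmod_0. lra.
Qed.

(** * Absolutely convergent integrals over the line *)

(** Both ends tend to infinity independently. Continuity is part of the notion, so that the
    integrals over segments exist and may be split and added. *)
Definition impr (f : R -> C) (I : C) : Prop :=
  (forall s, ccont f s) /\
  forall e, 0 < e -> exists A, forall a b, a <= - A -> A <= b -> Cmod (cint f a b - I)%C <= e.

Lemma impr_is_RInt_gen (f : R -> C) (I : C) : impr f I ->
  @is_RInt_gen C_R_NormedModule f (Rbar_locally m_infty) (Rbar_locally p_infty) I.
Proof.
  intros [Hc H] P HP. apply locally_norm_le_locally in HP. destruct HP as [e He].
  assert (He2 : 0 < e / 2) by (generalize (cond_pos e); lra).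
  destruct (H (e / 2) He2) as [A HA].
  exists (fun a => a < - Rabs A) (fun b => Rabs A < b).
  - exists (- Rabs A). auto.
  - exists (Rabs A). auto.
  - intros a b Ha Hb. assert (P1 := Rle_abs A). assert (P2 := Rabs_pos A).
    exists (cint f a b). split.
    + apply cint_correct; [lra|]. intros; apply Hc.
    + apply He. unfold ball_norm. rewrite norm_C_R. eapply Rle_lt_trans; [apply HA; lra|]. lra.
Qed.

Lemma impr_RInt_gen (f : R -> C) (I : C) : impr f I ->
  @RInt_gen C_R_CompleteNormedModule f (Rbar_locally m_infty) (Rbar_locally p_infty) = I.
Proof.
  intros H. apply (@is_RInt_gen_unique C_R_CompleteNormedModule); try apply Proper_StrongProper; try apply Rbar_locally_filter.
  apply impr_is_RInt_gen, H.
Qed.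

Lemma impr_cvg (f : R -> C) (I : C) (a b : nat -> R) : impr f I ->
  (forall A, exists N, forall n, (N <= n)%nat -> a n <= - A /\ A <= b n) -> cvg (fun n => cint f (a n) (b n)) I.
Proof.
  intros [_ H] Hab e He. destruct (H e He) as [A HA]. destruct (Hab A) as [N HN].
  exists N. intros n Hn. apply HA; apply HN, Hn.
Qed.

Lemma impr_cvg_nat (f : R -> C) (I : C) : impr f I -> cvg (fun n => cint f (- INR n) (INR n)) I.
Proof.
  intros H. apply (impr_cvg f I _ _ H). intros A. destruct (INR_unbounded A) as [N HN]. exists N.
  intros n Hn. apply le_INR in Hn. lra.
Qed.

Lemma impr_unique (f : R -> C) (I J : C) : impr f I -> impr f J -> I = J.
Proof. intros H1 H2. apply (cvg_unique _ _ _ (impr_cvg_nat _ _ H1) (impr_cvg_nat _ _ H2)). Qed.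

Lemma impr_ext (f g : R -> C) (I : C) : (forall s, f s = g s) -> impr f I -> impr g I.
Proof.
  intros E [Hc H]. split; [intros s; apply (ccont_ext f); auto|].
  intros e He. destruct (H e He) as [A HA]. exists (Rabs A). intros a b Ha Hb.
  assert (P1 := Rle_abs A). assert (P2 := Rabs_pos A).
  rewrite <- (cint_ext f g) by (intros; try apply E; lra). apply HA; lra.
Qed.

Lemma impr_plus (f g : R -> C) (I J : C) : impr f I -> impr g J -> impr (fun s => f s + g s)%C (I + J).
Proof.
  intros [Hf H1] [Hg H2]. split; [intros; apply ccont_plus; auto|]. intros e He.
  destruct (H1 (e/2)) as [A HA]; [lra|]. destruct (H2 (e/2)) as [B HB]; [lra|].
  exists (Rabs A + Rabs B). intros a b Ha Hb.
  assert (P1 := Rle_abs A). assert (P2 := Rabs_pos A). assert (P3 := Rle_abs B). assert (P4 := Rabs_pos B).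
  replace (cint (fun s => f s + g s)%C a b) with (cint f a b + cint g a b)%C.
  - replace (cint f a b + cint g a b - (I + J))%C with ((cint f a b - I) + (cint g a b - J))%C by ring.
    eapply Rle_trans; [apply Cmod_triangle|]. specialize (HA a b ltac:(lra) ltac:(lra)). specialize (HB a b ltac:(lra) ltac:(lra)). lra.
  - symmetry. apply cint_unique. apply (is_RInt_plus (V := C_R_NormedModule)); apply cint_correct; auto; lra.
Qed.

Lemma impr_scal (k : C) (f : R -> C) (I : C) : impr f I -> impr (fun s => k * f s)%C (k * I).
Proof.
  intros [Hf H]. split; [intros; apply ccont_scal; auto|]. intros e He. assert (Pk := Cmod_ge_0 k).
  destruct (H (e/(Cmod k + 1))) as [A HA]; [apply Rdiv_lt_0_compat; lra|].
  exists (Rabs A). intros a b Ha Hb. assert (P1 := Rle_abs A). assert (P2 := Rabs_pos A).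
  rewrite <- cint_scal by (auto; lra). replace (k * cint f a b - k * I)%C with (k * (cint f a b - I))%C by ring.
  rewrite Cmod_mult. specialize (HA a b ltac:(lra) ltac:(lra)).
  apply Rle_trans with ((Cmod k + 1) * (e / (Cmod k + 1))); [|right; field; lra].
  apply Rmult_le_compat; try apply Cmod_ge_0; lra.
Qed.

Lemma impr_zero : impr (fun _ => RtoC 0) 0.
Proof.
  split; [intros; apply ccont_const|]. intros e He. exists 0. intros a b Ha Hb.
  assert (B : Cmod (cint (fun _ => RtoC 0) a b) <= 0 * (b - a)).
  { apply cint_bound; [lra | intros; apply ccont_const |]. intros s _. simpl. rewrite Cmod_0. lra. }
  eapply Rle_trans; [apply Cmod_minus_le|]. rewrite Cmod_0. lra.
Qed.

Lemma impr_sum {A : Type} (f : A -> R -> C) (I : A -> C) (l : list A) :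
  (forall a, In a l -> impr (f a) (I a)) -> impr (fun s => Csum l (fun a => f a s)) (Csum l I).
Proof.
  induction l as [|a l IH]; intros H; [exact impr_zero|].
  apply (impr_plus (f a) (fun s => Csum l (fun a => f a s))).
  - apply H; left; reflexivity.
  - apply IH. intros; apply H; right; assumption.
Qed.

Lemma cint_shift (f : R -> C) (c a b : R) :
  a <= b -> (forall s, ccont f s) -> cint (fun s => f (s + c)) a b = cint f (a + c) (b + c).
Proof.
  intros H Hf. apply cint_unique.
  assert (K := is_RInt_comp_lin (V := C_R_NormedModule) f 1 c a b (cint f (a + c) (b + c))).
  rewrite !Rmult_1_l in K. specialize (K (cint_correct f (a + c) (b + c) ltac:(lra) (fun s _ => Hf s))).
  eapply (is_RInt_ext (V := C_R_NormedModule)); [|exact K].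
  intros x _. simpl. rewrite (@scal_one R_AbsRing C_R_NormedModule), Rmult_1_l. reflexivity.
Qed.

Lemma impr_shift (f : R -> C) (c : R) (I : C) : impr f I -> impr (fun s => f (s + c)) I.
Proof.
  intros [Hf H]. split.
  - intros s. apply ccont_eps. intros e He. destruct (proj2 (ccont_eps f (s + c)) (Hf _) e He) as [r [Hr Q]].
    exists r. split; [exact Hr|]. intros h Hh. specialize (Q h Hh).
    replace (s + h + c) with (s + c + h) by ring. exact Q.
  - intros e He. destruct (H e He) as [A HA]. exists (Rabs A + Rabs c). intros a b Ha Hb.
    assert (P1 := Rle_abs A). assert (P2 := Rabs_pos A). assert (P3 := Rle_abs c).
    assert (P5 := Rle_abs (- c)). rewrite Rabs_Ropp in P5.
    rewrite cint_shift by (auto; lra). apply HA; lra.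
Qed.

(** Along a q-spiral log|tau/(eps t)| is affine in s with slope L = log|q|. The integral of this
    majorant is K pi / L whatever the offset c, hence uniform in the parameters hidden in c. *)
Definition adom (K L c : R) (f : R -> C) : Prop := forall s, Cmod (f s) <= K / (1 + (L * s + c) ^ 2).

Lemma adom_cint_atan (K L c : R) (f : R -> C) (a b : R) :
  0 < L -> a <= b -> (forall s, a <= s <= b -> ccont f s) ->
  (forall s, a <= s <= b -> Cmod (f s) <= K / (1 + (L * s + c) ^ 2)) ->
  Cmod (cint f a b) <= K / L * (atan (L * b + c) - atan (L * a + c)).
Proof.
  intros HL Hab Hf HK. rewrite <- norm_C_R.
  refine (norm_RInt_le (V := C_R_NormedModule) f (fun s => K / (1 + (L * s + c) ^ 2)) a b _ _ Hab _ (cint_correct f a b Hab Hf) _).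
  - intros x Hx. rewrite norm_C_R. apply HK, Hx.
  - replace (K / L * (atan (L * b + c) - atan (L * a + c))) with
      (minus (K / L * atan (L * b + c)) (K / L * atan (L * a + c))) by (unfold minus, plus, opp; simpl; ring).
    apply (is_RInt_derive (V := R_CompleteNormedModule) (fun s => K / L * atan (L * s + c))).
    + intros x _. auto_derive; [trivial|]. assert (Q : 0 < 1 + (L * x + c) ^ 2) by (generalize (pow2_ge_0 (L * x + c)); lra).
      unfold Rsqr. field. split; [|lra]. intros Z. ring_simplify in Q. ring_simplify in Z. lra.
    + intros x _. apply (ex_derive_continuous (K := R_AbsRing) (V := R_NormedModule)). assert (Q : 0 < 1 + (L * x + c) ^ 2) by (generalize (pow2_ge_0 (L * x + c)); lra). auto_derive. lra.
Qed.

Lemma adom_nonneg (K L c : R) (f : R -> C) : adom K L c f -> 0 <= K.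
Proof.
  intros H. specialize (H 0). assert (P := Cmod_ge_0 (f 0)).
  assert (0 <= K / (1 + (L * 0 + c) ^ 2)) by lra.
  apply Rnot_lt_le. intros N. assert (K / (1 + (L * 0 + c) ^ 2) < 0); [|lra].
  apply Rmult_lt_reg_r with (1 + (L * 0 + c) ^ 2); [nra|]. unfold Rdiv. rewrite Rmult_assoc, Rinv_l by nra. lra.
Qed.

Lemma adom_cint (K L c : R) (f : R -> C) (a b : R) :
  0 < L -> a <= b -> (forall s, ccont f s) -> adom K L c f -> Cmod (cint f a b) <= K * PI / L.
Proof.
  intros HL Hab Hf HK. assert (K0 := adom_nonneg _ _ _ _ HK).
  eapply Rle_trans; [apply (adom_cint_atan K L c); auto|].
  assert (A := atan_bound (L * b + c)). assert (B := atan_bound (L * a + c)).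
  replace (K * PI / L) with (K / L * PI) by (field; lra).
  apply Rmult_le_compat_l; [|lra]. apply Rmult_le_pos; [lra | left; apply Rinv_0_lt_compat; lra].
Qed.

Lemma atan_tail (e : R) : 0 < e -> exists X, forall x, X <= x -> PI / 2 - atan x <= e /\ PI / 2 + atan (- x) <= e.
Proof.
  intros He. assert (Hp := PI_RGT_0).
  (* The cap at pi/4 keeps y in the interval where atan inverts tan. *)
  set (y := PI / 2 - Rmin e (PI / 4)).
  assert (Hm : 0 < Rmin e (PI / 4)) by (apply Rmin_pos; lra).
  assert (Hm1 : Rmin e (PI / 4) <= e) by apply Rmin_l.
  assert (Hm2 : Rmin e (PI / 4) <= PI / 4) by apply Rmin_r.
  exists (tan y). intros x Hx. rewrite atan_opp.
  assert (y <= atan x).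
  { rewrite <- (atan_tan y) by (unfold y; lra).
    destruct Hx as [Hx|Hx]; [left; apply atan_increasing, Hx | rewrite Hx; lra]. }
  unfold y in *. lra.
Qed.

Lemma adom_impr (K L c : R) (f : R -> C) :
  0 < L -> (forall s, ccont f s) -> adom K L c f -> exists I, impr f I /\ Cmod I <= K * PI / L.
Proof.
  intros HL Hf HK. assert (K0 := adom_nonneg _ _ _ _ HK).
  assert (HKL : 0 <= K / L) by (apply Rmult_le_pos; [lra | left; apply Rinv_0_lt_compat; lra]).
  assert (Hx : forall x, K / L * x <= (K / L + 1) * Rmax x 0) .
  { intros x. assert (x <= Rmax x 0) by apply Rmax_l. assert (0 <= Rmax x 0) by apply Rmax_r. nra. }
  assert (Tail : forall e, 0 < e -> exists A, 0 <= A /\ forall a b, a <= b -> (b <= - A \/ A <= a) -> Cmod (cint f a b) <= e).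
  { intros e He. destruct (atan_tail (e / (K / L + 1))) as [X HX]; [apply Rdiv_lt_0_compat; lra|].
    exists ((Rabs X + Rabs c) / L).
    assert (P1 := Rle_abs X). assert (P2 := Rabs_pos X). assert (P3 := Rle_abs c).
    assert (P5 := Rle_abs (- c)). rewrite Rabs_Ropp in P5.
    split; [apply Rmult_le_pos; [lra | left; apply Rinv_0_lt_compat; lra]|].
    intros a b Hab Hor. eapply Rle_trans; [apply (adom_cint_atan K L c); auto|].
    assert (A := atan_bound (L * b + c)). assert (B := atan_bound (L * a + c)).
    assert (D : atan (L * b + c) - atan (L * a + c) <= e / (K / L + 1)).
    { destruct Hor as [H|H].
      - assert (L * b <= - (Rabs X + Rabs c)).
        { apply (Rmult_le_compat_l L) in H; [|lra]. eapply Rle_trans; [exact H|]. right. field. lra. }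
        destruct (HX (- (L * b + c))) as [_ Q]; [lra|]. rewrite Ropp_involutive in Q. lra.
      - assert (Rabs X + Rabs c <= L * a).
        { apply (Rmult_le_compat_l L) in H; [|lra]. eapply Rle_trans; [|exact H]. right. field. lra. }
        destruct (HX (L * a + c)) as [Q _]; [lra|]. lra. }
    assert (D0 : 0 < e / (K / L + 1)) by (apply Rdiv_lt_0_compat; lra).
    apply Rle_trans with ((K / L + 1) * (e / (K / L + 1))); [|right; field; lra].
    eapply Rle_trans; [apply Hx|]. apply Rmult_le_compat_l; [lra|]. apply Rmax_lub; lra. }
  assert (Comp : forall e, 0 < e -> exists A, 0 <= A /\ forall a b a' b', a <= - A -> a' <= - A -> A <= b -> A <= b' ->
     Cmod (cint f a b - cint f a' b')%C <= e).
  { intros e He. destruct (Tail (e / 4)) as [A [A0 HA]]; [lra|]. exists A. split; [exact A0|].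
    assert (Base : forall a b, a <= - A -> A <= b -> Cmod (cint f a b - cint f (- A) A)%C <= e / 2).
    { intros a b Ha Hb.
      rewrite (cint_Chasles f a (- A) b) by (intros; auto; lra). rewrite (cint_Chasles f (- A) A b) by (intros; auto; lra).
      match goal with |- Cmod (?u + (?v + ?w) - ?v)%C <= _ => replace (u + (v + w) - v)%C with (u + w)%C by ring end.
      eapply Rle_trans; [apply Cmod_triangle|].
      assert (T1 := HA a (- A) Ha (or_introl (Rle_refl _))). assert (T2 := HA A b Hb (or_intror (Rle_refl _))). lra. }
    intros a b a' b' Ha Ha' Hb Hb'.
    assert (T1 := Base a b Ha Hb). assert (T2 := Base a' b' Ha' Hb').
    replace (cint f a b - cint f a' b')%C with ((cint f a b - cint f (- A) A) - (cint f a' b' - cint f (- A) A))%C by ring.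
    eapply Rle_trans; [apply Cmod_minus_le|]. lra. }
  destruct (cvg_cauchy (fun n => cint f (- INR n) (INR n))) as [I HI].
  { intros e He. destruct (Comp e He) as [A [A0 HA]]. destruct (INR_unbounded A) as [N HN]. exists N.
    intros n m Hn Hm. apply le_INR in Hn. apply le_INR in Hm. apply HA; lra. }
  exists I. split.
  - split; [exact Hf|]. intros e He. destruct (Comp (e / 2)) as [A [A0 HA]]; [lra|]. exists A. intros a b Ha Hb.
    destruct (HI (e / 2)) as [N HN]; [lra|]. destruct (INR_unbounded A) as [N2 HN2].
    set (n := Nat.max N N2). specialize (HN n ltac:(lia)).
    assert (INR N2 <= INR n) by (apply le_INR; lia).
    specialize (HA a b (- INR n) (INR n) ltac:(lra) ltac:(lra) ltac:(lra) ltac:(lra)).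
    replace (cint f a b - I)%C with ((cint f a b - cint f (- INR n) (INR n)) + (cint f (- INR n) (INR n) - I))%C by ring.
    eapply Rle_trans; [apply Cmod_triangle|]. lra.
  - apply (cvg_bound (fun n => cint f (- INR n) (INR n))); [|exact HI].
    intros n. apply (adom_cint K L c); auto. generalize (pos_INR n). lra.
Qed.

(** The truncated integrals are holomorphic and bounded by K pi / L, so [vhol_limit] applies once
    more. The offset c may depend on x in any way because this bound does not contain it. The radius
    is halved since [vhol_cint] requires a ball around each nearby point. *)
Lemma vhol_impr {V : NormedModule C_AbsRing} (f : R -> V -> C) (F : V -> C) (p : V) (r K L : R) (c : V -> R) :
  0 < r -> 0 < L ->
  (forall s x, vball p r x -> vhol (f s) x) ->
  (forall s x, vball p r x -> ccont (fun s => f s x) s) ->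
  (forall x, vball p r x -> adom K L (c x) (fun s => f s x)) ->
  (forall x, vball p r x -> impr (fun s => f s x) (F x)) ->
  vhol F p.
Proof.
  intros Hr HL Hf Hc HK HF.
  assert (Tri : forall y z, vball p (r / 2) y -> vball y (r / 2) z -> vball p r z).
  { unfold vball. intros y z Hy Hz.
    replace (minus z p) with (plus (minus z y) (minus y p)).
    - eapply Rle_lt_trans; [exact (norm_triangle (minus z y) (minus y p))|]. lra.
    - symmetry. exact (minus_trans (G := NormedModule.AbelianGroup C_AbsRing V) y z p). }
  apply (vhol_limit (fun n x => cint (fun s => f s x) (- INR n) (INR n)) F p (r / 2) (K * PI / L)); [lra| | |].
  - intros n x Hx. assert (Hn := pos_INR n).
    assert (K0 : 0 <= K). { apply (adom_nonneg K L (c x) (fun s => f s x)). apply HK. apply (Tri x); [exact Hx|]. unfold vball.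
      replace (minus x x) with (@zero V) by (symmetry; apply (@plus_opp_r (NormedModule.AbelianGroup C_AbsRing V))). rewrite norm_zero. lra. }
    apply (vhol_cint f x (- INR n) (INR n) (r / 2) K); try lra.
    + intros s y Hy. apply Hf. apply (Tri x); assumption.
    + intros s y Hy _. eapply Rle_trans; [apply (HK y); apply (Tri x); assumption|].
      assert (P := pow2_ge_0 (L * s + c y)). apply Rle_div_l; [lra|].
      rewrite <- (Rmult_1_r K) at 1. apply Rmult_le_compat_l; lra.
    + intros s y Hy. apply Hc. apply (Tri x); assumption.
  - intros n x Hx. assert (Hn := pos_INR n).
    assert (Hx' : vball p r x) by (unfold vball in *; lra).
    apply (adom_cint K L (c x)); auto; lra.
  - intros x Hx. apply impr_cvg_nat, HF. unfold vball in *; lra.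
Qed.

(** * Series of complex numbers *)

Definition psum (a : nat -> C) (N : nat) : C := Csum (seq 0 N) a.

Lemma Csum_app {A} (l1 l2 : list A) (f : A -> C) : Csum (l1 ++ l2) f = (Csum l1 f + Csum l2 f)%C.
Proof.
  induction l1 as [|a l IH]; simpl.
  - unfold Csum at 2. simpl. ring.
  - unfold Csum in *. simpl. rewrite IH. ring.
Qed.

Lemma psum_S (a : nat -> C) (N : nat) : psum a (S N) = (psum a N + a N)%C.
Proof. unfold psum. rewrite seq_S, Csum_app. simpl. unfold Csum at 2. simpl. ring. Qed.

Lemma psum_0 (a : nat -> C) : psum a 0 = 0.
Proof. reflexivity. Qed.

Lemma psum_ext (a b : nat -> C) (N : nat) : (forall n, (n < N)%nat -> a n = b n) -> psum a N = psum b N.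
Proof.
  induction N as [|N IH]; intros H; [reflexivity|]. rewrite !psum_S, IH, H by (intros; try apply H; lia).
  reflexivity.
Qed.

Lemma psum_scal (k : C) (a : nat -> C) (N : nat) : psum (fun n => k * a n)%C N = (k * psum a N)%C.
Proof. induction N as [|N IH]; [rewrite !psum_0; ring|]. rewrite !psum_S, IH. ring. Qed.

Lemma psum_plus (a b : nat -> C) (N : nat) : psum (fun n => a n + b n)%C N = (psum a N + psum b N)%C.
Proof. induction N as [|N IH]; [rewrite !psum_0; ring|]. rewrite !psum_S, IH. ring. Qed.

Lemma psum_head (a : nat -> C) (N : nat) : psum a (S N) = (a O + psum (fun n => a (S n)) N)%C.
Proof.
  induction N as [|N IH]; [rewrite psum_S, !psum_0; ring|]. rewrite psum_S, IH, psum_S. ring.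
Qed.

Lemma psum_split (a : nat -> C) (N M : nat) : psum a (N + M) = (psum a N + psum (fun n => a (N + n)%nat) M)%C.
Proof.
  induction M as [|M IH]; [rewrite Nat.add_0_r, psum_0; ring|].
  rewrite Nat.add_succ_r, !psum_S, IH. ring.
Qed.

Lemma psum_rev (a : nat -> C) (N : nat) : psum a N = psum (fun i => a (N - 1 - i)%nat) N.
Proof.
  induction N as [|N IH]; [reflexivity|]. rewrite psum_S, psum_head, IH.
  replace (S N - 1 - 0)%nat with N by lia. rewrite Cplus_comm. f_equal.
  apply psum_ext. intros n Hn. f_equal. lia.
Qed.

Lemma psum_geom_le (a : nat -> C) (K g : R) (N : nat) :
  0 <= g < 1 -> 0 <= K -> (forall n, (n < N)%nat -> Cmod (a n) <= K * g ^ n) -> Cmod (psum a N) <= K / (1 - g).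
Proof.
  intros Hg HK H. apply Rle_trans with (K * (1 - g ^ N) / (1 - g)).
  - induction N as [|N IH].
    + rewrite psum_0, Cmod_0. simpl. replace (K * (1 - 1) / (1 - g)) with 0 by (field; lra). lra.
    + rewrite psum_S. eapply Rle_trans; [apply Cmod_triangle|].
      specialize (IH ltac:(intros; apply H; lia)). specialize (H N ltac:(lia)).
      replace (K * (1 - g ^ S N) / (1 - g)) with (K * (1 - g ^ N) / (1 - g) + K * g ^ N) by (simpl; field; lra). lra.
  - unfold Rdiv. apply Rmult_le_compat_r; [left; apply Rinv_0_lt_compat; lra|].
    assert (0 <= g ^ N) by (apply pow_le; lra). nra.
Qed.

Lemma psum_tail_le (a : nat -> C) (K g : R) (N M : nat) :
  0 <= g < 1 -> 0 <= K -> (forall n, Cmod (a n) <= K * g ^ n) -> (N <= M)%nat ->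
  Cmod (psum a M - psum a N)%C <= K * g ^ N / (1 - g).
Proof.
  intros Hg HK H L. replace M with (N + (M - N))%nat by lia. rewrite psum_split.
  replace (psum a N + psum (fun n => a (N + n)%nat) (M - N) - psum a N)%C with (psum (fun n => a (N + n)%nat) (M - N)) by ring.
  apply psum_geom_le; [exact Hg | apply Rmult_le_pos; [exact HK | apply pow_le; lra] |].
  intros n _. rewrite Rmult_assoc, <- pow_add. apply H.
Qed.

Lemma geom_small (K g e : R) : 0 <= g < 1 -> 0 <= K -> 0 < e -> exists N, K * g ^ N / (1 - g) <= e.
Proof.
  intros Hg HK He. destruct (pow_lt_1_zero g ltac:(rewrite Rabs_right; lra) (e * (1 - g) / (K + 1))) as [N HN].
  { apply Rdiv_lt_0_compat; [nra | lra]. }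
  exists N. specialize (HN N (Nat.le_refl N)). assert (P : 0 <= g ^ N) by (apply pow_le; lra). rewrite Rabs_right in HN by lra.
  apply Rle_div_l; [lra|]. apply Rlt_div_r in HN; nra.
Qed.

Lemma cvg_psum_geom (a : nat -> C) (K g : R) :
  0 <= g < 1 -> 0 <= K -> (forall n, Cmod (a n) <= K * g ^ n) -> exists l, cvg (psum a) l /\ Cmod l <= K / (1 - g).
Proof.
  intros Hg HK H. destruct (cvg_cauchy (psum a)) as [l Hl].
  - intros e He. destruct (geom_small K g e Hg HK He) as [N HN]. exists N. intros n m Hn Hm.
    assert (HN2 : forall n m, (N <= n)%nat -> (n <= m)%nat -> Cmod (psum a m - psum a n)%C <= e).
    { intros n' m' L1 L2. eapply Rle_trans; [apply (psum_tail_le a K g); assumption|].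
      eapply Rle_trans; [|exact HN]. unfold Rdiv. apply Rmult_le_compat_r; [left; apply Rinv_0_lt_compat; lra|].
      apply Rmult_le_compat_l; [exact HK|]. replace n' with (N + (n' - N))%nat by lia. rewrite pow_add.
      assert (0 <= g ^ N) by (apply pow_le; lra).
      assert (g ^ (n' - N) <= 1) by (rewrite <- (pow1 (n' - N)); apply pow_incr; lra). nra. }
    destruct (Nat.le_ge_cases n m) as [L|L]; [rewrite Cmod_minus_sym|]; apply HN2; assumption.
  - exists l. split; [exact Hl|]. apply (cvg_bound (psum a)); [|exact Hl]. intros n. apply psum_geom_le; auto.
Qed.

Lemma cvg_psum_tail (a : nat -> C) (l : C) (K g : R) (N : nat) :
  0 <= g < 1 -> 0 <= K -> (forall n, Cmod (a n) <= K * g ^ n) -> cvg (psum a) l ->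
  Cmod (l - psum a N)%C <= K * g ^ N / (1 - g).
Proof.
  intros Hg HK H Hl. apply (cvg_bound (fun n => psum a (n + N) - psum a N)%C).
  - intros n. apply psum_tail_le; auto. lia.
  - apply cvg_minus; [|apply cvg_const]. apply (cvg_sub (psum a) l (fun n => n + N)%nat); [intros; lia | exact Hl].
Qed.

(** Tannery's theorem, with summands and summation range depending on the same N. *)
Lemma cvg_psum_dominated (u : nat -> nat -> C) (v : nat -> C) (l : C) (K g : R) :
  0 <= g < 1 -> 0 <= K -> (forall N j, Cmod (u N j) <= K * g ^ j) ->
  (forall j, cvg (fun N => u N j) (v j)) -> cvg (psum v) l -> cvg (fun N => psum (u N) N) l.
Proof.
  intros Hg HK Hu Hc Hl e He.
  assert (Hv : forall j, Cmod (v j) <= K * g ^ j).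
  { intros j. apply (cvg_bound (fun N => u N j)); [intros; apply Hu | apply Hc]. }
  destruct (geom_small K g (e / 4) Hg HK ltac:(lra)) as [J HJ].
  assert (Hfin : cvg (fun N => psum (u N) J) (psum v J)).
  { clear HJ. induction J as [|J IH]; [exact (cvg_const (RtoC 0))|]. rewrite psum_S.
    eapply cvg_ext; [|apply (cvg_plus _ _ _ _ IH (Hc J))]. intros; simpl; rewrite psum_S; reflexivity. }
  destruct (Hfin (e / 4) ltac:(lra)) as [N HN]. exists (Nat.max N J). intros n Hn.
  specialize (HN n ltac:(lia)).
  assert (T1 := psum_tail_le (u n) K g J n Hg HK (Hu n) ltac:(lia)).
  assert (T2 := cvg_psum_tail v l K g J Hg HK Hv Hl).
  replace (psum (u n) n - l)%C with ((psum (u n) n - psum (u n) J) + (psum (u n) J - psum v J) - (l - psum v J))%C by ring.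
  eapply Rle_trans; [apply Cmod_minus_le|].
  assert (T := Cmod_triangle (psum (u n) n - psum (u n) J) (psum (u n) J - psum v J)). lra.
Qed.

Lemma cvg_comp_cd (u : nat -> C) (l : C) (g : C -> C) (d : C) : cvg u l -> cd g l d -> cvg (fun n => g (u n)) (g l).
Proof.
  intros Hu Hg e He. destruct (cd_continuous g l d Hg e He) as [r [Hr Q]].
  destruct (Hu (r / 2) ltac:(lra)) as [N HN]. exists N. intros n Hn. specialize (HN n Hn).
  replace (u n) with (l + (u n - l))%C by ring. apply Q. lra.
Qed.

Lemma cvg_mult (u v : nat -> C) (l m : C) : cvg u l -> cvg v m -> cvg (fun n => u n * v n)%C (l * m).
Proof.
  intros Hu Hv.
  assert (Sq : forall w k, cvg w k -> cvg (fun n => w n * w n)%C (k * k)).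
  { intros w k Hw. apply (cvg_comp_cd w k (fun z => z * z)%C (1 * k + k * 1)%C Hw). apply cd_mult; apply cd_id. }
  assert (D := cvg_minus _ _ _ _ (Sq _ _ (cvg_plus _ _ _ _ Hu Hv)) (Sq _ _ (cvg_minus _ _ _ _ Hu Hv))).
  apply (cvg_scal (/ 4)%C) in D.
  replace (l * m)%C with (/ 4 * ((l + m) * (l + m) - (l - m) * (l - m)))%C by (field; intro K; injection K; lra).
  eapply cvg_ext; [|exact D]. intros n; simpl. field; intro K; injection K; lra.
Qed.

Lemma cvg_inv (u : nat -> C) (l : C) : l <> 0 -> cvg u l -> cvg (fun n => / u n)%C (/ l).
Proof. intros N H. apply (cvg_comp_cd u l Cinv _ H (cd_inv l N)). Qed.

(** * Logarithms and powers of q *)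

Lemma polar_unit (c s : R) : c ^ 2 + s ^ 2 = 1 -> exists a, 0 <= a < 2 * PI /\ c = cos a /\ s = sin a.
Proof.
  intros H. assert (Hpi := PI_RGT_0). assert (Hc : -1 <= c <= 1) by nra.
  assert (B := acos_bound c). assert (E := cos_acos c Hc). assert (E2 := sin_acos c Hc).
  assert (Hs : 1 - c² = s²) by (unfold Rsqr; nra). rewrite Hs, sqrt_Rsqr_abs in E2.
  destruct (Rle_lt_dec 0 s) as [L|L].
  - exists (acos c). rewrite E, E2, Rabs_right by lra. repeat split; lra.
  - exists (2 * PI - acos c). assert (acos c <> 0).
    { intros Z. rewrite Z, sin_0 in E2. rewrite Rabs_left in E2 by lra. lra. }
    repeat split; try lra.
    + replace (2 * PI - acos c) with (- acos c + 2 * PI) by ring. rewrite cos_plus, cos_2PI, sin_2PI, cos_neg. lra.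
    + replace (2 * PI - acos c) with (- acos c + 2 * PI) by ring. rewrite sin_plus, cos_2PI, sin_2PI, sin_neg, E2, Rabs_left by lra. lra.
Qed.

Lemma Clog_exists (x : C) : x <> 0 -> exists w, Cexp w = x /\ fst w = ln (Cmod x) /\ 0 <= snd w < 2 * PI.
Proof.
  intros Hx. assert (P := proj1 (Cmod_gt_0 x) Hx).
  destruct (polar_unit (fst x / Cmod x) (snd x / Cmod x)) as [a [Ha [E1 E2]]].
  { assert (Q := Cmod2_alt x). unfold Re, Im in Q. unfold Rdiv. rewrite !Rpow_mult_distr, <- Rmult_plus_distr_r, <- Q.
    field. lra. }
  exists (ln (Cmod x), a). split; [|split; [reflexivity | exact Ha]].
  unfold Cexp, Re, Im. simpl. rewrite exp_ln, <- E1, <- E2 by exact P.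
  destruct x as [x1 x2]. simpl. f_equal; field; lra.
Qed.

Lemma Cexp_ln_mod (w : C) : ln (Cmod (Cexp w)) = fst w.
Proof. rewrite Cmod_Cexp, ln_exp. reflexivity. Qed.

Lemma exp_le (x y : R) : x <= y -> exp x <= exp y.
Proof. intros [H|H]; [left; apply exp_increasing, H | rewrite H; lra]. Qed.

Section Q.
Variable lq : C.
Let L := fst lq.

Lemma qpow_plus (a b : R) : qpow lq (a + b) = (qpow lq a * qpow lq b)%C.
Proof. unfold qpow. rewrite <- Cexp_plus, RtoC_plus. f_equal. ring. Qed.

Lemma qpow_0 : qpow lq 0 = 1.
Proof. unfold qpow. replace (0 * lq)%C with (RtoC 0) by ring. apply Cexp_0. Qed.

Lemma qpow_neq_0 (a : R) : qpow lq a <> 0.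
Proof. apply Cexp_neq_0. Qed.

Lemma qpow_opp (a : R) : qpow lq (- a) = (/ qpow lq a)%C.
Proof. unfold qpow. rewrite <- Cexp_opp, RtoC_opp. f_equal. ring. Qed.

Lemma Cmod_qpow (a : R) : Cmod (qpow lq a) = exp (a * L).
Proof. unfold qpow. rewrite Cmod_Cexp. simpl. f_equal. unfold L. ring. Qed.

Lemma qpow_1 : qpow lq 1 = Cexp lq.
Proof. unfold qpow. f_equal. ring. Qed.

(** * The theta function *)

(* The terms of Theta in the logarithmic coordinate w, x = Cexp w, where negative n need no separate treatment. *)
Definition thw (w : C) (n : Z) : C := Cexp (RtoC (- (IZR (n * (n - 1)) / 2)) * lq + RtoC (IZR n) * w)%C.

Lemma Cpow_Cexp (w : C) (n : nat) : Cpow (Cexp w) n = Cexp (RtoC (INR n) * w)%C.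
Proof.
  induction n as [|n IH].
  - simpl. replace (0 * w)%C with (RtoC 0) by ring. rewrite Cexp_0. reflexivity.
  - cbn [Cpow]. rewrite IH, <- Cexp_plus, S_INR, RtoC_plus. f_equal. ring.
Qed.

Lemma Cpowz_Cexp (w : C) (n : Z) : Cpowz (Cexp w) n = Cexp (RtoC (IZR n) * w)%C.
Proof.
  unfold Cpowz. destruct (Z.ltb_spec n 0) as [H|H]; rewrite Cpow_Cexp, INR_IZR_INZ, Z2Nat.id by lia.
  - rewrite <- Cexp_opp. f_equal. rewrite opp_IZR, RtoC_opp. ring.
  - reflexivity.
Qed.

Lemma theta_term_Cexp (w : C) (n : Z) : theta_term lq (Cexp w) n = thw w n.
Proof. unfold theta_term, thw, qpow. rewrite Cpowz_Cexp, <- Cexp_plus. reflexivity. Qed.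

Lemma thw_shift (w : C) (n : Z) : thw (w + lq) n = (Cexp lq * Cexp w * thw w (n - 1))%C.
Proof.
  unfold thw. rewrite <- !Cexp_plus. f_equal.
  rewrite !mult_IZR, !minus_IZR.
  replace (- ((IZR n - 1) * (IZR n - 1 - 1) / 2)) with (- (IZR n * (IZR n - 1) / 2) + IZR n - 1) by field.
  rewrite !RtoC_minus, RtoC_plus. ring.
Qed.

Hypothesis HL : 0 < L.

(** The maximum found by completing the square in the exponent of a theta term: A bounds |Re w|, L/2
    comes from n(n - 1)/2 instead of n^2/2, and the 1 sets aside a factor exp(-n) for geometric
    convergence. *)
Definition thK (A : R) : R := exp ((A + 1 + L / 2) ^ 2 / (2 * L)).

Lemma thK_pos A : 0 < thK A.
Proof. apply exp_pos. Qed.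

Lemma Cmod_thw (w : C) (n : Z) : Cmod (thw w n) = exp (- (IZR (n * (n - 1)) / 2) * L + IZR n * fst w).
Proof. unfold thw. rewrite Cmod_Cexp. simpl. f_equal. unfold L. ring. Qed.

Lemma square_bound (B m : R) : - (m ^ 2 / 2) * L + m * B <= B ^ 2 / (2 * L).
Proof.
  assert (0 <= (m * L - B) ^ 2 / (2 * L)).
  { apply Rmult_le_pos; [apply pow2_ge_0 | left; apply Rinv_0_lt_compat; lra]. }
  replace (B ^ 2 / (2 * L)) with ((m * L - B) ^ 2 / (2 * L) + (- (m ^ 2 / 2) * L + m * B)) by (field; lra). lra.
Qed.

Lemma exp_m1_pow (n : nat) : exp (-1) ^ n = exp (- INR n).
Proof.
  induction n as [|n IH]; [simpl; rewrite Ropp_0, exp_0; reflexivity|].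
  cbn [pow]. rewrite IH, <- exp_plus, S_INR. f_equal. ring.
Qed.

Lemma exp_m1_bounds : 0 <= exp (-1) < 1.
Proof. split; [left; apply exp_pos|]. rewrite <- exp_0. apply exp_increasing. lra. Qed.

Lemma thw_pos_bound (w : C) (A : R) (n : nat) : Rabs (fst w) <= A -> Cmod (thw w (Z.of_nat n)) <= thK A * exp (-1) ^ n.
Proof.
  intros HA. rewrite Cmod_thw, exp_m1_pow. unfold thK. rewrite <- exp_plus.
  apply Rabs_le_between in HA. assert (Hn := pos_INR n).
  rewrite mult_IZR, minus_IZR, <- INR_IZR_INZ.
  assert (S := square_bound (A + 1 + L / 2) (INR n)).
  assert (INR n * fst w <= INR n * A) by nra.
  assert (E : - (INR n * (INR n - 1) / 2) * L + INR n * fst w <= (A + 1 + L / 2) ^ 2 / (2 * L) + - INR n) by nra.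
  apply exp_le, E.
Qed.

Lemma thw_neg_bound (w : C) (A : R) (n : nat) : Rabs (fst w) <= A -> Cmod (thw w (- Z.of_nat (S n))) <= thK A * exp (-1) ^ n.
Proof.
  intros HA. rewrite Cmod_thw, exp_m1_pow. unfold thK. rewrite <- exp_plus.
  apply Rabs_le_between in HA. assert (Hn := pos_INR n).
  rewrite mult_IZR, minus_IZR, opp_IZR, <- INR_IZR_INZ, S_INR.
  assert (S := square_bound (A + 1 + L / 2) (INR n + 1)).
  assert (E : - (- (INR n + 1) * (- (INR n + 1) - 1) / 2) * L + - (INR n + 1) * fst w <= (A + 1 + L / 2) ^ 2 / (2 * L) + - INR n) by nra.
  apply exp_le, E.
Qed.

Lemma CSeries_cvg (a : nat -> C) (l : C) : cvg (psum a) l -> CSeries a = l.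
Proof.
  intros H. unfold CSeries. apply cvg_CLim_seq. apply (cvg_sub (psum a) l S); [intros; lia | exact H].
Qed.

Definition thS (w : C) (N : nat) : C :=
  (psum (fun n => thw w (Z.of_nat n)) N + psum (fun n => thw w (- Z.of_nat (S n))) N)%C.

Lemma Theta_parts (w : C) : exists a b,
  cvg (psum (fun n => thw w (Z.of_nat n))) a /\ cvg (psum (fun n => thw w (- Z.of_nat (S n)))) b /\
  Theta lq (Cexp w) = (a + b)%C.
Proof.
  assert (K := thK_pos (Rabs (fst w))). assert (Hg := exp_m1_bounds).
  destruct (cvg_psum_geom (fun n => thw w (Z.of_nat n)) (thK (Rabs (fst w))) (exp (-1)) Hg ltac:(lra)) as [a [Ha _]].
  { intros n. apply thw_pos_bound. lra. }
  destruct (cvg_psum_geom (fun n => thw w (- Z.of_nat (S n))) (thK (Rabs (fst w))) (exp (-1)) Hg ltac:(lra)) as [b [Hb _]].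
  { intros n. apply thw_neg_bound. lra. }
  exists a, b. split; [exact Ha|split; [exact Hb|]]. unfold Theta. f_equal; apply CSeries_cvg.
  - eapply cvg_ext; [|exact Ha]. intros N. apply psum_ext. intros n _. symmetry. apply theta_term_Cexp.
  - eapply cvg_ext; [|exact Hb]. intros N. apply psum_ext. intros n _. symmetry. apply theta_term_Cexp.
Qed.

Lemma Theta_cvg (w : C) : cvg (thS w) (Theta lq (Cexp w)).
Proof. destruct (Theta_parts w) as [a [b [Ha [Hb E]]]]. rewrite E. apply cvg_plus; assumption. Qed.

(** By [thw_shift] the terms shift by one index. The term of index -1 leaves the negative half and
    becomes the head of the other. *)
Lemma Theta_shift_Cexp (w : C) : Theta lq (Cexp (w + lq)) = (Cexp lq * Cexp w * Theta lq (Cexp w))%C.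
Proof.
  destruct (Theta_parts w) as [a [b [Ha [Hb E]]]]. destruct (Theta_parts (w + lq)%C) as [a' [b' [Ha' [Hb' E']]]].
  set (k := (Cexp lq * Cexp w)%C) in *.
  assert (A : a' = (k * (thw w (-1) + a))%C).
  { apply (cvg_unique (fun N => psum (fun n => thw (w + lq) (Z.of_nat n)) (S N))).
    - apply (cvg_sub _ _ S) in Ha'; [exact Ha' | intros; lia].
    - eapply cvg_ext; [|apply cvg_scal, cvg_plus; [apply cvg_const | exact Ha]].
      intros N. cbv beta. rewrite psum_head, thw_shift. fold k. simpl (Z.of_nat 0 - 1)%Z.
      rewrite Cmult_plus_distr_l. f_equal. rewrite <- psum_scal. apply psum_ext. intros n _.
      rewrite thw_shift. fold k. do 2 f_equal. lia. }
  assert (B : b' = (k * (b - thw w (-1)))%C).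
  { apply (cvg_unique (fun N => psum (fun n => thw (w + lq) (- Z.of_nat (S n))) N)); [exact Hb'|].
    eapply cvg_ext; [|apply cvg_scal, cvg_minus; [apply (cvg_sub _ _ S) in Hb; [exact Hb | intros; lia] | apply cvg_const]].
    intros N. cbv beta. rewrite psum_head. simpl (- Z.of_nat 1)%Z.
    match goal with |- (k * (?u + ?v - ?u))%C = _ => replace (u + v - u)%C with v by ring end.
    rewrite <- psum_scal. apply psum_ext. intros n _.
    rewrite thw_shift. fold k. do 2 f_equal. lia. }
  rewrite E, E', A, B. ring.
Qed.

Lemma Theta_q (x : C) : x <> 0 -> Theta lq (Cexp lq * x) = (Cexp lq * x * Theta lq x)%C.
Proof.
  intros Hx. destruct (Clog_exists x Hx) as [w [<- _]]. rewrite <- Theta_shift_Cexp, Cexp_plus. f_equal. ring.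
Qed.

(** The quotient |x|/|p| lies between 1/2 and 3/2, and e >= 2. This yields local uniformity of every
    bound expressed through log|x|. *)
Lemma ln_mod_bound (p x : C) : p <> 0 -> Cmod (x - p)%C < Cmod p / 2 -> x <> 0 /\ Rabs (ln (Cmod x)) <= Rabs (ln (Cmod p)) + 1.
Proof.
  intros Hp H.
  assert (T := Cmod_triangle_rev p x). rewrite Cmod_minus_sym in T.
  assert (T2 := Cmod_triangle_rev x p).
  assert (X : 0 < Cmod x) by lra. split; [apply Cmod_gt_0, X|].
  assert (E1 : ln (Cmod x) <= ln (Cmod p) + 1).
  { rewrite <- (ln_exp 1) at 1. rewrite <- ln_mult by (try apply exp_pos; lra).
    left. apply ln_increasing; [lra|]. assert (Q := exp_ineq1_le 1). nra. }
  assert (E2 : ln (Cmod p) <= ln (Cmod x) + 1).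
  { rewrite <- (ln_exp 1) at 1. rewrite <- ln_mult by (try apply exp_pos; lra).
    left. apply ln_increasing; [lra|]. assert (Q := exp_ineq1 1 ltac:(lra)). nra. }
  apply Rabs_le. unfold Rabs. destruct (Rcase_abs (ln (Cmod p))); lra.
Qed.

End Q.

Lemma vhol_cd (f : C -> C) (p : C) : @vhol C_NormedModule f p <-> exists d, cd f p d.
Proof.
  split.
  - intros [l [Hl H]]. exists (l (RtoC 1)). intros e He. destruct (H e He) as [r [Hr Q]]. exists r. split; [exact Hr|].
    intros h Hh. specialize (Q h Hh).
    assert (E : l h = (l (RtoC 1) * h)%C).
    { assert (E0 : l (h * RtoC 1)%C = (h * l (RtoC 1))%C) by exact (linear_scal _ Hl h (RtoC 1)).
      rewrite Cmult_1_r in E0. rewrite E0. apply Cmult_comm. }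
    rewrite <- E. exact Q.
  - intros [d H]. exists (fun h => d * h)%C. split.
    + split.
      * intros x y. apply Cmult_plus_distr_l.
      * intros k x. change ((d * (k * x))%C = (k * (d * x))%C). ring.
      * exists (Cmod d + 1). split; [generalize (Cmod_ge_0 d); lra|]. intros x.
        change (Cmod (d * x)%C <= (Cmod d + 1) * Cmod x). rewrite Cmod_mult. generalize (Cmod_ge_0 x); nra.
    + exact H.
Qed.

Section Theta.
Variable lq : C.
Hypothesis HL : 0 < fst lq.

Lemma theta_term_cd (x : C) (n : Z) : x <> 0 -> exists d, cd (fun x => theta_term lq x n) x d.
Proof.
  intros Hx. unfold theta_term, Cpowz. destruct (n <? 0)%Z; eexists; apply cd_scal.
  - eapply (cd_comp (fun x => Cpow x (Z.to_nat (- n))) Cinv); [apply cd_pow|]. apply cd_inv.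
    apply Cpow_nz, Hx.
  - apply cd_pow.
Qed.

(** The partial sums are Laurent polynomials, bounded uniformly on the disc of radius |x|/2 about
    x. *)
Lemma Theta_cd (x : C) : x <> 0 -> exists d, cd (Theta lq) x d.
Proof.
  intros Hx. apply vhol_cd. assert (P := proj1 (Cmod_gt_0 x) Hx).
  set (F := fun N y => (psum (fun n => theta_term lq y (Z.of_nat n)) N + psum (fun n => theta_term lq y (- Z.of_nat (S n))) N)%C).
  set (A := Rabs (ln (Cmod x)) + 1).
  assert (HK := thK_pos lq A). assert (Hg := exp_m1_bounds).
  apply (vhol_limit (V := C_NormedModule) F (Theta lq) x (Cmod x / 2) (thK lq A / (1 - exp (-1)) + thK lq A / (1 - exp (-1)))).
  - lra.
  - intros N y Hy. destruct (ln_mod_bound x y Hx Hy) as [Hy0 _].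
    apply vhol_plus; apply vhol_sum; intros n _; apply vhol_cd, theta_term_cd, Hy0.
  - intros N y Hy. destruct (ln_mod_bound x y Hx Hy) as [Hy0 HA].
    destruct (Clog_exists y Hy0) as [w [Ew [Ew2 _]]]. rewrite <- Ew2 in HA. unfold F.
    eapply Rle_trans; [apply Cmod_triangle|]. apply Rplus_le_compat; apply psum_geom_le; try lra; intros n _;
    rewrite <- Ew, theta_term_Cexp.
    + apply thw_pos_bound; assumption.
    + apply thw_neg_bound; assumption.
  - intros y Hy. destruct (ln_mod_bound x y Hx Hy) as [Hy0 HA].
    destruct (Clog_exists y Hy0) as [w [Ew _]]. rewrite <- Ew.
    eapply cvg_ext; [|apply Theta_cvg, HL]. intros N. unfold thS, F.
    f_equal; apply psum_ext; intros n _; rewrite theta_term_Cexp; reflexivity.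
Qed.

(** ** Lower bound, from the finite Jacobi triple product *)

Let r := exp (- fst lq).

Lemma r_bounds : 0 < r < 1.
Proof. split; [apply exp_pos|]. unfold r. rewrite <- exp_0. apply exp_increasing. lra. Qed.

Lemma r_pow (n : nat) : r ^ n = exp (- INR n * fst lq).
Proof.
  induction n as [|n IH]; [simpl; rewrite Ropp_0, Rmult_0_l, exp_0; reflexivity|].
  cbn [pow]. rewrite IH. unfold r. rewrite <- exp_plus, S_INR. f_equal. ring.
Qed.

Definition pn (n : nat) : C := qpow lq (- INR n).

Lemma Cmod_pn n : Cmod (pn n) = r ^ n.
Proof. unfold pn. rewrite Cmod_qpow, r_pow. reflexivity. Qed.

Lemma pn_plus n m : pn (n + m) = (pn n * pn m)%C.
Proof. unfold pn. rewrite <- qpow_plus, plus_INR. f_equal. ring. Qed.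

(** The q-Pochhammer symbol (1/q; 1/q)_n. Its companion [rfac], built from r = 1/|q|, bounds its
    modulus from below. *)
Fixpoint qfac (n : nat) : C := match n with O => RtoC 1 | S k => (qfac k * (1 - pn (S k)))%C end.

Fixpoint rfac (n : nat) : R := match n with O => 1 | S k => rfac k * (1 - r ^ S k) end.

(** For 0 < t <= r one has 1 - t >= exp(-t/(1 - r)); with t = r^k the exponents sum to r/(1 - r)^2,
    which is below 1/(1 - r)^2. The upper bound [rhigh] comes in the same way from 1 + t <= exp
    t. *)
Definition rlow : R := exp (- (/ (1 - r) ^ 2)).

Lemma r_pow_S n : 0 < r ^ S n <= r.
Proof.
  assert (B := r_bounds). split; [apply pow_lt; lra|]. simpl.
  assert (0 < r ^ n <= 1) by (split; [apply pow_lt; lra | rewrite <- (pow1 n); apply pow_incr; lra]). nra.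
Qed.

Lemma rfac_low n : rlow <= rfac n <= 1.
Proof.
  assert (B := r_bounds).
  assert (H : exp (- ((r - r ^ S n) / (1 - r) ^ 2)) <= rfac n <= 1).
  { induction n as [|n IH].
    - simpl. replace (- ((r - r * 1) / ((1 - r) * ((1 - r) * 1)))) with 0 by (field; lra). rewrite exp_0. lra.
    - assert (P := r_pow_S n). cbn [rfac]. split; [|apply Rle_trans with (1 * 1); [apply Rmult_le_compat; try lra; eapply Rle_trans; [|apply IH]; left; apply exp_pos | lra]].
      set (t := r ^ S n) in *.
      replace (- ((r - r ^ S (S n)) / (1 - r) ^ 2)) with (- ((r - t) / (1 - r) ^ 2) + - (t / (1 - r))).
      2:{ change (r ^ S (S n)) with (r * t). field. lra. }
      rewrite exp_plus. apply Rmult_le_compat; try (left; apply exp_pos); [apply IH|].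
      rewrite exp_Ropp. rewrite <- (Rinv_inv (1 - t)). apply Rinv_le_contravar; [apply Rinv_0_lt_compat; lra|].
      apply Rle_trans with (1 + t / (1 - r)).
      + apply Rmult_le_reg_r with (1 - t); [lra|]. rewrite Rinv_l by lra.
        apply Rle_trans with ((1 + t / (1 - t)) * (1 - t)); [right; field; lra|].
        apply Rmult_le_compat_r; [lra|]. apply Rplus_le_compat_l. unfold Rdiv. apply Rmult_le_compat_l; [lra|].
        apply Rinv_le_contravar; lra.
      + apply exp_ineq1_le. }
  split; [|apply H]. eapply Rle_trans; [|apply H]. unfold rlow.
  assert (P := r_pow_S n). apply exp_le.
  assert ((r - r ^ S n) / (1 - r) ^ 2 <= / (1 - r) ^ 2); [|lra].
  rewrite <- (Rmult_1_l (/ (1 - r) ^ 2)). unfold Rdiv. apply Rmult_le_compat_r; [left; apply Rinv_0_lt_compat; nra | lra].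
Qed.

Lemma rlow_pos : 0 < rlow.
Proof. apply exp_pos. Qed.

Lemma qfac_low n : rlow <= Cmod (qfac n).
Proof.
  eapply Rle_trans; [apply (rfac_low n)|]. induction n as [|n IH]; [simpl; rewrite Cmod_1; lra|].
  cbn [rfac qfac]. rewrite Cmod_mult. assert (P := r_pow_S n). assert (B := r_bounds).
  apply Rmult_le_compat; [| |exact IH|].
  - assert (Q := rfac_low n). assert (Q2 := rlow_pos). lra.
  - lra.
  - assert (T := Cmod_triangle_rev 1 (pn (S n))). rewrite Cmod_1, Cmod_pn in T. exact T.
Qed.

Definition rhigh : R := exp (/ (1 - r)).

Lemma qfac_high n : Cmod (qfac n) <= rhigh.
Proof.
  assert (B := r_bounds).
  assert (H : Cmod (qfac n) <= exp ((1 - r ^ S n) / (1 - r))).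
  { induction n as [|n IH].
    - simpl. rewrite Cmod_1. assert (Q := exp_ineq1_le ((1 - r * 1) / (1 - r))).
      replace ((1 - r * 1) / (1 - r)) with 1 in * by (field; lra). lra.
    - cbn [qfac]. rewrite Cmod_mult.
      replace ((1 - r ^ S (S n)) / (1 - r)) with ((1 - r ^ S n) / (1 - r) + r ^ S n) by (simpl; field; lra).
      rewrite exp_plus. apply Rmult_le_compat; try apply Cmod_ge_0; [exact IH|].
      eapply Rle_trans; [apply Cmod_minus_le|]. rewrite Cmod_1, Cmod_pn. apply exp_ineq1_le. }
  eapply Rle_trans; [exact H|]. unfold rhigh. apply exp_le.
  assert (P := r_pow_S n). rewrite <- (Rmult_1_l (/ (1 - r))). unfold Rdiv.
  apply Rmult_le_compat_r; [left; apply Rinv_0_lt_compat; lra | lra].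
Qed.

Lemma qfac_neq_0 n : qfac n <> 0.
Proof. apply Cmod_gt_0. assert (P := qfac_low n). assert (Q := rlow_pos). lra. Qed.

(** The differences of consecutive products decay like r^n because the products stay below [rhigh];
    the limit is nonzero because they stay above [rlow]. *)
Lemma qfac_cvg : exists l, cvg qfac l /\ l <> 0.
Proof.
  assert (B := r_bounds).
  set (a := fun n => (qfac (S n) - qfac n)%C).
  assert (Hh : 0 < rhigh) by apply exp_pos.
  destruct (cvg_psum_geom a rhigh r ltac:(lra) ltac:(lra)) as [l [Hl _]].
  { intros n. unfold a. cbn [qfac]. replace (qfac n * (1 - pn (S n)) - qfac n)%C with (- (qfac n * pn (S n)))%C by ring.
    rewrite Cmod_opp, Cmod_mult, Cmod_pn. apply Rmult_le_compat; [apply Cmod_ge_0 | left; apply pow_lt; lra | apply qfac_high |].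
    simpl. assert (0 < r ^ n) by (apply pow_lt; lra). nra. }
  assert (E : forall n, (1 + psum a n)%C = qfac n).
  { induction n as [|n IH]; [rewrite psum_0; simpl; ring|]. rewrite psum_S. unfold a at 2.
    replace (1 + (psum a n + (qfac (S n) - qfac n)))%C with (1 + psum a n + (qfac (S n) - qfac n))%C by ring. rewrite IH. ring. }
  assert (Hc : cvg qfac (1 + l)%C).
  { eapply cvg_ext; [exact E|]. apply cvg_plus; [apply cvg_const | exact Hl]. }
  exists (1 + l)%C. split; [exact Hc|]. intros Z. rewrite Z in Hc.
  destruct (Hc (rlow / 2)) as [N HN]; [generalize rlow_pos; lra|]. specialize (HN N (Nat.le_refl N)).
  replace (qfac N - 0)%C with (qfac N) in HN by ring. assert (P := qfac_low N). assert (Q := rlow_pos). lra.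
Qed.

(** The Gaussian binomial coefficient in base 1/q. The value 0 beyond m is what the induction in
    [qbinomial] needs at its last index. *)
Definition qbin (m k : nat) : C := if (k <=? m)%nat then (qfac m / (qfac k * qfac (m - k)))%C else 0.

Lemma qbin_pascal m k : (k <= m)%nat -> qbin (S m) (S k) = (qbin m (S k) + pn (m - k) * qbin m k)%C.
Proof.
  intros H. unfold qbin.
  replace (S k <=? S m)%nat with true by (symmetry; apply Nat.leb_le; lia).
  replace (k <=? m)%nat with true by (symmetry; apply Nat.leb_le; lia).
  assert (N1 := qfac_neq_0 k). assert (N2 := qfac_neq_0 (S k)). simpl in N2.
  destruct (Nat.leb_spec (S k) m) as [L|L].
  - replace (S m - S k)%nat with (S (m - S k)) by lia. replace (m - k)%nat with (S (m - S k)) by lia.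
    set (j := (m - S k)%nat). assert (N3 := qfac_neq_0 j). assert (N4 := qfac_neq_0 (S j)).
    assert (E : pn (S m) = (pn (S j) * pn (S k))%C) by (rewrite <- pn_plus; f_equal; unfold j; lia).
    cbn [qfac] in *. rewrite E.
    assert (A1 : (1 - pn (S k))%C <> 0) by (intros Z; apply N2; rewrite Z; ring).
    assert (A2 : (1 - pn (S j))%C <> 0) by (intros Z; apply N4; rewrite Z; ring).
    field. repeat split; assumption.
  - assert (m = k) as -> by lia. rewrite !Nat.sub_diag.
    replace (pn 0) with (RtoC 1) by (unfold pn; simpl; rewrite Ropp_0, qpow_0; reflexivity).
    cbn [qfac] in *. change (qfac 0) with (RtoC 1).
    assert (A1 : (1 - pn (S k))%C <> 0) by (intros Z; apply N2; rewrite Z; ring).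
    field. repeat split; assumption.
Qed.

Definition eterm (v : C) (k : nat) : C := thw lq v (Z.of_nat k).

Lemma eterm_S v m k : (k <= m)%nat -> (eterm v k * Cexp (v - RtoC (INR m) * lq))%C = (eterm v (S k) * pn (m - k))%C.
Proof.
  intros H. unfold eterm, thw, pn, qpow. rewrite <- !Cexp_plus. f_equal.
  rewrite !mult_IZR, !minus_IZR, Nat2Z.inj_succ, succ_IZR, <- !INR_IZR_INZ, minus_INR by exact H.
  replace (- ((INR k + 1) * (INR k + 1 - 1) / 2)) with (- (INR k * (INR k - 1) / 2) - INR k) by field.
  rewrite !RtoC_minus, !RtoC_opp, !RtoC_minus, !RtoC_plus. ring.
Qed.

Fixpoint lprod (m : nat) (v : C) : C :=
  match m with O => RtoC 1 | S k => (lprod k v * (1 + Cexp (v - RtoC (INR k) * lq)))%C end.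

(** The q-binomial theorem for the product of the factors 1 + x q^(-k), k < m, with x = exp v.
    Pascal's rule [qbin_pascal] matches the extra factor through [eterm_S]. *)
Lemma qbinomial m v : lprod m v = psum (fun k => qbin m k * eterm v k)%C (S m).
Proof.
  assert (E0 : forall v, eterm v 0 = 1).
  { intros u. unfold eterm, thw. simpl. replace (- (0 / 2)) with 0 by field. replace (0 * lq + 0 * u)%C with (RtoC 0) by ring. apply Cexp_0. }
  assert (B0 : forall m, qbin m 0 = 1).
  { intros k. unfold qbin. simpl. rewrite Nat.sub_0_r. field. apply qfac_neq_0. }
  induction m as [|m IH].
  - simpl. rewrite psum_S, psum_0, E0, B0. ring.
  - cbn [lprod]. rewrite IH. set (X := Cexp (v - RtoC (INR m) * lq)).
    rewrite (psum_head _ (S m)), E0, B0.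
    rewrite (psum_ext (fun n => qbin (S m) (S n) * eterm v (S n))%C (fun k => qbin m (S k) * eterm v (S k) + X * (qbin m k * eterm v k))%C).
    2:{ intros k Hk. rewrite qbin_pascal by lia. assert (Q := eterm_S v m k ltac:(lia)). fold X in Q.
        replace (X * (qbin m k * eterm v k))%C with (qbin m k * (eterm v k * X))%C by ring. rewrite Q. ring. }
    rewrite psum_plus, psum_scal.
    assert (T : psum (fun k => qbin m (S k) * eterm v (S k))%C (S m) = (psum (fun k => qbin m k * eterm v k)%C (S m) - 1)%C).
    { rewrite psum_S. replace (qbin m (S m)) with (RtoC 0).
      2:{ unfold qbin. destruct (Nat.leb_spec (S m) m); [lia | reflexivity]. }
      rewrite (psum_head _ m), E0, B0. ring. }
    rewrite T. ring.
Qed.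

(** Replacing x by q^N x recentres the sum over 0..2N as a sum over -N..N of theta terms, up to one
    common factor. *)
Lemma eterm_shift w N k :
  eterm (w + RtoC (INR N) * lq) k = (Cexp (RtoC (INR N) * w + RtoC (INR N * (INR N + 1) / 2) * lq) * thw lq w (Z.of_nat k - Z.of_nat N))%C.
Proof.
  unfold eterm, thw. rewrite <- Cexp_plus. f_equal.
  rewrite !mult_IZR, !minus_IZR, <- !INR_IZR_INZ.
  replace (- ((INR k - INR N) * (INR k - INR N - 1) / 2)) with (- (INR k * (INR k - 1) / 2) + INR k * INR N - INR N * (INR N + 1) / 2) by field.
  rewrite !RtoC_minus, !RtoC_plus, RtoC_mult. ring.
Qed.

Lemma lprod_head m v : lprod (S m) v = ((1 + Cexp v) * lprod m (v - lq))%C.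
Proof.
  induction m as [|m IH].
  - simpl. replace (v - 0 * lq)%C with v by ring. ring.
  - change (lprod (S (S m)) v) with (lprod (S m) v * (1 + Cexp (v - RtoC (INR (S m)) * lq)))%C. rewrite IH. cbn [lprod].
    replace (v - lq - RtoC (INR m) * lq)%C with (v - RtoC (INR (S m)) * lq)%C by (rewrite S_INR, RtoC_plus; ring). ring.
Qed.

Lemma lprod_add m n v : lprod (m + n) v = (lprod m v * lprod n (v - RtoC (INR m) * lq))%C.
Proof.
  induction n as [|n IH]; [rewrite Nat.add_0_r; simpl; ring|].
  rewrite Nat.add_succ_r. cbn [lprod]. rewrite IH, plus_INR, RtoC_plus.
  replace (v - (RtoC (INR m) + RtoC (INR n)) * lq)%C with (v - RtoC (INR m) * lq - RtoC (INR n) * lq)%C by ring. ring.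
Qed.

(** These are the factors 1 + x q^j, 1 <= j <= N, with |x| >= 1: each is at least |x| |q|^j (1 -
    r^j). *)
Lemma lprod_up_low (w : C) N : 0 <= fst w ->
  exp (INR N * fst w + INR N * (INR N + 1) / 2 * fst lq) * rfac N <= Cmod (lprod N (w + RtoC (INR N) * lq)%C).
Proof.
  intros Hw. assert (B := r_bounds). induction N as [|N IH].
  - simpl. rewrite Cmod_1. replace (0 * fst w + 0 * (0 + 1) / 2 * fst lq) with 0 by field. rewrite exp_0. lra.
  - rewrite lprod_head, Cmod_mult.
    replace (w + RtoC (INR (S N)) * lq - lq)%C with (w + RtoC (INR N) * lq)%C by (rewrite S_INR, RtoC_plus; ring).
    cbn [rfac].
    replace (INR (S N) * fst w + INR (S N) * (INR (S N) + 1) / 2 * fst lq) with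
      ((INR N * fst w + INR N * (INR N + 1) / 2 * fst lq) + (fst w + INR (S N) * fst lq)) by (rewrite S_INR; field).
    rewrite exp_plus. set (u := fst w + INR (S N) * fst lq).
    assert (P := r_pow_S N). assert (Q := rfac_low N). assert (Q2 := rlow_pos).
    assert (U : exp u * (1 - r ^ S N) <= Cmod (1 + Cexp (w + RtoC (INR (S N)) * lq))%C).
    { assert (T := Cmod_triangle_rev (Cexp (w + RtoC (INR (S N)) * lq)) (- RtoC 1)%C).
      replace (Cexp (w + RtoC (INR (S N)) * lq) - - RtoC 1)%C with (1 + Cexp (w + RtoC (INR (S N)) * lq))%C in T by ring.
      rewrite Cmod_Cexp in T. replace (fst (w + RtoC (INR (S N)) * lq)%C) with u in T by (unfold u; simpl; ring).
      rewrite Cmod_opp, Cmod_1 in T.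
      assert (1 <= exp u * r ^ S N); [|lra].
      rewrite r_pow, <- exp_plus. rewrite <- exp_0. apply exp_le. unfold u. lra. }
    match goal with |- ?a * ?b * (?c * ?d) <= _ => replace (a * b * (c * d)) with ((b * d) * (a * c)) by ring end.
    apply Rmult_le_compat; [|  | exact U | exact IH].
    + apply Rmult_le_pos; [left; apply exp_pos | lra].
    + apply Rmult_le_pos; [left; apply exp_pos | lra].
Qed.

(** These are the factors 1 + x q^(-k) with 1 <= |x| <= |q|. Only k = 0 and k = 1 can come near zero
    and are bounded by d; for k >= 2 one has |x q^(-k)| <= r^(k-1). *)
Lemma lprod_down_low (w : C) N d : 0 <= fst w <= fst lq -> 0 <= d ->
  d <= Cmod (1 + Cexp w)%C -> d <= Cmod (1 + Cexp (w - lq))%C ->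
  d ^ 2 * rfac N <= Cmod (lprod (S (S N)) w).
Proof.
  intros Hw Hd H1 H2. assert (B := r_bounds). induction N as [|N IH].
  - cbn [lprod rfac]. rewrite !Cmod_mult, Cmod_1.
    assert (E0 : (w - RtoC (INR 0) * lq)%C = w) by (simpl INR; ring).
    assert (E1 : (w - RtoC (INR 1) * lq)%C = (w - lq)%C) by (simpl INR; ring).
    rewrite E0, E1.
    rewrite Rmult_1_l, Rmult_1_r. simpl. rewrite Rmult_1_r. apply Rmult_le_compat; assumption.
  - change (lprod (S (S (S N))) w) with (lprod (S (S N)) w * (1 + Cexp (w - RtoC (INR (S (S N))) * lq)))%C.
    rewrite Cmod_mult. cbn [rfac]. rewrite <- Rmult_assoc.
    assert (P := r_pow_S N). assert (Q := rfac_low N). assert (Q2 := rlow_pos).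
    apply Rmult_le_compat; [apply Rmult_le_pos; [apply pow2_ge_0 | lra] | lra | exact IH |].
    assert (T := Cmod_triangle_rev 1 (- Cexp (w - RtoC (INR (S (S N))) * lq))%C).
    replace (1 - - Cexp (w - RtoC (INR (S (S N))) * lq))%C with (1 + Cexp (w - RtoC (INR (S (S N))) * lq))%C in T by ring.
    rewrite Cmod_1, Cmod_opp, Cmod_Cexp in T.
    assert (exp (fst (w - RtoC (INR (S (S N))) * lq)%C) <= r ^ S N); [|lra].
    assert (F : forall a, fst (w - RtoC a * lq)%C = fst w - a * fst lq) by (intros a; simpl; ring).
    rewrite F, r_pow. apply exp_le. rewrite (S_INR (S N)). lra.
Qed.

(** The Gaussian binomial of 2N over k, rescaled by qfac(N)^2 / qfac(2N) so that it tends to 1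
    around the middle index. The infinite product then never has to be evaluated. *)
Definition dcoef (N k : nat) : C := if (k <=? 2 * N)%nat then (qfac N * qfac N / (qfac k * qfac (2 * N - k)))%C else 0.

Lemma dcoef_bound N k : Cmod (dcoef N k) <= (rhigh / rlow) ^ 2.
Proof.
  assert (P := rlow_pos).
  unfold dcoef. destruct (k <=? 2 * N)%nat.
  - rewrite Cmod_div by (apply Cmult_neq_0; apply qfac_neq_0). rewrite !Cmod_mult.
    assert (H1 := qfac_high N). assert (H2 := qfac_low k). assert (H3 := qfac_low (2 * N - k)).
    assert (H0 := Cmod_ge_0 (qfac N)).
    replace ((rhigh / rlow) ^ 2) with (rhigh * rhigh * / (rlow * rlow)) by (field; lra).
    apply Rmult_le_compat; [nra | left; apply Rinv_0_lt_compat; nra | nra |].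
    apply Rinv_le_contravar; nra.
  - rewrite Cmod_0. apply pow2_ge_0.
Qed.

(** Both f N and 2N - f N stay within M of N from below, so all four factors tend to the same
    nonzero limit of [qfac]. *)
Lemma dcoef_cvg (f : nat -> nat) (M : nat) :
  (forall N, (M <= N)%nat -> (f N <= 2 * N)%nat /\ (N - M <= f N)%nat /\ (N - M <= 2 * N - f N)%nat) ->
  cvg (fun N => dcoef N (f N)) 1.
Proof.
  intros Hf. destruct qfac_cvg as [l [Hl Nl]].
  assert (Sub : forall g : nat -> nat, (forall N, (M <= N)%nat -> (N - M <= g N)%nat) -> cvg (fun N => qfac (g N)) l).
  { intros g Hg e He. destruct (Hl e He) as [N0 H0]. exists (N0 + M)%nat. intros n Hn. apply H0.
    specialize (Hg n ltac:(lia)). lia. }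
  assert (D : cvg (fun N => qfac N * qfac N * / (qfac (f N) * qfac (2 * N - f N)))%C (l * l * / (l * l))%C).
  { apply cvg_mult; [apply cvg_mult; exact Hl|]. apply cvg_inv; [apply Cmult_neq_0; exact Nl|].
    apply cvg_mult; apply Sub; intros N HN; apply (Hf N HN). }
  rewrite Cinv_r in D by (apply Cmult_neq_0; exact Nl).
  intros e He. destruct (D e He) as [N0 H0]. exists (Nat.max N0 M). intros n Hn.
  unfold dcoef. replace (f n <=? 2 * n)%nat with true by (symmetry; apply Nat.leb_le; apply Hf; lia).
  apply H0. lia.
Qed.

Definition jacobi_sum (w : C) (N : nat) : C :=
  (psum (fun j => dcoef N (N + j) * thw lq w (Z.of_nat j)) (S N) +
   psum (fun i => dcoef N (N - 1 - i) * thw lq w (- Z.of_nat (S i))) N)%C.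

Lemma jacobi_sum_eq w N :
  (qfac (2 * N) * Cexp (RtoC (INR N) * w + RtoC (INR N * (INR N + 1) / 2) * lq) * jacobi_sum w N)%C =
  (qfac N * qfac N * lprod (2 * N) (w + RtoC (INR N) * lq))%C.
Proof.
  rewrite qbinomial. replace (S (2 * N)) with (N + S N)%nat by lia. rewrite psum_split, psum_rev.
  unfold jacobi_sum. rewrite !Cmult_plus_distr_l, <- !psum_scal. rewrite Cplus_comm.
  f_equal; apply psum_ext; intros i Hi.
  - rewrite eterm_shift. replace (Z.of_nat (N - 1 - i) - Z.of_nat N)%Z with (- Z.of_nat (S i))%Z by lia.
    unfold dcoef, qbin. replace (N - 1 - i <=? 2 * N)%nat with true by (symmetry; apply Nat.leb_le; lia).
    field. split; apply qfac_neq_0.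
  - rewrite eterm_shift. replace (Z.of_nat (N + i) - Z.of_nat N)%Z with (Z.of_nat i)%Z by lia.
    unfold dcoef, qbin. replace (N + i <=? 2 * N)%nat with true by (symmetry; apply Nat.leb_le; lia).
    field. split; apply qfac_neq_0.
Qed.

(** Tannery's theorem with the uniform bound [dcoef_bound] times the geometric bound for theta
    terms. The nonnegative half has N + 1 terms, so its last one is shown separately to tend to
    0. *)
Lemma jacobi_sum_cvg w : cvg (jacobi_sum w) (Theta lq (Cexp w)).
Proof.
  destruct (Theta_parts lq HL w) as [a [b [Ha [Hb E]]]]. rewrite E.
  assert (K := thK_pos lq (Rabs (fst w))). assert (Hg := exp_m1_bounds).
  set (D := (rhigh / rlow) ^ 2). assert (HD : 0 <= D) by apply pow2_ge_0.
  apply cvg_plus.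
  - assert (H : cvg (fun N => psum (fun j => dcoef N (N + j) * thw lq w (Z.of_nat j))%C N) a).
    { apply (cvg_psum_dominated _ (fun j => thw lq w (Z.of_nat j)) a (D * thK lq (Rabs (fst w))) (exp (-1)) Hg).
      - apply Rmult_le_pos; lra.
      - intros N j. rewrite Cmod_mult, Rmult_assoc. apply Rmult_le_compat; try apply Cmod_ge_0; [apply dcoef_bound|].
        apply thw_pos_bound; lra.
      - intros j. rewrite <- (Cmult_1_l (thw lq w (Z.of_nat j))) at 1. apply cvg_mult; [|apply cvg_const].
        apply (dcoef_cvg (fun N => (N + j)%nat) j). intros N HN. lia.
      - exact Ha. }
    intros e He. destruct (H (e / 2) ltac:(lra)) as [N1 H1].
    destruct (geom_small (D * thK lq (Rabs (fst w))) (exp (-1)) (e / 2) Hg ltac:(apply Rmult_le_pos; lra) ltac:(lra)) as [N2 H2].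
    exists (Nat.max N1 N2). intros n Hn. rewrite psum_S. specialize (H1 n ltac:(lia)).
    match goal with |- Cmod (?u + ?v - a)%C <= _ => replace (u + v - a)%C with ((u - a) + v)%C by ring end.
    eapply Rle_trans; [apply Cmod_triangle|].
    assert (Cmod (dcoef n (n + n) * thw lq w (Z.of_nat n))%C <= e / 2); [|lra].
    rewrite Cmod_mult. eapply Rle_trans; [apply Rmult_le_compat; try apply Cmod_ge_0; [apply dcoef_bound | apply (thw_pos_bound lq HL w (Rabs (fst w))); lra]|].
    fold D. eapply Rle_trans; [|exact H2]. rewrite <- Rmult_assoc.
    assert (G : exp (-1) ^ n <= exp (-1) ^ N2).
    { replace n with (N2 + (n - N2))%nat by lia. rewrite pow_add.
      assert (0 <= exp (-1) ^ N2) by (apply pow_le; lra).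
      assert (exp (-1) ^ (n - N2) <= 1) by (rewrite <- (pow1 (n - N2)); apply pow_incr; lra). nra. }
    apply Rle_trans with (D * thK lq (Rabs (fst w)) * exp (-1) ^ N2 * 1).
    + rewrite Rmult_1_r. apply Rmult_le_compat_l; [apply Rmult_le_pos; lra | exact G].
    + unfold Rdiv. apply Rmult_le_compat_l; [apply Rmult_le_pos; [apply Rmult_le_pos; lra | apply pow_le; lra]|].
      rewrite <- Rinv_1 at 1. apply Rinv_le_contravar; lra.
  - apply (cvg_psum_dominated _ (fun j => thw lq w (- Z.of_nat (S j))) b (D * thK lq (Rabs (fst w))) (exp (-1)) Hg).
    + apply Rmult_le_pos; lra.
    + intros N j. rewrite Cmod_mult, Rmult_assoc. apply Rmult_le_compat; try apply Cmod_ge_0; [apply dcoef_bound|].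
      apply thw_neg_bound; lra.
    + intros j. rewrite <- (Cmult_1_l (thw lq w (- Z.of_nat (S j)))) at 1. apply cvg_mult; [|apply cvg_const].
      apply (dcoef_cvg (fun N => (N - 1 - j)%nat) (S j)). intros N HN. lia.
    + exact Hb.
Qed.

(** Two factors [rlow] come from qfac(N)^2 and two from the halves of the product; [rhigh] bounds
    qfac(2N). *)
Definition theta_const : R := rlow ^ 4 / rhigh.

Lemma theta_const_pos : 0 < theta_const.
Proof. apply Rdiv_lt_0_compat; [apply pow_lt, rlow_pos | apply exp_pos]. Qed.

Lemma Theta_low_annulus (w : C) d : 0 <= fst w <= fst lq -> 0 <= d ->
  d <= Cmod (1 + Cexp w)%C -> d <= Cmod (1 + Cexp (w - lq))%C ->
  theta_const * d ^ 2 <= Cmod (Theta lq (Cexp w)).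
Proof.
  intros Hw Hd H1 H2. apply Rnot_lt_le. intros Hlt.
  destruct (jacobi_sum_cvg w ((theta_const * d ^ 2 - Cmod (Theta lq (Cexp w))) / 2)) as [N0 H0]; [lra|].
  (* The lower part of the product is estimated by [lprod_down_low], which sets two factors apart,
     hence this shape of N. *)
  set (N := S (S N0)). specialize (H0 N ltac:(unfold N; lia)).
  assert (T := Cmod_triangle_rev (jacobi_sum w N) (Theta lq (Cexp w))).
  assert (E := f_equal Cmod (jacobi_sum_eq w N)). rewrite !Cmod_mult in E.
  replace (2 * N)%nat with (N + N)%nat in E by lia. rewrite lprod_add, Cmod_mult in E.
  replace (w + RtoC (INR N) * lq - RtoC (INR N) * lq)%C with w in E by ring.
  assert (A := lprod_up_low w N ltac:(lra)).
  assert (B : d ^ 2 * rfac N0 <= Cmod (lprod N w)) by (apply lprod_down_low; assumption).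
  rewrite Cmod_Cexp in E.
  replace (fst (RtoC (INR N) * w + RtoC (INR N * (INR N + 1) / 2) * lq)%C) with
    (INR N * fst w + INR N * (INR N + 1) / 2 * fst lq) in E by (simpl; ring).
  set (G := exp (INR N * fst w + INR N * (INR N + 1) / 2 * fst lq)) in *.
  assert (HG : 0 < G) by apply exp_pos.
  assert (F1 := rfac_low N). assert (F2 := rfac_low N0). assert (F3 := qfac_low N). assert (F4 := qfac_high (N + N)).
  assert (Pl := rlow_pos). assert (Ph : 0 < rhigh) by apply exp_pos.
  assert (X1 : G * rlow <= Cmod (lprod N (w + RtoC (INR N) * lq)%C)) by nra.
  assert (Hd2 := pow2_ge_0 d).
  assert (X2 : d ^ 2 * rlow <= Cmod (lprod N w)) by nra.
  assert (X3 : rlow * rlow <= Cmod (qfac N) * Cmod (qfac N)) by nra.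
  assert (X4 : (G * rlow) * (d ^ 2 * rlow) <= Cmod (lprod N (w + RtoC (INR N) * lq)%C) * Cmod (lprod N w)).
  { apply Rmult_le_compat; try assumption; apply Rmult_le_pos; lra. }
  assert (X5 : (rlow * rlow) * ((G * rlow) * (d ^ 2 * rlow)) <= Cmod (qfac (N + N)) * G * Cmod (jacobi_sum w N)).
  { rewrite E. apply Rmult_le_compat; try assumption; [nra|]. apply Rmult_le_pos; apply Rmult_le_pos; lra. }
  assert (Hj := Cmod_ge_0 (jacobi_sum w N)).
  assert (X6 : Cmod (qfac (N + N)) * G * Cmod (jacobi_sum w N) <= rhigh * G * Cmod (jacobi_sum w N)).
  { apply Rmult_le_compat_r; [exact Hj|]. apply Rmult_le_compat_r; lra. }
  assert (X7 : theta_const * d ^ 2 <= Cmod (jacobi_sum w N)).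
  { unfold theta_const. apply Rmult_le_reg_l with (rhigh * G); [nra|].
    replace (rhigh * G * (rlow ^ 4 / rhigh * d ^ 2)) with (rlow * rlow * (G * rlow * (d ^ 2 * rlow))) by (field; lra). lra. }
  lra.
Qed.

Definition theta_gauge (u : R) : R := exp (u ^ 2 / (2 * fst lq) + u / 2).

(** On 0 <= u <= L the gauge u^2/(2L) + u/2 is at most L, which exp(-L) compensates. *)
Lemma Theta_lower_annulus (w : C) d : 0 <= fst w <= fst lq -> 0 <= d ->
  d <= Cmod (1 + Cexp w)%C -> d <= Cmod (1 + Cexp (w - lq))%C ->
  theta_const * exp (- fst lq) * d ^ 2 * theta_gauge (fst w) <= Cmod (Theta lq (Cexp w)).
Proof.
  intros Hw Hd H1 H2. eapply Rle_trans; [|apply (Theta_low_annulus w d); assumption].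
  assert (P := theta_const_pos).
  replace (theta_const * exp (- fst lq) * d ^ 2 * theta_gauge (fst w)) with
    (theta_const * d ^ 2 * (exp (- fst lq) * theta_gauge (fst w))) by ring.
  rewrite <- (Rmult_1_r (theta_const * d ^ 2)) at 2. apply Rmult_le_compat_l; [apply Rmult_le_pos; [lra | apply pow2_ge_0]|].
  unfold theta_gauge. rewrite <- exp_plus, <- exp_0. apply exp_le.
  assert (fst w ^ 2 / (2 * fst lq) <= fst lq / 2); [|lra].
  apply Rle_div_l; [lra|]. nra.
Qed.

(* Both sides of the bound are multiplied by the same factor under x -> q x. *)
Lemma Theta_lower_Cexp (w : C) d : 0 <= d -> (forall n : Z, d <= Cmod (1 + Cexp (w + RtoC (IZR n) * lq))%C) ->
  theta_const * exp (- fst lq) * d ^ 2 * theta_gauge (fst w) <= Cmod (Theta lq (Cexp w)).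
Proof.
  intros Hd H. set (c := theta_const * exp (- fst lq) * d ^ 2).
  assert (Step : forall v : C, c * theta_gauge (fst v) <= Cmod (Theta lq (Cexp v)) <->
                           c * theta_gauge (fst (v + lq)%C) <= Cmod (Theta lq (Cexp (v + lq)))).
  { intros v. rewrite (Theta_shift_Cexp lq HL), !Cmod_mult, !Cmod_Cexp.
    assert (E : theta_gauge (fst (v + lq)%C) = exp (fst lq) * exp (fst v) * theta_gauge (fst v)).
    { unfold theta_gauge. rewrite <- !exp_plus. f_equal. simpl. field. lra. }
    rewrite E. assert (Q : 0 < exp (fst lq) * exp (fst v)) by (apply Rmult_lt_0_compat; apply exp_pos).
    replace (c * (exp (fst lq) * exp (fst v) * theta_gauge (fst v))) with (exp (fst lq) * exp (fst v) * (c * theta_gauge (fst v))) by ring.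
    split; intros K; [apply Rmult_le_compat_l; lra | apply Rmult_le_reg_l in K; assumption]. }
  assert (StepN : forall n (v : C), c * theta_gauge (fst v) <= Cmod (Theta lq (Cexp v)) <->
                           c * theta_gauge (fst (v + RtoC (INR n) * lq)%C) <= Cmod (Theta lq (Cexp (v + RtoC (INR n) * lq)))).
  { induction n as [|n IH]; intros v.
    - simpl INR. replace (v + RtoC 0 * lq)%C with v by ring. tauto.
    - rewrite (IH v), (Step (v + RtoC (INR n) * lq)%C). replace (v + RtoC (INR n) * lq + lq)%C with (v + RtoC (INR (S n)) * lq)%C by (rewrite S_INR, RtoC_plus; ring). tauto. }
  (* The integer that brings log|x| + k L into the fundamental annulus ]0, L]. *)
  set (k := (up (- fst w / fst lq))%Z).
  destruct (archimed (- fst w / fst lq)) as [A1 A2]. fold k in A1, A2.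
  assert (B1 : - fst w < IZR k * fst lq) by (apply Rlt_div_l; lra).
  assert (B2 : IZR k * fst lq <= - fst w + fst lq).
  { assert (IZR k <= (- fst w + fst lq) / fst lq) by (replace ((- fst w + fst lq) / fst lq) with (- fst w / fst lq + 1) by (field; lra); lra).
    apply Rle_div_r in H0; lra. }
  assert (Ann : c * theta_gauge (fst (w + RtoC (IZR k) * lq)%C) <= Cmod (Theta lq (Cexp (w + RtoC (IZR k) * lq)))).
  { apply Theta_lower_annulus; [simpl; lra | exact Hd | apply H |].
    replace (w + RtoC (IZR k) * lq - lq)%C with (w + RtoC (IZR (k - 1)) * lq)%C by (rewrite minus_IZR, RtoC_minus; ring). apply H. }
  destruct (Z.le_ge_cases 0 k) as [S|S].
  - replace (IZR k) with (INR (Z.to_nat k)) in Ann by (rewrite INR_IZR_INZ, Z2Nat.id by lia; reflexivity).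
    apply StepN in Ann. exact Ann.
  - apply (StepN (Z.to_nat (- k))) in Ann. rewrite INR_IZR_INZ, Z2Nat.id, opp_IZR, RtoC_opp in Ann by lia.
    replace (w + RtoC (IZR k) * lq + - RtoC (IZR k) * lq)%C with w in Ann by ring. exact Ann.
Qed.

Lemma Theta_lower (x : C) (d : R) : x <> 0 -> 0 < d ->
  (forall n : Z, d <= Cmod (1 + x * qpow lq (IZR n))%C) ->
  theta_const * exp (- fst lq) * d ^ 2 * theta_gauge (ln (Cmod x)) <= Cmod (Theta lq x).
Proof.
  intros Hx Hd H. destruct (Clog_exists x Hx) as [w [Ew [Ew2 _]]]. rewrite <- Ew2, <- Ew.
  apply Theta_lower_Cexp; [lra|]. intros n. rewrite Cexp_plus, Ew. apply H.
Qed.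
End Theta.

(** * Gaussian estimates *)

Lemma quad_le (a k y : R) : 0 < a -> k * y - a * y ^ 2 <= k ^ 2 / (4 * a).
Proof.
  intros Ha. assert (H := pow2_ge_0 (2 * a * y - k)).
  replace (k ^ 2 / (4 * a)) with ((2 * a * y - k) ^ 2 / (4 * a) + (k * y - a * y ^ 2)) by (field; lra).
  assert (0 <= (2 * a * y - k) ^ 2 / (4 * a)) by (apply Rmult_le_pos; [lra | left; apply Rinv_0_lt_compat; lra]). lra.
Qed.

(** 1 + u^2 <= (1 + 1/a)(1 + a u^2) <= (1 + 1/a) exp(a u^2). It converts Gaussian bounds into the
    majorants of [adom]. *)
Lemma exp_cauchy_density (a u : R) : 0 < a -> exp (- (a * u ^ 2)) <= (1 + / a) / (1 + u ^ 2).
Proof.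
  intros Ha. assert (Hu := pow2_ge_0 u). assert (Hi := Rinv_0_lt_compat a Ha).
  apply Rle_div_r; [lra|]. rewrite exp_Ropp.
  assert (E := exp_ineq1_le (a * u ^ 2)). assert (P := exp_pos (a * u ^ 2)).
  rewrite Rmult_comm. apply Rle_div_l; [exact P|].
  assert (1 + u ^ 2 <= (1 + / a) * (1 + a * u ^ 2)).
  { replace ((1 + / a) * (1 + a * u ^ 2)) with (1 + u ^ 2 + / a + a * u ^ 2) by (field; lra). nra. }
  nra.
Qed.

Lemma geom_gauss (D c : R) : 0 < c -> 0 <= D -> exists K, 0 < K /\ forall n : nat, D ^ n * exp (- (c * INR n ^ 2)) <= K * (/ 2) ^ n.
Proof.
  (* The 2 leaves room for the factor (1/2)^n, the 1 keeps the logarithm defined when D = 0. *)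
  intros Hc HD. set (a := ln (2 * D + 1)).
  exists (exp (a ^ 2 / (4 * c))). split; [apply exp_pos|]. intros n.
  assert (E : (2 * D + 1) ^ n = exp (a * INR n)).
  { assert (Ea : exp a = 2 * D + 1) by (apply exp_ln; lra).
    induction n as [|n IH]; [simpl; rewrite Rmult_0_r, exp_0; reflexivity|].
    cbn [pow]. rewrite IH, <- Ea, <- exp_plus, S_INR. f_equal. ring. }
  apply Rmult_le_reg_r with (2 ^ n); [apply pow_lt; lra|].
  rewrite Rmult_assoc, (Rmult_assoc (exp _)), <- Rpow_mult_distr. replace (/ 2 * 2) with 1 by field. rewrite pow1, Rmult_1_r.
  replace (D ^ n * (exp (- (c * INR n ^ 2)) * 2 ^ n)) with ((2 * D) ^ n * exp (- (c * INR n ^ 2))) by (rewrite Rpow_mult_distr; ring).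
  apply Rle_trans with ((2 * D + 1) ^ n * exp (- (c * INR n ^ 2))).
  - apply Rmult_le_compat_r; [left; apply exp_pos|]. apply pow_incr. lra.
  - rewrite E, <- exp_plus. apply exp_le. assert (Q := quad_le c a (INR n) Hc). lra.
Qed.

Section Exponents.
Variables L M A1 Cst xi xib : R.
Hypotheses (HL : 0 < L) (HM : 0 < M) (HCst : 0 < Cst) (Hxi : 0 < xi < 1) (Hxib : 0 < xib < 1).
Let c' := xi / (2 * L) - M.
Hypotheses (Hc' : 0 < c') (HA : Cst ^ 2 / (4 * xib * c') < A1 * L).

(* What is left of -A1 L n^2, and of M x^2 - x^2/(2L), once the cross term C n x is split by AM-GM with weight xib. *)
Definition rate : R := A1 * L - Cst ^ 2 / (4 * xib * (xi / (2 * L) - M)).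
Definition slack : R := 1 / (2 * L) - M - xib * (xi / (2 * L) - M).

Lemma rate_pos : 0 < rate.
Proof. unfold rate. fold c'. lra. Qed.

(** The first summand is the exponent 1/A of the flat factor. The second is the surplus that still
    gives integrability once the first has been spent. *)
Lemma slack_eq : slack = (1 - xib) * (xi / (2 * L) - M) + (1 - xi) / (2 * L).
Proof. unfold slack. field. lra. Qed.

Lemma gain_pos : 0 < (1 - xi) / (2 * L).
Proof. apply Rdiv_lt_0_compat; lra. Qed.

Lemma slack_pos : 0 < slack.
Proof. rewrite slack_eq. fold c'. assert (P := gain_pos). nra. Qed.

Lemma cross_le (n v : R) : Cst * n * v - A1 * L * n ^ 2 <= xib * c' * v ^ 2 - rate * n ^ 2.
Proof.
  unfold rate. fold c'. assert (P : 0 < xib * c') by nra.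
  assert (Q := quad_le (xib * c') (Cst * n) v P).
  replace ((Cst * n) ^ 2 / (4 * (xib * c'))) with (Cst ^ 2 / (4 * xib * c') * n ^ 2) in Q by (field; lra). lra.
Qed.

(* The growth of the coefficients is absorbed by the decay of 1/Theta. *)
Lemma expo_kernel (P : R) : 0 <= P -> exists K, 0 < K /\ forall (n : nat) u X, 0 <= X <= Rmax u 0 + P ->
  exp (M * X ^ 2 + Cst * INR n * X - A1 * L * INR n ^ 2) * exp (- (u ^ 2 / (2 * L) + u / 2)) <=
  K * exp (- (rate / 2 * INR n ^ 2)) / (1 + u ^ 2).
Proof.
  intros HP. assert (Hs := slack_pos). assert (Hr := rate_pos).
  (* Expanding M (v + P)^2 leaves the linear term 2 M P v, which together with -u/2 is at most k1
     |u| for either sign of u. Half of [slack] absorbs it and half of [rate] absorbs C P n. *)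
  set (k1 := 2 * M * P + 1). set (K0 := M * P ^ 2 + k1 ^ 2 / (2 * slack) + (Cst * P) ^ 2 / (2 * rate)).
  exists (exp K0 * (1 + / (slack / 2))). split.
  { apply Rmult_lt_0_compat; [apply exp_pos|]. assert (0 < / (slack / 2)) by (apply Rinv_0_lt_compat; lra). lra. }
  intros n u X HX. set (v := Rmax u 0) in *. set (y := INR n).
  assert (Hy : 0 <= y) by apply pos_INR.
  assert (Hvu : v ^ 2 <= u ^ 2) by (unfold v, Rmax; destruct (Rle_dec u 0); nra).
  assert (Hlin : 2 * M * P * v - u / 2 <= k1 * Rabs u).
  { unfold k1, v, Rmax. assert (0 <= M * P) by nra. unfold Rabs. destruct (Rcase_abs u); destruct (Rle_dec u 0); nra. }
  assert (E : M * X ^ 2 + Cst * y * X - A1 * L * y ^ 2 + - (u ^ 2 / (2 * L) + u / 2) <= K0 + - (rate / 2 * y ^ 2) + - (slack / 2 * u ^ 2)).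
  { assert (X1 : M * X ^ 2 <= M * (v + P) ^ 2) by (apply Rmult_le_compat_l; [lra | apply pow_incr; lra]).
    assert (X2 : Cst * y * X <= Cst * y * v + Cst * P * y) by (assert (0 <= Cst * y) by nra; nra).
    assert (X3 := cross_le y v).
    assert (X4 : (M + xib * c') * v ^ 2 - u ^ 2 / (2 * L) <= - slack * u ^ 2).
    { unfold slack. fold c'. replace (u ^ 2 / (2 * L)) with (1 / (2 * L) * u ^ 2) by (field; lra).
      assert (0 <= M + xib * c') by nra. nra. }
    assert (X5 := quad_le (slack / 2) k1 (Rabs u) ltac:(lra)). rewrite pow2_abs in X5.
    replace (4 * (slack / 2)) with (2 * slack) in X5 by field.
    assert (X6 := quad_le (rate / 2) (Cst * P) y ltac:(lra)).
    replace (4 * (rate / 2)) with (2 * rate) in X6 by field.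
    unfold K0. lra. }
  rewrite <- exp_plus. eapply Rle_trans; [apply exp_le, E|]. rewrite !exp_plus.
  assert (G := exp_cauchy_density (slack / 2) u ltac:(lra)).
  apply Rle_trans with (exp K0 * exp (- (rate / 2 * y ^ 2)) * ((1 + / (slack / 2)) / (1 + u ^ 2))); [|right; unfold Rdiv; ring].
  apply Rmult_le_compat_l; [left; apply Rmult_lt_0_compat; apply exp_pos | exact G].
Qed.

(** Meant for x = log|tau/eps|, u = log|tau/(eps t)|, Y = -log|eps| and Z = log 2: |tau| >= 1/2
    gives x >= Y - Z, and |t| <= 1 gives x <= u. Decay in x can then be traded for decay in
    |eps|. *)
Lemma expo_tail (Z : R) : exists K, 0 < K /\ forall (n : nat) u x Y, 0 <= x <= u -> 0 <= Y - Z <= x ->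
  exp (M * x ^ 2 + Cst * INR n * x - A1 * L * INR n ^ 2) * exp (- (u ^ 2 / (2 * L) + u / 2)) <=
  K * exp (- ((1 - xib) * (xi / (2 * L) - M) * Y ^ 2)) * exp (- (rate / 2 * INR n ^ 2)) / (1 + x ^ 2).
Proof.
  assert (Hr := rate_pos). assert (Hg := gain_pos). fold c'.
  (* One half of g is moved with a from x to Y, where it absorbs the linear term produced by the
     shift Z; the other half stays on x^2 for integrability. *)
  set (g := (1 - xi) / (2 * L)) in *. set (a := (1 - xib) * c').
  assert (Ha : 0 < a) by (unfold a; nra).
  set (K0 := (2 * (a + g / 2) * Z) ^ 2 / (4 * (g / 2))).
  exists (exp K0 * (1 + / (g / 2))). split.
  { apply Rmult_lt_0_compat; [apply exp_pos|]. assert (0 < / (g / 2)) by (apply Rinv_0_lt_compat; lra). lra. }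
  intros n u x Y Hx HY. set (y := INR n).
  assert (E : M * x ^ 2 + Cst * y * x - A1 * L * y ^ 2 + - (u ^ 2 / (2 * L) + u / 2) <= K0 + - (a * Y ^ 2) + - (rate / 2 * y ^ 2) + - (g / 2 * x ^ 2)).
  { assert (X1 : x ^ 2 / (2 * L) <= u ^ 2 / (2 * L) + u / 2).
    { assert (x ^ 2 / (2 * L) <= u ^ 2 / (2 * L)); [|lra]. unfold Rdiv. apply Rmult_le_compat_r; [left; apply Rinv_0_lt_compat; lra|].
      apply pow_incr. lra. }
    assert (X3 := cross_le y x).
    assert (X4 : (M + xib * c') * x ^ 2 - x ^ 2 / (2 * L) = - ((a + g / 2) * x ^ 2) - g / 2 * x ^ 2).
    { unfold a, g, c'. field. lra. }
    assert (X5 : (Y - Z) ^ 2 <= x ^ 2) by (apply pow_incr; lra).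
    assert (X6 : (a + g / 2) * (Y - Z) ^ 2 <= (a + g / 2) * x ^ 2) by (apply Rmult_le_compat_l; lra).
    assert (X7 := quad_le (g / 2) (2 * (a + g / 2) * Z) Y ltac:(lra)). fold K0 in X7.
    assert (X8 : 0 <= (a + g / 2) * Z ^ 2) by (apply Rmult_le_pos; [lra | apply pow2_ge_0]).
    assert (0 <= rate / 2 * y ^ 2) by (apply Rmult_le_pos; [lra | apply pow2_ge_0]).
    replace ((Y - Z) ^ 2) with (Y ^ 2 - 2 * Y * Z + Z ^ 2) in X6 by ring. lra. }
  rewrite <- exp_plus. eapply Rle_trans; [apply exp_le, E|]. rewrite !exp_plus.
  assert (G := exp_cauchy_density (g / 2) x ltac:(lra)).
  match goal with |- ?p * ?q * ?s * _ <= _ => apply Rle_trans with (p * q * s * ((1 + / (g / 2)) / (1 + x ^ 2))); [|right; unfold Rdiv; ring] end.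
  apply Rmult_le_compat_l; [|exact G]. left; repeat apply Rmult_lt_0_compat; apply exp_pos.
Qed.
End Exponents.

(** * The coefficients of the formal solution in the Borel plane *)

Definition Rsum {A : Type} (l : list A) (f : A -> R) : R := fold_right Rplus 0 (map f l).

Lemma Cmod_Csum_le {A} (l : list A) (f : A -> C) (g : A -> R) :
  (forall a, In a l -> Cmod (f a) <= g a) -> Cmod (Csum l f) <= Rsum l g.
Proof.
  induction l as [|a l IH]; intros H; [unfold Csum, Rsum; simpl; rewrite Cmod_0; lra|].
  change (Cmod (f a + Csum l f)%C <= g a + Rsum l g). eapply Rle_trans; [apply Cmod_triangle|].
  apply Rplus_le_compat; [apply H; left; reflexivity | apply IH; intros; apply H; right; assumption].
Qed.

Lemma Rsum_scal {A} (l : list A) (g : A -> R) (k : R) : Rsum l (fun a => g a * k) = Rsum l g * k.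
Proof. induction l as [|a l IH]; unfold Rsum in *; simpl; [ring | rewrite IH; ring]. Qed.

Lemma Rsum_nonneg {A} (l : list A) (g : A -> R) : (forall a, In a l -> 0 <= g a) -> 0 <= Rsum l g.
Proof.
  induction l as [|a l IH]; intros H; unfold Rsum in *; simpl; [lra|].
  assert (0 <= g a) by (apply H; left; reflexivity). specialize (IH (fun x Hx => H x (or_intror Hx))). lra.
Qed.

Lemma Csum_ext {A} (l : list A) (f g : A -> C) : (forall a, In a l -> f a = g a) -> Csum l f = Csum l g.
Proof.
  induction l as [|a l IH]; intros H; [reflexivity|].
  change ((f a + Csum l f)%C = (g a + Csum l g)%C). rewrite (H a), IH; [reflexivity | |left; reflexivity].
  intros; apply H; right; assumption.
Qed.

Lemma Csum_scal {A} (l : list A) (f : A -> C) (k : C) : Csum l (fun a => k * f a)%C = (k * Csum l f)%C.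
Proof. induction l as [|a l IH]; unfold Csum in *; simpl; [ring | rewrite IH; ring]. Qed.

(** Equivalently (l + k)!/l! <= (l + s + k)!/(l + s)!: a product of k consecutive integers grows
    with its starting point. *)
Lemma fact_ratio (l s k : nat) : (fact (l + s) * fact (l + k) <= fact l * fact (l + s + k))%nat.
Proof.
  induction k as [|k IH]; [rewrite !Nat.add_0_r; lia|].
  rewrite !Nat.add_succ_r. cbn [fact Nat.mul].
  change (fact (l + k) + (l + k) * fact (l + k))%nat with (S (l + k) * fact (l + k))%nat.
  change (fact (l + s + k) + (l + s + k) * fact (l + s + k))%nat with (S (l + s + k) * fact (l + s + k))%nat.
  nia.
Qed.

Section Coefficients.
Variables (lq : C) (Sd : nat) (m0 m1 : nat -> nat) (J : nat -> list nat) (b : nat -> nat -> C -> C).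
Variable W : nat -> C -> C -> C.
Let q := Cexp lq.

(* The integrand of X is w(tau, z)/Theta(tau/(e t)), and Theta(q x) = q x Theta(x) turns (t sigma_q)^m into
   multiplication by (tau/e)^m, so that (E) becomes
   (tau + 1) d_z^S w = sum_k b_k(e, z) (tau/e)^(m0 k) (d_z^k w)(tau, z q^(-m1 k)).
   [wco n] is the coefficient of z^n in w: for n < S it is W_n/n!, and [wstep] reads off the coefficient of
   z^(n-S) on both sides. *)
Definition wterm (h k s : nat) (e tau x : C) : C :=
  if (s <=? h)%nat then
    (b k s e * Cpow (tau / e) (m0 k) / Cpow q (m1 k * (h - s)) *
     RtoC (INR (fact (h - s + k)) / INR (fact (h - s))) * x)%C
  else 0.

Definition wstep (n : nat) (g : nat -> C -> C -> C) (e tau : C) : C :=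
  if (n <? Sd)%nat then (W n e tau * / RtoC (INR (fact n)))%C
  else (RtoC (INR (fact (n - Sd)) / INR (fact n)) * / (tau + 1) *
        Csum (seq 0 Sd) (fun k => Csum (J k) (fun s =>
          wterm (n - Sd) k s e tau (g (n - Sd - s + k)%nat e tau))))%C.

(** The recursion reaches back by a variable number of indices. A table holding the first n
    coefficients makes it structural; [wco_eq] recovers the intended equation. *)
Fixpoint wtab (n : nat) : nat -> C -> C -> C :=
  match n with
  | O => fun _ _ _ => RtoC 0
  | S p => fun i => if (i =? p)%nat then wstep p (wtab p) else wtab p i
  end.

Definition wco (n : nat) : C -> C -> C := wtab (S n) n.

Lemma wtab_wco (n i : nat) : (i < n)%nat -> wtab n i = wco i.
Proof.
  induction n as [|n IH]; intros H; [lia|]. simpl. destruct (Nat.eqb_spec i n) as [->|N].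
  - unfold wco. simpl. rewrite Nat.eqb_refl. reflexivity.
  - apply IH. lia.
Qed.

Lemma wco_eq (n : nat) (e tau : C) : wco n e tau = wstep n wco e tau.
Proof.
  unfold wco at 1. simpl. rewrite Nat.eqb_refl. unfold wstep. destruct (Nat.ltb_spec n Sd) as [H|H]; [reflexivity|].
  f_equal. apply Csum_ext. intros k Hk. apply in_seq in Hk. apply Csum_ext. intros s _.
  unfold wterm. destruct (Nat.leb_spec s (n - Sd)) as [K|K]; [|reflexivity].
  rewrite wtab_wco by lia. reflexivity.
Qed.

Lemma wco_init (n : nat) (e tau : C) : (n < Sd)%nat -> (RtoC (INR (fact n)) * wco n e tau)%C = W n e tau.
Proof.
  intros H. rewrite wco_eq. unfold wstep. replace (n <? Sd)%nat with true by (symmetry; apply Nat.ltb_lt, H).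
  field. intros Z. apply (INR_fact_neq_0 n). injection Z. auto.
Qed.

Lemma wco_rec (h : nat) (e tau : C) : (tau + 1)%C <> 0 ->
  (RtoC (INR (fact (h + Sd)) / INR (fact h)) * ((tau + 1) * wco (h + Sd) e tau))%C =
  Csum (seq 0 Sd) (fun k => Csum (J k) (fun s => wterm h k s e tau (wco (h - s + k) e tau))).
Proof.
  intros Ht. rewrite wco_eq. unfold wstep. replace (h + Sd <? Sd)%nat with false by (symmetry; apply Nat.ltb_ge; lia).
  replace (h + Sd - Sd)%nat with h by lia.
  set (X := Csum (seq 0 Sd) _).
  assert (N1 : RtoC (INR (fact h)) <> 0) by (intros Z; apply (INR_fact_neq_0 h); injection Z; auto).
  assert (N2 : RtoC (INR (fact (h + Sd))) <> 0) by (intros Z; apply (INR_fact_neq_0 (h + Sd)); injection Z; auto).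
  rewrite !RtoC_div by apply INR_fact_neq_0. field. auto.
Qed.

Section Bound.
Variables (A1 Cst M Kb K1 d1 : R) (e tau : C) (X : R).
Hypotheses (HL : 0 < fst lq) (HA1 : 0 < A1) (HCst : 0 < Cst) (HM : 0 < M).
Hypotheses (HKb : 0 <= Kb) (HK1 : 0 <= K1) (Hd1 : 0 < d1).
Hypothesis HA : assumption_A Sd J m0 m1 Cst A1.
Hypothesis HX : 0 <= X.
Hypothesis Htau : d1 <= Cmod (tau + 1)%C.
Hypothesis Hxe : Cmod (tau / e)%C <= exp X.
Hypothesis Hb : forall k s, (k < Sd)%nat -> In s (J k) -> Cmod (b k s e) <= Kb.
Hypothesis HW : forall j, (j < Sd)%nat -> Cmod (W j e tau) <= K1 * exp (M * X ^ 2).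

Let L := fst lq.

(** Put n = S - k + s. Then (l + k + n)^2 - (l + k)^2 = n^2 + 2 n k + 2 n l, and the last term is
    paid by |q|^(-m1 l) since m1 >= 2 n A1. What remains does not depend on l, so one recursion step
    costs a constant. *)
Definition step_weight (k s : nat) : R :=
  Kb / d1 * exp (A1 * L * ((INR Sd - INR k + INR s) ^ 2 + 2 * (INR Sd - INR k + INR s) * INR k)).

Definition ratio : R := 1 + Rsum (seq 0 Sd) (fun k => Rsum (J k) (fun s => step_weight k s)).

(** The exponential undoes the factor exp(-A1 L n^2) of [gaussX] for the initial coefficients, n <
    S. *)
Definition base : R := K1 * exp (A1 * L * INR Sd ^ 2).

Definition gaussX (n : nat) : R := exp (M * X ^ 2 + Cst * INR n * X - A1 * L * INR n ^ 2).

Lemma step_weight_nonneg k s : 0 <= step_weight k s.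
Proof.
  unfold step_weight. apply Rmult_le_pos; [apply Rmult_le_pos; [exact HKb | left; apply Rinv_0_lt_compat, Hd1] | left; apply exp_pos].
Qed.

Lemma ratio_ge_1 : 1 <= ratio.
Proof.
  unfold ratio. assert (0 <= Rsum (seq 0 Sd) (fun k => Rsum (J k) (fun s => step_weight k s))); [|lra].
  apply Rsum_nonneg. intros k _. apply Rsum_nonneg. intros s _. apply step_weight_nonneg.
Qed.

Lemma base_nonneg : 0 <= base.
Proof. unfold base. apply Rmult_le_pos; [exact HK1 | left; apply exp_pos]. Qed.

(** Three budgets balance: the factorials by [fact_ratio], the power (tau/eps)^(m0 k) by the growth
    of C n X in the index, and the loss in n^2 by q^(-m1 l). *)
Lemma wterm_bound (h k s : nat) (x : C) (B : R) : (k < Sd)%nat -> In s (J k) -> 0 <= B ->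
  Cmod x <= B * gaussX (h - s + k) ->
  Cmod (RtoC (INR (fact h) / INR (fact (h + Sd))) * / (tau + 1) * wterm h k s e tau x)%C <=
  step_weight k s * (B * gaussX (h + Sd)).
Proof.
  intros Hk Hs HB Hx. unfold wterm. destruct (Nat.leb_spec s h) as [Hsh|Hsh].
  2:{ rewrite Cmult_0_r, Cmod_0. apply Rmult_le_pos; [apply step_weight_nonneg|].
      apply Rmult_le_pos; [exact HB | left; apply exp_pos]. }
  destruct (HA k s Hk Hs) as [Hm0 Hm1]. set (l := (h - s)%nat) in *.
  assert (Hh : h = (l + s)%nat) by (unfold l; lia).
  set (n := INR Sd - INR k + INR s) in *.
  assert (Hn : INR (h + Sd) = INR (l + k) + n) by (unfold n; rewrite Hh, !plus_INR; ring).
  assert (Hl0 := pos_INR l).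
  assert (Nt : (tau + 1)%C <> 0) by (apply Cmod_gt_0; lra).
  assert (Nq : Cpow q (m1 k * l) <> 0) by (apply Cpow_nz, Cexp_neq_0).
  unfold Cdiv at 1. rewrite !Cmod_mult, !Cmod_R, !Cmod_inv, !Cmod_pow by assumption.
  assert (F : forall i, 0 < INR (fact i)) by (intros; apply INR_fact_lt_0).
  rewrite !Rabs_right by (left; apply Rdiv_lt_0_compat; apply F).
  assert (Hq : Cmod q = exp L) by (unfold q; apply Cmod_Cexp).
  assert (P1 : / Cmod q ^ (m1 k * l) = exp (- (INR (m1 k) * INR l * L))).
  { rewrite Hq, exp_Ropp, <- mult_INR. f_equal. clear. induction (m1 k * l)%nat as [|i IH]; [simpl; rewrite Rmult_0_l, exp_0; reflexivity|].
    cbn [pow]. rewrite IH, <- exp_plus, S_INR. f_equal. ring. }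
  rewrite P1.
  assert (P2 : Cmod (tau / e)%C ^ m0 k <= exp (INR (m0 k) * X)).
  { apply Rle_trans with (exp X ^ m0 k); [apply pow_incr; split; [apply Cmod_ge_0 | exact Hxe]|].
    right. clear. induction (m0 k) as [|i IH]; [simpl; rewrite Rmult_0_l, exp_0; reflexivity|].
    cbn [pow]. rewrite IH, <- exp_plus, S_INR. f_equal. ring. }
  assert (Fr : INR (fact h) / INR (fact (h + Sd)) * (INR (fact (l + k)) / INR (fact l)) <= 1).
  { replace (INR (fact h) / INR (fact (h + Sd)) * (INR (fact (l + k)) / INR (fact l))) with
      (INR (fact h) * INR (fact (l + k)) / (INR (fact (h + Sd)) * INR (fact l))) by (field; split; apply INR_fact_neq_0).
    apply Rle_div_l; [apply Rmult_lt_0_compat; apply F|]. rewrite Rmult_1_l, <- !mult_INR. apply le_INR.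
    assert (Q := fact_ratio l s k). rewrite <- Hh in Q. assert (Q2 : (fact (h + k) <= fact (h + Sd))%nat) by (apply fact_le; lia). nia. }
  set (FA := INR (fact h) / INR (fact (h + Sd))) in *. set (FB := INR (fact (l + k)) / INR (fact l)) in *.
  assert (FA0 : 0 < FA) by (apply Rdiv_lt_0_compat; apply F). assert (FB0 : 0 < FB) by (apply Rdiv_lt_0_compat; apply F).
  assert (P3 : / Cmod (tau + 1)%C <= / d1) by (apply Rinv_le_contravar; assumption).
  assert (P30 : 0 < / Cmod (tau + 1)%C) by (apply Rinv_0_lt_compat; lra).
  assert (P4 := Hb k s Hk Hs).
  replace (FA * / Cmod (tau + 1)%C * (Cmod (b k s e) * Cmod (tau / e)%C ^ m0 k * exp (- (INR (m1 k) * INR l * L)) * FB * Cmod x)) with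
    ((FA * FB) * (Cmod (b k s e) * / Cmod (tau + 1)%C) * (Cmod (tau / e)%C ^ m0 k * exp (- (INR (m1 k) * INR l * L)) * Cmod x)) by ring.
  apply Rle_trans with (1 * (Kb * / d1) * (exp (INR (m0 k) * X) * exp (- (INR (m1 k) * INR l * L)) * (B * gaussX (l + k)))).
  - apply Rmult_le_compat.
    + apply Rmult_le_pos; [nra|]. apply Rmult_le_pos; [apply Cmod_ge_0 | lra].
    + repeat apply Rmult_le_pos; try apply Cmod_ge_0; [apply pow_le, Cmod_ge_0 | left; apply exp_pos].
    + apply Rmult_le_compat; [nra | apply Rmult_le_pos; [apply Cmod_ge_0 | lra] | exact Fr|].
      apply Rmult_le_compat; [apply Cmod_ge_0 | lra | exact P4 | exact P3].
    + apply Rmult_le_compat; [apply Rmult_le_pos; [apply pow_le, Cmod_ge_0 | left; apply exp_pos] | apply Cmod_ge_0 | | exact Hx].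
      apply Rmult_le_compat_r; [left; apply exp_pos | exact P2].
  - unfold step_weight, gaussX. fold n.
    replace (1 * (Kb * / d1) * (exp (INR (m0 k) * X) * exp (- (INR (m1 k) * INR l * L)) * (B * exp (M * X ^ 2 + Cst * INR (l + k) * X - A1 * L * INR (l + k) ^ 2)))) with
      (Kb / d1 * B * (exp (INR (m0 k) * X) * exp (- (INR (m1 k) * INR l * L)) * exp (M * X ^ 2 + Cst * INR (l + k) * X - A1 * L * INR (l + k) ^ 2))) by (unfold Rdiv; ring).
    match goal with |- _ <= Kb / d1 * ?a * (B * ?c) => replace (Kb / d1 * a * (B * c)) with (Kb / d1 * B * (a * c)) by ring end.
    apply Rmult_le_compat_l.
    { apply Rmult_le_pos; [|exact HB]. apply Rmult_le_pos; [exact HKb | left; apply Rinv_0_lt_compat, Hd1]. }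
    rewrite <- !exp_plus. apply exp_le. rewrite Hn, (plus_INR l k).
    assert (Q1 : INR (m0 k) * X <= Cst * n * X) by (apply Rmult_le_compat_r; lra).
    assert (Q2 : 2 * n * A1 * (INR l * L) <= INR (m1 k) * INR l * L).
    { rewrite (Rmult_assoc (INR (m1 k))). apply Rmult_le_compat_r; [apply Rmult_le_pos; [lra | unfold L; lra] | lra]. }
    set (a := INR l) in *. set (c := INR k) in *. clearbody a c n. clear - Q1 Q2.
    lra.
Qed.

Lemma wco_bound (n : nat) : Cmod (wco n e tau) <= base * ratio ^ n * gaussX n.
Proof.
  induction n as [n IH] using lt_wf_ind. assert (R1 := ratio_ge_1). assert (B0 := base_nonneg).
  rewrite wco_eq. unfold wstep. destruct (Nat.ltb_spec n Sd) as [H|H].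
  - assert (F1 : 1 <= INR (fact n)) by (change 1 with (INR 1); apply le_INR; generalize (lt_O_fact n); lia).
    rewrite Cmod_mult, Cmod_inv, Cmod_R, Rabs_right by (try lra; intros Z; injection Z; lra).
    apply Rle_trans with (Cmod (W n e tau)).
    { rewrite <- (Rmult_1_r (Cmod (W n e tau))) at 2. apply Rmult_le_compat_l; [apply Cmod_ge_0|].
      rewrite <- Rinv_1. apply Rinv_le_contravar; lra. }
    eapply Rle_trans; [apply HW, H|]. unfold base, gaussX.
    apply Rle_trans with (K1 * exp (A1 * L * INR Sd ^ 2) * 1 * exp (M * X ^ 2 + Cst * INR n * X - A1 * L * INR n ^ 2)).
    + rewrite Rmult_1_r, Rmult_assoc, <- exp_plus. apply Rmult_le_compat_l; [exact HK1|]. apply exp_le.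
      assert (N := pos_INR n). apply lt_INR in H.
      assert (0 <= Cst * INR n * X) by (repeat apply Rmult_le_pos; lra).
      assert (0 < A1 * L) by (apply Rmult_lt_0_compat; assumption).
      assert (INR n ^ 2 <= INR Sd ^ 2) by (apply pow_incr; lra). nra.
    + apply Rmult_le_compat_r; [left; apply exp_pos|]. apply Rmult_le_compat_l; [exact B0 | apply pow_R1_Rle, R1].
  - rewrite <- Csum_scal.
    eapply Rle_trans.
    { apply (Cmod_Csum_le _ _ (fun k => Rsum (J k) (fun s => step_weight k s) * (base * ratio ^ (n - 1) * gaussX n))).
      intros k Hk. apply in_seq in Hk. rewrite <- Csum_scal, <- Rsum_scal. apply Cmod_Csum_le. intros s Hs.
      destruct (Nat.leb_spec s (n - Sd)) as [Hsn|Hsn].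
      - assert (Q := wterm_bound (n - Sd) k s (wco (n - Sd - s + k) e tau) (base * ratio ^ (n - 1))).
        replace (n - Sd + Sd)%nat with n in Q by lia. apply Q; [lia | exact Hs | apply Rmult_le_pos; [exact B0 | apply pow_le; lra] |].
        eapply Rle_trans; [apply IH; lia|]. apply Rmult_le_compat_r; [left; apply exp_pos|].
        apply Rmult_le_compat_l; [exact B0|]. apply Rle_pow; [exact R1 | lia].
      - unfold wterm. replace (s <=? n - Sd)%nat with false by (symmetry; apply Nat.leb_gt; lia).
        rewrite Cmult_0_r, Cmod_0. apply Rmult_le_pos; [apply step_weight_nonneg|].
        apply Rmult_le_pos; [apply Rmult_le_pos; [exact B0 | apply pow_le; lra] | left; apply exp_pos]. }
    rewrite Rsum_scal.
    destruct n as [|n'].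
    (* Here n - 1 is truncated to 0. But n = 0 together with S <= n forces S = 0 and an empty
       sum. *)
    + assert (Es : seq 0 Sd = []) by (replace Sd with O by lia; reflexivity). rewrite Es. cbn [pow]. unfold Rsum. simpl. rewrite Rmult_0_l.
      apply Rmult_le_pos; [rewrite Rmult_1_r; exact B0 | left; apply exp_pos].
    + replace (S n' - 1)%nat with n' by lia. cbn [pow].
      replace (base * (ratio * ratio ^ n') * gaussX (S n')) with (ratio * (base * ratio ^ n' * gaussX (S n'))) by ring.
      apply Rmult_le_compat_r; [|unfold ratio; lra].
      apply Rmult_le_pos; [apply Rmult_le_pos; [exact B0 | apply pow_le; lra] | left; apply exp_pos].
Qed.
End Bound.

Lemma wterm_vhol {V : NormedModule C_AbsRing} (h k s : nat) (fe ft fx : V -> C) (p : V) :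
  fe p <> 0 -> vhol (fun y => b k s (fe y)) p -> vhol fe p -> vhol ft p -> vhol fx p ->
  vhol (fun y => wterm h k s (fe y) (ft y) (fx y)) p.
Proof.
  intros N Hb He Ht Hx. unfold wterm. destruct (s <=? h)%nat; [|apply vhol_const].
  apply vhol_mult; [|exact Hx]. apply vhol_mult; [|apply vhol_const].
  apply vhol_mult; [|apply vhol_const]. apply vhol_mult; [exact Hb|].
  apply vhol_pow. apply vhol_mult; [exact Ht | apply vhol_inv; assumption].
Qed.

Lemma wco_vhol {V : NormedModule C_AbsRing} (fe ft : V -> C) (p : V) (n : nat) :
  fe p <> 0 -> (ft p + 1)%C <> 0 ->
  (forall k s, (k < Sd)%nat -> In s (J k) -> vhol (fun y => b k s (fe y)) p) ->
  (forall j, (j < Sd)%nat -> vhol (fun y => W j (fe y) (ft y)) p) ->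
  vhol fe p -> vhol ft p -> vhol (fun y => wco n (fe y) (ft y)) p.
Proof.
  intros N1 N2 Hb HW He Ht. induction n as [n IH] using lt_wf_ind.
  refine (vhol_ext_loc (fun y => wstep n wco (fe y) (ft y)) _ p 1 Rlt_0_1 _ _).
  { intros y _. symmetry. apply wco_eq. }
  unfold wstep. destruct (Nat.ltb_spec n Sd) as [H|H].
  - apply vhol_mult; [apply HW, H | apply vhol_const].
  - apply vhol_mult.
    + apply vhol_mult; [apply vhol_const|]. apply (vhol_inv (fun y => ft y + 1)%C); [exact N2|].
      apply vhol_plus; [exact Ht | apply vhol_const].
    + apply (vhol_sum (fun k y => Csum (J k) (fun s => wterm (n - Sd) k s (fe y) (ft y) (wco (n - Sd - s + k) (fe y) (ft y))))).
      intros k Hk. apply in_seq in Hk.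
      apply (vhol_sum (fun s y => wterm (n - Sd) k s (fe y) (ft y) (wco (n - Sd - s + k) (fe y) (ft y)))).
      intros s Hs. destruct (Nat.leb_spec s (n - Sd)) as [Hsn|Hsn].
      * apply (wterm_vhol (n - Sd) k s fe ft (fun y => wco (n - Sd - s + k) (fe y) (ft y))); auto; [apply Hb; [lia | exact Hs] | apply IH; lia].
      * unfold wterm. replace (s <=? n - Sd)%nat with false by (symmetry; apply Nat.leb_gt; lia). apply vhol_const.
Qed.
End Coefficients.

Lemma wco_ext lq Sd m0 m1 J b W W' n e tau :
  (forall j, (j < Sd)%nat -> W j e tau = W' j e tau) ->
  wco lq Sd m0 m1 J b W n e tau = wco lq Sd m0 m1 J b W' n e tau.
Proof.
  intros H. induction n as [n IH] using lt_wf_ind. rewrite !wco_eq. unfold wstep.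
  destruct (Nat.ltb_spec n Sd) as [L|L]; [rewrite H by exact L; reflexivity|].
  f_equal. apply Csum_ext. intros k Hk. apply in_seq in Hk. apply Csum_ext. intros s _.
  unfold wterm. destruct (Nat.leb_spec s (n - Sd)) as [K|K]; [|reflexivity].
  rewrite IH by lia. reflexivity.
Qed.

(** * Entire power series *)

(** Infinite radius of convergence, with the factor (1/2)^n built in so that every tail is geometric
    with one fixed ratio. *)
Definition entire (a : nat -> C) : Prop :=
  forall D, 0 <= D -> exists K, 0 < K /\ forall n, D ^ n * Cmod (a n) <= K * (/ 2) ^ n.

Definition PS (a : nat -> C) (z : C) : C := CSeries (fun n => a n * Cpow z n)%C.

Lemma half_bounds : 0 <= / 2 < 1.
Proof. lra. Qed.

Lemma entire_term (a : nat -> C) (D : R) : entire a -> 0 <= D -> exists K, 0 < K /\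
  forall z, Cmod z <= D -> forall n, Cmod (a n * Cpow z n)%C <= K * (/ 2) ^ n.
Proof.
  intros Ha HD. destruct (Ha D HD) as [K [HK H]]. exists K. split; [exact HK|]. intros z Hz n.
  rewrite Cmod_mult, Cmod_pow. eapply Rle_trans; [|apply H]. rewrite Rmult_comm.
  apply Rmult_le_compat_r; [apply Cmod_ge_0|]. apply pow_incr. split; [apply Cmod_ge_0 | exact Hz].
Qed.

Lemma PS_cvg (a : nat -> C) (z : C) : entire a -> cvg (psum (fun n => a n * Cpow z n)%C) (PS a z).
Proof.
  intros Ha. destruct (entire_term a (Cmod z) Ha (Cmod_ge_0 z)) as [K [HK H]].
  destruct (cvg_psum_geom _ K (/ 2) half_bounds ltac:(lra) (H z (Rle_refl _))) as [l [Hl _]].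
  unfold PS. rewrite (CSeries_cvg _ l Hl). exact Hl.
Qed.

Lemma PS_bound (a : nat -> C) (z : C) (K D : R) : 0 <= K -> 0 <= D -> Cmod z <= D ->
  (forall n, D ^ n * Cmod (a n) <= K * (/ 2) ^ n) -> Cmod (PS a z) <= 2 * K.
Proof.
  intros HK HD Hz H.
  assert (H' : forall n, Cmod (a n * Cpow z n)%C <= K * (/ 2) ^ n).
  { intros n. rewrite Cmod_mult, Cmod_pow. eapply Rle_trans; [|apply H]. rewrite Rmult_comm.
    apply Rmult_le_compat_r; [apply Cmod_ge_0|]. apply pow_incr. split; [apply Cmod_ge_0 | exact Hz]. }
  destruct (cvg_psum_geom _ K (/ 2) half_bounds HK H') as [l [Hl Bl]].
  unfold PS. rewrite (CSeries_cvg _ l Hl). replace (2 * K) with (K / (1 - / 2)) by field. exact Bl.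
Qed.

Lemma pow_INR_le (n : nat) : INR (S n) <= 2 ^ n.
Proof.
  induction n as [|n IH]; [simpl; lra|]. rewrite S_INR. cbn [pow].
  assert (1 <= 2 ^ n) by (apply pow_R1_Rle; lra). lra.
Qed.

Definition dcoefs (a : nat -> C) (n : nat) : C := (RtoC (INR (S n)) * a (S n))%C.

(** The factor n + 1 is at most 2^n and is absorbed by enlarging the radius from D to 2D + 1. *)
Lemma entire_dcoefs (a : nat -> C) : entire a -> entire (dcoefs a).
Proof.
  intros Ha D HD. destruct (Ha (2 * D + 1)) as [K [HK H]]; [lra|]. exists K. split; [exact HK|]. intros n.
  unfold dcoefs. rewrite Cmod_mult, Cmod_R, Rabs_right by (apply Rle_ge, pos_INR).
  specialize (H (S n)). cbn [pow] in H. assert (P := Cmod_ge_0 (a (S n))).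
  assert (Q : 0 <= (/ 2) ^ n) by (apply pow_le; lra).
  assert (E : D ^ n * INR (S n) <= (2 * D + 1) * (2 * D + 1) ^ n).
  { apply Rle_trans with ((2 * D) ^ n).
    - rewrite Rpow_mult_distr, Rmult_comm. apply Rmult_le_compat_r; [apply pow_le, HD | apply pow_INR_le].
    - apply Rle_trans with (1 * (2 * D + 1) ^ n).
      + rewrite Rmult_1_l. apply pow_incr. lra.
      + apply Rmult_le_compat_r; [apply pow_le; lra | lra]. }
  apply Rle_trans with (((2 * D + 1) * (2 * D + 1) ^ n) * Cmod (a (S n))).
  - rewrite <- Rmult_assoc. apply Rmult_le_compat_r; assumption.
  - eapply Rle_trans; [exact H|]. assert (0 <= K * (/2)^n) by (apply Rmult_le_pos; lra). nra.
Qed.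

(** [vd_limit] also says that the derivatives of the partial sums converge to the derivative of the
    limit; the shift by one index removes the constant term, whose derivative is 0. *)
Lemma PS_cd (a : nat -> C) (z : C) : entire a -> cd (PS a) z (PS (dcoefs a) z).
Proof.
  intros Ha. destruct (entire_term a (Cmod z + 1) Ha ltac:(generalize (Cmod_ge_0 z); lra)) as [K [HK H]].
  set (F := fun N y => psum (fun n => a n * Cpow y n)%C N).
  assert (DF : forall N y, cd (F N) y (psum (fun n => a n * (RtoC (INR n) * Cpow y (Nat.pred n)))%C N)).
  { intros N y. apply (cd_sum (fun n y => a n * Cpow y n)%C). intros n _. apply cd_scal, cd_pow. }
  assert (Vd : forall N y, @vd C_NormedModule (F N) y (fun h => psum (fun n => a n * (RtoC (INR n) * Cpow y (Nat.pred n)))%C N * h)%C).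
  { intros N y. split; [|exact (DF N y)]. split.
    - intros u v. apply Cmult_plus_distr_l.
    - intros k u. change (psum (fun n => a n * (RtoC (INR n) * Cpow y (Nat.pred n)))%C N * (k * u) = k * (psum (fun n => a n * (RtoC (INR n) * Cpow y (Nat.pred n)))%C N * u))%C. ring.
    - set (d := psum _ N). exists (Cmod d + 1). split; [generalize (Cmod_ge_0 d); lra|]. intros u.
      change (Cmod (d * u)%C <= (Cmod d + 1) * Cmod u). rewrite Cmod_mult. generalize (Cmod_ge_0 u); nra. }
  destruct (vd_limit (V := C_NormedModule) F (PS a) z 1 (2 * K) (fun N h => psum (fun n => a n * (RtoC (INR n) * Cpow z (Nat.pred n)))%C N * h)%C) as [L [[_ HL] HLc]].
  - lra.
  - intros n x _. eexists. apply Vd.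
  - intros n x Hx. replace (2 * K) with (K / (1 - / 2)) by field. apply psum_geom_le; [exact half_bounds | lra|].
    intros i _. apply H. change (Cmod (x - z)%C < 1) in Hx. assert (T := Cmod_triangle_rev x z). lra.
  - intros x _. apply PS_cvg, Ha.
  - intros n. apply Vd.
  - assert (E : forall h, L h = (PS (dcoefs a) z * h)%C).
    { intros h. apply (cvg_unique _ _ _ (HLc h)).
      apply (cvg_ext (fun N => h * psum (fun n => a n * (RtoC (INR n) * Cpow z (Nat.pred n)))%C N)%C); [intros; apply Cmult_comm|].
      rewrite Cmult_comm. apply cvg_scal. apply (cvg_shift_inv _ _ 1).
      eapply cvg_ext; [|apply (PS_cvg _ z (entire_dcoefs a Ha))]. intros N. rewrite Nat.add_1_r, psum_head.
      change (INR 0) with 0. rewrite Cmult_0_l, Cmult_0_r, Cplus_0_l. apply psum_ext. intros n _.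
      unfold dcoefs. cbn [Nat.pred]. ring. }
    intros e He. destruct (HL e He) as [r [Hr Q]]. exists r. split; [exact Hr|]. intros h Hh.
    rewrite <- E. apply Q, Hh.
Qed.

Fixpoint ncoefs (k : nat) (a : nat -> C) : nat -> C :=
  match k with O => a | S p => dcoefs (ncoefs p a) end.

Lemma entire_ncoefs (k : nat) (a : nat -> C) : entire a -> entire (ncoefs k a).
Proof. intros H. induction k as [|k IH]; [exact H | apply entire_dcoefs, IH]. Qed.

Lemma ncoefs_eq (k : nat) (a : nat -> C) (l : nat) :
  ncoefs k a l = (RtoC (INR (fact (l + k)) / INR (fact l)) * a (l + k)%nat)%C.
Proof.
  revert l. induction k as [|k IH]; intros l.
  - rewrite Nat.add_0_r. unfold Rdiv. rewrite Rinv_r by apply INR_fact_neq_0. simpl. ring.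
  - cbn [ncoefs]. unfold dcoefs. rewrite IH. replace (S l + k)%nat with (l + S k)%nat by lia.
    rewrite Cmult_assoc, <- RtoC_mult. do 2 f_equal.
    replace (INR (fact (S l))) with (INR (S l) * INR (fact l)) by (rewrite <- mult_INR; f_equal).
    assert (N := INR_fact_neq_0 l). assert (N2 : INR (S l) <> 0) by (apply not_0_INR; lia). field. auto.
Qed.

Lemma C_derive_n_PS (f : C -> C) (a : nat -> C) (k : nat) :
  entire a -> (forall z, f z = PS a z) -> forall z, C_derive_n f k z = PS (ncoefs k a) z.
Proof.
  intros Ha Hf. induction k as [|k IH]; intros z; [apply Hf|].
  cbn [C_derive_n ncoefs]. apply C_derive_cd. eapply cd_ext; [intros x; symmetry; apply IH|].
  apply PS_cd, entire_ncoefs, Ha.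
Qed.

Lemma PS_zero (a : nat -> C) : entire a -> PS a 0 = a O.
Proof.
  intros Ha. apply (cvg_unique _ _ _ (PS_cvg a 0 Ha)). apply (cvg_shift_inv _ _ 1).
  eapply cvg_ext; [|apply (cvg_const (a O))]. intros N. rewrite Nat.add_1_r, psum_head.
  rewrite (psum_ext _ (fun n => 0 * 0)%C), psum_scal.
  - simpl. ring.
  - intros n _. simpl. ring.
Qed.

(** * Pointwise bounds for the Laplace integrand *)

Section Pointwise.
Variables (lq : C) (Sd : nat) (m0 m1 : nat -> nat) (J : nat -> list nat) (b : nat -> nat -> C -> C).
Variables (M A1 Cst xi xib Kb K1 d1 dl : R) (W : nat -> C -> C -> C).
Let L := fst lq.
Hypotheses (HL : 0 < fst lq) (HM : 0 < M) (HCst : 0 < Cst) (HA1 : 0 < A1) (Hxi : 0 < xi < 1) (Hxib : 0 < xib < 1).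
Hypotheses (Hc' : 0 < xi / (2 * fst lq) - M) (HAC : Cst ^ 2 / (4 * xib * (xi / (2 * fst lq) - M)) < A1 * fst lq).
Hypotheses (HKb : 0 <= Kb) (HK1 : 0 <= K1) (Hd1 : 0 < d1) (Hdl : 0 < dl).
Hypothesis HasA : assumption_A Sd J m0 m1 Cst A1.

(** What the estimate of the coefficients needs at one point, so that it can be checked separately
    on the spirals and on the small disc. *)
Definition good_pt (e tau : C) : Prop :=
  e <> 0 /\ tau <> 0 /\ d1 <= Cmod (tau + 1)%C /\
  (forall k s, (k < Sd)%nat -> In s (J k) -> Cmod (b k s e) <= Kb) /\
  (forall j, (j < Sd)%nat -> Cmod (W j e tau) <= K1 * exp (M * (Rmax 0 (ln (Cmod (tau / e)%C))) ^ 2)).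

(** The zeros of Theta are the points -q^n, so this is a scale-invariant distance from all of them
    at once. *)
Definition far_pt (x : C) : Prop := x <> 0 /\ forall n : Z, dl <= Cmod (1 + x * qpow lq (IZR n))%C.

Definition integrand (n : nat) (e t tau : C) : C :=
  (wco lq Sd m0 m1 J b W n e tau / Theta lq (tau / (e * t)))%C.

Let B0 := base lq Sd A1 K1.
Let B1 := ratio lq Sd J A1 Kb d1.
Let cT := theta_const lq * exp (- fst lq) * dl ^ 2.

Lemma cT_pos : 0 < cT.
Proof.
  unfold cT. apply Rmult_lt_0_compat; [|apply pow_lt, Hdl].
  apply Rmult_lt_0_compat; [apply theta_const_pos | apply exp_pos].
Qed.

Lemma far_Theta (x : C) : far_pt x -> Theta lq x <> 0 /\
  Cmod (/ Theta lq x)%C <= / cT * exp (- (ln (Cmod x) ^ 2 / (2 * L) + ln (Cmod x) / 2)).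
Proof.
  intros [Hx H]. assert (T := Theta_lower lq HL x dl Hx Hdl H). fold cT in T. assert (P := cT_pos).
  assert (G : 0 < theta_gauge lq (ln (Cmod x))) by apply exp_pos.
  assert (CG : 0 < cT * theta_gauge lq (ln (Cmod x))) by (apply Rmult_lt_0_compat; assumption).
  assert (N : Theta lq x <> 0) by (apply Cmod_gt_0; lra). split; [exact N|].
  rewrite Cmod_inv by exact N. rewrite exp_Ropp.
  change (exp (ln (Cmod x) ^ 2 / (2 * L) + ln (Cmod x) / 2)) with (theta_gauge lq (ln (Cmod x))).
  rewrite <- Rinv_mult. apply Rinv_le_contravar; assumption.
Qed.

Lemma ln_Cmod_div (x y : C) : x <> 0 -> y <> 0 -> ln (Cmod (x / y)%C) = ln (Cmod x) - ln (Cmod y).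
Proof.
  intros Hx Hy. rewrite Cmod_div by exact Hy. apply ln_div; apply Cmod_gt_0; assumption.
Qed.

Lemma ln_Cmod_mult (x y : C) : x <> 0 -> y <> 0 -> ln (Cmod (x * y)%C) = ln (Cmod x) + ln (Cmod y).
Proof.
  intros Hx Hy. rewrite Cmod_mult. apply ln_mult; apply Cmod_gt_0; assumption.
Qed.

Lemma wco_bound_pt (n : nat) (e tau : C) : good_pt e tau ->
  Cmod (wco lq Sd m0 m1 J b W n e tau) <=
  B0 * B1 ^ n * exp (M * (Rmax 0 (ln (Cmod (tau / e)%C))) ^ 2 + Cst * INR n * Rmax 0 (ln (Cmod (tau / e)%C)) - A1 * fst lq * INR n ^ 2).
Proof.
  intros [He [Ht [H1 [H2 H3]]]].
  assert (Nte : (tau / e)%C <> 0).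
  { intros Z. apply Ht. replace tau with (tau / e * e)%C by (field; exact He). rewrite Z. ring. }
  assert (Pte := proj1 (Cmod_gt_0 _) Nte).
  apply (wco_bound lq Sd m0 m1 J b W A1 Cst M Kb K1 d1 e tau (Rmax 0 (ln (Cmod (tau / e)%C)))); try assumption.
  - apply Rmax_l.
  - rewrite <- (exp_ln (Cmod (tau / e)%C)) at 1 by exact Pte. apply exp_le, Rmax_r.
Qed.

Lemma B0_nonneg : 0 <= B0.
Proof. apply base_nonneg, HK1. Qed.

Lemma B1_ge_1 : 1 <= B1.
Proof. apply ratio_ge_1; assumption. Qed.

(** The coefficients are controlled by log|tau/eps| and the kernel by log|tau/(eps t)|; the two
    differ by log|t|, whence the bound P. The constant is uniform in eps and n. *)
Lemma integrand_bound (P : R) : 0 <= P -> exists K, 0 < K /\ forall (n : nat) (e t tau : C),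
  good_pt e tau -> t <> 0 -> ln (Cmod t) <= P -> far_pt (tau / (e * t))%C ->
  Cmod (integrand n e t tau) <=
  K * (B1 ^ n * exp (- (rate L M A1 Cst xi xib / 2 * INR n ^ 2))) / (1 + ln (Cmod (tau / (e * t))%C) ^ 2).
Proof.
  intros HP. destruct (expo_kernel L M A1 Cst xi xib HL HM HCst Hxi Hxib Hc' HAC P HP) as [KE [HKE HE]].
  assert (P0 := B0_nonneg). assert (P1 := B1_ge_1). assert (PT := cT_pos).
  exists ((B0 + 1) * / cT * KE). split.
  { assert (0 < / cT) by (apply Rinv_0_lt_compat; lra).
    apply Rmult_lt_0_compat; [apply Rmult_lt_0_compat; lra | lra]. }
  intros n e t tau Hg Ht HtP Hf. assert (Hw := wco_bound_pt n e tau Hg).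
  destruct (far_Theta _ Hf) as [N HT]. destruct Hg as [He [Htau _]].
  unfold integrand, Cdiv. rewrite Cmod_mult. fold (tau / (e * t))%C.
  set (u := ln (Cmod (tau / (e * t))%C)) in *. set (X := Rmax 0 (ln (Cmod (tau / e)%C))) in *.
  assert (Net : (e * t)%C <> 0) by (apply Cmult_neq_0; assumption).
  assert (HX : 0 <= X <= Rmax u 0 + P).
  { split; [apply Rmax_l|]. apply Rmax_lub; [assert (0 <= Rmax u 0) by apply Rmax_r; lra|].
    assert (Hu : u <= Rmax u 0) by apply Rmax_l.
    assert (Eu : u = ln (Cmod tau) - (ln (Cmod e) + ln (Cmod t))) by (unfold u; rewrite ln_Cmod_div, ln_Cmod_mult by assumption; ring).
    rewrite ln_Cmod_div by assumption. lra. }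
  specialize (HE n u X HX). fold L in Hw.
  set (G := exp (M * X ^ 2 + Cst * INR n * X - A1 * L * INR n ^ 2)) in *.
  set (G2 := exp (- (u ^ 2 / (2 * L) + u / 2))) in *.
  assert (HB1 : 0 < B1 ^ n) by (apply pow_lt; lra).
  assert (HG2 : 0 < G2) by apply exp_pos. assert (HG : 0 < G) by apply exp_pos.
  assert (HiT : 0 < / cT) by (apply Rinv_0_lt_compat; lra).
  apply Rle_trans with ((B0 * B1 ^ n * G) * (/ cT * G2)); [apply Rmult_le_compat; try apply Cmod_ge_0; assumption|].
  replace (B0 * B1 ^ n * G * (/ cT * G2)) with (B0 * / cT * B1 ^ n * (G * G2)) by ring.
  apply Rle_trans with ((B0 + 1) * / cT * B1 ^ n * (KE * exp (- (rate L M A1 Cst xi xib / 2 * INR n ^ 2)) / (1 + u ^ 2))); [|right; unfold Rdiv; ring].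
  apply Rmult_le_compat; [| |apply Rmult_le_compat_r; [lra|]; apply Rmult_le_compat_r; lra | exact HE].
  - apply Rmult_le_pos; [apply Rmult_le_pos; lra | lra].
  - apply Rmult_le_pos; lra.
Qed.

(** For |eps| <= 1/2 <= |tau| the variable x = log|tau/eps| is nonnegative, so [expo_tail] applies
    and yields the flat factor in eps. *)
Lemma integrand_tail : exists K, 0 < K /\ forall (n : nat) (e t tau : C),
  good_pt e tau -> t <> 0 -> Cmod t <= 1 -> Cmod e <= 1 / 2 -> 1 / 2 <= Cmod tau -> far_pt (tau / (e * t))%C ->
  Cmod (integrand n e t tau) <=
  K * exp (- ((1 - xib) * (xi / (2 * L) - M) * ln (Cmod e) ^ 2)) *
   (B1 ^ n * exp (- (rate L M A1 Cst xi xib / 2 * INR n ^ 2))) / (1 + ln (Cmod (tau / e)%C) ^ 2).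
Proof.
  destruct (expo_tail L M A1 Cst xi xib HL Hxi Hxib Hc' HAC (- ln (1 / 2))) as [KE [HKE HE]].
  assert (P0 := B0_nonneg). assert (P1 := B1_ge_1). assert (PT := cT_pos).
  exists ((B0 + 1) * / cT * KE). split.
  { assert (0 < / cT) by (apply Rinv_0_lt_compat; lra).
    apply Rmult_lt_0_compat; [apply Rmult_lt_0_compat; lra | lra]. }
  intros n e t tau Hg Ht Ht1 He2 Htau2 Hf. assert (Hw := wco_bound_pt n e tau Hg).
  destruct (far_Theta _ Hf) as [N HT]. destruct Hg as [He [Htau _]].
  unfold integrand, Cdiv. rewrite Cmod_mult. fold (tau / (e * t))%C. fold (tau / e)%C.
  assert (Net : (e * t)%C <> 0) by (apply Cmult_neq_0; assumption).
  assert (Pe := proj1 (Cmod_gt_0 _) He). assert (Pt := proj1 (Cmod_gt_0 _) Ht).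
  assert (Lt : ln (Cmod t) <= 0) by (rewrite <- ln_1; apply ln_le; lra).
  assert (Le : ln (Cmod e) <= ln (1 / 2)) by (apply ln_le; lra).
  assert (Ltau : ln (1 / 2) <= ln (Cmod tau)) by (apply ln_le; lra).
  assert (Eu : ln (Cmod (tau / (e * t))%C) = ln (Cmod tau) - (ln (Cmod e) + ln (Cmod t))) by (rewrite ln_Cmod_div, ln_Cmod_mult by assumption; ring).
  assert (Ex : ln (Cmod (tau / e)%C) = ln (Cmod tau) - ln (Cmod e)) by (apply ln_Cmod_div; assumption).
  set (u := ln (Cmod (tau / (e * t))%C)) in *. set (x := ln (Cmod (tau / e)%C)) in *.
  rewrite Rmax_right in Hw by lra. fold L in Hw.
  specialize (HE n u x (- ln (Cmod e)) ltac:(lra) ltac:(lra)).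
  replace ((- ln (Cmod e)) ^ 2) with (ln (Cmod e) ^ 2) in HE by ring.
  set (G := exp (M * x ^ 2 + Cst * INR n * x - A1 * L * INR n ^ 2)) in *.
  set (G2 := exp (- (u ^ 2 / (2 * L) + u / 2))) in *.
  assert (HB1 : 0 < B1 ^ n) by (apply pow_lt; lra).
  assert (HG2 : 0 < G2) by apply exp_pos. assert (HG : 0 < G) by apply exp_pos.
  assert (HiT : 0 < / cT) by (apply Rinv_0_lt_compat; lra).
  apply Rle_trans with ((B0 * B1 ^ n * G) * (/ cT * G2)); [apply Rmult_le_compat; try apply Cmod_ge_0; assumption|].
  replace (B0 * B1 ^ n * G * (/ cT * G2)) with (B0 * / cT * B1 ^ n * (G * G2)) by ring.
  match type of HE with _ <= ?rhs => apply Rle_trans with ((B0 + 1) * / cT * B1 ^ n * rhs); [|right; unfold Rdiv; ring] end.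
  apply Rmult_le_compat; [| |apply Rmult_le_compat_r; [lra|]; apply Rmult_le_compat_r; lra | exact HE].
  - apply Rmult_le_pos; [apply Rmult_le_pos; lra | lra].
  - apply Rmult_le_pos; lra.
Qed.

(** Gaussian decay in n beats both the growth [B1] of the recursion and any power of |z| <= D. *)
Lemma decay_const (D : R) : 0 <= D -> exists K, 0 < K /\
  forall n, D ^ n * (B1 ^ n * exp (- (rate L M A1 Cst xi xib / 2 * INR n ^ 2))) <= K * (/ 2) ^ n.
Proof.
  intros HD. assert (P1 := B1_ge_1).
  assert (Hr : 0 < rate L M A1 Cst xi xib) by (apply (rate_pos L M A1 Cst xi xib HAC)).
  destruct (geom_gauss (D * B1) (rate L M A1 Cst xi xib / 2)) as [K [HK H]]; [lra | apply Rmult_le_pos; lra |].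
  exists K. split; [exact HK|]. intros n. rewrite <- Rmult_assoc, <- Rpow_mult_distr. apply H.
Qed.
End Pointwise.

(** * The solution on one sector *)

Lemma ccont_qpow (lq lam : C) (s : R) : ccont (fun s => qpow lq s * lam)%C s.
Proof.
  apply ccont_mult; [|apply ccont_const]. unfold qpow.
  eapply (ccont_comp_cd (fun s => RtoC s * lq)%C Cexp); [|apply cd_Cexp].
  apply ccont_mult; [apply ccont_RtoC | apply ccont_const].
Qed.

(** * The coordinates (eps, t, z) *)

Lemma CCC_norms (h : CCC) : Cmod (fst (fst h)) <= norm h /\ Cmod (snd (fst h)) <= norm h /\ Cmod (snd h) <= norm h.
Proof.
  destruct h as [[e t] z]. simpl.
  assert (A := proj1 (norm_prod (K := C_AbsRing) (U := CC) (V := C_NormedModule) ((e, t) : CC) z)).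
  assert (B := proj1 (norm_prod (K := C_AbsRing) (U := C_NormedModule) (V := C_NormedModule) e t)).
  assert (A1 := Rle_trans _ _ _ (Rmax_l _ _) A). assert (A2 := Rle_trans _ _ _ (Rmax_r _ _) A).
  assert (B1 := Rle_trans _ _ _ (Rmax_l _ _) B). assert (B2 := Rle_trans _ _ _ (Rmax_r _ _) B).
  split; [|split].
  - exact (Rle_trans _ _ _ B1 A1).
  - exact (Rle_trans _ _ _ B2 A1).
  - exact A2.
Qed.

Lemma vball_CCC (p x : CCC) (r : R) : vball p r x ->
  Cmod (fst (fst x) - fst (fst p))%C < r /\ Cmod (snd (fst x) - snd (fst p))%C < r /\ Cmod (snd x - snd p)%C < r.
Proof.
  unfold vball. intros H. assert (N := CCC_norms (minus x p)).
  change (fst (fst (minus x p))) with (fst (fst x) - fst (fst p))%C in N.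
  change (snd (fst (minus x p))) with (snd (fst x) - snd (fst p))%C in N.
  change (snd (minus x p)) with (snd x - snd p)%C in N. lra.
Qed.

Lemma vhol_eps (p : CCC) : @vhol CCC (fun x => fst (fst x)) p.
Proof.
  apply vhol_linear. apply (is_linear_comp (V := CC) (fun x : CCC => fst x) (fun x : CC => fst x));
  apply is_linear_fst.
Qed.

Lemma vhol_t (p : CCC) : @vhol CCC (fun x => snd (fst x)) p.
Proof.
  apply vhol_linear. apply (is_linear_comp (V := CC) (fun x : CCC => fst x) (fun x : CC => snd x)).
  - apply is_linear_fst.
  - apply is_linear_snd.
Qed.

Lemma vhol_z (p : CCC) : @vhol CCC (fun x => snd x) p.
Proof. apply vhol_linear. apply is_linear_snd. Qed.

Section Sector.
Variables (lq : C) (Sd : nat) (m0 m1 : nat -> nat) (J : nat -> list nat) (b : nat -> nat -> C -> C).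
Variables (M A1 Cst xi xib Kb K1 d1 dl : R) (W : nat -> C -> C -> C) (lam : C) (Ue Tt : C -> Prop).
Let L := fst lq.
Let q := Cexp lq.
Hypotheses (HL : 0 < fst lq) (HM : 0 < M) (HCst : 0 < Cst) (HA1 : 0 < A1) (Hxi : 0 < xi < 1) (Hxib : 0 < xib < 1).
Hypotheses (Hc' : 0 < xi / (2 * fst lq) - M) (HAC : Cst ^ 2 / (4 * xib * (xi / (2 * fst lq) - M)) < A1 * fst lq).
Hypotheses (HKb : 0 <= Kb) (HK1 : 0 <= K1) (Hd1 : 0 < d1) (Hdl : 0 < dl).
Hypothesis HasA : assumption_A Sd J m0 m1 Cst A1.
Hypothesis Ue_open : forall e, Ue e -> exists r, 0 < r /\ forall e', Cmod (e' - e)%C < r -> Ue e'.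
Hypothesis Tt_open : forall t, Tt t -> exists r, 0 < r /\ forall t', Cmod (t' - t)%C < r -> Tt t'.
Hypothesis Tt_q : forall t, Tt t -> Tt (q * t)%C.
Hypothesis Tt_nz : forall t, Tt t -> t <> 0.
Hypothesis Hb : forall k s e, (k < Sd)%nat -> In s (J k) -> Ue e -> exists d, cd (b k s) e d.

Let tau s := (qpow lq s * lam)%C.

Hypothesis Hgood : forall e s, Ue e -> good_pt Sd J b M Kb K1 d1 W e (tau s).
Hypothesis Hfar : forall e t s, Ue e -> Tt t -> far_pt lq dl (tau s / (e * t))%C.
Hypothesis HWe : forall j e s, (j < Sd)%nat -> Ue e -> exists d, cd (fun e => W j e (tau s)) e d.
Hypothesis HWt : forall j e s, (j < Sd)%nat -> Ue e -> exists d, cd (fun x => W j e x) (tau s) d.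

Let ig n e t s := integrand lq Sd m0 m1 J b W n e t (tau s).
Let B1 := ratio lq Sd J A1 Kb d1.
Let decay n := B1 ^ n * exp (- (rate L M A1 Cst xi xib / 2 * INR n ^ 2)).

Lemma Ue_nz (e : C) : Ue e -> e <> 0.
Proof. intros H. apply (Hgood e 0 H). Qed.

Lemma tau_nz (e : C) (s : R) : Ue e -> tau s <> 0.
Proof. intros He. apply (Hgood e s He). Qed.

(** The parameters e and t enter only through the offset, which is the shape required by [adom]. *)
Lemma ln_tau (e t : C) (s : R) : Ue e -> Tt t ->
  ln (Cmod (tau s / (e * t))%C) = L * s + (ln (Cmod lam) - ln (Cmod (e * t)%C)).
Proof.
  intros He Ht. assert (Net : (e * t)%C <> 0) by (apply Cmult_neq_0; [apply Ue_nz | apply Tt_nz]; assumption).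
  assert (Nl : lam <> 0). { intros Z. apply (tau_nz e s He). unfold tau. rewrite Z. ring. }
  rewrite ln_Cmod_div; [|apply (tau_nz e s He) | exact Net].
  unfold tau. rewrite ln_Cmod_mult by (assumption || apply qpow_neq_0). rewrite Cmod_qpow, ln_exp. unfold L. ring.
Qed.

Lemma ig_adom (P : R) : 0 <= P -> exists K, 0 < K /\ forall (n : nat) (e t : C), Ue e -> Tt t -> ln (Cmod t) <= P ->
  adom (K * decay n) L (ln (Cmod lam) - ln (Cmod (e * t)%C)) (ig n e t).
Proof.
  intros HP. destruct (integrand_bound lq Sd m0 m1 J b M A1 Cst xi xib Kb K1 d1 dl W HL HM HCst HA1 Hxi Hxib Hc' HAC HKb HK1 Hd1 Hdl HasA P HP) as [K [HK H]].
  exists K. split; [exact HK|]. intros n e t He Ht HtP s. rewrite <- (ln_tau e t s He Ht).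
  apply H; auto.
Qed.

Lemma ig_ccont (n : nat) (e t : C) (s : R) : Ue e -> Tt t -> ccont (ig n e t) s.
Proof.
  intros He Ht. unfold ig, integrand, Cdiv.
  destruct (Hgood e s He) as [Ne [Nt [Hd [_ _]]]].
  apply ccont_mult.
  - assert (Hv : @vhol C_NormedModule (fun x => wco lq Sd m0 m1 J b W n e x) (tau s)).
    { apply (wco_vhol lq Sd m0 m1 J b W (fun _ => e) (fun x => x)).
      - exact Ne.
      - apply Cmod_gt_0. lra.
      - intros k s' Hk Hs. apply vhol_const.
      - intros j Hj. apply vhol_cd. apply HWt; assumption.
      - apply vhol_const.
      - apply vhol_cd. eexists. apply cd_id. }
    apply vhol_cd in Hv. destruct Hv as [d Hv]. eapply (ccont_comp_cd tau); [apply ccont_qpow | exact Hv].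
  - destruct (far_Theta lq dl HL Hdl _ (Hfar e t s He Ht)) as [NT _].
    apply ccont_inv; [exact NT|].
    destruct (Theta_cd lq HL _ (proj1 (Hfar e t s He Ht))) as [d Hd'].
    eapply (ccont_comp_cd (fun s => tau s * / (e * t))%C (Theta lq)); [|exact Hd'].
    apply ccont_mult; [apply ccont_qpow | apply ccont_const].
Qed.

(** Defined by the same [RInt_gen] as [q_laplace], so that the initial conditions match without
    conversion; [ig_impr] gives it meaning. *)
Definition xint (n : nat) (e t : C) : C :=
  @RInt_gen C_R_CompleteNormedModule (ig n e t) (Rbar_locally m_infty) (Rbar_locally p_infty).

Lemma ig_impr (n : nat) (e t : C) : Ue e -> Tt t -> impr (ig n e t) (xint n e t).
Proof.
  intros He Ht. destruct (ig_adom (Rabs (ln (Cmod t))) (Rabs_pos _)) as [K [HK H]].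
  destruct (adom_impr _ L _ (ig n e t) HL (fun s => ig_ccont n e t s He Ht) (H n e t He Ht (Rle_abs _))) as [I [HI _]].
  unfold xint. rewrite (impr_RInt_gen _ _ HI). exact HI.
Qed.

Lemma xint_bound (P : R) : 0 <= P -> exists K, 0 < K /\ forall (n : nat) (e t : C), Ue e -> Tt t -> ln (Cmod t) <= P ->
  Cmod (xint n e t) <= K * decay n.
Proof.
  intros HP. destruct (ig_adom P HP) as [K [HK H]]. assert (Hpi := PI_RGT_0).
  exists (K * PI / L). split; [apply Rdiv_lt_0_compat; [apply Rmult_lt_0_compat; assumption | exact HL]|].
  intros n e t He Ht HtP.
  destruct (adom_impr _ L _ (ig n e t) HL (fun s => ig_ccont n e t s He Ht) (H n e t He Ht HtP)) as [I [HI BI]].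
  rewrite (impr_unique _ _ _ (ig_impr n e t He Ht) HI).
  replace (K * PI / L * decay n) with (K * decay n * PI / L) by (field; unfold L; lra). exact BI.
Qed.

(** A neighbourhood on which log|t| and |z| are bounded: there every constant of the estimates is
    uniform. *)
Lemma sector_ball (p : CCC) : Ue (fst (fst p)) -> Tt (snd (fst p)) -> exists r P, 0 < r /\ 0 <= P /\
  forall x, vball p r x -> Ue (fst (fst x)) /\ Tt (snd (fst x)) /\ ln (Cmod (snd (fst x))) <= P /\ Cmod (snd x) <= Cmod (snd p) + 1.
Proof.
  intros He Ht. destruct (Ue_open _ He) as [r1 [Hr1 Q1]]. destruct (Tt_open _ Ht) as [r2 [Hr2 Q2]].
  assert (Nt := proj1 (Cmod_gt_0 _) (Tt_nz _ Ht)).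
  exists (Rmin (Rmin r1 r2) (Rmin 1 (Cmod (snd (fst p)) / 2))), (Rabs (ln (Cmod (snd (fst p)))) + 1).
  split; [repeat apply Rmin_pos; lra|]. split; [generalize (Rabs_pos (ln (Cmod (snd (fst p))))); lra|].
  intros x Hx. apply vball_CCC in Hx. destruct Hx as [X1 [X2 X3]].
  assert (M1 := Rmin_l (Rmin r1 r2) (Rmin 1 (Cmod (snd (fst p)) / 2))).
  assert (M2 := Rmin_r (Rmin r1 r2) (Rmin 1 (Cmod (snd (fst p)) / 2))).
  assert (M3 := Rmin_l r1 r2). assert (M4 := Rmin_r r1 r2).
  assert (M5 := Rmin_l 1 (Cmod (snd (fst p)) / 2)). assert (M6 := Rmin_r 1 (Cmod (snd (fst p)) / 2)).
  split; [apply Q1; lra|]. split; [apply Q2; lra|]. split.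
  - destruct (ln_mod_bound (snd (fst p)) (snd (fst x)) (Tt_nz _ Ht) ltac:(lra)) as [_ B].
    apply Rle_trans with (2 := B). apply Rle_abs.
  - assert (T := Cmod_triangle_rev (snd x) (snd p)). lra.
Qed.

Lemma xint_vhol (n : nat) (p : CCC) : Ue (fst (fst p)) -> Tt (snd (fst p)) ->
  @vhol CCC (fun x => xint n (fst (fst x)) (snd (fst x))) p.
Proof.
  intros He Ht. destruct (sector_ball p He Ht) as [r [P [Hr [HP HB]]]].
  destruct (ig_adom P HP) as [K [HK H]].
  apply (vhol_impr (V := CCC) (fun s x => ig n (fst (fst x)) (snd (fst x)) s) _ p r (K * decay n) L
    (fun x => ln (Cmod lam) - ln (Cmod (fst (fst x) * snd (fst x))%C)) Hr HL).
  - intros s x Hx. destruct (HB x Hx) as [He' [Ht' _]].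
    assert (Net : (fst (fst x) * snd (fst x))%C <> 0) by (apply Cmult_neq_0; [apply Ue_nz | apply Tt_nz]; assumption).
    destruct (Hgood _ s He') as [Ne [Nt [Hd [_ _]]]].
    unfold ig, integrand, Cdiv. apply vhol_mult.
    + apply (wco_vhol lq Sd m0 m1 J b W (fun x : CCC => fst (fst x)) (fun _ => tau s)).
      * exact Ne.
      * apply Cmod_gt_0. lra.
      * intros k s' Hk Hs. destruct (Hb k s' _ Hk Hs He') as [d D]. eapply (vhol_comp (fun x : CCC => fst (fst x)) (b k s')); [apply vhol_eps | exact D].
      * intros j Hj. destruct (HWe j _ s Hj He') as [d D]. eapply (vhol_comp (fun x : CCC => fst (fst x)) (fun e => W j e (tau s))); [apply vhol_eps | exact D].
      * apply vhol_eps.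
      * apply vhol_const.
    + destruct (far_Theta lq dl HL Hdl _ (Hfar _ _ s He' Ht')) as [NT _].
      apply vhol_inv; [exact NT|].
      destruct (Theta_cd lq HL _ (proj1 (Hfar _ _ s He' Ht'))) as [d Hd'].
      eapply (vhol_comp (fun x : CCC => tau s * / (fst (fst x) * snd (fst x)))%C (Theta lq)); [|exact Hd'].
      apply vhol_mult; [apply vhol_const|]. apply vhol_inv; [exact Net|]. apply vhol_mult; [apply vhol_eps | apply vhol_t].
  - intros s x Hx. destruct (HB x Hx) as [He' [Ht' _]]. apply ig_ccont; assumption.
  - intros x Hx. destruct (HB x Hx) as [He' [Ht' [HtP _]]]. apply H; assumption.
  - intros x Hx. destruct (HB x Hx) as [He' [Ht' _]]. apply ig_impr; assumption.
Qed.

(* Stands for log q / pi_q, whose value plays no role. *)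
Variable kap : C.

Definition xcoef (e t : C) (n : nat) : C := (kap * xint n e t)%C.

Definition Xsol (e t z : C) : C := PS (xcoef e t) z.

Lemma xcoef_decay (P D : R) : 0 <= P -> 0 <= D -> exists K, 0 < K /\ forall (n : nat) (e t : C), Ue e -> Tt t -> ln (Cmod t) <= P ->
  D ^ n * Cmod (xcoef e t n) <= K * (/ 2) ^ n.
Proof.
  intros HP HD. destruct (xint_bound P HP) as [K [HK H]].
  destruct (decay_const lq Sd J M A1 Cst xi xib Kb d1 HAC HKb Hd1 D HD) as [K2 [HK2 H2]].
  assert (Pk := Cmod_ge_0 kap).
  exists ((Cmod kap + 1) * K * K2). split; [repeat apply Rmult_lt_0_compat; lra|].
  intros n e t He Ht HtP. unfold xcoef. rewrite Cmod_mult. specialize (H n e t He Ht HtP). specialize (H2 n).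
  fold L B1 in H2. fold (decay n) in H2.
  assert (PD : 0 <= D ^ n) by (apply pow_le, HD).
  apply Rle_trans with (D ^ n * ((Cmod kap + 1) * (K * decay n))).
  - apply Rmult_le_compat_l; [exact PD|]. apply Rmult_le_compat; try apply Cmod_ge_0; [lra | exact H].
  - replace (D ^ n * ((Cmod kap + 1) * (K * decay n))) with ((Cmod kap + 1) * K * (D ^ n * decay n)) by ring.
    replace ((Cmod kap + 1) * K * K2 * (/ 2) ^ n) with ((Cmod kap + 1) * K * (K2 * (/ 2) ^ n)) by ring.
    apply Rmult_le_compat_l; [apply Rmult_le_pos; lra | exact H2].
Qed.

Lemma xcoef_entire (e t : C) : Ue e -> Tt t -> entire (xcoef e t).
Proof.
  intros He Ht D HD. destruct (xcoef_decay (Rabs (ln (Cmod t))) D (Rabs_pos _) HD) as [K [HK H]].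
  exists K. split; [exact HK|]. intros n. apply H; auto. apply Rle_abs.
Qed.

Lemma Xsol_vhol (p : CCC) : Ue (fst (fst p)) -> Tt (snd (fst p)) ->
  @vhol CCC (fun x => Xsol (fst (fst x)) (snd (fst x)) (snd x)) p.
Proof.
  intros He Ht. destruct (sector_ball p He Ht) as [r [P [Hr [HP HB]]]].
  assert (HD : 0 <= Cmod (snd p) + 1) by (generalize (Cmod_ge_0 (snd p)); lra).
  destruct (xcoef_decay P (Cmod (snd p) + 1) HP HD) as [K [HK H]].
  apply (vhol_limit (V := CCC) (fun N x => psum (fun n => xcoef (fst (fst x)) (snd (fst x)) n * Cpow (snd x) n)%C N) _ p r (2 * K) Hr).
  - intros N x Hx. destruct (HB x Hx) as [He' [Ht' _]]. apply vhol_sum. intros n _.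
    apply vhol_mult; [apply vhol_scal, xint_vhol; assumption|]. apply vhol_pow, vhol_z.
  - intros N x Hx. destruct (HB x Hx) as [He' [Ht' [HtP Hz]]].
    replace (2 * K) with (K / (1 - / 2)) by field. apply psum_geom_le; [exact half_bounds | lra|]. intros n _.
    rewrite Cmod_mult, Cmod_pow. eapply Rle_trans; [|apply (H n _ _ He' Ht' HtP)]. rewrite Rmult_comm.
    apply Rmult_le_compat_r; [apply Cmod_ge_0|]. apply pow_incr. split; [apply Cmod_ge_0 | exact Hz].
  - intros x Hx. destruct (HB x Hx) as [He' [Ht' _]]. apply PS_cvg, xcoef_entire; assumption.
Qed.

Lemma dz_Xsol (k : nat) (e t z : C) : Ue e -> Tt t -> dz k Xsol e t z = PS (ncoefs k (xcoef e t)) z.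
Proof. intros He Ht. apply C_derive_n_PS; [apply xcoef_entire; assumption | reflexivity]. Qed.

Lemma Xsol_bounded (rho : R) : 0 < rho -> exists K, forall e t z, Ue e -> Tt t -> Cmod t <= 1 -> disc rho z ->
  Cmod (Xsol e t z) <= K.
Proof.
  intros Hrho. destruct (xcoef_decay 0 rho (Rle_refl 0) ltac:(lra)) as [K [HK H]].
  exists (2 * K). intros e t z He Ht Ht1 Hz. apply (PS_bound _ _ K rho); [lra | lra | left; exact Hz |].
  intros n. apply H; auto. rewrite <- ln_1. apply ln_le; [apply Cmod_gt_0, Tt_nz, Ht | exact Ht1].
Qed.

(** ** The equation and the initial conditions *)

Fixpoint tprod (m : nat) (t : C) : C :=
  match m with O => RtoC 1 | S p => (t * tprod p (q * t))%C end.

Lemma iter_t_sigma (m : nat) (Y : C -> C -> C -> C) (e t z : C) :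
  Nat.iter m (t_sigma q) Y e t z = (tprod m t * Y e (Cpow q m * t)%C z)%C.
Proof.
  revert t. induction m as [|m IH]; intros t.
  - simpl. rewrite !Cmult_1_l. reflexivity.
  - change (Nat.iter (S m) (t_sigma q) Y) with (t_sigma q (Nat.iter m (t_sigma q) Y)).
    unfold t_sigma at 1. rewrite IH. cbn [tprod Cpow].
    replace (Cpow q m * (q * t))%C with (q * Cpow q m * t)%C by ring. ring.
Qed.

Lemma Tt_qpow (m : nat) (t : C) : Tt t -> Tt (Cpow q m * t)%C.
Proof.
  intros Ht. induction m as [|m IH]; [simpl; rewrite Cmult_1_l; exact Ht|].
  cbn [Cpow]. replace (q * Cpow q m * t)%C with (q * (Cpow q m * t))%C by ring. apply Tt_q, IH.
Qed.

Lemma Theta_div_q (x : C) : x <> 0 -> Theta lq x = (x * Theta lq (x / q))%C.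
Proof.
  intros Hx. assert (Nq : q <> 0) by apply Cexp_neq_0.
  assert (Nx : (x / q)%C <> 0).
  { intros Z. apply Hx. replace x with (x / q * q)%C by (field; exact Nq). rewrite Z. ring. }
  assert (E := Theta_q lq HL (x / q)%C Nx). fold q in E.
  replace (q * (x / q))%C with x in E by (field; exact Nq). exact E.
Qed.

Lemma kernel_shift (e t : C) (s : R) : Ue e -> Tt t ->
  (e * t * / Theta lq (tau s / (e * (q * t))))%C = (tau s * / Theta lq (tau s / (e * t)))%C.
Proof.
  intros He Ht. assert (Nq : q <> 0) by apply Cexp_neq_0. assert (Ne := Ue_nz e He).
  assert (Ntau := tau_nz e s He).
  destruct (far_Theta lq dl HL Hdl _ (Hfar e (q * t)%C s He (Tt_q t Ht))) as [N1 _].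
  destruct (Hfar e t s He Ht) as [Nx _].
  rewrite (Theta_div_q _ Nx). replace (tau s / (e * t) / q)%C with (tau s / (e * (q * t)))%C by (field; auto).
  field. repeat split; auto.
Qed.

Lemma kernel_shift_n (m : nat) (e t : C) (s : R) : Ue e -> Tt t ->
  (tprod m t * / Theta lq (tau s / (e * (Cpow q m * t))))%C = (Cpow (tau s / e) m * / Theta lq (tau s / (e * t)))%C.
Proof.
  intros He. revert t. induction m as [|m IH]; intros t Ht.
  - simpl. rewrite !Cmult_1_l. reflexivity.
  - cbn [tprod Cpow]. replace (e * (q * Cpow q m * t))%C with (e * (Cpow q m * (q * t)))%C by ring.
    rewrite <- Cmult_assoc, (IH _ (Tt_q t Ht)).
    assert (Ne := Ue_nz e He). assert (K := kernel_shift e t s He Ht).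
    replace (t * (Cpow (tau s / e) m * / Theta lq (tau s / (e * (q * t)))))%C with
      (Cpow (tau s / e) m * / e * (e * t * / Theta lq (tau s / (e * (q * t)))))%C.
    + rewrite K. unfold Cdiv. ring.
    + set (X := (/ Theta lq (tau s / (e * (q * t))))%C). set (Y := Cpow (tau s / e) m). field. exact Ne.
Qed.

Lemma impr_lhs (n : nat) (e t : C) : Ue e -> Tt t ->
  impr (fun s => (tau s + 1) * ig n e t s)%C (e * t * xint n e (q * t) + xint n e t).
Proof.
  intros He Ht.
  apply (impr_ext (fun s => e * t * ig n e (q * t)%C s + ig n e t s)%C).
  - intros s. unfold ig, integrand, Cdiv. fold (tau s / (e * t))%C. fold (tau s / (e * (q * t)))%C.
    assert (K := kernel_shift e t s He Ht). set (w := wco _ _ _ _ _ _ _ _ _ _) in *.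
    replace (e * t * (w * / Theta lq (tau s / (e * (q * t)))))%C with (w * (e * t * / Theta lq (tau s / (e * (q * t)))))%C by ring.
    rewrite K. ring.
  - apply impr_plus; [apply impr_scal|]; apply ig_impr; auto.
Qed.

Lemma impr_rhs (m n : nat) (e t : C) : Ue e -> Tt t ->
  impr (fun s => Cpow (tau s / e) m * ig n e t s)%C (tprod m t * xint n e (Cpow q m * t)%C).
Proof.
  intros He Ht.
  apply (impr_ext (fun s => tprod m t * ig n e (Cpow q m * t)%C s)%C).
  - intros s. unfold ig, integrand, Cdiv. fold (tau s / (e * t))%C. fold (tau s / (e * (Cpow q m * t)))%C. fold (tau s / e)%C.
    assert (K := kernel_shift_n m e t s He Ht). set (w := wco _ _ _ _ _ _ _ _ _ _) in *.
    replace (tprod m t * (w * / Theta lq (tau s / (e * (Cpow q m * t)))))%C with (w * (tprod m t * / Theta lq (tau s / (e * (Cpow q m * t)))))%C by ring.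
    rewrite K. ring.
  - apply impr_scal, ig_impr; [exact He | apply Tt_qpow, Ht].
Qed.

(** The Laplace integral of [wterm]: multiplication by (tau/eps)^(m0 k) has become (t sigma_q)^(m0
    k). *)
Definition eqterm (e t : C) (h k s : nat) : C :=
  if (s <=? h)%nat then
    (b k s e * / Cpow q (m1 k * (h - s)) * RtoC (INR (fact (h - s + k)) / INR (fact (h - s))) *
     (tprod (m0 k) t * xint (h - s + k) e (Cpow q (m0 k) * t)%C))%C
  else 0.

(** The recursion [wco_rec] multiplied by the kernel and integrated. It concerns a single power of
    z, so series and integrals are never interchanged. *)
Lemma coefficient_equation (h : nat) (e t : C) : Ue e -> Tt t ->
  (RtoC (INR (fact (h + Sd)) / INR (fact h)) * (e * t * xint (h + Sd) e (q * t) + xint (h + Sd) e t))%C =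
  Csum (seq 0 Sd) (fun k => Csum (J k) (fun s => eqterm e t h k s)).
Proof.
  intros He Ht.
  assert (A := impr_scal (RtoC (INR (fact (h + Sd)) / INR (fact h))) _ _ (impr_lhs (h + Sd) e t He Ht)).
  refine (impr_unique _ _ _ A _).
  apply (impr_ext (fun s => Csum (seq 0 Sd) (fun k => Csum (J k) (fun s' =>
     wterm lq m0 m1 b h k s' e (tau s) (ig (h - s' + k) e t s))))).
  - intros s. destruct (Hgood e s He) as [_ [_ [Hd _]]].
    assert (N1 : (tau s + 1)%C <> 0) by (apply Cmod_gt_0; lra).
    assert (R := wco_rec lq Sd m0 m1 J b W h e (tau s) N1).
    unfold ig at 2. unfold integrand, Cdiv. fold (tau s / (e * t))%C.
    set (T := (/ Theta lq (tau s / (e * t)))%C).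
    transitivity (T * (RtoC (INR (fact (h + Sd)) / INR (fact h)) * ((tau s + 1) * wco lq Sd m0 m1 J b W (h + Sd) e (tau s))))%C.
    + rewrite R, <- Csum_scal. apply Csum_ext. intros k _. rewrite <- Csum_scal. apply Csum_ext. intros s' _.
      unfold wterm, ig, integrand, Cdiv. fold (tau s / (e * t))%C. fold T. destruct (s' <=? h)%nat; ring.
    + unfold Rdiv. ring.
  - apply (impr_sum (fun k s => Csum (J k) (fun s' => wterm lq m0 m1 b h k s' e (tau s) (ig (h - s' + k) e t s)))).
    intros k _. apply (impr_sum (fun s' s => wterm lq m0 m1 b h k s' e (tau s) (ig (h - s' + k) e t s))).
    intros s' _. unfold eqterm, wterm. destruct (s' <=? h)%nat; [|apply impr_zero].
    eapply impr_ext; [|apply impr_scal, (impr_rhs (m0 k) (h - s' + k) e t He Ht)].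
    intros s. unfold Cdiv. fold q. ring.
Qed.

(** Multiplication by z^s delays a power series by s terms; the partial sums agree after the same
    delay. *)
Lemma psum_delay (s N : nat) (u : nat -> C) :
  psum (fun h => if (s <=? h)%nat then u (h - s)%nat else 0) (N + s) = psum u N.
Proof.
  rewrite Nat.add_comm, psum_split.
  rewrite (psum_ext (fun h => if (s <=? h)%nat then u (h - s)%nat else 0) (fun _ => 0 * 0)%C s), psum_scal, Cmult_0_l, Cplus_0_l.
  - apply psum_ext. intros n _. replace (s <=? s + n)%nat with true by (symmetry; apply Nat.leb_le; lia). f_equal. lia.
  - intros n Hn. replace (s <=? n)%nat with false by (symmetry; apply Nat.leb_gt; lia). ring.
Qed.

Lemma cvg_Csum {A} (l : list A) (u : A -> nat -> C) (v : A -> C) : (forall a, In a l -> cvg (u a) (v a)) ->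
  cvg (fun n => Csum l (fun a => u a n)) (Csum l v).
Proof.
  induction l as [|a l IH]; intros H; [exact (cvg_const (RtoC 0))|].
  apply (cvg_plus (u a) (fun n => Csum l (fun a => u a n))); [apply H; left; reflexivity | apply IH; intros; apply H; right; assumption].
Qed.

Lemma psum_Csum {A} (l : list A) (u : A -> nat -> C) (N : nat) : psum (fun n => Csum l (fun a => u a n)) N = Csum l (fun a => psum (u a) N).
Proof.
  induction l as [|a l IH].
  - transitivity (psum (fun _ => 0 * 0)%C N); [apply psum_ext; intros; unfold Csum; simpl; ring|]. rewrite psum_scal. unfold Csum; simpl; ring.
  - change (psum (fun n => u a n + Csum l (fun a => u a n))%C N = (psum (u a) N + Csum l (fun a => psum (u a) N))%C).
    rewrite psum_plus, IH. reflexivity.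
Qed.

Lemma solves_E (e t z : C) : Ue e -> Tt t -> equation_E q Sd m0 m1 J b Xsol e t z.
Proof.
  intros He Ht. unfold equation_E. rewrite !dz_Xsol by auto.
  assert (En : forall k t, Tt t -> entire (ncoefs k (xcoef e t))) by (intros; apply entire_ncoefs, xcoef_entire; assumption).
  (* Both sides of (E) are shown to be the limit of the partial sums of this one series: the left
     side by [coefficient_equation], the right side by regrouping the finite sums. *)
  set (c := fun h => (kap * Cpow z h * Csum (seq 0 Sd) (fun k => Csum (J k) (fun s => eqterm e t h k s)))%C).
  apply (cvg_unique (psum c)).
  - assert (C1 := PS_cvg _ z (En Sd _ (Tt_q t Ht))). assert (C2 := PS_cvg _ z (En Sd t Ht)).
    eapply cvg_ext; [|apply (cvg_plus _ _ _ _ (cvg_scal (e * t) _ _ C1) C2)].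
    intros N. cbv beta. rewrite <- psum_scal, <- psum_plus. apply psum_ext. intros h _.
    unfold c. rewrite <- (coefficient_equation h e t He Ht), !ncoefs_eq. unfold xcoef. ring.
  - apply (cvg_ext (fun N => Csum (seq 0 Sd) (fun k => Csum (J k) (fun s => psum (fun h => kap * Cpow z h * eqterm e t h k s)%C N)))).
    { intros N. transitivity (psum (fun h => Csum (seq 0 Sd) (fun k => Csum (J k) (fun s => kap * Cpow z h * eqterm e t h k s)%C)) N).
      - rewrite (psum_Csum (seq 0 Sd) (fun k h => Csum (J k) (fun s => kap * Cpow z h * eqterm e t h k s)%C)). apply Csum_ext. intros k _.
        rewrite (psum_Csum (J k) (fun s h => kap * Cpow z h * eqterm e t h k s)%C). reflexivity.
      - apply psum_ext. intros h _. unfold c. rewrite <- Csum_scal. apply Csum_ext. intros k _. rewrite <- Csum_scal. reflexivity. }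
    apply (cvg_Csum (seq 0 Sd) (fun k N => Csum (J k) (fun s => psum (fun h => kap * Cpow z h * eqterm e t h k s)%C N))).
    intros k Hk. apply in_seq in Hk. rewrite iter_t_sigma. unfold b_poly.
    rewrite (dz_Xsol k e (Cpow q (m0 k) * t)%C) by (auto using Tt_qpow).
    rewrite Cmult_comm, <- Csum_scal.
    apply (cvg_Csum (J k) (fun s N => psum (fun h => kap * Cpow z h * eqterm e t h k s)%C N)).
    (* Each pair (k, s) has its own delay s. Convergence is insensitive to it, so it is removed pair
       by pair. *)
    intros s Hs. apply (cvg_shift_inv _ _ s).
    assert (C3 := PS_cvg _ (z / Cpow q (m1 k))%C (En k _ (Tt_qpow (m0 k) t Ht))).
    set (PSv := PS (ncoefs k (xcoef e (Cpow q (m0 k) * t)%C)) (z / Cpow q (m1 k))%C) in *.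
    replace (tprod (m0 k) t * PSv * (b k s e * Cpow z s))%C with ((tprod (m0 k) t * b k s e * Cpow z s) * PSv)%C by ring.
    eapply cvg_ext; [|apply (cvg_scal (tprod (m0 k) t * b k s e * Cpow z s)%C _ _ C3)].
    intros N. cbv beta. rewrite <- psum_scal, <- (psum_delay s N). apply psum_ext. intros h _.
    unfold eqterm. destruct (Nat.leb_spec s h) as [Hsh|Hsh]; [|ring].
    rewrite ncoefs_eq. unfold xcoef.
    assert (Nq : q <> 0) by apply Cexp_neq_0.
    replace (Cpow z h) with (Cpow z s * Cpow z (h - s))%C by (rewrite <- Cpow_add_r; f_equal; lia).
    replace (Cpow (z / Cpow q (m1 k)) (h - s))%C with (Cpow z (h - s) * / Cpow q (m1 k * (h - s)))%C.
    + ring.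
    + unfold Cdiv. rewrite Cpow_mult_l, Cpow_mult_r, Cpow_inv by (apply Cpow_nz, Nq). reflexivity.
Qed.

Lemma solves_IC (e t : C) (phi : nat -> C -> C -> C) : Ue e -> Tt t ->
  (forall j, (j < Sd)%nat -> phi j e t = (kap * @RInt_gen C_R_CompleteNormedModule (fun s => W j e (qpow lq s * lam) / Theta lq (qpow lq s * lam / (e * t)))%C
     (Rbar_locally m_infty) (Rbar_locally p_infty))%C) ->
  condition_IC Sd phi Xsol e t.
Proof.
  intros He Ht Hphi j Hj. rewrite dz_Xsol, PS_zero by (try apply entire_ncoefs, xcoef_entire; assumption).
  rewrite ncoefs_eq, Hphi by exact Hj. unfold xcoef. rewrite Nat.add_0_l.
  rewrite (impr_RInt_gen _ (RtoC (INR (fact j)) * xint j e t)%C).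
  - simpl (fact 0). simpl (INR 1). unfold Rdiv. rewrite Rinv_1, Rmult_1_r. ring.
  - eapply impr_ext; [|apply impr_scal, (ig_impr j e t He Ht)].
    intros s. cbv beta. unfold ig, integrand. fold (tau s). rewrite <- (wco_init lq Sd m0 m1 J b W j e (tau s) Hj). unfold Cdiv. ring.
Qed.
End Sector.

(** * Difference of two solutions *)

Lemma Cmod_1_minus_Cexp_Ci (a : R) : Cmod (1 - Cexp (RtoC a * Ci))%C ^ 2 = 2 - 2 * cos a.
Proof.
  rewrite Cmod2_alt. unfold Cexp, Re, Im, Cminus, Cplus, Copp, Cmult, RtoC, Ci. simpl.
  replace (a * 0 - 0 * 1) with 0 by ring. replace (a * 1 + 0 * 0) with a by ring. rewrite exp_0.
  assert (H := sin2_cos2 a). unfold Rsqr in H. nra.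
Qed.

(** |1 - exp(ia)|^2 = 2 - 2 cos a increases on [0, pi] and decreases on [pi, 2 pi], so on a
    subinterval its minimum is at an end. *)
Lemma arc_min (a1 a2 a d : R) : 0 <= a1 -> a1 <= a <= a2 -> a2 <= 2 * PI -> 0 <= d ->
  d <= Cmod (1 - Cexp (RtoC a1 * Ci))%C -> d <= Cmod (1 - Cexp (RtoC a2 * Ci))%C ->
  d <= Cmod (1 - Cexp (RtoC a * Ci))%C.
Proof.
  intros H1 Ha H2 Hd D1 D2.
  assert (Hc : cos a <= cos a1 \/ cos a <= cos a2).
  { destruct (Rle_lt_dec a PI) as [L|L].
    - left. apply cos_decr_1; lra.
    - right. apply cos_incr_1; lra. }
  assert (N := Cmod_ge_0 (1 - Cexp (RtoC a * Ci))%C).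
  assert (E := Cmod_1_minus_Cexp_Ci a). assert (E1 := Cmod_1_minus_Cexp_Ci a1). assert (E2 := Cmod_1_minus_Cexp_Ci a2).
  assert (Q1 := pow_incr _ _ 2 (conj Hd D1)). assert (Q2 := pow_incr _ _ 2 (conj Hd D2)).
  apply Rnot_lt_le. intros Hlt. assert (Cmod (1 - Cexp (RtoC a * Ci))%C ^ 2 < d ^ 2) by nra.
  destruct Hc; lra.
Qed.

Section Far.
Variable lq : C.
Hypothesis HL : 0 < fst lq.

(** Distance from 1 at the one point r = 0 of the spiral controls the whole spiral: for small |r| by
    continuity of [Cexp], for larger |r| because the modulus differs from 1. The constant d2 depends
    on d and q only. *)
Lemma spiral_far (d : R) : 0 < d -> exists d2, 0 < d2 /\ d2 <= d /\ forall a, d <= Cmod (1 - Cexp (RtoC a * Ci))%C ->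
  forall r, d2 <= Cmod (1 - Cexp (RtoC r * lq + RtoC a * Ci))%C.
Proof.
  intros Hd. destruct (cd_continuous _ _ _ (cd_Cexp 0) (d / 2) ltac:(lra)) as [r0 [Hr0 Q]].
  assert (Nl : 0 < Cmod lq) by (assert (T := Re_le_Cmod lq); assert (T2 := Rle_abs (fst lq)); lra).
  set (r1 := r0 / (2 * Cmod lq)). assert (Hr1 : 0 < r1) by (apply Rdiv_lt_0_compat; lra).
  assert (E1 : 0 < exp (r1 * fst lq) - 1).
  { assert (T := exp_ineq1 (r1 * fst lq)). assert (0 < r1 * fst lq) by (apply Rmult_lt_0_compat; assumption).
    assert (1 + r1 * fst lq < exp (r1 * fst lq)) by (apply exp_ineq1; lra). lra. }
  assert (E2 : 0 < 1 - exp (- (r1 * fst lq))).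
  { assert (exp (- (r1 * fst lq)) < exp 0); [|rewrite exp_0 in *; lra]. apply exp_increasing.
    assert (0 < r1 * fst lq) by (apply Rmult_lt_0_compat; assumption). lra. }
  exists (Rmin (d / 2) (Rmin (exp (r1 * fst lq) - 1) (1 - exp (- (r1 * fst lq))))).
  assert (M1 := Rmin_l (d / 2) (Rmin (exp (r1 * fst lq) - 1) (1 - exp (- (r1 * fst lq))))).
  assert (M2 := Rmin_r (d / 2) (Rmin (exp (r1 * fst lq) - 1) (1 - exp (- (r1 * fst lq))))).
  assert (M3 := Rmin_l (exp (r1 * fst lq) - 1) (1 - exp (- (r1 * fst lq)))).
  assert (M4 := Rmin_r (exp (r1 * fst lq) - 1) (1 - exp (- (r1 * fst lq)))).
  split; [repeat apply Rmin_pos; lra|]. split; [lra|]. intros a Ha r.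
  assert (U : Cmod (Cexp (RtoC a * Ci)) = 1).
  { rewrite Cmod_Cexp. simpl. replace (a * 0 - 0 * 1) with 0 by ring. apply exp_0. }
  assert (Mo : Cmod (Cexp (RtoC r * lq + RtoC a * Ci)) = exp (r * fst lq)).
  { rewrite Cmod_Cexp. f_equal. simpl. ring. }
  destruct (Rle_lt_dec (Rabs r) r1) as [H|H].
  - rewrite Cexp_plus.
    assert (B : Cmod (Cexp (RtoC r * lq) - 1)%C <= d / 2).
    { specialize (Q (RtoC r * lq)%C). rewrite Cexp_0, Cplus_0_l in Q. apply Q.
      rewrite Cmod_mult, Cmod_R. apply Rle_lt_trans with (r1 * Cmod lq); [apply Rmult_le_compat_r; lra|].
      unfold r1. replace (r0 / (2 * Cmod lq) * Cmod lq) with (r0 / 2) by (field; lra). lra. }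
    replace (1 - Cexp (RtoC r * lq) * Cexp (RtoC a * Ci))%C with
      ((1 - Cexp (RtoC a * Ci)) - (Cexp (RtoC r * lq) - 1) * Cexp (RtoC a * Ci))%C by ring.
    assert (T := Cmod_triangle_rev (1 - Cexp (RtoC a * Ci)) ((Cexp (RtoC r * lq) - 1) * Cexp (RtoC a * Ci))).
    rewrite (Cmod_mult (Cexp (RtoC r * lq) - 1)), U in T. lra.
  - unfold Rabs in H. destruct (Rcase_abs r) as [Hr|Hr].
    + assert (T := Cmod_triangle_rev 1 (Cexp (RtoC r * lq + RtoC a * Ci))). rewrite Cmod_1, Mo in T.
      assert (exp (r * fst lq) <= exp (- (r1 * fst lq))); [|lra]. apply exp_le. nra.
    + assert (T := Cmod_triangle_rev (Cexp (RtoC r * lq + RtoC a * Ci)) 1). rewrite Cmod_1, Mo, Cmod_minus_sym in T.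
      assert (exp (r1 * fst lq) <= exp (r * fst lq)); [|lra]. apply exp_le. nra.
Qed.

(** The point -y q^s exp(ia). The value a = 0 gives the pole spiral of 1/Theta(tau/y). *)
Definition spt (y : C) (s a : R) : C := (- y * Cexp (RtoC s * lq + RtoC a * Ci))%C.

Lemma Cmod_spt (y : C) (s a : R) : Cmod (spt y s a) = Cmod y * exp (s * fst lq).
Proof. unfold spt. rewrite Cmod_mult, Cmod_opp, Cmod_Cexp. do 2 f_equal. simpl. ring. Qed.

Lemma spt_nz (y : C) (s a : R) : y <> 0 -> spt y s a <> 0.
Proof. intros Hy. apply Cmod_gt_0. rewrite Cmod_spt. apply Rmult_lt_0_compat; [apply Cmod_gt_0, Hy | apply exp_pos]. Qed.

Lemma spt_far (y : C) (d : R) (s a : R) : y <> 0 ->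
  (forall r, d <= Cmod (1 - Cexp (RtoC r * lq + RtoC a * Ci))%C) -> far_pt lq d (spt y s a / y)%C.
Proof.
  intros Hy H. split.
  - intros Z. apply (spt_nz y s a Hy). replace (spt y s a) with (spt y s a / y * y)%C by (field; exact Hy). rewrite Z. ring.
  - intros n. specialize (H (s + IZR n)).
    replace (1 + spt y s a / y * qpow lq (IZR n))%C with (1 - Cexp (RtoC (s + IZR n) * lq + RtoC a * Ci))%C; [exact H|].
    unfold spt, qpow. rewrite RtoC_plus.
    replace ((RtoC s + RtoC (IZR n)) * lq + RtoC a * Ci)%C with ((RtoC s * lq + RtoC a * Ci) + RtoC (IZR n) * lq)%C by ring.
    rewrite (Cexp_plus (RtoC s * lq + RtoC a * Ci)). field. exact Hy.
Qed.

(* Polar coordinates adapted to q: every direction avoiding the pole spiral -y q^R is a point of the open arc. *)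
Lemma spt_coordinates (lam y : C) (d : R) : lam <> 0 -> y <> 0 -> 0 < d ->
  (forall r, d <= Cmod (1 + lam / y * qpow lq r)%C) ->
  exists s1 a, 0 < a < 2 * PI /\ d <= Cmod (1 - Cexp (RtoC a * Ci))%C /\ forall s, (qpow lq s * lam)%C = spt y (s + s1) a.
Proof.
  intros Hl Hy Hd H. assert (Nly : (lam / y)%C <> 0).
  { intros Z. apply Hl. replace lam with (lam / y * y)%C by (field; exact Hy). rewrite Z. ring. }
  assert (P := proj1 (Cmod_gt_0 _) Nly).
  (* The shift s1 brings -lam/y along its spiral to a point v of the unit circle, whose argument is
     a. The argument is not 0, as v would then be 1, against the lower bound d. *)
  set (s1 := ln (Cmod (lam / y)%C) / fst lq). set (v := (- (lam / y) * qpow lq (- s1))%C).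
  assert (Nv : v <> 0).
  { apply Cmod_gt_0. unfold v. rewrite Cmod_mult, Cmod_opp, Cmod_qpow. apply Rmult_lt_0_compat; [exact P | apply exp_pos]. }
  assert (Mv : Cmod v = 1).
  { unfold v. rewrite Cmod_mult, Cmod_opp, Cmod_qpow. rewrite <- (exp_ln _ P) at 1. rewrite <- exp_plus.
    replace (ln (Cmod (lam / y)%C) + - s1 * fst lq) with 0 by (unfold s1; field; lra). apply exp_0. }
  destruct (Clog_exists v Nv) as [[w1 a] [Ew [E1 E2]]]. simpl in E1, E2. rewrite Mv, ln_1 in E1. subst w1.
  assert (Ew' : Cexp (RtoC a * Ci) = v).
  { rewrite <- Ew. f_equal. unfold Cmult, RtoC, Ci. simpl. f_equal; ring. }
  assert (D : d <= Cmod (1 - Cexp (RtoC a * Ci))%C).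
  { rewrite Ew'. unfold v. replace (1 - - (lam / y) * qpow lq (- s1))%C with (1 + lam / y * qpow lq (- s1))%C by ring. apply H. }
  exists s1, a. split; [|split; [exact D|]].
  - split; [|apply E2]. destruct (Rle_lt_or_eq_dec 0 a (proj1 E2)) as [L|L]; [exact L|]. exfalso. subst a.
    replace (RtoC 0 * Ci)%C with (RtoC 0) in D by ring. rewrite Cexp_0 in D. replace (1 - 1)%C with (RtoC 0) in D by ring. rewrite Cmod_0 in D. lra.
  - intros s. unfold spt. rewrite Cexp_plus, Ew'. unfold v. change (Cexp (RtoC (s + s1) * lq)) with (qpow lq (s + s1)).
    rewrite qpow_opp, qpow_plus. assert (N := qpow_neq_0 lq s1). field. auto.
Qed.
End Far.

Section Difference.
Variables (lq : C) (Sd : nat) (m0 m1 : nat -> nat) (J : nat -> list nat) (b : nat -> nat -> C -> C).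
Variables (M A1 Cst xi xib Kb K1 d1 dl : R).
Let L := fst lq.
Hypotheses (HL : 0 < fst lq) (HM : 0 < M) (HCst : 0 < Cst) (HA1 : 0 < A1) (Hxi : 0 < xi < 1) (Hxib : 0 < xib < 1).
Hypotheses (Hc' : 0 < xi / (2 * fst lq) - M) (HAC : Cst ^ 2 / (4 * xib * (xi / (2 * fst lq) - M)) < A1 * fst lq).
Hypotheses (HKb : 0 <= Kb) (HK1 : 0 <= K1) (Hd1 : 0 < d1) (Hdl : 0 < dl).
Hypothesis HasA : assumption_A Sd J m0 m1 Cst A1.

Let B1 := ratio lq Sd J A1 Kb d1.
Let decay n := B1 ^ n * exp (- (rate L M A1 Cst xi xib / 2 * INR n ^ 2)).
Let flat e := exp (- ((1 - xib) * (xi / (2 * L) - M) * ln (Cmod e) ^ 2)).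
Let ig W n e t tau := integrand lq Sd m0 m1 J b W n e t tau.
Let gp W e tau := good_pt Sd J b M Kb K1 d1 W e tau.

Lemma ig_cd (W : nat -> C -> C -> C) (d2 : R) (n : nat) (e t tau : C) : 0 < d2 -> gp W e tau -> t <> 0 -> far_pt lq d2 (tau / (e * t))%C ->
  (forall j, (j < Sd)%nat -> exists d, cd (W j e) tau d) -> exists d, cd (ig W n e t) tau d.
Proof.
  intros Hd2 Hg Ht Hf HW. destruct Hg as [Ne [Nt [Hd [_ _]]]].
  apply vhol_cd. unfold ig, integrand, Cdiv. apply vhol_mult.
  - apply (wco_vhol lq Sd m0 m1 J b W (fun _ => e) (fun x => x)).
    + exact Ne.
    + apply Cmod_gt_0. lra.
    + intros k s' Hk Hs. apply vhol_const.
    + intros j Hj. apply vhol_cd, HW, Hj.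
    + apply vhol_const.
    + apply vhol_cd. eexists. apply cd_id.
  - destruct (far_Theta lq d2 HL Hd2 _ Hf) as [NT _]. apply vhol_inv; [exact NT|].
    destruct (Theta_cd lq HL _ (proj1 Hf)) as [d Hd'].
    eapply (vhol_comp (fun x : C_NormedModule => (x * / (e * t))%C) (Theta lq)); [|exact Hd'].
    apply vhol_mult; [apply vhol_cd; eexists; apply cd_id | apply vhol_const].
Qed.

Lemma ig_eq (W W' : nat -> C -> C -> C) (n : nat) (e t tau : C) :
  (forall j, (j < Sd)%nat -> W j e tau = W' j e tau) -> ig W n e t tau = ig W' n e t tau.
Proof. intros H. unfold ig, integrand. f_equal. apply wco_ext, H. Qed.

(** Goursat's lemma in the coordinates (s, a): the difference of the two spiral integrals, times lq,
    equals that of the two arc integrals, times i up to sign. Dividing uses |lq| >= L. *)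
Lemma box_closed_bound (g : C -> C) (s a w h B0' B1' : R) : 0 <= w -> 0 <= h -> holo_box g 0 lq Ci s a w h ->
  (forall y, a <= y <= a + h -> Cmod (g (0 + RtoC (s + w) * lq + RtoC y * Ci)%C) <= B0') ->
  (forall y, a <= y <= a + h -> Cmod (g (0 + RtoC s * lq + RtoC y * Ci)%C) <= B1') ->
  Cmod (cint (fun x => g (0 + RtoC a * Ci + RtoC x * lq)%C) s (s + w) -
        cint (fun x => g (0 + RtoC (a + h) * Ci + RtoC x * lq)%C) s (s + w))%C <= (B0' + B1') * h / fst lq.
Proof.
  intros Hw Hh Hg H0 H1. assert (G := goursat g 0 lq Ci s a w h Hw Hh Hg). unfold box_int in G.
  set (X := (cint (fun x => g (0 + RtoC a * Ci + RtoC x * lq)%C) s (s + w) -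
        cint (fun x => g (0 + RtoC (a + h) * Ci + RtoC x * lq)%C) s (s + w))%C) in *.
  set (Y0 := cint (fun y => g (0 + RtoC (s + w) * lq + RtoC y * Ci)%C) a (a + h)) in *.
  set (Y1 := cint (fun y => g (0 + RtoC s * lq + RtoC y * Ci)%C) a (a + h)) in *.
  assert (P0 : Cmod Y0 <= B0' * (a + h - a)).
  { apply cint_bound; [lra| |exact H0]. intros y Hy. apply (holo_box_cont_v g 0 lq Ci s a w h y (s + w) Hg). split; lra. }
  assert (P1 : Cmod Y1 <= B1' * (a + h - a)).
  { apply cint_bound; [lra| |exact H1]. intros y Hy. apply (holo_box_cont_v g 0 lq Ci s a w h y s Hg). split; lra. }
  assert (E : (lq * X)%C = (Ci * (Y1 - Y0))%C).
  { replace (lq * X)%C with (lq * X + Ci * (Y0 - Y1) - Ci * (Y0 - Y1))%C by ring. rewrite G. ring. }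
  apply (f_equal Cmod) in E. rewrite !Cmod_mult, Cmod_Ci, Rmult_1_l in E.
  assert (T := Cmod_minus_le Y1 Y0). assert (Nl := Re_le_Cmod lq). assert (Nl2 := Rle_abs (fst lq)).
  apply Rle_div_r; [exact HL|]. assert (PX := Cmod_ge_0 X). nra.
Qed.

(** K is chosen before n, e and t, so that the estimate can afterwards be summed against z^n. *)
Lemma integral_difference (W W' : nat -> C -> C -> C) : exists K, 0 < K /\ forall (n : nat) (e t lam lam' I1 I2 : C),
  t <> 0 -> Cmod t <= 1 -> Cmod e <= 1 / 2 -> lam <> 0 -> lam' <> 0 ->
  (forall s, gp W e (qpow lq s * lam)%C) -> (forall s, gp W' e (qpow lq s * lam')%C) ->
  (forall r, dl <= Cmod (1 + lam / (e * t) * qpow lq r)%C) -> (forall r, dl <= Cmod (1 + lam' / (e * t) * qpow lq r)%C) ->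
  (forall tau : C, tau <> 0 -> Cmod tau <= 1 / 2 -> gp W e tau /\
     forall j, (j < Sd)%nat -> W j e tau = W' j e tau /\ exists d, cd (W j e) tau d) ->
  impr (fun s => ig W n e t (qpow lq s * lam)%C) I1 -> impr (fun s => ig W' n e t (qpow lq s * lam')%C) I2 ->
  Cmod (I1 - I2)%C <= K * flat e * decay n.
Proof.
  destruct (spiral_far lq HL dl Hdl) as [d2 [Hd2 [Hd2l Far]]].
  destruct (integrand_tail lq Sd m0 m1 J b M A1 Cst xi xib Kb K1 d1 d2 W HL HCst HA1 Hxi Hxib Hc' HAC HKb HK1 Hd1 Hd2 HasA) as [Ka [HKa Ta]].
  destruct (integrand_tail lq Sd m0 m1 J b M A1 Cst xi xib Kb K1 d1 d2 W' HL HCst HA1 Hxi Hxib Hc' HAC HKb HK1 Hd1 Hd2 HasA) as [Kc [HKc Tc]].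
  destruct (integrand_bound lq Sd m0 m1 J b M A1 Cst xi xib Kb K1 d1 d2 W HL HM HCst HA1 Hxi Hxib Hc' HAC HKb HK1 Hd1 Hd2 HasA 0 (Rle_refl 0)) as [Kd [HKd Td]].
  assert (Hpi := PI_RGT_0).
  (* Two tails above the cut contribute pi/L each, and the arc in |tau| = 1/2 has angular length at
     most 2 pi. *)
  exists ((Ka * PI + Kc * PI + Ka * (2 * PI)) / L).
  split; [apply Rdiv_lt_0_compat; [|exact HL]; repeat apply Rplus_lt_0_compat; apply Rmult_lt_0_compat; lra|].
  intros n e t lam lam' I1 I2 Nt Ht He Nl Nl' G1 G2 F1 F2 Low Im1 Im2.
  assert (Ne : e <> 0) by apply (G1 0).
  assert (Ny : (e * t)%C <> 0) by (apply Cmult_neq_0; assumption).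
  set (y := (e * t)%C) in *.
  destruct (spt_coordinates lq HL lam y dl Nl Ny Hdl F1) as [s1 [a1 [Ha1 [D1 E1]]]].
  destruct (spt_coordinates lq HL lam' y dl Nl' Ny Hdl F2) as [s2 [a2 [Ha2 [D2 E2]]]].
  set (P1 := fun s => ig W n e t (spt lq y s a1)). set (P2 := fun s => ig W' n e t (spt lq y s a2)).
  assert (Hdec : 0 <= decay n).
  { unfold decay. apply Rmult_le_pos; [apply pow_le | left; apply exp_pos].
    assert (R := ratio_ge_1 lq Sd J A1 Kb d1 HKb Hd1). unfold B1. lra. }
  assert (Hfl : 0 < flat e) by apply exp_pos.
  assert (J1 : impr P1 I1).
  { apply (impr_ext (fun s => ig W n e t (qpow lq (s + - s1) * lam)%C)).
    - intros s. rewrite E1. unfold P1. do 2 f_equal. ring.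
    - apply (impr_shift (fun s => ig W n e t (qpow lq s * lam)%C) (- s1)), Im1. }
  assert (J2 : impr P2 I2).
  { apply (impr_ext (fun s => ig W' n e t (qpow lq (s + - s2) * lam')%C)).
    - intros s. rewrite E2. unfold P2. do 2 f_equal. ring.
    - apply (impr_shift (fun s => ig W' n e t (qpow lq s * lam')%C) (- s2)), Im2. }
  assert (Q1 : forall s, gp W e (spt lq y s a1)).
  { intros s. replace s with (s - s1 + s1) by ring. rewrite <- E1. apply G1. }
  assert (Q2 : forall s, gp W' e (spt lq y s a2)).
  { intros s. replace s with (s - s2 + s2) by ring. rewrite <- E2. apply G2. }
  assert (Py := proj1 (Cmod_gt_0 _) Ny).
  (* The parameter at which every spiral -y q^s exp(ia) crosses |tau| = 1/2. *)
  set (s0 := (ln (1 / 2) - ln (Cmod y)) / L).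
  assert (Hs0 : Cmod y * exp (s0 * fst lq) = 1 / 2).
  { rewrite <- (exp_ln _ Py) at 1. rewrite <- exp_plus. rewrite <- (exp_ln (1 / 2)) by lra. f_equal. unfold s0, L. field. lra. }
  assert (Up : forall s a, s0 <= s -> 1 / 2 <= Cmod (spt lq y s a)).
  { intros s a H. rewrite Cmod_spt, <- Hs0. apply Rmult_le_compat_l; [lra|]. apply exp_le. apply Rmult_le_compat_r; lra. }
  assert (Dn : forall s a, s <= s0 -> Cmod (spt lq y s a) <= 1 / 2).
  { intros s a H. rewrite Cmod_spt, <- Hs0. apply Rmult_le_compat_l; [lra|]. apply exp_le. apply Rmult_le_compat_r; lra. }
  assert (Lx : forall s a, ln (Cmod (spt lq y s a / e)%C) = L * s + ln (Cmod t)).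
  { intros s a. rewrite ln_Cmod_div by (auto using spt_nz). rewrite Cmod_spt, ln_mult, ln_exp by (try apply exp_pos; lra).
    unfold y. rewrite ln_Cmod_mult by assumption. unfold L. ring. }
  assert (Lu : forall s a, ln (Cmod (spt lq y s a / y)%C) = L * s).
  { intros s a. rewrite ln_Cmod_div by (auto using spt_nz). rewrite Cmod_spt, ln_mult, ln_exp by (try apply exp_pos; lra). unfold L. ring. }
  assert (Lt : ln (Cmod t) <= 0) by (rewrite <- ln_1; apply ln_le; [apply Cmod_gt_0, Nt | exact Ht]).
  assert (T1 : forall N, 0 <= N -> Cmod (cint P1 s0 (s0 + N)) <= Ka * PI / L * flat e * decay n).
  { intros N HN. eapply Rle_trans.
    - apply (adom_cint_atan (Ka * flat e * decay n) L (ln (Cmod t))); [exact HL | lra | intros; apply J1 |].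
      intros s Hs. rewrite <- (Lx s a1). apply Ta; [apply Q1 | exact Nt | exact Ht | exact He | apply Up; lra |]. apply spt_far; [exact Ny | apply Far, D1].
    - assert (A := atan_bound (L * (s0 + N) + ln (Cmod t))). assert (B := atan_bound (L * s0 + ln (Cmod t))).
      replace (Ka * PI / L * flat e * decay n) with (Ka * flat e * decay n / L * PI) by (field; unfold L; lra).
      apply Rmult_le_compat_l; [|lra]. apply Rmult_le_pos; [|left; apply Rinv_0_lt_compat; exact HL].
      apply Rmult_le_pos; [apply Rmult_le_pos; lra | exact Hdec]. }
  assert (T2 : forall N, 0 <= N -> Cmod (cint P2 s0 (s0 + N)) <= Kc * PI / L * flat e * decay n).
  { intros N HN. eapply Rle_trans.
    - apply (adom_cint_atan (Kc * flat e * decay n) L (ln (Cmod t))); [exact HL | lra | intros; apply J2 |].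
      intros s Hs. rewrite <- (Lx s a2). apply Tc; [apply Q2 | exact Nt | exact Ht | exact He | apply Up; lra |]. apply spt_far; [exact Ny | apply Far, D2].
    - assert (A := atan_bound (L * (s0 + N) + ln (Cmod t))). assert (B := atan_bound (L * s0 + ln (Cmod t))).
      replace (Kc * PI / L * flat e * decay n) with (Kc * flat e * decay n / L * PI) by (field; unfold L; lra).
      apply Rmult_le_compat_l; [|lra]. apply Rmult_le_pos; [|left; apply Rinv_0_lt_compat; exact HL].
      apply Rmult_le_pos; [apply Rmult_le_pos; lra | exact Hdec]. }
  (* Between the two angles [arc_min] and [spiral_far] keep the whole box away from the poles. The
     outer arc carries the flat factor by [Ta]; the inner one, at s0 - N, is estimated by [Td] and
     vanishes as N grows. *)
  assert (Box : forall alo ahi, 0 < alo <= ahi -> ahi < 2 * PI ->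
     dl <= Cmod (1 - Cexp (RtoC alo * Ci))%C -> dl <= Cmod (1 - Cexp (RtoC ahi * Ci))%C -> forall N, 0 <= N ->
     Cmod (cint (fun s => ig W n e t (spt lq y s alo)) (s0 - N) s0 - cint (fun s => ig W n e t (spt lq y s ahi)) (s0 - N) s0)%C <=
     (Ka * flat e * decay n + Kd * decay n / (1 + (L * (s0 - N)) ^ 2)) * (2 * PI) / L).
  { intros alo ahi Hlo Hhi Dlo Dhi N HN.
    assert (FarA : forall a s, alo <= a <= ahi -> far_pt lq d2 (spt lq y s a / y)%C).
    { intros a s Ha. apply spt_far; [exact Ny|]. apply Far. apply (arc_min alo ahi); lra. }
    set (g := fun w => ig W n e t (- y * Cexp w)%C).
    assert (Eg : forall s a, g (0 + RtoC s * lq + RtoC a * Ci)%C = ig W n e t (spt lq y s a)).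
    { intros s a. unfold g, spt. do 3 f_equal. ring. }
    assert (Hg : holo_box g 0 lq Ci (s0 - N) alo N (ahi - alo)).
    { intros s a [Hs Ha].
      assert (Hn := spt_nz lq y s a Ny).
      destruct (Low _ Hn (Dn s a ltac:(lra))) as [Gp Gj].
      destruct (ig_cd W d2 n e t (spt lq y s a) Hd2 Gp Nt (FarA a s ltac:(lra))) as [d Hd].
      { intros j Hj. apply (Gj j Hj). }
      eexists. unfold g. apply (cd_comp (fun w => - y * Cexp w)%C (ig W n e t)).
      - apply cd_scal, cd_Cexp.
      - replace (- y * Cexp (0 + RtoC s * lq + RtoC a * Ci))%C with (spt lq y s a) by (unfold spt; do 2 f_equal; ring). exact Hd. }
    assert (X := box_closed_bound g (s0 - N) alo N (ahi - alo) (Ka * flat e * decay n) (Kd * decay n / (1 + (L * (s0 - N)) ^ 2)) HN ltac:(lra) Hg).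
    replace (s0 - N + N) with s0 in X by ring. replace (alo + (ahi - alo)) with ahi in X by ring.
    rewrite (cint_ext (fun x => g (0 + RtoC alo * Ci + RtoC x * lq)%C) (fun s => ig W n e t (spt lq y s alo))) in X; [|lra|].
    2:{ intros s _. rewrite <- Eg. f_equal. ring. }
    rewrite (cint_ext (fun x => g (0 + RtoC ahi * Ci + RtoC x * lq)%C) (fun s => ig W n e t (spt lq y s ahi))) in X; [|lra|].
    2:{ intros s _. rewrite <- Eg. f_equal. ring. }
    assert (PosK : 0 <= Ka * flat e * decay n) by (apply Rmult_le_pos; [apply Rmult_le_pos; lra | exact Hdec]).
    assert (PosD : 0 <= Kd * decay n / (1 + (L * (s0 - N)) ^ 2)).
    { apply Rmult_le_pos; [apply Rmult_le_pos; lra|]. left. apply Rinv_0_lt_compat. assert (Z := pow2_ge_0 (L * (s0 - N))). lra. }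
    eapply Rle_trans; [apply X|].
    - intros a Ha. rewrite Eg. assert (Hn := spt_nz lq y s0 a Ny). destruct (Low _ Hn (Dn s0 a ltac:(lra))) as [Gp _].
      eapply Rle_trans; [apply Ta; [exact Gp | exact Nt | exact Ht | exact He | apply Up; lra | apply FarA; lra]|].
      assert (Z := pow2_ge_0 (ln (Cmod (spt lq y s0 a / e)%C))).
      apply Rle_div_l; [lra|]. rewrite <- (Rmult_1_r (_ * _ * _)) at 1. apply Rmult_le_compat_l; [exact PosK | lra].
    - intros a Ha. rewrite Eg. assert (Hn := spt_nz lq y (s0 - N) a Ny). destruct (Low _ Hn (Dn (s0 - N) a ltac:(lra))) as [Gp _].
      rewrite <- (Lu (s0 - N) a). apply Td; [exact Gp | exact Nt | exact Lt | apply FarA; lra].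
    - unfold Rdiv at 1. unfold Rdiv at 3. fold L. apply Rmult_le_compat_r; [left; apply Rinv_0_lt_compat; exact HL|].
      apply Rmult_le_compat_l; lra. }
  assert (Low12 : forall N, 0 <= N -> Cmod (cint P1 (s0 - N) s0 - cint P2 (s0 - N) s0)%C <=
     (Ka * flat e * decay n + Kd * decay n / (1 + (L * (s0 - N)) ^ 2)) * (2 * PI) / L).
  { intros N HN.
    (* Below the cut W' may be replaced by W, so one holomorphic function lives on the box whichever
       of a1 and a2 is larger. *)
    rewrite (cint_ext P2 (fun s => ig W n e t (spt lq y s a2))); [|lra|].
    2:{ intros s Hs. unfold P2. symmetry. apply ig_eq. intros j Hj. apply (Low _ (spt_nz lq y s a2 Ny) (Dn s a2 ltac:(lra))), Hj. }
    destruct (Rle_lt_dec a1 a2) as [H|H].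
    - apply Box; auto; lra.
    - rewrite Cmod_minus_sym. apply Box; auto; lra. }
  apply le_epsilon. intros eps Heps.
  destruct (proj2 J1 (eps / 3) ltac:(lra)) as [B2 HB2]. destruct (proj2 J2 (eps / 3) ltac:(lra)) as [B3 HB3].
  set (X := Kd * decay n * (2 * PI) / L).
  assert (HX : 0 <= X). { unfold X. apply Rmult_le_pos; [|left; apply Rinv_0_lt_compat; exact HL]. apply Rmult_le_pos; [apply Rmult_le_pos; lra | lra]. }
  (* Large enough for both truncated integrals to be within eps/3 of their limits, and for L (N -
     s0) >= X / (eps/3). *)
  set (N := Rabs s0 + Rabs B2 + Rabs B3 + X / (eps / 3) / L).
  assert (A2 := Rabs_pos B2). assert (A3 := Rabs_pos B3).
  assert (A4 := Rle_abs s0). assert (A5 := Rle_abs B2). assert (A6 := Rle_abs B3). assert (A7 := Rle_abs (- s0)). rewrite Rabs_Ropp in A7.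
  assert (XE : 0 <= X / (eps / 3)) by (apply Rmult_le_pos; [lra | left; apply Rinv_0_lt_compat; lra]).
  assert (XL : 0 <= X / (eps / 3) / L) by (apply Rmult_le_pos; [lra | left; apply Rinv_0_lt_compat; exact HL]).
  assert (HN : 0 <= N) by (unfold N; lra).
  specialize (HB2 (s0 - N) (s0 + N) ltac:(unfold N; lra) ltac:(unfold N; lra)).
  specialize (HB3 (s0 - N) (s0 + N) ltac:(unfold N; lra) ltac:(unfold N; lra)).
  rewrite (cint_Chasles P1 (s0 - N) s0 (s0 + N)) in HB2 by (first [lra | intros; apply J1]).
  rewrite (cint_Chasles P2 (s0 - N) s0 (s0 + N)) in HB3 by (first [lra | intros; apply J2]).
  specialize (T1 N HN). specialize (T2 N HN). specialize (Low12 N HN).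
  (* With v = L (N - s0) one has X <= v eps/3, and v <= 1 + v^2. *)
  assert (Small : X / (1 + (L * (s0 - N)) ^ 2) <= eps / 3).
  { assert (V : X / (eps / 3) <= L * (N - s0)).
    { apply Rle_trans with (L * (X / (eps / 3) / L)); [right; field; unfold L; lra|]. apply Rmult_le_compat_l; [left; exact HL | unfold N; lra]. }
    set (v := L * (N - s0)) in *. replace ((L * (s0 - N)) ^ 2) with (v ^ 2) by (unfold v; ring).
    assert (Z := pow2_ge_0 (v - 1 / 2)). apply Rle_div_l; [lra|].
    apply (Rmult_le_compat_r (eps / 3)) in V; [|lra]. replace (X / (eps / 3) * (eps / 3)) with X in V by (field; lra).
    replace ((v - 1 / 2) ^ 2) with (v ^ 2 - v + 1 / 4) in Z by field.
    eapply Rle_trans; [exact V|]. rewrite (Rmult_comm v). apply Rmult_le_compat_l; lra. }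
  set (u1 := cint P1 (s0 - N) s0) in *. set (u2 := cint P2 (s0 - N) s0) in *.
  set (v1 := cint P1 s0 (s0 + N)) in *. set (v2 := cint P2 s0 (s0 + N)) in *.
  replace (I1 - I2)%C with ((u1 - u2) + v1 - v2 - (u1 + v1 - I1) + (u2 + v2 - I2))%C by ring.
  assert (Tr1 := Cmod_triangle ((u1 - u2) + v1 - v2 - (u1 + v1 - I1)) (u2 + v2 - I2)).
  assert (Tr2 := Cmod_minus_le ((u1 - u2) + v1 - v2) (u1 + v1 - I1)).
  assert (Tr3 := Cmod_minus_le ((u1 - u2) + v1) v2). assert (Tr4 := Cmod_triangle (u1 - u2) v1).
  replace ((Ka * PI + Kc * PI + Ka * (2 * PI)) / L * flat e * decay n) with
    (Ka * PI / L * flat e * decay n + Kc * PI / L * flat e * decay n + Ka * flat e * decay n * (2 * PI) / L) by (field; unfold L; lra).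
  replace ((Ka * flat e * decay n + Kd * decay n / (1 + (L * (s0 - N)) ^ 2)) * (2 * PI) / L) with
    (Ka * flat e * decay n * (2 * PI) / L + X / (1 + (L * (s0 - N)) ^ 2)) in Low12.
  2:{ assert (Z := pow2_ge_0 (L * (s0 - N))). unfold X. field. split; unfold L in *; lra. }
  lra.
Qed.
End Difference.

(** * Domains *)

Lemma open_eps (V : C -> Prop) : @open C_UniformSpace V ->
  forall z, V z -> exists r, 0 < r /\ forall y, Cmod (y - z)%C < r -> V y.
Proof.
  intros H z Hz. destruct (H z Hz) as [d Hd]. exists d. split; [apply cond_pos|]. intros y Hy. apply Hd.
  assert (A := Re_le_Cmod (y - z)%C). assert (B := Im_le_Cmod (y - z)%C). split.
  - change (Rabs (fst y - fst z) < d). simpl in A. unfold Rminus. lra.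
  - change (Rabs (snd y - snd z) < d). simpl in B. unfold Rminus. lra.
Qed.

(** A small logarithm near 1, given explicitly by ln of the modulus and atan(y/x). It makes the
    sectors open, being images under [Cexp]. *)
Lemma Clog_near_1 (eta : R) : 0 < eta -> exists r, 0 < r /\ forall h, Cmod (h - 1)%C < r ->
  exists w, Cexp w = h /\ Rabs (fst w) < eta /\ Rabs (snd w) < eta.
Proof.
  intros He. set (r := Rmin (1 / 2) (eta / 4)).
  assert (Hr : 0 < r) by (apply Rmin_pos; lra). assert (R1 := Rmin_l (1 / 2) (eta / 4)). assert (R2 := Rmin_r (1 / 2) (eta / 4)). fold r in R1, R2.
  exists r. split; [exact Hr|]. intros h Hh.
  assert (A := Re_le_Cmod (h - 1)%C). assert (B := Im_le_Cmod (h - 1)%C).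
  destruct h as [x y]. simpl in A, B.
  replace (y + - 0) with y in B by ring.
  assert (Hx : Rabs (x + - (1)) < r) by lra.
  apply Rabs_lt_between in Hx.
  assert (Nz : ((x, y) : C) <> 0) by (intros Z; injection Z; lra).
  assert (P := proj1 (Cmod_gt_0 _) Nz).
  assert (M1 := Cmod_triangle_rev (x, y) 1). assert (M2 := Cmod_triangle_rev 1 (x, y)).
  rewrite Cmod_1 in M1, M2. rewrite Cmod_minus_sym in M2.
  set (m := Cmod (x, y)) in *.
  exists (ln m, atan (y / x)). split; [|split].
  - unfold Cexp, Re, Im. simpl. rewrite exp_ln, cos_atan, sin_atan by exact P.
    assert (E : sqrt (1 + (y / x)²) = m / x).
    { rewrite <- (sqrt_Rsqr (m / x)) by (apply Rmult_le_pos; [lra | left; apply Rinv_0_lt_compat; lra]). f_equal.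
      assert (Q := Cmod2_alt (x, y)). fold m in Q. unfold Re, Im in Q. simpl in Q. unfold Rsqr.
      replace (m / x * (m / x)) with (m * (m * 1) / (x * x)) by (field; lra). rewrite Q. field. lra. }
    rewrite E. f_equal; field; split; lra.
  - simpl.
    assert (U : ln m <= m - 1). { assert (T := exp_ineq1_le (ln m)). rewrite exp_ln in T by exact P. lra. }
    assert (V : 1 - / m <= ln m).
    { assert (T := exp_ineq1_le (- ln m)). rewrite exp_Ropp, exp_ln in T by exact P. lra. }
    assert (V2 : / m <= 1 + 2 * (1 - m) \/ 1 < m).
    { destruct (Rle_lt_dec m 1) as [L|L]; [left | right; exact L].
      apply Rmult_le_reg_r with m; [exact P|]. rewrite Rinv_l by lra. nra. }
    apply Rabs_lt_between. split; [|lra].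
    destruct V2 as [V2|V2]; [lra|]. assert (/ m < 1) by (rewrite <- Rinv_1; apply Rinv_lt_contravar; lra). lra.
  - simpl.
    assert (T : Rabs (atan (y / x)) <= Rabs (y / x)).
    { destruct (MVT_gen atan 0 (y / x) (fun u => / (1 + u²))) as [u [_ E]].
      - intros u _. apply is_derive_atan.
      - intros u _. apply continuity_pt_filterlim. apply continuous_atan.
      - rewrite atan_0 in E. replace (atan (y / x)) with (/ (1 + u²) * (y / x)) by lra.
        rewrite Rabs_mult. assert (Q := Rle_0_sqr u). rewrite (Rabs_right (/ _)) by (left; apply Rinv_0_lt_compat; lra).
        assert (/ (1 + u²) <= 1) by (rewrite <- Rinv_1; apply Rinv_le_contravar; lra).
        assert (0 <= Rabs (y / x)) by apply Rabs_pos. nra. }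
    unfold Rdiv in T at 2. rewrite Rabs_mult in T. rewrite (Rabs_right (/ x)) in T by (left; apply Rinv_0_lt_compat; lra).
    assert (/ x <= 2) by (replace 2 with (/ (1 / 2)) by field; apply Rinv_le_contravar; lra).
    assert (0 <= Rabs y) by apply Rabs_pos. nra.
Qed.

Section Domains.
Variable lq : C.
Hypothesis HL : 0 < fst lq.

Lemma U_of_open (I : ipair) (e : C) : U_of lq I e -> exists r, 0 < r /\ forall e', Cmod (e' - e)%C < r -> U_of lq I e'.
Proof.
  intros [u [v [Hu [Hv E]]]]. assert (Hpi := PI_RGT_0).
  set (eta1 := Rmin (Rmin (u - u_lo I) (u_hi I - u)) (Rmin (v - v_lo I) (v_hi I - v))).
  assert (H1 : 0 < eta1) by (repeat apply Rmin_pos; lra).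
  assert (E1 := Rmin_l (Rmin (u - u_lo I) (u_hi I - u)) (Rmin (v - v_lo I) (v_hi I - v))).
  assert (E2 := Rmin_r (Rmin (u - u_lo I) (u_hi I - u)) (Rmin (v - v_lo I) (v_hi I - v))).
  assert (E3 := Rmin_l (u - u_lo I) (u_hi I - u)). assert (E4 := Rmin_r (u - u_lo I) (u_hi I - u)).
  assert (E5 := Rmin_l (v - v_lo I) (v_hi I - v)). assert (E6 := Rmin_r (v - v_lo I) (v_hi I - v)).
  fold eta1 in E1, E2.
  (* Bounds the linear map from a logarithm w to the increments (du, dv) below. *)
  set (k := 1 + Rabs (snd lq) / fst lq + / fst lq).
  assert (Hk1 : 0 <= Rabs (snd lq) / fst lq) by (apply Rmult_le_pos; [apply Rabs_pos | left; apply Rinv_0_lt_compat, HL]).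
  assert (Hk2 : 0 < / fst lq) by (apply Rinv_0_lt_compat, HL).
  destruct (Clog_near_1 (eta1 / k)) as [r [Hr Q]]; [apply Rdiv_lt_0_compat; [exact H1 | unfold k; lra]|].
  assert (Ne : e <> 0) by (rewrite E; apply Cmult_neq_0; apply Cexp_neq_0).
  assert (Pe := proj1 (Cmod_gt_0 _) Ne).
  exists (r * Cmod e). split; [apply Rmult_lt_0_compat; assumption|]. intros e' He'.
  destruct (Q (e' / e)%C) as [w [Ew [W1 W2]]].
  { replace (e' / e - 1)%C with ((e' - e) / e)%C by (field; exact Ne). rewrite Cmod_div by exact Ne. apply Rlt_div_l; assumption. }
  (* The solution of w = 2 pi i du + dv lq: the real part determines dv, the imaginary part then
     du. *)
  set (dv := fst w / fst lq). set (du := (snd w - dv * snd lq) / (2 * PI)).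
  assert (Hdv : Rabs dv < eta1).
  { unfold dv, Rdiv. rewrite Rabs_mult, (Rabs_right (/ fst lq)) by lra.
    apply Rle_lt_trans with (eta1 / k * / fst lq); [apply Rmult_le_compat_r; lra|].
    replace (eta1 / k * / fst lq) with (eta1 * (/ fst lq / k)) by (field; split; unfold k; lra).
    rewrite <- (Rmult_1_r eta1) at 2. apply Rmult_lt_compat_l; [exact H1|]. apply Rlt_div_l; unfold k; lra. }
  assert (Hdu : Rabs du < eta1).
  { unfold du, Rdiv. rewrite Rabs_mult, (Rabs_right (/ (2 * PI))) by (left; apply Rinv_0_lt_compat; lra).
    assert (B : Rabs (snd w - dv * snd lq) <= eta1 / k * (1 + Rabs (snd lq) / fst lq)).
    { eapply Rle_trans; [apply Rabs_triang|]. rewrite Rabs_Ropp, Rabs_mult. unfold dv, Rdiv. rewrite Rabs_mult, (Rabs_right (/ fst lq)) by lra.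
      assert (X := Rabs_pos (snd lq)). fold (eta1 / k).
      assert (Rabs (fst w) * / fst lq * Rabs (snd lq) <= eta1 / k * / fst lq * Rabs (snd lq)).
      { apply Rmult_le_compat_r; [exact X|]. apply Rmult_le_compat_r; lra. }
      unfold Rdiv at 1 in W2. fold (eta1 / k) in W2. nra. }
    assert (B2 : eta1 / k * (1 + Rabs (snd lq) / fst lq) <= eta1).
    { replace (eta1 / k * (1 + Rabs (snd lq) / fst lq)) with (eta1 * ((1 + Rabs (snd lq) / fst lq) / k)) by (field; split; unfold k; lra).
      rewrite <- (Rmult_1_r eta1) at 2. apply Rmult_le_compat_l; [lra|]. apply Rle_div_l; unfold k; lra. }
    assert (P3 : / (2 * PI) < 1) by (rewrite <- Rinv_1; apply Rinv_lt_contravar; [lra|]; assert (T := PI2_1); lra).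
    assert (P4 : 0 < / (2 * PI)) by (apply Rinv_0_lt_compat; lra).
    apply Rle_lt_trans with (eta1 * / (2 * PI)); [apply Rmult_le_compat_r; lra|]. nra. }
  apply Rabs_lt_between in Hdv. apply Rabs_lt_between in Hdu.
  exists (u + du), (v + dv). split; [lra|]. split; [lra|].
  replace e' with (e * (e' / e))%C by (field; exact Ne). rewrite <- Ew, E. unfold qpow.
  rewrite <- !Cexp_plus. f_equal.
  assert (Ew2 : w = (RtoC (2 * PI * du) * Ci + RtoC dv * lq)%C).
  { destruct w as [w1 w2]. destruct lq as [l1 l2]. unfold Cplus, Cmult, RtoC, Ci. simpl in *.
    unfold du, dv. simpl. f_equal; field; lra. }
  rewrite Ew2 at 1. rewrite Rmult_plus_distr_l, !RtoC_plus. ring.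
Qed.

Lemma Uq_open (I : ipair) (e : C) : Uq lq I e -> exists r, 0 < r /\ forall e', Cmod (e' - e)%C < r -> Uq lq I e'.
Proof.
  intros [e0 [n [H E]]]. destruct (U_of_open I e0 H) as [r [Hr Q]].
  assert (N := qpow_neq_0 lq (INR n)). assert (P := proj1 (Cmod_gt_0 _) N).
  exists (r / Cmod (qpow lq (INR n))). split; [apply Rdiv_lt_0_compat; assumption|]. intros e' He'.
  exists (e' * qpow lq (INR n))%C, n. rewrite qpow_opp. split; [|field; exact N].
  apply Q. replace (e' * qpow lq (INR n) - e0)%C with ((e' - e) * qpow lq (INR n))%C.
  - rewrite Cmod_mult. apply Rlt_div_r in He'; assumption.
  - rewrite E, qpow_opp. field. exact N.
Qed.

Lemma Uq_nz (I : ipair) (e : C) : Uq lq I e -> e <> 0.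
Proof.
  intros [e0 [n [[u [v [_ [_ E0]]]] E]]]. rewrite E, E0. repeat apply Cmult_neq_0; apply Cexp_neq_0.
Qed.

Lemma q_Rplus_open (T : C -> Prop) : @open C_UniformSpace T ->
  forall t, q_Rplus lq T t -> exists r, 0 < r /\ forall t', Cmod (t' - t)%C < r -> q_Rplus lq T t'.
Proof.
  intros HT t [t0 [l [H [Hl E]]]]. destruct (open_eps T HT t0 H) as [r [Hr Q]].
  assert (N := qpow_neq_0 lq l). assert (P := proj1 (Cmod_gt_0 _) N).
  exists (r * Cmod (qpow lq l)). split; [apply Rmult_lt_0_compat; assumption|]. intros t' Ht'.
  exists (t' / qpow lq l)%C, l. split; [|split; [exact Hl | field; exact N]].
  apply Q. replace (t' / qpow lq l - t0)%C with ((t' - t) / qpow lq l)%C by (rewrite E; field; exact N).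
  rewrite Cmod_div by exact N. apply Rlt_div_l; assumption.
Qed.

Lemma q_Rplus_nz (T : C -> Prop) (t : C) : ~ T 0 -> q_Rplus lq T t -> t <> 0.
Proof.
  intros H0 [t0 [l [H [_ E]]]]. rewrite E. apply Cmult_neq_0; [|apply qpow_neq_0]. intros Z. subst t0. contradiction.
Qed.

Lemma q_Rplus_q (T : C -> Prop) (t : C) : q_Rplus lq T t -> q_Rplus lq T (Cexp lq * t)%C.
Proof.
  intros [t0 [l [H [Hl E]]]]. exists t0, (l + 1). split; [exact H|]. split; [lra|].
  rewrite qpow_plus, qpow_1, E. ring.
Qed.

Lemma q_Rplus_incl (T : C -> Prop) (t : C) : T t -> q_Rplus lq T t.
Proof. intros H. exists t, 0. split; [exact H|]. split; [lra|]. rewrite qpow_0. ring. Qed.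
End Domains.

(** * Restriction of functions of two variables to coordinate lines *)

Lemma holo2_vhol (f : C -> C -> C) (x y : C) :
  @ex_filterdiff C_AbsRing CC C_NormedModule (fun p => f (fst p) (snd p)) (@locally CC (x, y)) ->
  @vhol CC (fun p => f (fst p) (snd p)) ((x, y) : CC).
Proof. intros [l H]. exists l. apply vd_filterdiff, H. Qed.

Lemma holo2_cd_fst (D : C -> C -> Prop) (f : C -> C -> C) (x y : C) :
  holo2 D f -> D x y -> exists d, cd (fun z => f z y) x d.
Proof.
  intros H Hxy. destruct (holo2_vhol f x y (H x y Hxy)) as [l Hl].
  set (p := ((RtoC 0, y) : CC)). set (h := ((RtoC 1, RtoC 0) : CC)).
  assert (E : forall z : C, plus p (scal (z : C_Ring) h) = ((z, y) : CC)).
  { intros z. change (((0 + z * 1)%C, (y + z * 0)%C) = (z, y)). f_equal; ring. }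
  exists (l h). eapply cd_ext; [|apply (vd_line (V := CC) (fun q => f (fst q) (snd q)) p h l x)].
  - intros z. cbv beta. rewrite (E z). reflexivity.
  - rewrite (E x). exact Hl.
Qed.

Lemma holo2_cd_snd (D : C -> C -> Prop) (f : C -> C -> C) (x y : C) :
  holo2 D f -> D x y -> exists d, cd (f x) y d.
Proof.
  intros H Hxy. destruct (holo2_vhol f x y (H x y Hxy)) as [l Hl].
  set (p := ((x, RtoC 0) : CC)). set (h := ((RtoC 0, RtoC 1) : CC)).
  assert (E : forall z : C, plus p (scal (z : C_Ring) h) = ((x, z) : CC)).
  { intros z. change (((x + z * 0)%C, (0 + z * 1)%C) = (x, z)). f_equal; ring. }
  exists (l h). eapply cd_ext; [|apply (vd_line (V := CC) (fun q => f (fst q) (snd q)) p h l y)].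
  - intros z. cbv beta. rewrite (E z). reflexivity.
  - rewrite (E y). exact Hl.
Qed.

Lemma holo1_cd (D : C -> Prop) (f : C -> C) (x : C) : holo1 D f -> D x -> exists d, cd f x d.
Proof. intros H Hx. destruct (H x Hx) as [d Hd]. exists d. apply is_derive_cd, Hd. Qed.

(** * Uniform constants and the family of solutions *)

Lemma finite_bound {A : Type} (l : list A) (P : A -> R -> Prop) :
  (forall a, In a l -> exists K, P a K) -> (forall a K K', K <= K' -> P a K -> P a K') ->
  exists K, 0 <= K /\ forall a, In a l -> P a K.
Proof.
  intros H Hm. induction l as [|a l IH]; [exists 0; split; [lra | intros a []]|].
  destruct IH as [K1 [P1 Q1]]; [intros; apply H; right; assumption|].
  destruct (H a (or_introl eq_refl)) as [K2 Q2]. exists (Rmax K1 K2). split; [eapply Rle_trans; [exact P1 | apply Rmax_l]|].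
  intros a' [->|Ha']; [apply (Hm _ K2); [apply Rmax_r | exact Q2] | apply (Hm _ K1); [apply Rmax_l | apply Q1, Ha']].
Qed.

Lemma PS_diff_bound (a a' : nat -> C) (z : C) (K D : R) : entire a -> entire a' -> 0 <= K -> Cmod z <= D ->
  (forall n, D ^ n * Cmod (a n - a' n)%C <= K * (/ 2) ^ n) -> Cmod (PS a z - PS a' z)%C <= 2 * K.
Proof.
  intros Ha Ha' HK Hz H. apply (cvg_bound (fun N => psum (fun n => a n * Cpow z n)%C N - psum (fun n => a' n * Cpow z n)%C N)%C).
  - intros N. replace (psum (fun n => a n * Cpow z n)%C N - psum (fun n => a' n * Cpow z n)%C N)%C with (psum (fun n => (a n - a' n) * Cpow z n)%C N).
    + replace (2 * K) with (K / (1 - / 2)) by field. apply psum_geom_le; [exact half_bounds | exact HK|]. intros n _.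
      rewrite Cmod_mult, Cmod_pow. eapply Rle_trans; [|apply H]. rewrite Rmult_comm.
      apply Rmult_le_compat_r; [apply Cmod_ge_0|]. apply pow_incr. split; [apply Cmod_ge_0 | exact Hz].
    + induction N as [|N IH]; [rewrite !psum_0; ring|]. rewrite !psum_S, IH. ring.
  - apply cvg_minus; apply PS_cvg; assumption.
Qed.

Theorem theorem3
  (q lq : C) (hlq : Cexp lq = q) (hq : 1 < Cmod q)
  (Sd : nat) (hS : (1 <= Sd)%nat)
  (m0 m1 : nat -> nat)
  (hm : forall k, (k < Sd)%nat -> (0 < m0 k)%nat /\ (0 < m1 k)%nat)
  (r0 : R) (hr0 : 0 < r0 <= 1)
  (J : nat -> list nat) (hJ : forall k, (k < Sd)%nat -> NoDup (J k))
  (b : nat -> nat -> C -> C)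
  (hb : forall k s, (k < Sd)%nat -> In s (J k) ->
     holo1 (disc r0) (b k s) /\
     exists K, forall eps, disc r0 eps -> Cmod (b k s eps) <= K)
  (cI : list ipair) (hcI : good_covering lq cI)
  (hU : forall I eps, In I cI -> Uq lq I eps -> disc r0 eps)
  (delta rho0 : R) (hdelta : 0 < delta)
  (V : ipair -> C -> Prop) (T : C -> Prop)
  (hVT : associated_family lq delta rho0 cI V T)
  (M A1 Cst : R) (hM : 0 < M) (hA1 : 0 < A1) (hCst : 0 < Cst)
  (W : nat -> C -> C -> C) (WI : ipair -> nat -> C -> C -> C)
  (hW : forall j, (j < Sd)%nat ->
     initial_datum lq r0 rho0 M cI V (W j) (fun I => WI I j))
  (lam : ipair -> C)
  (hlam : forall I, In I cI ->
     V I (lam I) /\ disc rho0 (lam I) /\ r0 < 1 < Cmod (lam I))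
  (hA : assumption_A Sd J m0 m1 Cst A1)
  (hB : assumption_B q M)
  (a1 a2 b1 b2 d1 d2 xi xib : R)
  (hC : assumption_C q M A1 Cst a1 a2 b1 b2 d1 d2 xi xib) :
  exists X : ipair -> C -> C -> C -> C,
    (forall I, In I cI ->
       cauchy_solution q lq Sd m0 m1 J b
         (fun j eps t => q_laplace lq (lam I) (WI I j eps) (eps * t)%C) T I (X I)) /\
    (forall rho, 0 < rho ->
     forall I I', In I cI -> In I' cI ->
       (exists eps, Uq lq I eps /\ Uq lq I' eps) ->
       exists C1, 0 < C1 /\
         forall eps t z, Uq lq I eps -> Uq lq I' eps -> T t -> disc rho z ->
           Cmod (X I eps t z - X I' eps t z)%C <=
             C1 * exp (- ((1 - xib) * (xi / (2 * ln (Cmod q)) - M) * ln (Cmod eps) ^ 2))).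
Proof.
  subst q. rewrite Cmod_Cexp in hq. unfold assumption_C in hC. rewrite Cexp_ln_mod in *.
  assert (HL : 0 < fst lq).
  { apply exp_lt_inv. rewrite exp_0. exact hq. }
  set (L := fst lq) in *.
  destruct hC as [[Pa1 [Pa2 [_ [_ [Pd1 Pd2]]]]] [Hxi [Hxib [_ [_ [HC3 HC4]]]]]].
  assert (Hdd : 0 < d2 / d1 * L) by (apply Rmult_lt_0_compat; [apply Rdiv_lt_0_compat; assumption | exact HL]).
  assert (Hc' : 0 < xi / (2 * L) - M) by lra.
  (* From (C.4): the bracket multiplying A1 is below 1 and the last summand is positive; the
     resulting inequality is then multiplied by L. *)
  assert (HAC : Cst ^ 2 / (4 * xib * (xi / (2 * L) - M)) < A1 * L).
  { set (c' := xi / (2 * L) - M) in *.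
    assert (X1 : 0 < d2 * L / (d1 * c')) by (apply Rdiv_lt_0_compat; apply Rmult_lt_0_compat; assumption).
    assert (X2 : 0 < Cst * a2 / a1) by (apply Rdiv_lt_0_compat; [apply Rmult_lt_0_compat|]; assumption).
    assert (X3 : Cst ^ 2 / (4 * xib * L * c') < A1) by nra.
    replace (Cst ^ 2 / (4 * xib * c')) with (Cst ^ 2 / (4 * xib * L * c') * L) by (field; repeat split; lra).
    apply Rmult_lt_compat_r; assumption. }
  destruct hVT as [HV [[HTo [HT0 _]] [Hrho0 [_ [Htau [Hfar HT1]]]]]].
  destruct (finite_bound (seq 0 Sd) (fun k K => forall s, In s (J k) -> forall e, disc r0 e -> Cmod (b k s e) <= K)) as [Kb [HKb HKb']].
  { intros k Hk. apply in_seq in Hk.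
    destruct (finite_bound (J k) (fun s K => forall e, disc r0 e -> Cmod (b k s e) <= K)) as [K [_ HK]].
    - intros s Hs. apply (hb k s ltac:(lia) Hs).
    - intros s K K' HKK H e He. specialize (H e He). lra.
    - exists K. exact HK. }
  { intros k K K' HKK H s Hs e He. specialize (H s Hs e He). lra. }
  destruct (finite_bound (seq 0 Sd) (fun j K => forall I e tau, In I cI -> Uq lq I e ->
     (q_Rplus lq (V I) tau \/ pdisc rho0 tau) -> tau <> 0 ->
     Cmod (WI I j e tau) <= K * exp (M * Rmax 0 (ln (Cmod (tau / e)%C)) ^ 2))) as [K1 [HK1 HK1']].
  { intros j Hj. apply in_seq in Hj.
    destruct (hW j ltac:(lia)) as [_ [[K HK] [_ [Heq [De [Mt [HDe [HMt [_ HWb]]]]]]]]].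
    exists (Rmax 0 (Rmax K De)). intros I e tau HI He Hdom Htz.
    assert (Ne := Uq_nz lq I e He). assert (Hr := hU I e HI He).
    assert (R1 : Rmax K De <= Rmax 0 (Rmax K De)) by apply Rmax_r.
    assert (R2 := Rmax_l K De). assert (R3 := Rmax_r K De).
    (* If |tau| <= |e|, then |tau| < r0 <= 1 < rho0, so the datum is the common function, bounded by
       K. Otherwise the logarithm is positive, equals its positive part, and Mt < M suffices. *)
    destruct (Rle_lt_dec (ln (Cmod (tau / e)%C)) 0) as [Hx|Hx].
    - rewrite (Rmax_left 0 (ln (Cmod (tau / e)%C))) by exact Hx. replace (M * 0 ^ 2) with 0 by ring. rewrite exp_0, Rmult_1_r.
      rewrite ln_Cmod_div in Hx by assumption.
      assert (Hte : Cmod tau <= Cmod e).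
      { rewrite <- (exp_ln (Cmod tau)), <- (exp_ln (Cmod e)) by (apply Cmod_gt_0; assumption). apply exp_le. lra. }
      unfold disc in Hr.
      assert (Pt : pdisc rho0 tau) by (split; [lra | exact Htz]).
      rewrite (Heq I e tau HI He Pt). eapply Rle_trans; [apply HK; [split; [exact Hr | exact Ne] | exact Pt]|]. lra.
    - rewrite (Rmax_right 0 (ln (Cmod (tau / e)%C))) by lra. eapply Rle_trans; [apply (HWb I e tau HI (conj He Hdom))|].
      apply Rmult_le_compat; [lra | left; apply exp_pos | lra|]. apply exp_le. apply Rmult_le_compat_r; [apply pow2_ge_0 | lra]. }
  { intros j K K' HKK H I e tau HI He Hdom Htz. eapply Rle_trans; [apply (H I e tau HI He Hdom Htz)|].
    apply Rmult_le_compat_r; [left; apply exp_pos | exact HKK]. }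
  (* |tau + 1| exceeds delta on the spirals by (2), and is at least 1/2 on the disc |tau| <= 1/2;
     one constant serves both. *)
  set (dd := Rmin delta (1 / 2)).
  assert (Hdd1 : 0 < dd) by (apply Rmin_pos; lra). assert (Hdd2 := Rmin_l delta (1 / 2)). assert (Hdd3 := Rmin_r delta (1 / 2)). fold dd in Hdd2, Hdd3.
  assert (Hlnz : forall I, In I cI -> lam I <> 0).
  { intros I HI Z. destruct (hlam I HI) as [_ [_ [_ H]]]. rewrite Z, Cmod_0 in H. lra. }
  (* The spiral through lam stays in the domain of the data: outwards inside V q^(R+), inwards
     inside the punctured disc, since |lam| < rho0. *)
  assert (Hspir : forall I s, In I cI -> q_Rplus lq (V I) (qpow lq s * lam I)%C \/ pdisc rho0 (qpow lq s * lam I)%C).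
  { intros I s HI. destruct (hlam I HI) as [HVl [Hlr [_ Hl1]]]. unfold disc in Hlr. destruct (Rle_lt_dec 0 s) as [Hs|Hs].
    - left. exists (lam I), s. split; [exact HVl|]. split; [exact Hs | ring].
    - right. split; [|apply Cmult_neq_0; [apply qpow_neq_0 | apply Hlnz, HI]].
      rewrite Cmod_mult, Cmod_qpow. fold L. assert (exp (s * L) <= 1) by (rewrite <- exp_0; apply exp_le; nra). nra. }
  assert (Hg0 : forall (I : ipair) (e tau : C), In I cI -> Uq lq I e -> (q_Rplus lq (V I) tau \/ pdisc rho0 tau) -> tau <> 0 -> dd <= Cmod (tau + 1)%C ->
     good_pt Sd J b M Kb K1 dd (WI I) e tau).
  { intros I e tau HI He Hdom Htz Hd. split; [apply (Uq_nz lq I), He|]. split; [exact Htz|]. split; [exact Hd|]. split.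
    - intros k s Hk Hs. apply HKb'; [apply in_seq; lia | exact Hs | apply (hU I), He; exact HI].
    - intros j Hj. apply HK1'; auto. apply in_seq; lia. }
  assert (Hgood : forall I e s, In I cI -> Uq lq I e -> good_pt Sd J b M Kb K1 dd (WI I) e (qpow lq s * lam I)%C).
  { intros I e s HI He. apply Hg0; auto; [apply Cmult_neq_0; [apply qpow_neq_0 | apply Hlnz, HI]|].
    assert (H := Htau I (qpow lq s * lam I)%C HI). assert (H2 : q_R lq (V I) (qpow lq s * lam I)%C).
    { exists (lam I), s. split; [apply (hlam I HI) | ring]. } specialize (H H2). lra. }
  assert (Hlow : forall (I : ipair) (e tau : C), In I cI -> Uq lq I e -> tau <> 0 -> Cmod tau <= 1 / 2 -> pdisc rho0 tau /\ good_pt Sd J b M Kb K1 dd (WI I) e tau).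
  { intros I e tau HI He Htz Ht2. assert (Pt : pdisc rho0 tau) by (split; [lra | exact Htz]). split; [exact Pt|].
    apply Hg0; auto. assert (X := Cmod_triangle_rev 1 (- tau)%C). rewrite Cmod_1, Cmod_opp in X.
    replace (1 - - tau)%C with (tau + 1)%C in X by ring. lra. }
  (* The real exponent in (3) absorbs the power q^(-n) of e, the power q^l of t and the running q^r,
     so the condition on [U_of] and T reaches U q^(-N) and T q^(R+). *)
  assert (Hfar' : forall I e t r, In I cI -> Uq lq I e -> q_Rplus lq T t -> delta <= Cmod (1 + lam I / (e * t) * qpow lq r)%C).
  { intros I e t r HI [e0 [n [He0 Ee]]] [t0 [l [Ht0 [Hl Et]]]]. destruct (hlam I HI) as [HVl [Hlr _]].
    assert (H := Hfar I t0 e0 (lam I) (l - INR n - r) HI Ht0 He0 HVl Hlr).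
    assert (N0 : e0 <> 0) by (destruct He0 as [u [v [_ [_ ->]]]]; apply Cmult_neq_0; apply Cexp_neq_0).
    assert (N1 : t0 <> 0) by (intros Z; subst t0; contradiction).
    assert (N2 := qpow_neq_0 lq l). assert (N3 := qpow_neq_0 lq (INR n)). assert (N4 := qpow_neq_0 lq r).
    replace (lam I / (e * t) * qpow lq r)%C with (lam I / (e0 * t0 * qpow lq (l - INR n - r)))%C; [lra|].
    unfold Rminus. rewrite Ee, Et, !qpow_plus, !qpow_opp. field. repeat split; assumption. }
  assert (Hfars : forall I e t s, In I cI -> Uq lq I e -> q_Rplus lq T t -> far_pt lq delta (qpow lq s * lam I / (e * t))%C).
  { intros I e t s HI He Ht. assert (Ne := Uq_nz lq I e He). assert (Nt := q_Rplus_nz lq T t HT0 Ht).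
    assert (Nq := qpow_neq_0 lq s). assert (Nl := Hlnz I HI). split.
    - intros Z. apply Nl. replace (lam I) with (qpow lq s * lam I / (e * t) * (e * t / qpow lq s))%C by (field; auto). rewrite Z. ring.
    - intros n. assert (H := Hfar' I e t (s + IZR n) HI He Ht). rewrite qpow_plus in H.
      replace (qpow lq s * lam I / (e * t) * qpow lq (IZR n))%C with (lam I / (e * t) * (qpow lq s * qpow lq (IZR n)))%C by (field; auto). exact H. }
  assert (HWe : forall I j e s, In I cI -> (j < Sd)%nat -> Uq lq I e -> exists d, cd (fun e => WI I j e (qpow lq s * lam I)%C) e d).
  { intros I j e s HI Hj He. destruct (hW j Hj) as [_ [_ [Hh _]]]. apply (holo2_cd_fst _ _ _ _ (Hh I HI)). split; auto. }
  assert (HWt : forall I j e s, In I cI -> (j < Sd)%nat -> Uq lq I e -> exists d, cd (fun x => WI I j e x) (qpow lq s * lam I)%C d).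
  { intros I j e s HI Hj He. destruct (hW j Hj) as [_ [_ [Hh _]]]. apply (holo2_cd_snd _ _ _ _ (Hh I HI)). split; auto. }
  assert (Hbh : forall I k s e, In I cI -> (k < Sd)%nat -> In s (J k) -> Uq lq I e -> exists d, cd (b k s) e d).
  { intros I k s e HI Hk Hs He. apply (holo1_cd (disc r0)); [apply (hb k s Hk Hs) | apply (hU I e HI He)]. }
  set (kap := (lq / pi_q lq)%C).
  exists (fun I => Xsol lq Sd m0 m1 J b (WI I) (lam I) kap).
  assert (Tt_nz := fun t => q_Rplus_nz lq T t HT0).
  assert (Hent : forall I e t, In I cI -> Uq lq I e -> q_Rplus lq T t -> entire (xcoef lq Sd m0 m1 J b (WI I) (lam I) kap e t)).
  { intros I e t HI. apply (xcoef_entire lq Sd m0 m1 J b M A1 Cst xi xib Kb K1 dd delta (WI I) (lam I) (Uq lq I) (q_Rplus lq T)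
      HL hM hCst hA1 Hxi Hxib Hc' HAC HKb HK1 Hdd1 hdelta hA Tt_nz); auto. }
  assert (Hbd : forall I rho, In I cI -> 0 < rho -> exists K, forall e t z, Uq lq I e -> q_Rplus lq T t -> Cmod t <= 1 -> disc rho z ->
      Cmod (Xsol lq Sd m0 m1 J b (WI I) (lam I) kap e t z) <= K).
  { intros I rho HI Hrho. apply (Xsol_bounded lq Sd m0 m1 J b M A1 Cst xi xib Kb K1 dd delta (WI I) (lam I) (Uq lq I) (q_Rplus lq T)
      HL hM hCst hA1 Hxi Hxib Hc' HAC HKb HK1 Hdd1 hdelta hA Tt_nz); auto. }
  split.
  - intros I HI. split; [|split; [|split]].
    + intros e t z [He Ht].
      destruct (Xsol_vhol lq Sd m0 m1 J b M A1 Cst xi xib Kb K1 dd delta (WI I) (lam I) (Uq lq I) (q_Rplus lq T)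
        HL hM hCst hA1 Hxi Hxib Hc' HAC HKb HK1 Hdd1 hdelta hA (Uq_open lq HL I) (q_Rplus_open lq T HTo) Tt_nz) with (kap := kap) (p := ((e, t, z) : CCC)) as [l Hl]; auto.
      { intros k s e' Hk Hs He'. apply (Hbh I); assumption. }
      exists l. apply vd_filterdiff, Hl.
    + intros e t z He Ht. apply (solves_E lq Sd m0 m1 J b M A1 Cst xi xib Kb K1 dd delta (WI I) (lam I) (Uq lq I) (q_Rplus lq T)
        HL hM hCst hA1 Hxi Hxib Hc' HAC HKb HK1 Hdd1 hdelta hA); auto. apply q_Rplus_q.
    + intros e t He Ht. apply (solves_IC lq Sd m0 m1 J b M A1 Cst xi xib Kb K1 dd delta (WI I) (lam I) (Uq lq I) (q_Rplus lq T)
        HL hM hCst hA1 Hxi Hxib Hc' HAC HKb HK1 Hdd1 hdelta hA Tt_nz); auto.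
    + intros rho Hrho. destruct (Hbd I rho HI Hrho) as [K HK]. exists K. intros e t z He Ht Hz.
      apply HK; auto. apply q_Rplus_incl, Ht.
  - intros rho Hrho I I' HI HI' _.
    destruct (Hbd I rho HI Hrho) as [KI HKI]. destruct (Hbd I' rho HI' Hrho) as [KI' HKI'].
    destruct (integral_difference lq Sd m0 m1 J b M A1 Cst xi xib Kb K1 dd delta HL hM hCst hA1 Hxi Hxib Hc' HAC HKb HK1 Hdd1 hdelta hA (WI I) (WI I')) as [Kf [HKf Hdiff]].
    destruct (decay_const lq Sd J M A1 Cst xi xib Kb dd HAC HKb Hdd1 rho ltac:(lra)) as [K2 [HK2 H2]].
    set (al := (1 - xib) * (xi / (2 * L) - M)).
    assert (Hal : 0 < al) by (apply Rmult_lt_0_compat; lra).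
    assert (Pk := Cmod_ge_0 kap).
    assert (Pn : 0 <= 2 * (Cmod kap * Kf * K2)) by (repeat apply Rmult_le_pos; lra).
    set (Cbig := (Rabs KI + Rabs KI') * exp (al * ln (1 / 2) ^ 2)).
    assert (Pb : 0 <= Cbig).
    { apply Rmult_le_pos; [generalize (Rabs_pos KI) (Rabs_pos KI'); lra | left; apply exp_pos]. }
    exists (Cbig + 2 * (Cmod kap * Kf * K2) + 1). split; [lra|].
    intros e t z He He' Ht Hz. assert (Ht' := q_Rplus_incl lq T t Ht). assert (Ht1 := HT1 t Ht).
    set (fl := exp (- (al * ln (Cmod e) ^ 2))). assert (Pfl : 0 < fl) by apply exp_pos.
    (* The contour argument requires |e| <= 1/2. For 1/2 < |e| < 1 the flat factor is bounded below
       by exp(-al log^2(1/2)), so the uniform bounds of both solutions are enough; this is the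
       origin of [Cbig]. *)
    destruct (Rle_lt_dec (Cmod e) (1 / 2)) as [Hsm|Hlg].
    + apply Rle_trans with (2 * (Cmod kap * Kf * K2 * fl)); [|nra].
      apply (PS_diff_bound _ _ z _ rho); [apply Hent; assumption | apply Hent; assumption | repeat apply Rmult_le_pos; lra | left; exact Hz |].
      intros n. unfold xcoef.
      match goal with |- rho ^ n * Cmod (kap * ?x - kap * ?y)%C <= _ => replace (kap * x - kap * y)%C with (kap * (x - y))%C by ring end.
      rewrite Cmod_mult.
      assert (Imp : forall I0, In I0 cI -> Uq lq I0 e -> impr (fun s => integrand lq Sd m0 m1 J b (WI I0) n e t (qpow lq s * lam I0)%C) (xint lq Sd m0 m1 J b (WI I0) (lam I0) n e t)).
      { intros I0 HI0 He0. apply (ig_impr lq Sd m0 m1 J b M A1 Cst xi xib Kb K1 dd delta (WI I0) (lam I0) (Uq lq I0) (q_Rplus lq T)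
          HL hM hCst hA1 Hxi Hxib Hc' HAC HKb HK1 Hdd1 hdelta hA Tt_nz); auto. }
      assert (D := Hdiff n e t (lam I) (lam I') (xint lq Sd m0 m1 J b (WI I) (lam I) n e t) (xint lq Sd m0 m1 J b (WI I') (lam I') n e t) (Tt_nz t Ht') Ht1 Hsm (Hlnz I HI) (Hlnz I' HI')
        (fun s => Hgood I e s HI He) (fun s => Hgood I' e s HI' He') (fun r => Hfar' I e t r HI He Ht') (fun r => Hfar' I' e t r HI' He' Ht')).
      assert (Hlw : forall tau : C, tau <> 0 -> Cmod tau <= 1 / 2 -> good_pt Sd J b M Kb K1 dd (WI I) e tau /\
         forall j, (j < Sd)%nat -> WI I j e tau = WI I' j e tau /\ exists d, cd (WI I j e) tau d).
      { intros tau Htz Ht2. destruct (Hlow I e tau HI He Htz Ht2) as [Pt G]. split; [exact G|]. intros j Hj.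
        destruct (hW j Hj) as [_ [_ [Hh [Heq _]]]]. split.
        - rewrite (Heq I e tau HI He Pt), (Heq I' e tau HI' He' Pt). reflexivity.
        - apply (holo2_cd_snd _ _ _ _ (Hh I HI)). split; [exact He | right; exact Pt]. }
      specialize (D Hlw (Imp I HI He) (Imp I' HI' He')).
      specialize (H2 n). fold L al fl in D.
      set (dec := ratio lq Sd J A1 Kb dd ^ n * exp (- (rate L M A1 Cst xi xib / 2 * INR n ^ 2))) in *.
      assert (Pr : 0 <= rho ^ n) by (apply pow_le; lra).
      apply Rle_trans with (rho ^ n * (Cmod kap * (Kf * fl * dec))).
      * apply Rmult_le_compat_l; [exact Pr|]. apply Rmult_le_compat_l; [exact Pk | exact D].
      * replace (rho ^ n * (Cmod kap * (Kf * fl * dec))) with (Cmod kap * Kf * fl * (rho ^ n * dec)) by ring.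
        replace (Cmod kap * Kf * K2 * fl * (/ 2) ^ n) with (Cmod kap * Kf * fl * (K2 * (/ 2) ^ n)) by ring.
        apply Rmult_le_compat_l; [repeat apply Rmult_le_pos; lra | exact H2].
    + apply Rle_trans with (Cbig * fl); [|nra].
      assert (B1 := HKI e t z He Ht' Ht1 Hz). assert (B2 := HKI' e t z He' Ht' Ht1 Hz).
      eapply Rle_trans; [apply Cmod_minus_le|].
      assert (Hr := hU I e HI He). unfold disc in Hr.
      assert (l1 : ln (1 / 2) <= ln (Cmod e)) by (apply ln_le; lra).
      assert (l2 : ln (Cmod e) <= 0) by (rewrite <- ln_1; apply ln_le; lra).
      assert (Sq : ln (Cmod e) ^ 2 <= ln (1 / 2) ^ 2) by nra.
      assert (One : 1 <= exp (al * ln (1 / 2) ^ 2) * fl).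
      { unfold fl. rewrite <- exp_plus. apply Rle_trans with (exp 0); [rewrite exp_0; lra | apply exp_le; nra]. }
      unfold Cbig. rewrite Rmult_assoc.
      assert (Q1 := Rle_abs KI). assert (Q2 := Rle_abs KI'). assert (Q3 := Rabs_pos KI). assert (Q4 := Rabs_pos KI'). nra.
Qed.
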